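(* Let $\underline b>0$ and suppose that $\mathbb{E}[g_m^2(X)]\ge\underline b$ and $\mathbb{E}[|h_m(X,X')|^{2+\ell}]\le B_n^\ell$ for $\ell=1,2$ and all $m=1,\dots,d$. Let $\gamma\in(0,e^{-1})$ and assume $\log(1/\gamma)\le K\log(dn)$ and $\log d\le\bar b n$ for some constants $K,\bar b>0$. Set $$\varpi_{1,n}=\left(\frac{B_n^2\log^7(nd)}{n}\right)^{1/6},\qquad \varpi^B_{2,n}(\gamma)=\left(\frac{B_n^2\log^3(nd)}{\gamma^{2/q}n^{1-2/q}}\right)^{1/3}.$$ (i) If $\|h_m(X,X')\|_{\psi_1}\le B_n$ for all $m=1,\dots,d$, then there exists a constant $C>0$ depending only on $\underline b,\bar b,K$ such that $\rho^B(T_n,T_n^\sharp)\le C\varpi_{1,n}$ holds with probability at least $1-\gamma$. (ii) If $\mathbb{E}[\max_{1\le m\le d}(|h_m(X,X')|/B_n)^q]\le1$ for some $q\ge4$, then there exists a constant $C>0$ depending only on $\underline b,\bar b,q,K$ such that $\rho^B(T_n,T_n^\sharp)\le C\{\varpi_{1,n}+\varpi^B_{2,n}(\gamma)\}$ holds with probability at least $1-\gamma$.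
   Context: Throughout $n\ge 4$, $d\ge 3$. $X_1,\dots,X_n$ are iid random vectors in $\mathbb{R}^p$ with distribution $F$, $X_1^n=(X_1,\dots,X_n)$, and $X,X'$ are independent with distribution $F$, independent of $X_1^n$. $h:\mathbb{R}^p\times\mathbb{R}^p\to\mathbb{R}^d$ is measurable with $h(x_1,x_2)=h(x_2,x_1)$ and $\mathbb{E}|h_k(X_1,X_2)|<\infty$ for all $k$. Put $\theta=\mathbb{E}[h(X_1,X_2)]$, $U_n=\frac1{n(n-1)}\sum_{1\le i\ne j\le n}h(X_i,X_j)$, $T_n=\sqrt n(U_n-\theta)/2$, $g(x)=\mathbb{E}[h(x,X')]-\theta$. $p,d,F$ may depend on $n$; $B_n\ge1$ is a sequence of reals possibly tending to infinity. Jackknife Gaussian multiplier bootstrap: $e_1,\dots,e_n$ are iid $N(0,1)$ random variables independent of $X_1^n$ and $$T_n^\sharp=\frac1{\sqrt n}\sum_{i=1}^n\Big[\frac1{n-1}\sum_{j\ne i}h(X_i,X_j)-U_n\Big]e_i.$$ $\mathcal{A}^{re}$ is the class of all hyperrectangles $\{x\in\mathbb{R}^d:a_j\le x_j\le b_j,\ j=1,\dots,d\}$ with $-\infty\le a_j\le b_j\le\infty$, and $\rho^B(T_n,T_n^\sharp)=\sup_{A\in\mathcal{A}^{re}}|\mathbb{P}(T_n\in A)-\mathbb{P}(T_n^\sharp\in A\mid X_1^n)|$. For a real random variable $\xi$, $\|\xi\|_{\psi_1}=\inf\{C>0:\mathbb{E}[\exp(|\xi|/C)-1]\le1\}$. 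*)

(* Defs.v *)
Set Warnings "-notation-overridden,-notation-incompatible-prefix".
From HB Require Import structures.
From mathcomp Require Export all_boot all_order all_algebra.
From mathcomp Require Export all_classical all_reals all_analysis.

Set Implicit Arguments.
Unset Strict Implicit.
Unset Printing Implicit Defensive.
Import Order.TTheory GRing.Theory Num.Theory.
Import numFieldNormedType.Exports.

Local Open Scope classical_set_scope.
Local Open Scope ring_scope.

(* Euclidean space R^k is [k.-tuple R] and a sample of size n in R^p is
   [n.-tuple (p.-tuple R)]; the library equips tuples with the product
   sigma-algebra, which here is the Borel one. Indices start at 0. *)

Section random_elements.
Context {R : realType} {disp : measure_display} {Omega : measurableType disp}.
Variable P : probability Omega R.

Definition has_law d (S : measurableType d) (X : Omega -> S)
    (F : set S -> \bar R) : Prop :=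
  forall A : set S, measurable A -> P (X @^-1` A) = F A.

Definition independent_RVs d1 d2 (S1 : measurableType d1)
    (S2 : measurableType d2) (X : Omega -> S1) (Y : Omega -> S2) : Prop :=
  forall (A : set S1) (B : set S2), measurable A -> measurable B ->
    (P (X @^-1` A `&` Y @^-1` B) = P (X @^-1` A) * P (Y @^-1` B))%E.

Definition mutually_independent d (S : measurableType d) (I : finType)
    (X : I -> Omega -> S) : Prop :=
  forall (J : {set I}) (A : I -> set S), (forall i, measurable (A i)) ->
    (P (\bigcap_(i in [set` J]) X i @^-1` A i) =
     \big[*%E/1%E]_(i in J) P (X i @^-1` A i))%E.

(* [kappa] is a regular conditional distribution of Y given X, i.e. for every
   measurable A the random variable [kappa (X w) A] is a version of
   P(Y \in A | X). *)
Definition regular_cond_distribution d1 d2 (S1 : measurableType d1)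
    (S2 : measurableType d2) (Y : Omega -> S2) (X : Omega -> S1)
    (kappa : R.-pker S1 ~> S2) : Prop :=
  forall (D : set S1) (A : set S2), measurable D -> measurable A ->
    (\int[P]_(w in X @^-1` D) kappa (X w) A = P (X @^-1` D `&` Y @^-1` A))%E.

(* [+oo] when no C is admissible *)
Definition psi1_norm (xi : Omega -> R) : \bar R :=
  ereal_inf [set C%:E | C in
    [set C : R | 0 < C /\
      ('E_P[fun w => (expR (`|xi w| / C) - 1)%R] <= 1)%E]].

End random_elements.

Section hyperrectangles.
Context {R : realType} (d : nat).

Definition hyperrectangles : set (set (d.-tuple R)) :=
  [set A | exists a b : 'I_d -> \bar R,
    (forall j, (a j <= b j)%E) /\
    A = [set x | forall j, (a j <= (tnth x j)%:E <= b j)%E]].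

Definition rect_dist (mu nu : set (d.-tuple R) -> \bar R) : \bar R :=
  ereal_sup [set `|mu A - nu A|%E | A in hyperrectangles].

End hyperrectangles.

Section ustatistic.
Context {R : realType} {p d : nat}.
Variable h : p.-tuple R -> p.-tuple R -> d.-tuple R.

Definition kernel_mean disp (Omega : measurableType disp)
    (P : probability Omega R) (Z Z' : Omega -> p.-tuple R) : d.-tuple R :=
  [tuple fine ('E_P[fun w => tnth (h (Z w) (Z' w)) m])%E | m < d].

(* g(x) = E[h(x, Z')] - theta; [fine] only matters on the null set of those x
   for which E[h(x, Z')] is not finite *)
Definition hajek disp (Omega : measurableType disp) (P : probability Omega R)
    (Z' : Omega -> p.-tuple R) (theta : d.-tuple R) (x : p.-tuple R) :
    d.-tuple R :=
  [tuple fine ('E_P[fun w => tnth (h x (Z' w)) m])%E - tnth theta m | m < d].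

Context {n : nat}.

Definition Ustat (s : n.-tuple (p.-tuple R)) : d.-tuple R :=
  [tuple (n%:R * n.-1%:R)^-1 *
    \sum_(i < n) \sum_(j < n | j != i) tnth (h (tnth s i) (tnth s j)) m
  | m < d].

Definition Tstat (theta : d.-tuple R) (s : n.-tuple (p.-tuple R)) :
    d.-tuple R :=
  [tuple Num.sqrt n%:R * (tnth (Ustat s) m - tnth theta m) / 2 | m < d].

Definition Tsharp (s : n.-tuple (p.-tuple R)) (e : n.-tuple R) : d.-tuple R :=
  [tuple (Num.sqrt n%:R)^-1 *
    \sum_(i < n)
      (n.-1%:R^-1 *
        (\sum_(j < n | j != i) tnth (h (tnth s i) (tnth s j)) m)
       - tnth (Ustat s) m) * tnth e i
  | m < d].

End ustatistic.

Section rates.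
Context {R : realType}.

Definition varpi1 (B : R) (n d : nat) : R :=
  (B ^+ 2 * ln (n * d)%:R ^+ 7 / n%:R) `^ (6%:R^-1).

Definition varpiB2 (q B : R) (n d : nat) (gamma : R) : R :=
  (B ^+ 2 * ln (n * d)%:R ^+ 3
   / (gamma `^ (2 / q) * n%:R `^ (1 - 2 / q))) `^ (3%:R^-1).

End rates.

(* Main.v *)
(** Let [g] be the first Hoeffding projection of the kernel. Given the sample,
    [Tsharp] is a centred Gaussian vector whose covariance matrix is a jackknife
    estimate of that of [g (X)]; off an event of probability [gamma] the two
    matrices are entrywise close, by Bernstein inequalities for truncated sums
    and, for the degenerate parts, by decoupling and type-2 moment bounds.

    For such a sample the normalised sum of the [g (X_i)] is compared with that
    very Gaussian vector on orthants, along the path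
    [sin theta * S + cos theta * G], by means of a smooth step of the soft
    maximum. Its derivatives are supported in a thin strip around the boundary
    of the orthant; the probability of the strip is at most a Gaussian strip
    probability plus twice the distance to be estimated, and the latter enters
    with a small enough coefficient to be absorbed. No separate comparison
    between two Gaussian vectors is needed.

    The degenerate part of the statistic is negligible and is absorbed by
    anticoncentration. A rectangle is an orthant for the doubled vector
    [(x, - x)]. Unbounded kernels are clipped at a level so high that clipping
    is noticed with probability at most [gamma / 2]. The sub-exponential case is
    the moment case with [q] of order [ln (n d)]. *)

Require Import Defs.
From mathcomp Require Import all_boot all_order all_algebra.
From mathcomp Require Import all_classical all_reals all_analysis.
From mathcomp Require Import measurable_realfun.
From mathcomp Require Import ring lra.
Set Implicit Arguments.
Unset Strict Implicit.
Unset Printing Implicit Defensive.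
Import Order.TTheory GRing.Theory Num.Theory.
Import numFieldNormedType.Exports.
Local Open Scope classical_set_scope.
Local Open Scope ring_scope.

(** * A smooth step function *)

(** All that is asked of the rate [om] is [B l^7 <= om^3 sqrt n] and
    [D^2 l^6 (2 n / gam)^(1 / r) <= om^3 n], where [l^2 = ln (n d)]; the two clauses differ only in
    the choice of [D] and [r]. With [Lam = l^2] and [beta] of order [l^3 / om] the smoothing width
    [Lam / beta] is of order [om / l], which anticoncentration of strength [l] turns into [om]. The
    third-order error [beta^3 B / (Lam sqrt n)] is then merely a small constant, so it must come
    multiplied by a strip probability and be absorbed; the covariance error comes with the same
    factor. Third derivatives are kept as averages under the soft-maximum weights, so only
    coordinatewise third moments enter there, and the maximum over coordinates matters only on the
    rare event that one summand exceeds [1 / beta]. For bounded kernels integrability is a closure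
    property, and no final estimate contains the bound, so the clipping level may be arbitrarily
    high. A conditional law is determined only up to a null set that depends on the rectangle, hence
    the passage through a countable grid of rectangles. *)

Section smooth_step.
Context {R : realType}.
Implicit Types x y h : R.

(** A quadratic bound on the remainder forces the difference quotient to converge, with no separate
    left and right limits at the kink of a truncated power. *)
Lemma is_derive_quad (F : R -> R) (x f C : R) :
  (forall h, `|F (x + h) - F x - h * f| <= C * h ^+ 2) -> is_derive x 1 F f.
Proof.
move=> H.
have C0 : 0 <= C by have := H 1; rewrite expr1n mulr1; apply: le_trans.
have cv : (fun h => h^-1 *: ((F \o shift x) (h *: 1) - F x)) @ 0^' --> f.
  apply/cvgrPdist_le => e e0.
  have eC : 0 < e / (C + 1) by rewrite divr_gt0// ltr_wpDl.
  near=> h.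
  have h0 : h != 0 by near: h; exact: nbhs_dnbhs_neq.
  have he : `|h| <= e / (C + 1).
    by near: h; apply: dnbhs0_le.
  rewrite /= /GRing.scale /= mulr1 (addrC h x) distrC.
  have -> : h^-1 * (F (x + h) - F x) - f = h^-1 * (F (x + h) - F x - h * f).
    by rewrite [RHS]mulrBr mulKf.
  rewrite normrM normfV ler_pdivrMl ?normr_gt0//.
  apply: (le_trans (H h)); rewrite -[h ^+ 2]real_normK ?num_real// expr2 mulrCA.
  rewrite ler_wpM2l//; apply: (@le_trans _ _ (C * (e / (C + 1)))).
    by rewrite ler_wpM2l.
  rewrite mulrCA ler_piMr//; first exact: ltW.
  by rewrite ler_pdivrMr ?mul1r ?lerDl// ltr_wpDl.
by apply: DeriveDef; [apply/cvg_ex; exists f|apply/cvg_lim].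
Unshelve. all: by end_near. Qed.

Definition pp x : R := Num.max x 0.

Lemma pp_ge0 x : 0 <= pp x. Proof. by rewrite /pp le_max lexx orbT. Qed.
Lemma pp_pos x : 0 <= x -> pp x = x. Proof. by rewrite /pp => /max_idPl. Qed.
Lemma pp_neg x : x <= 0 -> pp x = 0. Proof. by rewrite /pp => /max_idPr. Qed.

Lemma pp_case x : (0 <= x /\ pp x = x) \/ (x <= 0 /\ pp x = 0).
Proof.
by case: (leP 0 x) => x0; [left; rewrite pp_pos|right; rewrite (ltW x0) pp_neg ?ltW].
Qed.

Lemma is_derive_pp2 x : is_derive x 1 (fun x => pp x ^+ 2) (2 * pp x).
Proof.
apply: (@is_derive_quad _ _ _ 1) => h; rewrite mul1r ler_norml.
by case: (pp_case x) => -[hx ->]; case: (pp_case (x + h)) => -[hxh ->];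
  apply/andP; split; nra.
Qed.

Lemma ppX3 x : pp x ^+ 3 = pp x ^+ 2 * x.
Proof. by case: (pp_case x) => -[_ ->]; ring. Qed.

Lemma is_derive_pp3 x : is_derive x 1 (fun x => pp x ^+ 3) (3 * pp x ^+ 2).
Proof.
under eq_fun do rewrite ppX3.
apply: (is_derive_eq (is_deriveM (is_derive_pp2 x) (is_derive_id x 1))).
by rewrite /GRing.scale /=; case: (pp_case x) => -[_ ->]; ring.
Qed.

Lemma is_derive_pp4 x : is_derive x 1 (fun x => pp x ^+ 4) (4 * pp x ^+ 3).
Proof.
under eq_fun do rewrite (exprM _ 2 2).
apply: (is_derive_eq (is_deriveM (is_derive_pp2 x) (is_derive_pp2 x))).
by rewrite /GRing.scale /=; ring.
Qed.

(* [bspl k] is, up to sign, the fourth difference of the truncated power of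
   degree [k]: a cubic B-spline supported in [0, 4] and its derivatives. *)
Definition bspl k x : R := pp x ^+ k - 4 * pp (x - 1) ^+ k + 6 * pp (x - 2) ^+ k
  - 4 * pp (x - 3) ^+ k + pp (x - 4) ^+ k.

(** One minus the distribution function of a sum of four uniform variables: the fourth difference of
    [x ^+ 4] is 24, so [g0] falls from 1 to 0 across [0, 4]. Degree four is what makes three
    derivatives exist at the knots too, as the third-order expansion requires. *)
Definition g0 x : R := 1 - bspl 4 x / 24.
Definition g1 x : R := - (bspl 3 x / 6).
Definition g2 x : R := - (bspl 2 x / 2).
Definition g3 x : R := - bspl 1 x.

Lemma is_derive_shift (F : R -> R) x a f : is_derive (x - a) 1 F f ->
  is_derive x 1 (fun x => F (x - a)) f.
Proof.
move=> dF.
have d1 : is_derive x 1 (fun x => x - a) (1 : R).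
  by apply: (is_derive_eq (is_deriveB (is_derive_id x 1) (is_derive_cst a x 1))); rewrite subr0.
by have := @is_derive1_comp _ F (fun x => x - a) x f 1 dF d1; rewrite mulr1.
Qed.

Lemma is_derive_bspl k x : (forall x, is_derive x 1 (fun x => pp x ^+ k.+1) (k.+1%:R * pp x ^+ k)) ->
  is_derive x 1 (bspl k.+1) (k.+1%:R * bspl k x).
Proof.
move=> H.
have d0 := H x; have d1 := is_derive_shift (H (x - 1)).
have d2 := is_derive_shift (H (x - 2)); have d3 := is_derive_shift (H (x - 3)).
have d4 := is_derive_shift (H (x - 4)).
apply: is_derive_eq.
by rewrite /bspl /GRing.scale /=; ring.
Qed.

Lemma is_derive_g0 x : is_derive x 1 g0 (g1 x).
Proof.
have d := is_derive_bspl x is_derive_pp4.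
by apply: is_derive_eq; rewrite /g1 /GRing.scale /=; field.
Qed.

Lemma is_derive_g1 x : is_derive x 1 g1 (g2 x).
Proof.
have d := is_derive_bspl x is_derive_pp3.
by apply: is_derive_eq; rewrite /g2 /GRing.scale /=; field.
Qed.

Lemma is_derive_g2 x : is_derive x 1 g2 (g3 x).
Proof.
have d : is_derive x 1 (bspl 2) (2 * bspl 1 x).
  by apply: is_derive_bspl => z; rewrite expr1; exact: is_derive_pp2.
by apply: is_derive_eq; rewrite /g3 /GRing.scale /=; field.
Qed.

Lemma bspl_le0 k x : (0 < k)%N -> x <= 0 -> bspl k x = 0.
Proof.
by move=> k0 x0; rewrite /bspl !pp_neg ?expr0n ?gtn_eqF//; [ring|lra..].
Qed.

Lemma g0_le0 x : x <= 0 -> g0 x = 1.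
Proof. by move=> x0; rewrite /g0 bspl_le0// mul0r subr0. Qed.

Lemma g0_ge4 x : 4 <= x -> g0 x = 0.
Proof. by move=> x4; rewrite /g0 /bspl !pp_pos; [field|lra..]. Qed.

Lemma g123_out x : x <= 0 \/ 4 <= x -> [/\ g1 x = 0, g2 x = 0 & g3 x = 0].
Proof.
move=> [x0|x4]; rewrite /g1 /g2 /g3; first by rewrite !bspl_le0// !mul0r !oppr0.
by rewrite /bspl !pp_pos; [split; field|lra..].
Qed.

(** The absolute values 1, 4, 6, 4, 1 of the coefficients add up to 16. *)
Lemma bspl_bound k (M x : R) : (forall a, 0 <= a <= 4 -> 0 <= a ^+ k <= M) ->
  0 <= x <= 4 -> `|bspl k x| <= 16 * M.
Proof.
move=> kM /andP[x0 x4].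
have B a : 0 <= a -> 0 <= pp (x - a) <= 4.
  by move=> a0; rewrite pp_ge0 /=; case: (pp_case (x - a)) => -[_ ->]; lra.
have h0 : 0 <= pp x <= 4 by have := B 0 (lexx _); rewrite subr0.
have {h0} := kM _ h0; have := kM _ (B 1 ler01).
have := kM _ (B 2 (ler0n _ 2)); have := kM _ (B 3 (ler0n _ 3)).
have := kM _ (B 4 (ler0n _ 4)); rewrite /bspl ler_norml {B kM}.
by move=> /andP[? ?] /andP[? ?] /andP[? ?] /andP[? ?] /andP[? ?]; apply/andP; split; lra.
Qed.

(** Inside [0, 4] the crude bounds are 16 * 64 / 6, 16 * 16 / 2 and 16 * 4, all below 200; outside,
    the derivatives vanish. *)
Lemma g123_bound x : [/\ `|g1 x| <= 200, `|g2 x| <= 200 & `|g3 x| <= 200].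
Proof.
case: (leP x 0) => x0.
  have [-> -> ->] := g123_out (or_introl x0); rewrite normr0.
  by split; exact: ler0n.
case: (leP 4 x) => x4.
  have [-> -> ->] := g123_out (or_intror x4); rewrite normr0.
  by split; exact: ler0n.
have x04 : 0 <= x <= 4 by rewrite !ltW.
have b1 : `|bspl 1 x| <= 16 * 4 by apply: bspl_bound => // a; rewrite expr1.
have b2 : `|bspl 2 x| <= 16 * 16.
  by apply: bspl_bound => // a /andP[? ?]; apply/andP; split; nra.
have b3 : `|bspl 3 x| <= 16 * 64.
  apply: bspl_bound => // a /andP[? ?].
  have : 0 <= a ^+ 2 <= 16 by apply/andP; split; nra.
  by move=> /andP[? ?]; rewrite exprS; apply/andP; split; nra.
rewrite /g1 /g2 /g3 !normrN !normrM !(ger0_norm (_ : 0 <= _^-1))//.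
by split; lra.
Qed.

(** Checked between consecutive knots. By the symmetry of the spline about 2, the single inequality
    [4 u^3 <= (1 + u)^3] on [0, 1] serves on both middle intervals, with [u = x - 1] and
    [u = 3 - x]. *)
Lemma bspl3_ge0 x : 0 <= bspl 3 x.
Proof.
have cubic (u : R) : 0 <= u -> u <= 1 -> 0 <= (1 + u) ^+ 3 - 4 * u ^+ 3.
  move=> u0 u1; have -> : (1 + u) ^+ 3 - 4 * u ^+ 3 = 1 + 3 * u + 3 * u ^+ 2 * (1 - u) by ring.
  by rewrite addr_ge0 ?mulr_ge0 ?sqr_ge0//; lra.
case: (leP x 0) => x0; first by rewrite bspl_le0.
rewrite /bspl (pp_pos (ltW x0)).
case: (leP x 1) => x1.
  by rewrite !pp_neg; [rewrite !expr0n /= !mulr0 !subr0 !addr0 exprn_ge0// ltW|lra..].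
case: (leP x 2) => x2.
  rewrite (@pp_pos (x - 1)); last lra.
  rewrite !pp_neg; [|lra..]; rewrite !expr0n /= !mulr0 !subr0 !addr0.
  have -> : x ^+ 3 - 4 * (x - 1) ^+ 3 =
      (1 + (x - 1)) ^+ 3 - 4 * (x - 1) ^+ 3 by ring.
  by apply: cubic; lra.
case: (leP x 3) => x3.
  rewrite (@pp_pos (x - 1)); last lra.
  rewrite (@pp_pos (x - 2)); last lra.
  rewrite !pp_neg; [|lra..]; rewrite !expr0n /= !mulr0 !subr0 !addr0.
  have -> : x ^+ 3 - 4 * (x - 1) ^+ 3 + 6 * (x - 2) ^+ 3 =
      (1 + (3 - x)) ^+ 3 - 4 * (3 - x) ^+ 3 by ring.
  by apply: cubic; lra.
case: (leP x 4) => x4.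
  rewrite (@pp_pos (x - 1)); last lra.
  rewrite (@pp_pos (x - 2)); last lra.
  rewrite (@pp_pos (x - 3)); last lra.
  rewrite !pp_neg; [|lra..]; rewrite !expr0n /= !addr0.
  have -> : x ^+ 3 - 4 * (x - 1) ^+ 3 + 6 * (x - 2) ^+ 3 - 4 * (x - 3) ^+ 3 = (4 - x) ^+ 3 by ring.
  by rewrite exprn_ge0//; lra.
by rewrite !pp_pos; [rewrite le_eqVlt; apply/orP; left; apply/eqP; ring|lra..].
Qed.

Lemma mean_value (F f : R -> R) a b : (forall x, a <= x <= b -> is_derive x 1 F (f x)) ->
  a <= b -> exists2 c, a <= c <= b & F b - F a = f c * (b - a).
Proof.
move=> dF ab.
have dFo x : x \in `]a, b[ -> is_derive x 1 F (f x).
  by rewrite in_itv /= => /andP[? ?]; apply: dF; rewrite !ltW.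
have cF : {within `[a, b], continuous F}.
  apply: derivable_within_continuous => x; rewrite in_itv /= => xab.
  by have [] := dF x xab.
have [c] := MVT_segment ab dFo cF.
by rewrite in_itv /= => cab E; exists c.
Qed.

Lemma mean_value_le (F f : R -> R) a b K : a <= b ->
  (forall x, a <= x <= b -> is_derive x 1 F (f x)) ->
  (forall x, a <= x <= b -> `|f x| <= K) -> `|F b - F a| <= K * (b - a).
Proof.
move=> ab dF fK; have [c cab ->] := mean_value dF ab.
by rewrite normrM [X in _ * X]ger0_norm ?subr_ge0// ler_wpM2r ?subr_ge0// fK.
Qed.

Lemma g0_itv x : 0 <= g0 x <= 1.
Proof.
have mono a b : a <= b -> g0 b <= g0 a.
  move=> ab; have [c _ E] := mean_value (fun x _ => is_derive_g0 x) ab.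
  rewrite -subr_le0 E mulr_le0_ge0 ?subr_ge0// /g1 oppr_le0.
  by rewrite divr_ge0// bspl3_ge0.
case: (leP x 0) => x0; first by rewrite g0_le0 ?ler01 ?lexx.
case: (leP 4 x) => x4; first by rewrite g0_ge4 ?ler01 ?lexx.
have := mono _ _ (ltW x0); have := mono _ _ (ltW x4).
by rewrite (g0_le0 (lexx 0)) (g0_ge4 (lexx 4)) => -> ->.
Qed.

End smooth_step.

(** * Expectations and product measures *)

Section expectation.
Context {R : realType} {d : measure_display} {T : measurableType d}.
Implicit Types (m : probability T R) (f g : T -> R).

Definition Ex m f : R := fine (\int[m]_x (f x)%:E)%E.

Definition itg m f : Prop := m.-integrable setT (EFin \o f).

(** The working class for functions of the data: it is stable under every operation met below and
    gives integrability at once. The bound is only known to exist, and quantitative estimates use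
    moments instead, so that the kernel can be clipped at any level. *)
Definition bm f : Prop :=
  measurable_fun setT f /\ exists M : R, forall x, `|f x| <= M.

Lemma itg_fin_num m f : itg m f -> (\int[m]_x (f x)%:E)%E \is a fin_num.
Proof. by move=> h; exact: integrable_fin_num. Qed.

Lemma Ex_EFin m f : itg m f -> ((Ex m f)%:E = \int[m]_x (f x)%:E)%E.
Proof. by move=> h; rewrite /Ex fineK// itg_fin_num. Qed.

Lemma itg_dom m f g : measurable_fun setT f -> (forall x, `|f x| <= g x) ->
  itg m g -> itg m f.
Proof.
move=> mf fg ig; apply: (le_integrable measurableT) ig.
  exact/measurable_EFinP.
move=> x _ /=; rewrite lee_fin.
by rewrite (le_trans (fg x))// ler_norm.
Qed.

Lemma itg_cst m (c : R) : itg m (fun=> c).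
Proof. exact: (finite_measure_integrable_cst m c). Qed.

Lemma bm_itg m f : bm f -> itg m f.
Proof.
by move=> [mf [M fM]]; apply: (itg_dom mf fM); exact: itg_cst.
Qed.

Lemma itg_mf m f : itg m f -> measurable_fun setT f.
Proof. by move=> /measurable_int/measurable_EFinP. Qed.

Lemma itgD m f g : itg m f -> itg m g -> itg m (fun x => f x + g x).
Proof. by move=> hf hg; have := integrableD measurableT hf hg. Qed.

Lemma itgZ m (c : R) f : itg m f -> itg m (fun x => c * f x).
Proof. by move=> hf; have := integrableZl measurableT c hf. Qed.

Lemma itgN m f : itg m f -> itg m (fun x => - f x).
Proof. by move=> hf; have := integrableN hf. Qed.

Lemma itgB m f g : itg m f -> itg m g -> itg m (fun x => f x - g x).
Proof. by move=> hf hg; exact: itgD (itgN hg). Qed.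

Lemma itg_abs m f : itg m f -> itg m (fun x => `|f x|).
Proof.
move=> hf; apply: (@itg_dom m _ (fun x => `|f x|)).
- by apply: measurableT_comp => //; exact: itg_mf hf.
- by move=> x; rewrite normr_id.
- by have := integrable_norm hf.
Qed.

Lemma itg_sum m (J : Type) (r : seq J) (P : pred J) (F : J -> T -> R) :
  (forall j, itg m (F j)) -> itg m (fun x => \sum_(j <- r | P j) F j x).
Proof.
move=> h; elim: r => [|j r IH].
  rewrite (_ : (fun _ => _) = fun=> 0); first exact: itg_cst.
  by apply/funext => x; rewrite big_nil.
rewrite (_ : (fun _ => _) = fun x => (if P j then F j x else 0) +
    \sum_(j <- r | P j) F j x).
  by apply: itgD => //; case: (P j) => //; exact: itg_cst.
by apply/funext => x; rewrite big_cons; case: ifP => // _; rewrite add0r.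
Qed.

Lemma itg_bmM m f g : itg m f -> bm g -> itg m (fun x => f x * g x).
Proof.
move=> hf [mg [M gM]]; apply: (@itg_dom m _ (fun x => M * `|f x|)).
- by apply: measurable_funM => //; exact: itg_mf hf.
- by move=> x; rewrite normrM mulrC ler_wpM2r.
- exact/itgZ/itg_abs.
Qed.

Lemma Ex_cst m (c : R) : Ex m (fun=> c) = c.
Proof.
by rewrite /Ex (_ : (fun x => c%:E)%E = cst c%:E)// integral_cst//= probability_setT mule1.
Qed.

Lemma ExD m f g : itg m f -> itg m g ->
  Ex m (fun x => f x + g x) = Ex m f + Ex m g.
Proof.
move=> hf hg; apply: EFin_inj; rewrite EFinD !Ex_EFin//; last exact: itgD.
by under eq_integral do rewrite EFinD; rewrite integralD.
Qed.

Lemma ExZ m (c : R) f : itg m f -> Ex m (fun x => c * f x) = c * Ex m f.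
Proof.
move=> hf; apply: EFin_inj; rewrite EFinM !Ex_EFin//; last exact: itgZ.
by under eq_integral do rewrite EFinM; rewrite integralZl.
Qed.

Lemma ExN m f : itg m f -> Ex m (fun x => - f x) = - Ex m f.
Proof.
move=> hf; rewrite -mulN1r -ExZ//; congr Ex; apply/funext => x.
by rewrite mulN1r.
Qed.

Lemma ExB m f g : itg m f -> itg m g ->
  Ex m (fun x => f x - g x) = Ex m f - Ex m g.
Proof. by move=> hf hg; rewrite ExD ?ExN//; exact: itgN. Qed.

Lemma Ex_sum m (J : Type) (r : seq J) (P : pred J) (F : J -> T -> R) :
  (forall j, itg m (F j)) ->
  Ex m (fun x => \sum_(j <- r | P j) F j x) = \sum_(j <- r | P j) Ex m (F j).
Proof.
move=> h; elim: r => [|j r IH].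
  rewrite big_nil (_ : (fun _ => _) = fun=> 0) ?Ex_cst//.
  by apply/funext => x; rewrite big_nil.
rewrite big_cons (_ : (fun _ => _) = fun x => (if P j then F j x else 0) +
    \sum_(j <- r | P j) F j x); last first.
  by apply/funext => x; rewrite big_cons; case: ifP => // _; rewrite add0r.
have hs : itg m (fun x => \sum_(j <- r | P j) F j x) by exact: itg_sum.
rewrite ExD//; last by case: (P j) => //; exact: itg_cst.
by rewrite IH; case: (P j) => //; rewrite Ex_cst add0r.
Qed.

Lemma Ex_le m f g : itg m f -> itg m g -> (forall x, f x <= g x) ->
  Ex m f <= Ex m g.
Proof.
move=> hf hg fg; rewrite -lee_fin !Ex_EFin//.
by apply: le_integral => // x _; rewrite lee_fin.
Qed.

Lemma Ex_ge0 m f : (forall x, 0 <= f x) -> 0 <= Ex m f.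
Proof.
by move=> f0; apply/fine_ge0/integral_ge0 => x _; rewrite lee_fin.
Qed.

Lemma Ex_abs m f : itg m f -> `|Ex m f| <= Ex m (fun x => `|f x|).
Proof.
move=> hf; have ha := itg_abs hf; rewrite ler_norml -ExN// !Ex_le//.
- by move=> x; exact: ler_norm.
- exact: itgN.
- by move=> x; rewrite lerNl -normrN ler_norm.
Qed.

Lemma Ex_ext m f g : (forall x, f x = g x) -> Ex m f = Ex m g.
Proof. by move=> fg; congr Ex; apply/funext. Qed.

Lemma Ex_indic m (A : set T) : measurable A -> Ex m (\1_A) = fine (m A).
Proof. by move=> mA; rewrite /Ex integral_indic// setIT. Qed.

Lemma bm_cst (c : R) : bm (fun=> c).
Proof. by split => //; exists `|c|. Qed.

Lemma bmD f g : bm f -> bm g -> bm (fun x => f x + g x).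
Proof.
move=> [mf [M fM]] [mg [M' gM]]; split; first exact: measurable_funD.
by exists (M + M') => x; rewrite (le_trans (ler_normD _ _))// lerD.
Qed.

Lemma bmN f : bm f -> bm (fun x => - f x).
Proof.
move=> [mf [M fM]]; split; first exact: measurableT_comp.
by exists M => x; rewrite normrN.
Qed.

Lemma bmB f g : bm f -> bm g -> bm (fun x => f x - g x).
Proof. by move=> hf hg; exact: bmD (bmN hg). Qed.

Lemma bmM f g : bm f -> bm g -> bm (fun x => f x * g x).
Proof.
move=> [mf [M fM]] [mg [M' gM]]; split; first exact: measurable_funM.
by exists (M * M') => x; rewrite normrM ler_pM.
Qed.

Lemma bm_abs f : bm f -> bm (fun x => `|f x|).
Proof.
move=> [mf [M fM]]; split; first exact: measurableT_comp.
by exists M => x; rewrite normr_id.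
Qed.

Lemma bmX f n : bm f -> bm (fun x => f x ^+ n).
Proof.
move=> h; elim: n => [|n IH].
  by rewrite (_ : (fun _ => _) = fun=> 1); [exact: bm_cst|apply/funext].
rewrite (_ : (fun _ => _) = fun x => f x * f x ^+ n); first exact: bmM.
by apply/funext => x; rewrite exprS.
Qed.

Lemma bm_sum (J : Type) (r : seq J) (P : pred J) (F : J -> T -> R) :
  (forall j, bm (F j)) -> bm (fun x => \sum_(j <- r | P j) F j x).
Proof.
move=> h; elim: r => [|j r IH].
  rewrite (_ : (fun _ => _) = fun=> 0); first exact: bm_cst.
  by apply/funext => x; rewrite big_nil.
rewrite (_ : (fun _ => _) = fun x => (if P j then F j x else 0) +
    \sum_(j <- r | P j) F j x).
  by apply: bmD => //; case: (P j) => //; exact: bm_cst.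
by apply/funext => x; rewrite big_cons; case: ifP => // _; rewrite add0r.
Qed.

Lemma bm_max f g : bm f -> bm g -> bm (fun x => Num.max (f x) (g x)).
Proof.
move=> [mf [M fM]] [mg [M' gM]]; split; first exact: measurable_maxr.
exists (Num.max M M') => x.
by case: (leP (f x) (g x)) => _; rewrite le_max ?fM ?gM ?orbT.
Qed.

Lemma bm_bigmax (J : Type) (r : seq J) (P : pred J) (F : J -> T -> R) :
  (forall j, bm (F j)) -> bm (fun x => \big[Num.max/0]_(j <- r | P j) F j x).
Proof.
move=> h; elim: r => [|j r IH].
  rewrite (_ : (fun _ => _) = fun=> 0); first exact: bm_cst.
  by apply/funext => x; rewrite big_nil.
case Pj : (P j).
  rewrite (_ : (fun _ => _) = fun x => Num.max (F j x)
    (\big[Num.max/0]_(j <- r | P j) F j x)); first exact: bm_max.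
  by apply/funext => x; rewrite big_cons Pj.
rewrite (_ : (fun _ => _) = fun x => \big[Num.max/0]_(j <- r | P j) F j x)//.
by apply/funext => x; rewrite big_cons Pj.
Qed.

Lemma bm_dom f g : measurable_fun setT f -> bm g ->
  (forall x, `|f x| <= g x) -> bm f.
Proof.
move=> mf [_ [M gM]] fg; split => //; exists M => x.
by rewrite (le_trans (fg x))// (le_trans (ler_norm _)).
Qed.

Lemma bm_post (phi : R -> R) f : measurable_fun setT phi ->
  (forall M, exists M', forall x, `|x| <= M -> `|phi x| <= M') ->
  bm f -> bm (fun x => phi (f x)).
Proof.
move=> mphi hphi [mf [M fM]]; split; first exact: measurableT_comp.
by have [M' h] := hphi M; exists M' => x; exact: h.
Qed.

End expectation.

Lemma bm_pre {R : realType} d1 d2 (T1 : measurableType d1)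
    (T2 : measurableType d2) (f : T2 -> R) (phi : T1 -> T2) :
  measurable_fun setT phi -> bm f -> bm (fun x => f (phi x)).
Proof.
move=> mphi [mf [M fM]]; split; first exact: measurableT_comp.
by exists M.
Qed.

Section law.
Context {R : realType} {d1 d2 : measure_display}
  {T1 : measurableType d1} {T2 : measurableType d2}.
Variables (m1 : probability T1 R) (m2 : probability T2 R) (phi : T1 -> T2).

Definition law := measurable_fun setT phi /\
  forall A, measurable A -> m1 (phi @^-1` A) = m2 A.

Hypothesis hl : law.

Let phi_mfun : {mfun T1 >-> T2} := mfun_Sub (mem_set hl.1).

Lemma law_ge0_integral (f : T2 -> \bar R) : measurable_fun setT f ->
  (forall y, (0 <= f y)%E) -> (\int[m1]_x f (phi x) = \int[m2]_y f y)%E.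
Proof.
move=> mf f0; have := ge0_integral_distribution (P := m1) phi_mfun mf f0.
move=> <-; apply: eq_measure_integral => A mA _.
exact: hl.2.
Qed.

Lemma law_itg (f : T2 -> R) : itg m2 f -> itg m1 (fun x => f (phi x)).
Proof.
move=> hf; have mf := itg_mf hf; apply/integrableP; split.
  by apply/measurable_EFinP; apply: measurableT_comp => //; exact: hl.1.
rewrite (law_ge0_integral (f := fun y => `|(f y)%:E|%E))//.
  by case/integrableP : hf.
by apply: measurableT_comp => //; exact/measurable_EFinP.
Qed.

Lemma law_Ex (f : T2 -> R) : itg m2 f -> Ex m1 (fun x => f (phi x)) = Ex m2 f.
Proof.
move=> hf; have h1 := law_itg hf.
rewrite /Ex; congr fine.
have := @integral_distribution _ _ _ _ _ m1 phi_mfun (EFin \o f).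
move=> <-//; last exact/measurable_EFinP/(itg_mf hf).
by apply: eq_measure_integral => A mA _; exact: hl.2.
Qed.

End law.

Section fubini.
Context {R : realType} {d1 d2 : measure_display}
  {T1 : measurableType d1} {T2 : measurableType d2}.
Variables (m1 : probability T1 R) (m2 : probability T2 R).

Definition pprod : probability (T1 * T2)%type R := (m1 \x m2)%E.

Lemma pprodX (A : set T1) (B : set T2) : measurable A -> measurable B ->
  (pprod (A `*` B) = m1 A * m2 B)%E.
Proof. by move=> mA mB; exact: product_measure1E. Qed.

Lemma bm_Ex (f : T1 * T2 -> R) : bm f -> bm (fun x => Ex m2 (fun y => f (x, y))).
Proof.
move=> bf; have [mf [M fM]] := bf; split; last first.
  exists M => x; have h : bm (fun y => f (x, y)).
    apply: bm_pre => //; exact: pair1_measurable.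
  rewrite (le_trans (Ex_abs (bm_itg _ h)))//.
  rewrite -[leRHS](Ex_cst m2) Ex_le//.
    exact/bm_itg/bm_abs.
  exact: itg_cst.
by apply: measurableT_comp => //; exact: (measurable_fubini_F (bm_itg pprod bf)).
Qed.

Lemma bm_Ex2 (f : T1 * T2 -> R) : bm f -> bm (fun y => Ex m1 (fun x => f (x, y))).
Proof.
move=> bf; have [mf [M fM]] := bf; split; last first.
  exists M => y; have h : bm (fun x => f (x, y)).
    apply: bm_pre => //; exact: pair2_measurable.
  rewrite (le_trans (Ex_abs (bm_itg _ h)))//.
  rewrite -[leRHS](Ex_cst m1) Ex_le//.
    exact/bm_itg/bm_abs.
  exact: itg_cst.
by apply: measurableT_comp => //; exact: (measurable_fubini_G (bm_itg pprod bf)).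
Qed.

Lemma Ex_pprod (f : T1 * T2 -> R) : itg pprod f ->
  (forall x, itg m2 (fun y => f (x, y))) ->
  Ex pprod f = Ex m1 (fun x => Ex m2 (fun y => f (x, y))).
Proof.
move=> hf h2; rewrite /Ex; congr fine.
rewrite -(integral12_prod_meas1 hf); apply: eq_integral => x _.
by rewrite -[RHS]/((Ex m2 (fun y => f (x, y)))%:E) Ex_EFin.
Qed.

Lemma Ex_pprod2 (f : T1 * T2 -> R) : itg pprod f ->
  (forall y, itg m1 (fun x => f (x, y))) ->
  Ex pprod f = Ex m2 (fun y => Ex m1 (fun x => f (x, y))).
Proof.
move=> hf h2; rewrite /Ex; congr fine.
rewrite -(integral21_prod_meas1 hf); apply: eq_integral => x _.
by rewrite -[RHS]/((Ex m1 (fun y => f (y, x)))%:E) Ex_EFin.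
Qed.

Lemma bm_sec1 (f : T1 * T2 -> R) x : bm f -> bm (fun y => f (x, y)).
Proof. by move=> bf; apply: bm_pre => //; exact: pair1_measurable. Qed.

Lemma bm_sec2 (f : T1 * T2 -> R) y : bm f -> bm (fun x => f (x, y)).
Proof. by move=> bf; apply: bm_pre => //; exact: pair2_measurable. Qed.

Lemma law_fst : law pprod m1 fst.
Proof.
split => // A mA; rewrite (_ : fst @^-1` A = A `*` setT); last first.
  by apply/seteqP; split => -[x z] //= [].
by rewrite pprodX// -[RHS]mule1; congr (_ * _)%E; exact: probability_setT.
Qed.

Lemma law_snd : law pprod m2 snd.
Proof.
split => // A mA; rewrite (_ : snd @^-1` A = setT `*` A); last first.
  by apply/seteqP; split => -[x z] //= [].
by rewrite pprodX// -[RHS]mul1e; congr (_ * _)%E; exact: probability_setT.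
Qed.

Lemma Ex_swap (f : T1 * T2 -> R) : bm f ->
  Ex m1 (fun x => Ex m2 (fun y => f (x, y))) =
  Ex m2 (fun y => Ex m1 (fun x => f (x, y))).
Proof.
move=> bf; have ibf : itg pprod f by exact: bm_itg.
rewrite -Ex_pprod ?Ex_pprod2// => ?.
- by apply/bm_itg/bm_sec2.
- by apply/bm_itg/bm_sec1.
Qed.

End fubini.
Arguments pprod {R d1 d2 T1 T2} m1 m2.

(** * Powers of a probability on tuples, and resampling of coordinates *)

Section power.
Context {R : realType} {d : measure_display} {T : measurableType d}.
Variable mu : probability T R.

Lemma measurable_cons_pair n : measurable_fun setT
  (fun x : T * n.-tuple T => [the n.+1.-tuple T of x.1 :: x.2]).
Proof. exact: measurable_cons. Qed.

Definition cons_mfun n : {mfun (T * n.-tuple T)%type >-> n.+1.-tuple T} :=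
  mfun_Sub (mem_set (@measurable_cons_pair n)).

(** The recursion adds one coordinate at a time by [cons], so that the product law lives on the
    sample type itself and is accessible to induction on [n]. *)
Fixpoint pow n : probability (n.-tuple T) R :=
  if n is k.+1 then distribution (pprod mu (pow k)) (cons_mfun k)
  else (\d_ [tuple])%E.

Definition rect n (A : 'I_n -> set T) : set (n.-tuple T) :=
  [set s | forall i, A i (tnth s i)].

Lemma measurable_rect n (A : 'I_n -> set T) : (forall i, measurable (A i)) ->
  measurable (rect A).
Proof.
move=> mA; rewrite (_ : rect A = \big[setI/setT]_(i < n) ((fun s => tnth s i) @^-1` (A i))).
  apply: bigsetI_measurable => i _; rewrite -[X in measurable X]setTI.
  exact: measurable_tnth.
by rewrite -bigcap_seq; apply/seteqP; split => s /=; [move=> h i _; exact: h|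
  move=> h i; apply: h; rewrite /= mem_index_enum].
Qed.

Lemma tnth_cons0 n (x : T) (s : n.-tuple T) :
  tnth [the n.+1.-tuple T of x :: s] ord0 = x.
Proof. by []. Qed.

Lemma tnth_consS n (x : T) (s : n.-tuple T) i :
  tnth [the n.+1.-tuple T of x :: s] (lift ord0 i) = tnth s i.
Proof. by rewrite tnthS. Qed.

Lemma pow_rect n (A : 'I_n -> set T) : (forall i, measurable (A i)) ->
  (pow n (rect A) = \prod_(i < n) mu (A i))%E.
Proof.
elim: n A => [|n IH] A mA.
  rewrite big_ord0 /= diracE mem_set//= => -[]//.
rewrite big_ord_recl -IH//.
rewrite -product_measure1E//; last exact: measurable_rect.
rewrite /= /pushforward /=; congr (_ _).
apply/seteqP; split => -[x s] /=.
  move=> h; split => /=; first exact: (h ord0).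
  by move=> i; have := h (lift ord0 i); rewrite tnth_consS.
move=> [/= A0 h] i; case: (unliftP ord0 i) => [j|] ->; last exact: A0.
by rewrite tnth_consS; exact: h.
Qed.

(** Rectangles are closed under intersection and generate the sigma-algebra of tuples. Each later
    claim that some map produces an i.i.d. sample thereby reduces to a computation on rectangles. *)
Lemma pow_unique n (m : probability (n.-tuple T) R) :
  (forall A : 'I_n -> set T, (forall i, measurable (A i)) ->
     (m (rect A) = \prod_(i < n) mu (A i))%E) ->
  forall B, measurable B -> m B = pow n B.
Proof.
move=> mE B mB.
pose G : set (set (n.-tuple T)) := [set C | exists A : 'I_n -> set T,
  (forall i, measurable (A i)) /\ C = rect A].
apply: (measure_unique G (fun=> setT)) => //.
- apply/seteqP; split.
    apply: smallest_sub; first exact: smallest_sigma_algebra.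
    move=> C; rewrite -bigcup_seq => -[i _ [A mA <-]].
    apply: sub_sigma_algebra.
    rewrite setTI /G /=; exists (fun j => if j == i then A else setT); split.
      by move=> j; case: ifP.
    apply/seteqP; split => s /=.
      move=> As j; case: ifP => // /eqP ->; exact: As.
    by move=> /(_ i); rewrite eqxx.
  apply: smallest_sub; first exact: sigma_algebra_measurable.
  by move=> C [A [mA ->]]; exact: measurable_rect.
- move=> C D [A [mA ->]] [A' [mA' ->]].
  exists (fun i => A i `&` A' i); split; first by move=> i; exact: measurableI.
  apply/seteqP; split => s /=; first by move=> [h1 h2] i; split; [exact: h1|exact: h2].
  by move=> h; split => i; [exact: (h i).1|exact: (h i).2].
- move=> k; exists (fun=> setT); split => //.
  by apply/seteqP; split.
- by rewrite bigcup_const.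
- by move=> C [A [mA ->]]; transitivity (\prod_(i < n) mu (A i))%E; [exact: mE|exact/esym/pow_rect].
- by move=> k; apply: (@le_lt_trans _ _ 1%E); [exact: probability_le1|exact: ltry].
Qed.

Lemma law_pow d' (T' : measurableType d') (m : probability T' R) n
    (phi : T' -> n.-tuple T) : measurable_fun setT phi ->
  (forall A : 'I_n -> set T, (forall i, measurable (A i)) ->
     (m (phi @^-1` rect A) = \prod_(i < n) mu (A i))%E) ->
  law m (pow n) phi.
Proof.
move=> mphi h; split => //.
have := @pow_unique n (distribution m (mfun_Sub (mem_set mphi))).
by apply.
Qed.

Definition upd n (s : n.-tuple T) (i : 'I_n) (x : T) : n.-tuple T :=
  [tuple if j == i then x else tnth s j | j < n].

Definition splice n (J : pred 'I_n) (s1 s2 : n.-tuple T) : n.-tuple T :=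
  [tuple if J i then tnth s1 i else tnth s2 i | i < n].

Lemma measurable_upd n (i : 'I_n) :
  measurable_fun setT (fun xs : T * n.-tuple T => upd xs.2 i xs.1).
Proof.
apply/measurable_fun_tnthP => j.
rewrite (_ : _ \o _ = fun xs => if j == i then xs.1 else tnth xs.2 j); last first.
  by apply/funext => s /=; rewrite tnth_mktuple.
case: (j == i); first exact: measurable_fst.
by apply: (measurableT_comp (@measurable_tnth _ T n j)); exact: measurable_snd.
Qed.

Lemma measurable_splice n (J : pred 'I_n) :
  measurable_fun setT (fun ss : n.-tuple T * n.-tuple T => splice J ss.1 ss.2).
Proof.
apply/measurable_fun_tnthP => j.
rewrite (_ : _ \o _ = fun xs => if J j then tnth xs.1 j else tnth xs.2 j); last first.
  by apply/funext => s /=; rewrite tnth_mktuple.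
by case: (J j); apply: (measurableT_comp (@measurable_tnth _ T n j));
  [exact: measurable_fst|exact: measurable_snd].
Qed.

(** With Fubini this integrates out an arbitrary coordinate, not only the head of the tuple, while
    the others stay frozen: the basic move of the leave-one-out, Stein and symmetrisation
    arguments. *)
Lemma law_upd n (i : 'I_n) :
  law (pprod mu (pow n)) (pow n) (fun xs => upd xs.2 i xs.1).
Proof.
apply: law_pow; first exact: measurable_upd.
move=> A mA; pose A' j := if j == i then setT else A j.
have mA' j : measurable (A' j) by rewrite /A'; case: ifP.
rewrite (_ : _ @^-1` _ = A i `*` rect A').
  rewrite pprodX//; last exact: measurable_rect.
  rewrite pow_rect// (bigD1 i)//= [in RHS](bigD1 i)//= {1}/A' eqxx.
  rewrite [X in (_ * (X * _))%E]probability_setT mul1e; congr (_ * _)%E.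
  by apply: eq_bigr => j /negbTE ji; rewrite /A' ji.
apply/seteqP; split => -[x s] /=.
  move=> h; split => /=; first by have := h i; rewrite tnth_mktuple eqxx.
  by move=> j; rewrite /A'; case: eqP => // /eqP/negbTE ji; have := h j; rewrite tnth_mktuple ji.
move=> [/= Ai h] j; rewrite tnth_mktuple; case: eqP => [->//|/eqP/negbTE ji].
by have := h j; rewrite /A' ji.
Qed.

(** Serves decoupling: once a set [J] of indices is fixed, the observations inside and outside [J]
    may be taken from two independent samples. *)
Lemma law_splice n (J : pred 'I_n) :
  law (pprod (pow n) (pow n)) (pow n) (fun ss => splice J ss.1 ss.2).
Proof.
apply: law_pow; first exact: measurable_splice.
move=> A mA; pose A1 j := if J j then A j else setT.
pose A2 j := if J j then setT else A j.
have mA1 j : measurable (A1 j) by rewrite /A1; case: ifP.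
have mA2 j : measurable (A2 j) by rewrite /A2; case: ifP.
rewrite (_ : _ @^-1` _ = rect A1 `*` rect A2).
  rewrite pprodX//; [|exact: measurable_rect..].
  rewrite !pow_rect// -big_split/=; apply: eq_bigr => j _.
  rewrite /A1 /A2; case: ifP => _; last first.
    by rewrite [X in (X * _)%E]probability_setT mul1e.
  by rewrite [X in (_ * X)%E]probability_setT mule1.
apply/seteqP; split => -[x s] /=.
  move=> h; split => j /=; rewrite /A1 /A2.
    by case: ifP => // Jj; have := h j; rewrite tnth_mktuple Jj.
  by case: ifP => // Jj; have := h j; rewrite tnth_mktuple Jj.
move=> [/= h1 h2] j; rewrite tnth_mktuple.
by have := h1 j; have := h2 j; rewrite /A1 /A2; case: ifP.
Qed.

Lemma bm_upd n (i : 'I_n) (F : n.-tuple T -> R) : bm F ->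
  bm (fun xs : T * n.-tuple T => F (upd xs.2 i xs.1)).
Proof. by move=> bF; apply: bm_pre => //; exact: measurable_upd. Qed.

Lemma bm_updx n (i : 'I_n) (F : n.-tuple T -> R) s : bm F ->
  bm (fun x => F (upd s i x)).
Proof. by move=> /(bm_upd i)/(bm_sec2 s). Qed.

Lemma Ex_upd n (i : 'I_n) (F : n.-tuple T -> R) : bm F ->
  Ex (pow n) F = Ex (pow n) (fun s => Ex mu (fun x => F (upd s i x))).
Proof.
move=> bF; rewrite -(law_Ex (law_upd i)); last exact: bm_itg.
rewrite Ex_pprod2//; last by move=> s; exact/bm_itg/bm_updx.
exact/bm_itg/bm_upd.
Qed.

Lemma Ex_upd_itg n (i : 'I_n) (F : n.-tuple T -> R) : itg (pow n) F ->
  (forall s, itg mu (fun x => F (upd s i x))) ->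
  Ex (pow n) F = Ex (pow n) (fun s => Ex mu (fun x => F (upd s i x))).
Proof.
move=> iF iFx; rewrite -(law_Ex (law_upd i))// Ex_pprod2//.
exact: (law_itg (law_upd i)).
Qed.

Lemma law_tnth n (i : 'I_n) : law (pow n) mu (fun s => tnth s i).
Proof.
split; first exact: measurable_tnth.
move=> A mA; pose A' j := if j == i then A else setT.
have mA' k : measurable (A' k) by rewrite /A'; case: ifP.
rewrite (_ : _ @^-1` _ = rect A').
  rewrite pow_rect// (bigD1 i)//= /A' eqxx big1 ?mule1// => k /negbTE ->.
  exact: probability_setT.
apply/seteqP; split => s /=.
  by move=> As k; rewrite /A'; case: eqP => // ->.
by move=> /(_ i); rewrite /A' eqxx.
Qed.

Lemma Ex_coord n (i : 'I_n) (f : T -> R) : itg mu f ->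
  Ex (pow n) (fun s => f (tnth s i)) = Ex mu f.
Proof. by move=> itf; exact: (law_Ex (law_tnth i)). Qed.

Lemma Ex_splice n (J : pred 'I_n) (F : n.-tuple T -> R) : bm F ->
  Ex (pow n) F =
  Ex (pow n) (fun s2 => Ex (pow n) (fun s1 => F (splice J s1 s2))).
Proof.
move=> bF; rewrite -(law_Ex (law_splice J)); last exact: bm_itg.
have b2 : bm (fun ss : n.-tuple T * n.-tuple T => F (splice J ss.1 ss.2)).
  by apply: bm_pre => //; exact: measurable_splice.
rewrite Ex_pprod2//; last by move=> s; exact/bm_itg/(bm_sec2 s b2).
exact/bm_itg.
Qed.

Lemma bm_tnth n (i : 'I_n) (f : T -> R) : bm f ->
  bm (fun s : n.-tuple T => f (tnth s i)).
Proof. by move=> bf; apply: bm_pre => //; exact: measurable_tnth. Qed.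

Lemma tnth_upd n (s : n.-tuple T) i x j :
  tnth (upd s i x) j = if j == i then x else tnth s j.
Proof. by rewrite tnth_mktuple. Qed.

Lemma tnth_splice n (J : pred 'I_n) (s1 s2 : n.-tuple T) i :
  tnth (splice J s1 s2) i = if J i then tnth s1 i else tnth s2 i.
Proof. by rewrite tnth_mktuple. Qed.

End power.
Arguments pow {R d T} mu n.

(** * The standard Gaussian law *)

Section standard_normal.
Context {R : realType}.
Local Notation leb := (@lebesgue_measure R).

Let idTR : measurableTypeR R -> R := idfun.

Let measurable_idTR : measurable_fun setT idTR.
Proof. by move=> _ A mA; rewrite setTI. Qed.

Let idTR_mfun : {mfun measurableTypeR R >-> R} := mfun_Sub (mem_set measurable_idTR).

Let normal01 : probability (measurableTypeR R) R := normal_prob 0 1.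

(** The normal law is carried along the identity from [measurableTypeR R] to [R], the type of the
    coordinates of a tuple, so that [pow] applies to it. *)
Definition N01 : probability R R := distribution normal01 idTR_mfun.

Local Notation phi := (normal_pdf (0 : R) 1).

Lemma N01_pdfE x : phi x = normal_peak 1 * expR (- (x ^+ 2 / 2)).
Proof.
rewrite normal_pdfE ?oner_neq0// /normal_fun subr0 expr1n mulNr.
by rewrite -mulr_natr mul1r.
Qed.

Let numu : normal01 `<< leb := normal_prob_dominates 0 1.

Let mphi : measurable_fun setT (EFin \o phi).
Proof. by apply/measurable_EFinP; exact: measurable_normal_pdf. Qed.

Let density_ae : ae_eq leb setT
  (Radon_Nikodym_SigmaFinite.f (T := measurableTypeR R) normal01 leb) (EFin \o phi).
Proof.
apply: integral_ae_eq => //.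
- exact: Radon_Nikodym_SigmaFinite.f_integrable.
- by move=> E _ mE; rewrite -Radon_Nikodym_SigmaFinite.f_integral.
Qed.

Lemma N01_ge0_integral (f : R -> \bar R) : measurable_fun setT f ->
  (forall x, 0 <= f x)%E ->
  (\int[N01]_x f x = \int[leb]_x (f x * (phi x)%:E))%E.
Proof.
move=> mf f0.
transitivity (\int[normal01]_x f x)%E.
  by rewrite (ge0_integral_distribution (P := normal01) idTR_mfun).
rewrite -(Radon_Nikodym_SigmaFinite.change_of_variables numu f0)//.
apply: ae_eq_integral => //.
- apply: emeasurable_funM => //.
  by apply: (measurable_int leb); exact: Radon_Nikodym_SigmaFinite.f_integrable.
- exact: emeasurable_funM.
- exact: ae_eqe_mul2l.
Qed.

Lemma lebesgue_shift (v : R) (f : R -> \bar R) : measurable_fun setT f ->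
  (forall x, 0 <= f x)%E -> (\int[leb]_x f (x + v)%R = \int[leb]_x f x)%E.
Proof.
move=> mf f0.
pose sh (x : measurableTypeR R) : measurableTypeR R := x + v.
have msh : measurable_fun setT sh by apply: measurable_funD.
have -> : (\int[leb]_x f (x + v)%R)%E = (\int[pushforward leb sh]_x f x)%E.
  by rewrite ge0_integral_pushforward// => ? _.
apply: eq_measure_integral => A mA _; apply/esym.
apply: (lebesgue_measure_unique (mu := pushforward leb sh)) => //.
move=> _ [[a b] _ <-] /=.
rewrite /pushforward /= (_ : sh @^-1` _ = `]a - v, b - v]%classic).
  rewrite !lebesgue_measure_itv/= !lte_fin ltrD2r.
  by case: ifP => // _; rewrite -!EFinB; congr EFin; ring.
by apply/seteqP; split => x /=; rewrite !in_itv/= /sh ltrBlDr lerBrDr.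
Qed.

(** Completing the square: the density at [x - v] is the density at [x] times
    [expR (v * x - v ^+ 2 / 2)], and Lebesgue measure absorbs the translation. *)
Lemma N01_shift (v : R) (f : R -> \bar R) : measurable_fun setT f ->
  (forall x, 0 <= f x)%E ->
  (\int[N01]_x f (x + v)%R =
   \int[N01]_x (f x * (expR (v * x - v ^+ 2 / 2))%:E))%E.
Proof.
move=> mf f0.
rewrite N01_ge0_integral//; last first.
  by apply: measurableT_comp => //; exact: measurable_funD.
rewrite N01_ge0_integral//; last 2 first.
- apply: emeasurable_funM => //; apply/measurable_EFinP/measurableT_comp => //.
  by apply: measurable_funB => //; exact: measurable_funM.
- by move=> x; rewrite mule_ge0// lee_fin expR_ge0.
rewrite -(lebesgue_shift v (f := fun x => f x * (expR (v * x - v ^+ 2 / 2))%:E * (phi x)%:E)%E).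
- apply: eq_integral => x _; rewrite -muleA -EFinM; congr (_ * _%:E)%E.
  rewrite !N01_pdfE mulrCA -expRD; congr (_ * expR _); by field.
- apply: emeasurable_funM => //.
  apply: emeasurable_funM => //; apply/measurable_EFinP/measurableT_comp => //.
  by apply: measurable_funB => //; exact: measurable_funM.
- by move=> x; rewrite !mule_ge0// lee_fin ?expR_ge0// normal_pdf_ge0.
Qed.

Lemma pow_cons_ge0_integral d (T : measurableType d) (mu : probability T R) n
    (F : n.+1.-tuple T -> \bar R) : measurable_fun setT F ->
  (forall s, 0 <= F s)%E ->
  (\int[pow mu n.+1]_s F s =
   \int[mu]_x \int[pow mu n]_s F [the n.+1.-tuple T of x :: tval s])%E.
Proof.
move=> mF F0 /=.
rewrite (ge0_integral_distribution (P := pprod mu (pow mu n)) (cons_mfun n))//.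
rewrite fubini_tonelli1//; last by move=> x; exact: F0.
by apply: measurableT_comp => //; exact: measurable_cons_pair.
Qed.

Definition shiftn n (v : 'I_n -> R) (e : n.-tuple R) : n.-tuple R :=
  [tuple tnth e i + v i | i < n].

Lemma measurable_shiftn n (v : 'I_n -> R) : measurable_fun setT (shiftn v).
Proof.
apply/measurable_fun_tnthP => j.
rewrite (_ : _ \o _ = fun e : n.-tuple R => tnth e j + v j); last first.
  by apply/funext => s /=; rewrite tnth_mktuple.
by apply: measurable_funD => //; exact: measurable_tnth.
Qed.

(** Induction on the dimension: [N01_shift] moves the head, the induction hypothesis the tail. Since
    [F] is non-negative, Tonelli applies without any integrability. *)
Lemma pow_N01_shift n (v : 'I_n -> R) (F : n.-tuple R -> \bar R) :
  measurable_fun setT F -> (forall s, 0 <= F s)%E ->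
  (\int[pow N01 n]_e F (shiftn v e) =
   \int[pow N01 n]_e
     (F e * (expR (\sum_(i < n) (v i * tnth e i - v i ^+ 2 / 2)))%:E))%E.
Proof.
have mexp k (w : 'I_k -> R) : measurable_fun setT
    (fun e : k.-tuple R => (expR (\sum_(i < k) (w i * tnth e i - w i ^+ 2 / 2)))%:E).
  apply/measurable_EFinP/measurableT_comp => //.
  apply: measurable_sum => i; apply: measurable_funB => //.
  by apply: measurable_funM => //; exact: measurable_tnth.
elim: n v F => [|n IH] v F mF F0.
  apply: eq_integral => e _; rewrite big_ord0 expR0 mule1; congr F.
  by apply: eq_from_tnth => -[].
rewrite pow_cons_ge0_integral//; last first.
  by apply: measurableT_comp => //; exact: measurable_shiftn.
rewrite pow_cons_ge0_integral//; last 2 first.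
- by apply: emeasurable_funM => //; exact: mexp.
- by move=> e; rewrite mule_ge0// lee_fin expR_ge0.
pose v' i := v (lift ord0 i).
pose G x := (\int[pow N01 n]_s F [the n.+1.-tuple R of x :: tval (shiftn v' s)])%E.
have mcons k x : measurable_fun setT (fun s : k.-tuple R => [the k.+1.-tuple R of x :: tval s]).
  by apply: measurable_cons.
transitivity (\int[N01]_x G (x + v ord0)%R)%E.
  apply: eq_integral => x _; apply: eq_integral => s _; congr F.
  apply: eq_from_tnth => i; rewrite tnth_mktuple.
  by case: (unliftP ord0 i) => [j|] ->; rewrite ?tnthS ?tnth_mktuple// tnth_cons0.
rewrite N01_shift; last 2 first.
- pose H (xs : R * n.-tuple R) := F [the n.+1.-tuple R of xs.1 :: tval (shiftn v' xs.2)].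
  apply: (@measurable_fun_fubini_tonelli_F _ _ R (n.-tuple R) R (pow N01 n) H).
    apply: measurableT_comp => //; apply: measurable_cons => //=.
    by apply: measurableT_comp; [exact: measurable_shiftn|exact: measurable_snd].
  by move=> xs; exact: F0.
- by move=> x; apply: integral_ge0.
apply: eq_integral => x _; rewrite /G.
rewrite (IH v' (fun s => F [the n.+1.-tuple R of x :: tval s]))//; last first.
  by apply: measurableT_comp => //; exact: mcons.
have m1 : measurable_fun setT (fun s : n.-tuple R =>
    (F [the n.+1.-tuple R of x :: tval s] *
     (expR (\sum_(i < n) (v' i * tnth s i - v' i ^+ 2 / 2)))%:E)%E).
  apply: emeasurable_funM; last exact: mexp.
  by apply: measurableT_comp => //; exact: mcons.
rewrite -ge0_integralZr ?lee_fin ?expR_ge0//; last first.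
  by move=> e _; rewrite mule_ge0// lee_fin expR_ge0.
apply: eq_integral => s _; rewrite -muleA -EFinM -expRD; congr (_ * (expR _)%:E)%E.
rewrite big_ord_recl tnth_cons0 addrC; congr +%R.
by apply: eq_bigr => i _; rewrite tnthS.
Qed.

Lemma N01_integral (f : R -> \bar R) : measurable_fun setT f ->
  (\int[N01]_x f x = \int[leb]_x (f x * (phi x)%:E))%E.
Proof.
move=> mf; rewrite integralE [RHS]integralE.
rewrite !N01_ge0_integral//; [|exact: measurable_funeneg|exact: measurable_funepos].
by congr (_ - _)%E; apply: eq_integral => x _;
  rewrite ?funeposE ?funenegE -?mulNe -[X in _ = maxe _ X](mul0e (phi x)%:E) maxe_pMl// lee_fin normal_pdf_ge0.
Qed.

(** Against the standard density a growth of [expR (x ^+ 2 / 4)] leaves a multiple of the normal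
    density of variance 2, whose integral is 1. *)
Lemma N01_itg_exp (f : R -> R) (C : R) : measurable_fun setT f ->
  (forall x, `|f x| <= C * expR (x ^+ 2 / 4)) -> itg N01 f.
Proof.
move=> mf fC; apply/integrableP; split; first exact/measurable_EFinP.
have C0 : 0 <= C.
  by have := fC 0; rewrite expr0n/= mul0r expR0 mulr1; apply: le_trans.
have s2 : Num.sqrt 2 != 0 :> R by rewrite sqrtr_eq0 -ltNge ltr0n.
rewrite N01_integral//; last by do 2 apply: measurableT_comp => //.
pose c := C * normal_peak 1 / normal_peak (Num.sqrt (2 : R)).
apply: (@le_lt_trans _ _ (\int[leb]_x (c%:E * (normal_pdf (0 : R) (Num.sqrt 2) x)%:E))%E).
  apply: ge0_le_integral => //=.
  - by move=> x _; rewrite mule_ge0// lee_fin normal_pdf_ge0.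
  - apply: emeasurable_funM; first by do 2 apply: measurableT_comp => //.
    by apply/measurable_EFinP; exact: measurable_normal_pdf.
  - apply/measurable_EFinP/measurable_funM => //; exact: measurable_normal_pdf.
  - move=> x _; rewrite -EFinM lee_fin N01_pdfE normal_pdfE// /normal_fun subr0.
    rewrite sqr_sqrtr ?ler0n// /c [leRHS]mulrA mulfVK; last first.
      by rewrite gt_eqF// normal_peak_gt0.
    have h0 : 0 <= normal_peak (1 : R) * expR (- (x ^+ 2 / 2)).
      by rewrite mulr_ge0 ?normal_peak_ge0// expR_ge0.
    rewrite (le_trans (ler_wpM2r h0 (fC x)))//.
    rewrite mulrACA -mulrA -expRD le_eqVlt; apply/orP; left; apply/eqP.
    by rewrite mulrA; congr (_ * expR _); field.
rewrite integralZl//; last exact: integrable_normal_pdf.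
by rewrite integral_normal_pdf mule1 ltry.
Qed.

Lemma N01_itg_id : itg N01 (fun x => x).
Proof.
apply: (@N01_itg_exp _ 1) => // x; rewrite mul1r.
apply: (le_trans _ (expR_ge1Dx _)).
have -> : x ^+ 2 = `|x| ^+ 2 by rewrite real_normK ?num_real.
have := sqr_ge0 (`|x| - 2); nra.
Qed.

Lemma N01_itg_sqr : itg N01 (fun x => x ^+ 2).
Proof.
apply: (@N01_itg_exp _ 4); first exact: measurable_funX.
move=> x; rewrite ger0_norm ?sqr_ge0//.
have := expR_ge1Dx (x ^+ 2 / 4); have := sqr_ge0 x; lra.
Qed.

Let p (x : R) : R := normal_peak 1 * expR (- (x ^+ 2 / 2)).

Let is_derive_p (x : R) : is_derive x 1 p (- (x * p x)).
Proof.
have h1 : is_derive x 1 (fun x : R => x ^+ 2) (x *+ 2).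
  apply: is_derive_eq.
  by rewrite /GRing.scale /= mulr1 mulr2n.
apply: is_derive_eq.
by rewrite /p /GRing.scale /=; field.
Qed.

(** With [p] the normal density, [F p] has derivative [(f - x F) p]. Over [- k, k] the difference of
    the two sides is therefore a boundary term of [F p], which vanishes in the limit because [F] is
    bounded and [p k] is at most a multiple of [1 / k]; dominated convergence handles the
    integral. *)
Lemma stein_N01 (F f : R -> R) (M : R) : (forall x : R, is_derive x 1 F (f x)) ->
  continuous f -> (forall x, `|F x| <= M) -> (forall x, `|f x| <= M) ->
  Ex N01 (fun x => x * F x) = Ex N01 f.
Proof.
move=> dF cf FM fM.
have M0 : 0 <= M by exact: le_trans (FM 0).
have cF : continuous F.
  move=> x; apply: differentiable_continuous; apply/derivable1_diffP.
  by have [] := dF x.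
have mF : measurable_fun setT F by exact: continuous_measurable_fun.
have mf : measurable_fun setT f by exact: continuous_measurable_fun.
have iF : itg N01 (fun x => x * F x).
  apply: itg_bmM; first exact: N01_itg_id.
  by split => //; exists M.
have if_ : itg N01 f by apply: bm_itg; split => //; exists M.
apply/eqP; rewrite eq_sym -subr_eq0 -ExB//; apply/eqP.
pose h x := (f x - x * F x) * p x.
have ih0 : itg N01 (fun x => f x - x * F x) by exact: itgB.
have mh0 := itg_mf ih0.
have phip : phi = p by apply/funext => x; rewrite N01_pdfE.
have mp : measurable_fun setT p by rewrite -phip; exact: measurable_normal_pdf.
have mh : measurable_fun setT h by exact: measurable_funM.
have ih : leb.-integrable setT (EFin \o h).
  apply/integrableP; split; first exact/measurable_EFinP.
  have /integrableP[_] := ih0.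
  rewrite N01_integral; last by apply: measurableT_comp => //; exact/measurable_EFinP.
  apply: le_lt_trans; apply: ge0_le_integral => //=.
  - by do 2 apply: measurableT_comp => //.
  - apply: emeasurable_funM; first by do 2 apply: measurableT_comp => //.
    by rewrite phip; apply/measurable_EFinP.
  - move=> x _; rewrite lee_fin phip /h normrM ler_wpM2l//.
    by rewrite ger0_norm// -phip normal_pdf_ge0.
rewrite /Ex N01_integral; last exact/measurable_EFinP.
have -> : (\int[leb]_x ((f x - x * F x)%:E * (phi x)%:E) = \int[leb]_x (h x)%:E)%E.
  by apply: eq_integral => x _; rewrite phip -EFinM.
suff -> : (\int[leb]_x (h x)%:E = 0)%E by [].
pose G x := F x * p x.
have dG x : is_derive (x : R) 1 G (h x).
  apply: (is_derive_eq (is_deriveM (dF x) (is_derive_p x))).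
  by rewrite /h /=  /GRing.scale /=; ring.
pose I k : set R := `[- k.+1%:R, k.+1%:R]%classic.
have hk (k : nat) : (\int[leb]_(x in I k) (h x)%:E = (G k.+1%:R - G (- k.+1%:R))%:E)%E.
  rewrite /I (continuous_FTC2 (F := G))//.
  - by rewrite (@lt_le_trans _ _ 0)// oppr_lt0.
  - apply: continuous_subspaceT => x.
    apply: cvgM; last first.
      by apply: differentiable_continuous; apply/derivable1_diffP; have [] := is_derive_p x.
    by apply: cvgB; [exact: cf|apply: cvgM; [exact: cvg_id|exact: cF]].
  - have cG : continuous G.
      by move=> x; apply: differentiable_continuous; apply/derivable1_diffP; have [] := dG x.
    split; first by move=> x _; have [] := dG x.
      exact/cvg_at_right_filter/cG.
    exact/cvg_at_left_filter/cG.
  - by move=> x _; rewrite derive1E; have [_ ->] := dG x.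
have lim1 : (\int[leb]_(x in I k) (h x)%:E)%E @[k --> \oo] --> (\int[leb]_x (h x)%:E)%E.
  under eq_fun do rewrite integral_mkcond.
  have mI k : measurable_fun setT ((EFin \o h) \_ (I k)).
    apply/(measurable_restrictT _ _).1 => //; first exact: measurable_itv.
    by apply/measurable_funTS/measurable_EFinP.
  have [||||//] := @dominated_convergence _ _ _ leb setT measurableT
    (fun k => (EFin \o h) \_ (I k)) (EFin \o h) (fun x => `|(h x)%:E|%E) mI.
  - exact/measurable_EFinP.
  - apply: aeW => x _; apply: cvg_near_cst; near=> k.
    rewrite patchE; case: ifPn => //; rewrite notin_setE /I /= in_itv /= => /negP.
    rewrite -ler_norml -ltNge => xk; exfalso; move: xk; apply/negP; rewrite -leNgt.
    near: k; exists (Num.truncn `|x|) => // k /= xk.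
    apply: (le_trans (ltW (truncnS_gt _))).
    by rewrite ler_nat ltnS.
  - exact: integrable_abse.
  - by apply: aeW => x k _; rewrite patchE; case: ifP => // _; rewrite abse0.
have lim2 : (\int[leb]_(x in I k) (h x)%:E)%E @[k --> \oo] --> 0%E.
  under eq_fun do rewrite hk.
  apply: cvg_EFin; first by near=> k.
  apply/norm_cvg0P.
  apply: (@squeeze_cvgr _ _ _ _ (fun=> 0) (fun k => (2 * M * normal_peak 1) * harmonic k)).
  - near=> k; rewrite normr_ge0 /=.
    have pk : p k.+1%:R <= normal_peak 1 * harmonic k.
      rewrite /p ler_wpM2l ?normal_peak_ge0// expRN /harmonic lef_pV2 ?posrE ?expR_gt0//.
      apply: (le_trans _ (expR_ge1Dx _)).
      by have := sqr_ge0 (k.+1%:R - 1 : R); lra.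
    have pkN : p (- k.+1%:R) = p k.+1%:R by rewrite /p sqrrN.
    have p0 x : 0 <= p x by rewrite -phip normal_pdf_ge0.
    have GE x : `|G x| = `|F x| * p x by rewrite /G normrM (ger0_norm (p0 x)).
    rewrite (le_trans (ler_normB _ _))// !GE pkN -mulrDl.
    have := FM k.+1%:R; have := FM (- k.+1%:R) => h1 h2.
    have : (`|F k.+1%:R| + `|F (- k.+1%:R)|) * p k.+1%:R <= (2 * M) * (normal_peak 1 * harmonic k).
      by apply: ler_pM => //; lra.
    by rewrite /= !mulrA.
  - exact: cvg_cst.
  - rewrite -(mulr0 (2 * M * normal_peak 1)); apply: cvgM; first exact: cvg_cst.
    exact: cvg_harmonic.
by apply: cvg_unique lim1 lim2.
Unshelve. all: by end_near. Qed.

End standard_normal.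

(** * Gaussian anticoncentration *)

Section boolean_events.
Context {R : realType} {d : measure_display} {T : measurableType d}.
Implicit Types (m : probability T R) (b c : T -> bool).

Definition mb b := measurable_fun setT b.

(** Events are boolean functions, so that finite unions and intersections are finite quantifiers and
    identities between events are boolean rewriting. *)
Definition Pr m b : R := Ex m (fun x => (b x)%:R).

Lemma mb_bm b : mb b -> bm (fun x => (b x)%:R : R).
Proof.
move=> mb_b; split; last by exists 1 => x; case: (b x); rewrite ?normr1 ?normr0.
rewrite (_ : (fun _ => _) = (fun x => if b x then 1 else 0)).
  exact: measurable_fun_ifT.
by apply/funext => x; case: (b x).
Qed.

Lemma mb_le (f g : T -> R) : measurable_fun setT f -> measurable_fun setT g ->
  mb (fun x => f x <= g x).
Proof. exact: measurable_fun_ler. Qed.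

Lemma mb_lt (f g : T -> R) : measurable_fun setT f -> measurable_fun setT g ->
  mb (fun x => f x < g x).
Proof. exact: measurable_fun_ltr. Qed.

Lemma mb_and b c : mb b -> mb c -> mb (fun x => b x && c x).
Proof. exact: measurable_and. Qed.

Lemma mb_neg b : mb b -> mb (fun x => ~~ b x).
Proof. by move=> h; exact: measurable_neg. Qed.

Lemma mb_cst (c : bool) : mb (fun=> c).
Proof. exact: measurable_cst. Qed.

Lemma mb_or b c : mb b -> mb c -> mb (fun x => b x || c x).
Proof. exact: measurable_or. Qed.

Lemma mb_forall (I : finType) (F : I -> T -> bool) : (forall i, mb (F i)) ->
  mb (fun x => [forall i, F i x]).
Proof.
move=> h; rewrite (_ : (fun _ => _) = fun x => \big[andb/true]_i F i x).
  elim: (index_enum I) => [|i r IH].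
    by rewrite (_ : (fun _ => _) = fun=> true); [exact: mb_cst|apply/funext => x; rewrite big_nil].
  rewrite (_ : (fun _ => _) = fun x => F i x && \big[andb/true]_(i <- r) F i x).
    exact: mb_and.
  by apply/funext => x; rewrite big_cons.
by apply/funext => x; rewrite big_andE.
Qed.

Lemma mb_exists (I : finType) (F : I -> T -> bool) : (forall i, mb (F i)) ->
  mb (fun x => [exists i, F i x]).
Proof.
move=> h; rewrite (_ : (fun _ => _) = fun x => ~~ [forall i, ~~ F i x]).
  by apply/mb_neg/mb_forall => i; exact: mb_neg.
by apply/funext => x; rewrite negb_forall; apply: eq_existsb => i; rewrite negbK.
Qed.

Lemma natb_le1 (b : bool) : b%:R <= 1 :> R.
Proof. by case: b. Qed.

Lemma Pr_ge0 m b : 0 <= Pr m b.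
Proof. by apply: Ex_ge0 => x; rewrite ler0n. Qed.

Lemma Pr_le1 m b : mb b -> Pr m b <= 1.
Proof.
move=> h; rewrite -[leRHS](Ex_cst m); apply: Ex_le; first exact/bm_itg/mb_bm.
  exact: itg_cst.
by move=> x; case: (b x).
Qed.

Lemma Pr_mono m b c : mb b -> mb c -> (forall x, b x -> c x) -> Pr m b <= Pr m c.
Proof.
move=> mb_b mb_c bc; apply: Ex_le => [||x]; [exact/bm_itg/mb_bm..|].
by rewrite ler_nat; case: (b x) (bc x) => // ->.
Qed.

Lemma Pr_or m b c : mb b -> mb c -> Pr m (fun x => b x || c x) <= Pr m b + Pr m c.
Proof.
move=> mb_b mb_c; rewrite -ExD; [|exact/bm_itg/mb_bm..].
apply: Ex_le => [||x]; first exact/bm_itg/mb_bm/mb_or.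
  by apply: itgD; exact/bm_itg/mb_bm.
by rewrite -natrD ler_nat; case: (b x); case: (c x).
Qed.

Lemma Pr_exists m (I : finType) (F : I -> T -> bool) : (forall i, mb (F i)) ->
  Pr m (fun x => [exists i, F i x]) <= \sum_i Pr m (F i).
Proof.
move=> h; rewrite -Ex_sum; last by move=> i; exact/bm_itg/mb_bm.
apply: Ex_le => [||x]; first exact/bm_itg/mb_bm/mb_exists.
  by apply: itg_sum => i; exact/bm_itg/mb_bm.
case: existsP => [[i Fi]|_]; last by apply: sumr_ge0 => i _; rewrite ler0n.
by rewrite (bigD1 i)//= Fi lerDl; apply: sumr_ge0 => k _; rewrite ler0n.
Qed.

Lemma Pr_markov m (f : T -> R) (t : R) : itg m f -> (forall x, 0 <= f x) ->
  0 < t -> Pr m (fun x => t <= f x) <= Ex m f / t.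
Proof.
move=> hf f0 t0; rewrite ler_pdivlMr// mulrC -ExZ; last first.
  by apply/bm_itg/mb_bm/mb_le => //; exact: itg_mf hf.
apply: Ex_le => // [|x].
  by apply/itgZ/bm_itg/mb_bm/mb_le => //; exact: itg_mf hf.
by case: (boolP (t <= f x)) => tf; rewrite ?mulr1 ?mulr0.
Qed.

Lemma PrE m b : mb b -> (Pr m b)%:E = m [set x | b x].
Proof.
move=> h; have mB : measurable [set x | b x].
  by rewrite -[X in measurable X]setTI; exact: (h measurableT [set true]).
rewrite /Pr (_ : (fun x => (b x)%:R) = \1_[set x | b x]).
  by rewrite Ex_indic// fineK// fin_num_measure.
by apply/funext => x; rewrite indicE; congr (_%:R); case: (boolP (b x)) => bx;
  [rewrite mem_set|rewrite memNset//; exact/negP].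
Qed.

End boolean_events.

Lemma mb_pre {d1 d2} (T1 : measurableType d1) (T2 : measurableType d2)
    (b : T2 -> bool) (phi : T1 -> T2) :
  measurable_fun setT phi -> mb b -> mb (fun x => b (phi x)).
Proof. by move=> mphi mb_b; exact: measurableT_comp. Qed.

Section anticoncentration.
Context {R : realType} {n : nat}.
Local Notation P := (pow (@N01 R) n).
Implicit Types (c : 'I_n -> R) (e : n.-tuple R).

Definition dot c e : R := \sum_(i < n) c i * tnth e i.

Lemma measurable_dot c : measurable_fun setT (dot c).
Proof.
apply: measurable_sum => i; apply: measurable_funM => //.
exact: measurable_tnth.
Qed.

Lemma dot_shiftn c v e : dot c (shiftn v e) = dot c e + \sum_i c i * v i.
Proof.
rewrite /dot -big_split; apply: eq_bigr => i _ /=.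
by rewrite tnth_mktuple mulrDr.
Qed.

(* Cameron-Martin: translating by [s c] changes the density by
   [expR (s <c, e> - s^2 / 2)]. *)
Lemma gauss_shift_le c (s k : R) (a b : n.-tuple R -> bool) :
  \sum_i c i ^+ 2 = 1 -> mb a -> mb b ->
  (forall e, a e -> b (shiftn (fun i => s * c i) e)) ->
  (forall e, b e -> s * dot c e - s ^+ 2 / 2 <= k) ->
  Pr P a <= expR k * Pr P b.
Proof.
move=> c1 ma mb_ ab bk.
have ib := bm_itg P (mb_bm (R := R) mb_); have ia := bm_itg P (mb_bm (R := R) ma).
rewrite -lee_fin EFinM !Ex_EFin//.
have mbE : measurable_fun setT (fun e => ((b e)%:R : R)%:E) by have /integrableP[] := ib.
have b0 e : (0 <= ((b e)%:R : R)%:E)%E by rewrite lee_fin ler0n.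
have ek : (0 <= (expR k)%:E)%E by rewrite lee_fin expR_ge0.
rewrite -(@ge0_integralZl _ _ _ P _ measurableT _ mbE _ (fun e _ => b0 e) ek).
apply: (@le_trans _ _ (\int[P]_e ((b (shiftn (fun i => s * c i) e))%:R : R)%:E)%E).
  apply: ge0_le_integral => //.
  - by have /integrableP[] := ia.
  - by apply/measurable_EFinP; apply: (measurableT_comp (mb_bm mb_).1); exact: measurable_shiftn.
  - by move=> e _; rewrite lee_fin ler_nat; case: (a e) (ab e) => // ->.
rewrite (pow_N01_shift (fun i => s * c i) (F := fun e => ((b e)%:R : R)%:E)); last 2 first.
- by have /integrableP[] := ib.
- by move=> e; rewrite lee_fin ler0n.
have E e : \sum_(i < n) ((s * c i) * tnth e i - (s * c i) ^+ 2 / 2) =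
    s * dot c e - s ^+ 2 / 2.
  rewrite big_split /= sumrN -mulr_suml; congr (_ - _ / _).
    by rewrite /dot mulr_sumr; apply: eq_bigr => i _; rewrite mulrA.
  by rewrite -[RHS]mulr1 -c1 mulr_sumr; apply: eq_bigr => i _; rewrite exprMn.
apply: ge0_le_integral => //.
- apply: emeasurable_funM; first by have /integrableP[] := ib.
  under eq_fun do rewrite E.
  apply/measurable_EFinP/measurableT_comp => //.
  by apply: measurable_funB => //; apply: measurable_funM => //; exact: measurable_dot.
- by apply: emeasurable_funM => //; have /integrableP[] := ib.
- move=> e _; rewrite -!EFinM lee_fin E mulrC.
  case: (boolP (b e)) => be; rewrite ?mulr0// !mulr1 ler_expR; exact: bk.
Qed.

Lemma strip_sum (x t : R) N : 0 <= t ->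
  \sum_(i < N) ((i%:R * t < x <= i%:R * t + t)%R)%:R = ((0 < x <= N%:R * t)%R)%:R :> R.
Proof.
move=> t0; elim: N => [|N IH].
  by rewrite big_ord0 mul0r; case: ltP => //= x0; rewrite leNgt x0.
have Nt : 0 <= N%:R * t by rewrite mulr_ge0.
rewrite big_ord_recr/= IH -natr1 mulrDl mul1r -natrD; congr (_%:R)%R.
case: (ltP 0 x) => x0 /=; last first.
  by rewrite ltNge (le_trans x0 Nt).
case: (leP x (N%:R * t)) => xN /=; last by rewrite add0n.
by rewrite addn0 (le_trans xN)// lerDl.
Qed.

(** [N] is the integer part of [1 / (L t)]; since that number is at least 1, rounding down loses at
    most a factor 2. *)
Lemma strip_count (t : R) (L : R) : 0 < t -> 1 <= L -> L * t <= 1 -> exists N : nat,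
  (2 * L * t)^-1 <= N%:R /\ (forall i : nat, (i < N)%N -> i%:R * t <= L^-1).
Proof.
move=> t0 L1 Lt; have L0 : 0 < L by rewrite (lt_le_trans _ L1).
have Lt0 : 0 < L * t by rewrite mulr_gt0.
exists (Num.truncn (L * t)^-1).
have i1 : 1 <= (L * t)^-1 by rewrite invf_ge1.
have i0 : 0 <= (L * t)^-1 by rewrite (le_trans _ i1).
have /andP[h1 h2] := truncn_itv i0.
have N1 : (1 <= Num.truncn (L * t)^-1)%N by rewrite truncn_gt_nat.
split.
  have -> : (2 * L * t)^-1 = (L * t)^-1 / 2 by rewrite -mulrA invfM mulrC.
  have : (1 : R) <= (Num.truncn (L * t)^-1)%:R by rewrite ler1n.
  by move: h2; rewrite -natr1; lra.
move=> i iN; rewrite -ler_pdivlMr// -invfM.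
by apply: le_trans h1; rewrite ler_nat ltnW.
Qed.

(** The strip at height [y] is translated down to each of the disjoint strips at heights [i t <= 1].
    Every translation costs a density ratio of at most [expR ((i t)^2 / 2 - y^2 / 2)], and there are
    at least [1 / (2 t)] target strips of total probability at most 1. *)
Lemma gauss_tail_strip c (y t : R) : \sum_i c i ^+ 2 = 1 -> 1 <= y -> 0 < t -> t <= 1 ->
  Pr P (fun e => y < dot c e <= y + t) <= 2 * t * expR (1 / 2 - y ^+ 2 / 2).
Proof.
move=> c1 y1 t0 t1.
have [N [N1 N2]] := strip_count t0 (lexx 1) (eq_ind_r (fun z => is_true (z <= 1)) t1 (mul1r t)).
rewrite mulr1 in N1.
have mB (a : R) : mb (fun e => a < dot c e <= a + t).
  by apply: mb_and; [apply: mb_lt|apply: mb_le] => //; exact: measurable_dot.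
have key (i : 'I_N) : Pr P (fun e => y < dot c e <= y + t) <=
    expR (1 / 2 - y ^+ 2 / 2) * Pr P (fun e => i%:R * t < dot c e <= i%:R * t + t).
  have it1 := N2 i (ltn_ord i); rewrite invr1 in it1.
  have it0 : 0 <= i%:R * t by rewrite mulr_ge0// ltW.
  apply: (@gauss_shift_le c (i%:R * t - y)) => //.
    move=> e /andP[h1 h2]; rewrite dot_shiftn.
    have -> : \sum_(k < n) c k * ((i%:R * t - y) * c k) = i%:R * t - y.
      by rewrite -[RHS]mulr1 -c1 mulr_sumr; apply: eq_bigr => k _; ring.
    by apply/andP; split; lra.
  move=> e /andP[h1 _].
  by nra.
have sumB : \sum_(i < N) Pr P (fun e => i%:R * t < dot c e <= i%:R * t + t) <= 1.
  rewrite -Ex_sum; last by move=> i; exact/bm_itg/mb_bm.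
  rewrite -[leRHS](Ex_cst P); apply: Ex_le.
  - by apply: itg_sum => i; exact/bm_itg/mb_bm.
  - exact: itg_cst.
  - by move=> e; rewrite (strip_sum _ _ (ltW t0)) natb_le1.
have : N%:R * Pr P (fun e => y < dot c e <= y + t) <= expR (1 / 2 - y ^+ 2 / 2).
  rewrite mulrC mulr_natr -[X in _ *+ X]card_ord -sumr_const.
  apply: (@le_trans _ _ (\sum_(i < N) expR (1 / 2 - y ^+ 2 / 2) *
     Pr P (fun e => i%:R * t < dot c e <= i%:R * t + t))).
    by apply: ler_sum => i _; exact: key.
  by rewrite -mulr_sumr ler_piMr ?expR_ge0.
have p0 := Pr_ge0 P (fun e => y < dot c e <= y + t).
have tt0 : 0 < 2 * t by rewrite mulr_gt0.
move=> h; rewrite mulrC -ler_pdivrMr// mulrC.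
by apply: le_trans h; rewrite ler_wpM2r.
Qed.

Section orthant.
Variables (I : finType) (c : I -> 'I_n -> R) (y : I -> R).

(** Ties are broken by [enum_rank]: without a unique maximiser the pieces of the strip would overlap
    and the sum of their probabilities could exceed 1. *)
Let amax j e := [forall k, (dot (c k) e - y k <= dot (c j) e - y j) &&
  ((enum_rank k < enum_rank j)%N ==> (dot (c k) e - y k < dot (c j) e - y j))].

Let amax_uniq j k e : amax j e -> amax k e -> j = k.
Proof.
move=> /forallP hj /forallP hk; apply/enum_rank_inj/val_inj/eqP.
rewrite eqn_leq; apply/andP; split; rewrite leqNgt; apply/negP => lt.
  have /andP[h1 _] := hk j; have /andP[_] := hj k; rewrite lt/= => h2.
  by move: (lt_le_trans h2 h1); rewrite ltxx.
have /andP[h1 _] := hj k; have /andP[_] := hk j; rewrite lt/= => h2.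
by move: (lt_le_trans h2 h1); rewrite ltxx.
Qed.

Let amax_sum e : \sum_j ((amax j e)%:R : R) <= 1.
Proof.
case: (pickP (amax ^~ e)) => [j hj|no]; last first.
  by rewrite big1 ?ler01// => j _; rewrite no.
rewrite (bigD1 j)//= hj big1 ?addr0// => k kj.
by case: (boolP (amax k e)) => // hk; rewrite (amax_uniq hk hj) eqxx in kj.
Qed.

Let amax_exists e (i0 : I) : exists j, amax j e.
Proof.
pose F j := dot (c j) e - y j.
pose j1 := [arg max_(j > i0) F j]%O.
have hj1 k : F k <= F j1 by rewrite /j1; case: arg_maxP => // j _; apply.
pose Q j := F j1 <= F j.
pose j2 := [arg min_(j < j1 | Q j) (enum_rank j : nat)]%N.
have [j Qj jmin] : exists2 j, Q j & forall k, Q k -> (enum_rank j <= enum_rank k)%N.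
  have Q1 : Q j1 by exact: lexx.
  case: (@arg_minnP _ j1 Q (fun j => enum_rank j : nat) Q1) => j Qj jm.
  by exists j => // k; exact: jm.
exists j; apply/forallP => k; apply/andP; split; first exact: le_trans (hj1 k) Qj.
apply/implyP => kj; rewrite ltNge; apply/negP => jk.
have : Q k by exact: le_trans Qj jk.
by move/jmin; rewrite leqNgt kj.
Qed.

Let m_amax j : mb (amax j).
Proof.
have mF k : measurable_fun setT (fun e => dot (c k) e - y k).
  by apply: measurable_funB => //; exact: measurable_dot.
apply: mb_forall => k; apply: mb_and; first exact: mb_le.
case: (enum_rank k < enum_rank j)%N => /=; [exact: mb_lt|exact: mb_cst].
Qed.

(* For [y j <= Lam], split the strip according to the first index at which the
   maximum of [dot (c j) e - y j] is attained. Translating by [k t c j], with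
   [k t <= 1 / Lam], keeps that index maximal, so that the translates of each
   piece are disjoint while their probabilities stay comparable. Large [y j] are
   handled by the Gaussian tail and a union bound. *)
Lemma gauss_anticoncentration (Lam t : R) : (forall j, \sum_i c j i ^+ 2 = 1) ->
  2 <= Lam -> #|I|%:R <= expR (Lam ^+ 2 / 2) -> 0 <= t ->
  Pr P (fun e => [forall j, dot (c j) e <= y j + t]) -
  Pr P (fun e => [forall j, dot (c j) e <= y j]) <= 3 * expR 2 * Lam * t.
Proof.
move=> c1 Lam2 cardI; rewrite le_eqVlt => /predU1P[<-|t0].
  rewrite mulr0 (_ : (fun e => [forall j, dot (c j) e <= y j + 0]) =
    (fun e => [forall j, dot (c j) e <= y j])) ?subrr//.
  by apply/funext => e; apply: eq_forallb => j; rewrite addr0.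
have mD (a : I -> R) : mb (fun e => [forall j, dot (c j) e <= a j]).
  by apply: mb_forall => j; apply: mb_le => //; exact: measurable_dot.
have e1 : 1 <= expR (2 : R) by rewrite -expR0 ler_expR.
(* For [Lam * t > 1] the right-hand side already exceeds 1. *)
case: (leP (Lam * t) 1) => Lt; last first.
  have := Pr_le1 P (mD (fun j => y j + t)); have := Pr_ge0 P (fun e => [forall j, dot (c j) e <= y j]).
  have : 1 <= expR 2 * (Lam * t) by rewrite mulr_ege1// ltW.
  by nra.
have Lam1 : 1 <= Lam by lra.
have [N [N1 N2]] := strip_count t0 Lam1 Lt.
pose B j (i : nat) e := amax j e && (i%:R * t < dot (c j) e - y j <= i%:R * t + t).
have mB j i : mb (B j i).
  apply: mb_and; first exact: m_amax.
  by apply: mb_and; [apply: mb_lt|apply: mb_le] => //;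
    apply: measurable_funB => //; exact: measurable_dot.
have Li0 : 0 < Lam^-1 by rewrite invr_gt0; lra.
have LL : Lam * Lam^-1 = 1 by rewrite divff// gt_eqF//; lra.
have Li : Lam^-1 <= 1 / 2 by nra.
have tLi : t <= Lam^-1 by nra.
(* On the target piece the exponent is at most [i t (Lam + i t + t) - (i t)^2 / 2]. As [i t] and [t]
   are at most [1 / Lam <= 1 / 2], this stays below 2, whence [expR 2]. *)
have key j (i : 'I_N) : y j <= Lam -> Pr P (B j 0%N) <= expR 2 * Pr P (B j i).
  move=> yj; have it1 := N2 i (ltn_ord i).
  have it0 : 0 <= i%:R * t by rewrite mulr_ge0// ltW.
  apply: (@gauss_shift_le (c j) (i%:R * t)) => //.
    (* Correlations are at most 1, so a translation along [c j] raises no coordinate more than the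
       [j]-th one and [j] remains the selected maximiser. *)
    have rho k : \sum_i0 c k i0 * (i%:R * t * c j i0) <= i%:R * t.
      rewrite -[leRHS]mulr1.
      rewrite (_ : \sum_i0 _ = i%:R * t * \sum_i0 c k i0 * c j i0); last first.
        by rewrite mulr_sumr; apply: eq_bigr => l _; ring.
      rewrite ler_wpM2l//.
      apply: (@le_trans _ _ (\sum_l (c k l ^+ 2 + c j l ^+ 2) / 2)).
        by apply: ler_sum => l _; have := sqr_ge0 (c k l - c j l); lra.
      by rewrite -mulr_suml big_split /= !c1; lra.
    have rhoj : \sum_i0 c j i0 * (i%:R * t * c j i0) = i%:R * t.
      by rewrite -[RHS]mulr1 -(c1 j) mulr_sumr; apply: eq_bigr => l _; ring.
    move=> e /andP[/forallP aj /andP[h1 h2]]; rewrite mul0r in h1 h2.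
    apply/andP; split; last first.
      by rewrite dot_shiftn rhoj; apply/andP; split; lra.
    apply/forallP => k; have /andP[h3 h4] := aj k; have := rho k.
    rewrite !dot_shiftn rhoj => rk; apply/andP; split; first by lra.
    by apply/implyP => kj; rewrite kj /= in h4; lra.
  move=> e /andP[_ /andP[_ h2]].
  have : i%:R * t * dot (c j) e <= i%:R * t * (Lam + i%:R * t + t).
    by rewrite ler_wpM2l//; lra.
  have : i%:R * t * Lam <= 1 by rewrite -ler_pdivlMr ?div1r//; lra.
  by nra.
have sumB : \sum_(i < N) \sum_j Pr P (B j i) <= 1.
  rewrite exchange_big /=.
  under eq_bigr => j _.
    rewrite -Ex_sum; last by move=> i; exact/bm_itg/mb_bm.
    over.
  rewrite -Ex_sum; last by move=> j; apply: itg_sum => i; exact/bm_itg/mb_bm.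
  rewrite -[leRHS](Ex_cst P); apply: Ex_le.
  - by apply: itg_sum => j; apply: itg_sum => i; exact/bm_itg/mb_bm.
  - exact: itg_cst.
  - move=> e; apply: le_trans (amax_sum e); apply: ler_sum => j _.
    rewrite /B; case: (amax j e) => /=; last by rewrite big1.
    by rewrite (strip_sum _ _ (ltW t0)) natb_le1.
have S1 : \sum_(j | y j <= Lam) Pr P (B j 0%N) <= 2 * expR 2 * Lam * t.
  have h : N%:R * (\sum_(j | y j <= Lam) Pr P (B j 0%N)) <= expR 2.
    rewrite mulrC mulr_natr -[X in _ *+ X]card_ord -sumr_const.
    apply: (@le_trans _ _ (\sum_(i < N) expR 2 * \sum_j Pr P (B j i))).
      apply: ler_sum => i _; rewrite mulr_sumr big_mkcond /=; apply: ler_sum => j _.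
      by case: ifP => yj; [exact: key|rewrite mulr_ge0 ?expR_ge0// Pr_ge0].
    by rewrite -mulr_sumr ler_piMr ?expR_ge0.
  have s0 : 0 <= \sum_(j | y j <= Lam) Pr P (B j 0%N).
    by apply: sumr_ge0 => j _; exact: Pr_ge0.
  have Lt0 : 0 < 2 * Lam * t by rewrite !mulr_gt0//; lra.
  rewrite (_ : 2 * expR 2 * Lam * t = expR 2 * (2 * Lam * t)); last by ring.
  rewrite -ler_pdivrMr// mulrC; apply: le_trans h; exact: ler_wpM2r.
(* A union bound over the high levels: each strip has probability of order
   [t expR (- Lam ^+ 2 / 2)], and the hypothesis on the cardinality of [I] cancels the
   exponential. *)
have S2 : \sum_(j | ~~ (y j <= Lam)) Pr P (fun e => y j < dot (c j) e <= y j + t) <=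
    2 * t * expR (1 / 2).
  apply: (@le_trans _ _ (\sum_(j | ~~ (y j <= Lam)) (2 * t * expR (1 / 2 - Lam ^+ 2 / 2)))).
    apply: ler_sum => j; rewrite -ltNge => yj.
    apply: (le_trans (gauss_tail_strip (c1 j) _ t0 _)); [lra|lra|].
    have h : 1 / 2 - y j ^+ 2 / 2 <= 1 / 2 - Lam ^+ 2 / 2 by nra.
    by apply: ler_wpM2l; [rewrite mulr_ge0// ltW|rewrite ler_expR].
  rewrite big_mkcond /=.
  apply: (@le_trans _ _ (\sum_(j : I) (2 * t * expR (1 / 2 - Lam ^+ 2 / 2)))).
    apply: ler_sum => j _; case: ifP => // _.
    by rewrite !mulr_ge0 ?expR_ge0// ltW.
  have -> : \sum_(j : I) (2 * t * expR (1 / 2 - Lam ^+ 2 / 2)) =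
      2 * t * expR (1 / 2) * (#|I|%:R / expR (Lam ^+ 2 / 2)).
    by rewrite sumr_const -[LHS]mulr_natr expRD expRN; ring.
  rewrite ler_piMr//; last by rewrite ler_pdivrMr ?expR_gt0// mul1r.
  by rewrite !mulr_ge0 ?expR_ge0// ltW.
have ptw : Pr P (fun e => [forall j, dot (c j) e <= y j + t]) <=
    Pr P (fun e => [forall j, dot (c j) e <= y j]) +
    (\sum_(j | y j <= Lam) Pr P (B j 0%N) +
     \sum_(j | ~~ (y j <= Lam)) Pr P (fun e => y j < dot (c j) e <= y j + t)).
  have mS j : mb (fun e => y j < dot (c j) e <= y j + t).
    by apply: mb_and; [apply: mb_lt|apply: mb_le] => //; exact: measurable_dot.
  have i1 b : mb b -> itg P (fun e => (b e)%:R : R) by move=> ?; exact/bm_itg/mb_bm.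
  rewrite -Ex_sum; last by move=> j; exact: i1.
  rewrite -Ex_sum; last by move=> j; exact: i1.
  have is1 := itg_sum (index_enum I) (fun j => y j <= Lam) (fun j => i1 _ (mB j 0%N)).
  have is2 := itg_sum (index_enum I) (fun j => ~~ (y j <= Lam)) (fun j => i1 _ (mS j)).
  have is3 := itgD is1 is2.
  rewrite -ExD// -ExD//; last exact: i1.
  apply: Ex_le; [exact: i1|apply: itgD => //; exact: i1|move=> e].
  have n1 : 0 <= \sum_(j | y j <= Lam) ((B j 0%N e)%:R : R) by apply: sumr_ge0 => j _; exact: ler0n.
  have n2 : 0 <= \sum_(j | ~~ (y j <= Lam)) ((y j < dot (c j) e <= y j + t)%R%:R : R).
    by apply: sumr_ge0 => j _; exact: ler0n.
  case: (boolP [forall j, dot (c j) e <= y j + t]) => [/forallP h1|_]; last first.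
    by apply: addr_ge0; [exact: ler0n|exact: addr_ge0].
  case: (boolP [forall j, dot (c j) e <= y j]) => [_|]; first by rewrite lerDl addr_ge0.
  rewrite negb_forall => /existsP[k hk]; rewrite add0r.
  have [j aj] := amax_exists e k.
  have /andP[jk _] := forallP aj k.
  have j0 : 0 < dot (c j) e - y j by move: hk; rewrite -ltNge; lra.
  have jt : dot (c j) e - y j <= t by have := h1 j; lra.
  case: (boolP (y j <= Lam)) => yj.
    rewrite (bigD1 j)//= {1}/B aj mul0r add0r j0 jt /= -addrA lerDl addr_ge0//;
      by apply: sumr_ge0 => l _; rewrite ler0n.
  rewrite addrC (bigD1 j)//= -addrA.
  have -> : (y j < dot (c j) e <= y j + t) = true by apply/andP; split; lra.
  by rewrite lerDl addr_ge0//; apply: sumr_ge0 => l _; rewrite ler0n.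
have e12 : expR (1 / 2 : R) <= expR 2 by rewrite ler_expR; lra.
have h3 : 2 * t * expR (1 / 2) <= expR 2 * Lam * t.
  rewrite (_ : 2 * t * expR (1 / 2) = (2 * expR (1 / 2)) * t); last by ring.
  rewrite ler_wpM2r ?(ltW t0)// mulrC; apply: ler_pM => //; exact: expR_ge0.
by lra.
Qed.

End orthant.

(** Each coordinate is divided by its own standard deviation, which is at least [s]; the widths, now
    different, are all at most [t / s]. *)
Lemma gauss_anticoncentration_var (I : finType) (c : I -> 'I_n -> R) (y : I -> R)
    (Lam t s : R) : 0 < s -> (forall j, s ^+ 2 <= \sum_i c j i ^+ 2) ->
  2 <= Lam -> #|I|%:R <= expR (Lam ^+ 2 / 2) -> 0 <= t ->
  Pr P (fun e => [forall j, dot (c j) e <= y j + t]) -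
  Pr P (fun e => [forall j, dot (c j) e <= y j]) <= 3 * expR 2 * Lam * (t / s).
Proof.
move=> s0 cs Lam2 cardI t0.
pose sd j := Num.sqrt (\sum_i c j i ^+ 2).
have sds j : s <= sd j.
  by rewrite -(ger0_norm (ltW s0)) -sqrtr_sqr ler_wsqrtr.
have sd0 j : 0 < sd j by rewrite (lt_le_trans s0).
have sd2 j : sd j ^+ 2 = \sum_i c j i ^+ 2.
  by rewrite sqr_sqrtr// sumr_ge0// => i _; exact: sqr_ge0.
pose c' j i := c j i / sd j.
have c'1 j : \sum_i c' j i ^+ 2 = 1.
  rewrite -(@divff _ (sd j ^+ 2)); last by rewrite expf_neq0// gt_eqF.
  by rewrite [X in _ = X / _]sd2 mulr_suml; apply: eq_bigr => i _; rewrite /c' exprMn exprVn.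
have dotE j e : dot (c' j) e = dot (c j) e / sd j.
  by rewrite /dot mulr_suml; apply: eq_bigr => i _; rewrite /c' mulrAC.
have mD (a : I -> R) (b : I -> 'I_n -> R) : mb (fun e => [forall j, dot (b j) e <= a j]).
  by apply: mb_forall => j; apply: mb_le => //; exact: measurable_dot.
have ts : 0 <= t / s by rewrite divr_ge0// ltW.
apply: le_trans (gauss_anticoncentration (fun j => y j / sd j) c'1 Lam2 cardI ts).
have -> : (fun e => [forall j, dot (c' j) e <= y j / sd j]) =
    (fun e => [forall j, dot (c j) e <= y j]).
  by apply/funext => e; apply: eq_forallb => j; rewrite dotE ler_pM2r ?invr_gt0.
rewrite lerD2r; apply: Pr_mono => // e /forallP h; apply/forallP => j.
rewrite dotE ler_pdivrMr// mulrDl divfK ?gt_eqF//; apply: le_trans (h j) _.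
rewrite lerD2l mulrAC ler_pdivlMr// ler_wpM2l//.
Qed.

End anticoncentration.

(** * The smooth maximum *)

Section smooth_max.
Context {R : realType} (I : finType).
Variables (y : I -> R) (beta Lam : R).
Hypothesis beta0 : 0 < beta.
Hypothesis Lam1 : 1 <= Lam.
Hypothesis cardI : #|I|%:R <= expR Lam.
Hypothesis I0 : (0 < #|I|)%N.
Implicit Types (z v x : I -> R) (M : I -> I -> R).

Let Lam0 : 0 < Lam := lt_le_trans ltr01 Lam1.

(* [smf] is a smooth step of the soft maximum,
   [g0 (ln (\sum_j exp (beta * (z j - y j))) / Lam)]; [smD1], [smD2] and [smD3]
   are its derivatives, contracted with the given vectors and matrices. *)
Definition smW z j : R := expR (beta * (z j - y j)).
Definition smS z : R := \sum_j smW z j.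
Definition smA z v : R := \sum_j smW z j * v j.
Definition smQ z M : R := \sum_j \sum_k M j k * (smW z j * smW z k).
Definition smT z M : R := \sum_j M j j * smW z j.

(** The step is written as a function of the exponential sum rather than of its logarithm: the
    [k]-th derivative is then of size [s^-k / Lam], which matches the [k] weights that it
    multiplies. *)
Definition smH0 (s : R) : R := g0 (ln s / Lam).
Definition smH1 (s : R) : R := g1 (ln s / Lam) * Lam^-1 * s^-1.
Definition smH2 (s : R) : R :=
  (g2 (ln s / Lam) * Lam^-1 ^+ 2 - g1 (ln s / Lam) * Lam^-1) * s^-1 ^+ 2.
Definition smH3 (s : R) : R :=
  (g3 (ln s / Lam) * Lam^-1 ^+ 3 - 3 * (g2 (ln s / Lam) * Lam^-1 ^+ 2)
   + 2 * (g1 (ln s / Lam) * Lam^-1)) * s^-1 ^+ 3.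

Definition smf z : R := smH0 (smS z).
Definition smD1 z v : R := beta * (smH1 (smS z) * smA z v).
Definition smD2 z M : R :=
  beta ^+ 2 * (smH2 (smS z) * smQ z M + smH1 (smS z) * smT z M).
Definition smD3 z M x : R :=
  beta ^+ 3 * (smH3 (smS z) * smQ z M * smA z x
    + smH2 (smS z) * (smQ z (fun j k => M j k * (x j + x k)) + smT z M * smA z x)
    + smH1 (smS z) * smT z (fun j k => M j k * x j)).

Lemma smW_gt0 z j : 0 < smW z j. Proof. exact: expR_gt0. Qed.

Lemma smS_gt0 z : 0 < smS z.
Proof.
have /card_gt0P[i _] := I0.
rewrite /smS (bigD1 i)//= ltr_pwDl ?smW_gt0// sumr_ge0// => j _.
exact/ltW/smW_gt0.
Qed.

Lemma is_derive_recip (s : R) : 0 < s ->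
  is_derive s 1 (fun s : R => s^-1) (- s^-1 ^+ 2).
Proof.
move=> s0; have sn0 : s != 0 by rewrite gt_eqF.
have := @is_deriveV _ id s _ _ sn0 (is_derive_id s 1).
by rewrite /GRing.scale /= mulr1 exprVn.
Qed.

Lemma is_derive_comp_ln (g dg : R -> R) (s : R) : (forall u : R, is_derive u 1 g (dg u)) ->
  0 < s -> is_derive s 1 (fun s => g (ln s / Lam)) (dg (ln s / Lam) * (s^-1 * Lam^-1)).
Proof.
move=> hg s0; have d := is_derive1_ln s0.
have d1 : is_derive s 1 (fun s => ln s / Lam) (s^-1 * Lam^-1).
  by apply: is_derive_eq; rewrite /GRing.scale /= mulr0 add0r mulrC.
exact: (@is_derive1_comp _ g (fun s => ln s / Lam) s _ _ (hg _) d1).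
Qed.

Lemma is_derive_smH0 (s : R) : 0 < s -> is_derive s 1 smH0 (smH1 s).
Proof.
move=> s0; have := is_derive_comp_ln is_derive_g0 s0.
by rewrite /smH1 -mulrA (mulrC s^-1).
Qed.

Lemma is_derive_smH1 (s : R) : 0 < s -> is_derive s 1 smH1 (smH2 s).
Proof.
move=> s0; have d1 := is_derive_comp_ln is_derive_g1 s0.
have d := is_derive_recip s0.
by apply: is_derive_eq; rewrite /smH2 /GRing.scale /=; ring.
Qed.

Lemma is_derive_smH2 (s : R) : 0 < s -> is_derive s 1 smH2 (smH3 s).
Proof.
move=> s0; have d1 := is_derive_comp_ln is_derive_g1 s0.
have d2 := is_derive_comp_ln is_derive_g2 s0.
have d := is_derive_recip s0.
by apply: is_derive_eq; rewrite /smH3 /GRing.scale /=; ring.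
Qed.

Section curve.
Variables (t : R) (z : R -> I -> R) (dz : I -> R).
Hypothesis hz : forall j, is_derive t 1 (fun t => z t j) (dz j).

Lemma is_derive_smW j : is_derive t 1 (fun t => smW (z t) j)
  (beta * (smW (z t) j * dz j)).
Proof.
have d1 : is_derive t 1 (fun t => beta * (z t j - y j)) (beta * dz j).
  have dz1 := hz j.
  by apply: is_derive_eq; rewrite /GRing.scale /=; ring.
have := @is_derive1_comp _ expR (fun t => beta * (z t j - y j)) t _ _ (is_derive_expR _) d1.
by rewrite mulrCA.
Qed.

Lemma is_derive_bigsum (J : finType) (F : J -> R -> R) (dF : J -> R) :
  (forall j, is_derive t 1 (F j) (dF j)) ->
  is_derive t 1 (fun t => \sum_j F j t) (\sum_j dF j).
Proof.
move=> h; elim: (index_enum J) => [|j r IH].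
  rewrite big_nil; under eq_fun do rewrite big_nil.
  exact: is_derive_cst.
rewrite big_cons; under eq_fun do rewrite big_cons.
exact: is_deriveD.
Qed.

Lemma is_derive_smS : is_derive t 1 (fun t => smS (z t)) (beta * smA (z t) dz).
Proof.
rewrite /smA mulr_sumr; apply: is_derive_bigsum => j; exact: is_derive_smW.
Qed.

Lemma is_derive_smA (v : R -> I -> R) (dv : I -> R) :
  (forall j, is_derive t 1 (fun t => v t j) (dv j)) ->
  is_derive t 1 (fun t => smA (z t) (v t))
    (beta * smA (z t) (fun j => v t j * dz j) + smA (z t) dv).
Proof.
move=> hv; rewrite /smA mulr_sumr -big_split /=.
apply: is_derive_bigsum => j; have d1 := is_derive_smW j; have d2 := hv j.
by apply: is_derive_eq; rewrite /GRing.scale /=; ring.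
Qed.

Lemma is_derive_smQ M : is_derive t 1 (fun t => smQ (z t) M)
  (beta * smQ (z t) (fun j k => M j k * (dz j + dz k))).
Proof.
rewrite /smQ mulr_sumr; apply: is_derive_bigsum => j.
rewrite mulr_sumr; apply: is_derive_bigsum => k.
have d1 := is_derive_smW j; have d2 := is_derive_smW k.
by apply: is_derive_eq; rewrite /GRing.scale /=; ring.
Qed.

Lemma is_derive_smT M : is_derive t 1 (fun t => smT (z t) M)
  (beta * smT (z t) (fun j k => M j k * dz j)).
Proof.
rewrite /smT mulr_sumr; apply: is_derive_bigsum => j.
have d1 := is_derive_smW j.
by apply: is_derive_eq; rewrite /GRing.scale /=; ring.
Qed.

Lemma is_derive_smHS (h dh : R -> R) : (forall s : R, 0 < s -> is_derive s 1 h (dh s)) ->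
  is_derive t 1 (fun t => h (smS (z t))) (dh (smS (z t)) * (beta * smA (z t) dz)).
Proof.
move=> hh; apply: (@is_derive1_comp _ h (fun t => smS (z t)) t _ _ _ is_derive_smS).
exact/hh/smS_gt0.
Qed.

Lemma is_derive_smf : is_derive t 1 (fun t => smf (z t)) (smD1 (z t) dz).
Proof.
by have := is_derive_smHS is_derive_smH0; rewrite mulrCA.
Qed.

Lemma smQ_prod w v x : smQ w (fun j k => v j * x k) = smA w v * smA w x.
Proof.
rewrite /smA mulr_suml; apply: eq_bigr => j _; rewrite mulr_sumr.
by apply: eq_bigr => k _; ring.
Qed.

Lemma is_derive_smD1 (v : R -> I -> R) (dv : I -> R) :
  (forall j, is_derive t 1 (fun t => v t j) (dv j)) ->
  is_derive t 1 (fun t => smD1 (z t) (v t))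
    (smD2 (z t) (fun j k => v t j * dz k) + smD1 (z t) dv).
Proof.
move=> hv; have d1 := is_derive_smHS is_derive_smH1; have d2 := is_derive_smA hv.
have -> : smD2 (z t) (fun j k => v t j * dz k) = beta ^+ 2 *
    (smH2 (smS (z t)) * (smA (z t) (v t) * smA (z t) dz) +
     smH1 (smS (z t)) * smA (z t) (fun j => v t j * dz j)).
  rewrite /smD2 smQ_prod; congr (_ * (_ + _ * _)).
  by apply: eq_bigr => j _; rewrite mulrC.
by apply: is_derive_eq; rewrite /smD1 /GRing.scale /=; ring.
Qed.

Lemma is_derive_smD2 M : is_derive t 1 (fun t => smD2 (z t) M) (smD3 (z t) M dz).
Proof.
have d1 := is_derive_smHS is_derive_smH1; have d2 := is_derive_smHS is_derive_smH2.
have d3 := is_derive_smQ M; have d4 := is_derive_smT M.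
by apply: is_derive_eq; rewrite /smD3 /GRing.scale /=; ring.
Qed.

End curve.

(** Equivalently, the maximum over [j] of [z j - y j] lies in (- b, a]. *)
Definition strip (a b : R) z := [forall j, z j <= y j + a] && ~~ [forall j, z j <= y j - b].

(** The resolution of the smoothing: the soft maximum exceeds the true one by at most
    [ln #|I| / beta <= smw]. Thus [g0] is still 1 when the maximum is below [- smw], and already 0
    when it is above [4 * smw]. *)
Definition smw : R := Lam / beta.

Lemma smw_gt0 : 0 < smw. Proof. by rewrite divr_gt0. Qed.

Let bw : beta * smw = Lam.
Proof. by rewrite /smw mulrC divfK// gt_eqF. Qed.

Lemma smS_le z : (forall j, z j <= y j - smw) -> ln (smS z) <= 0.
Proof.
move=> h; rewrite -ln1 ler_ln ?posrE ?smS_gt0//.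
apply: (@le_trans _ _ (\sum_(j : I) expR (- Lam))).
  apply: ler_sum => j _; rewrite ler_expR.
  have hj := h j; have hh : z j - y j <= - smw by lra.
  by have := ler_wpM2l (ltW beta0) hh; rewrite mulrN bw.
rewrite sumr_const -[X in X <= _]mulr_natr mulrC expRN.
by rewrite ler_pdivrMr ?expR_gt0// mul1r.
Qed.

Lemma smS_ge z j : y j + 4 * smw < z j -> 4 * Lam <= ln (smS z).
Proof.
move=> h; rewrite -[leLHS]expRK ler_ln ?posrE ?expR_gt0 ?smS_gt0//.
apply: (@le_trans _ _ (smW z j)).
  rewrite ler_expR; have hh : 4 * smw <= z j - y j by lra.
  by have := ler_wpM2l (ltW beta0) hh; rewrite mulrCA bw.
by rewrite /smS (bigD1 j)//= lerDl sumr_ge0// => k _; exact/ltW/smW_gt0.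
Qed.

Lemma strip_out z : ~~ strip (4 * smw) smw z ->
  ln (smS z) / Lam <= 0 \/ 4 <= ln (smS z) / Lam.
Proof.
rewrite negb_and negbK => /orP[|/forallP h].
  rewrite negb_forall => /existsP[j]; rewrite -ltNge => /smS_ge h.
  by right; rewrite ler_pdivlMr.
by left; rewrite ler_pdivrMr// mul0r; exact: smS_le.
Qed.

Lemma smH_out z : ~~ strip (4 * smw) smw z ->
  [/\ smH1 (smS z) = 0, smH2 (smS z) = 0 & smH3 (smS z) = 0].
Proof.
move=> /strip_out/g123_out[h1 h2 h3].
by rewrite /smH1 /smH2 /smH3 h1 h2 h3 !(mul0r, mulr0, subr0, addr0).
Qed.

Lemma smf_ge z : (([forall j, z j <= y j - smw])%:R : R) <= smf z.
Proof.
have /andP[f0 _] := g0_itv (ln (smS z) / Lam).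
case: forallP => [h|_]; last exact: f0.
by rewrite /smf /smH0 g0_le0// ler_pdivrMr// mul0r; exact: smS_le.
Qed.

Lemma smf_le z : smf z <= ([forall j, z j <= y j + 4 * smw])%:R.
Proof.
have /andP[_ f1] := g0_itv (ln (smS z) / Lam).
case: (boolP [forall j, z j <= y j + 4 * smw]) => [_|]; first exact: f1.
rewrite negb_forall => /existsP[j]; rewrite -ltNge => /smS_ge h.
by rewrite /smf /smH0 g0_ge4// ler_pdivlMr.
Qed.

Lemma smf_itv z : 0 <= smf z <= 1.
Proof. exact: g0_itv. Qed.

(** The worst case is [smH3], with 200 * (1 + 3 + 2). Higher powers of [Lam^-1] are replaced by the
    first one, which the terms with [g1] have in any case. *)
Definition smK : R := 1200 / Lam.

Lemma smK_ge0 : 0 <= smK.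
Proof. by rewrite divr_ge0 ?ler0n// ltW. Qed.

Lemma smH_bound (s : R) : 0 < s -> [/\ `|smH1 s| <= smK * s^-1,
  `|smH2 s| <= smK * s^-1 ^+ 2 & `|smH3 s| <= smK * s^-1 ^+ 3].
Proof.
move=> s0; have [] := g123_bound (ln s / Lam).
rewrite /smH1 /smH2 /smH3 /smK.
set a1 := g1 _; set a2 := g2 _; set a3 := g3 _ => h1 h2 h3.
have l0 : 0 < Lam^-1 by rewrite invr_gt0.
have l1 : Lam^-1 <= 1 by rewrite invf_le1.
move: l0 l1; set l := Lam^-1 => l0 l1.
have r0 : 0 <= s^-1 by rewrite invr_ge0 ltW.
have l2 : l ^+ 2 <= l by rewrite expr2 ler_piMl// ltW.
have l3 : l ^+ 3 <= l.
  by rewrite exprS; apply: le_trans (ler_wpM2l (ltW l0) l2) _; rewrite ler_piMr// ltW.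
have l2_0 : 0 <= l ^+ 2 by rewrite exprn_ge0// ltW.
have l3_0 : 0 <= l ^+ 3 by rewrite exprn_ge0// ltW.
have b1 : `|a1 * l| <= 200 * l by rewrite normrM (gtr0_norm l0) ler_wpM2r// ltW.
have b2 : `|a2 * l ^+ 2| <= 200 * l.
  by rewrite normrM (ger0_norm l2_0); apply: ler_pM.
have b3 : `|a3 * l ^+ 3| <= 200 * l.
  by rewrite normrM (ger0_norm l3_0); apply: ler_pM.
split; rewrite normrM [X in _ * X <= _]ger0_norm ?exprn_ge0// ler_wpM2r ?exprn_ge0//.
- by lra.
- by rewrite (le_trans (ler_normB _ _))//; lra.
- rewrite (le_trans (ler_normD _ _))// [X in _ + X]normrM (ger0_norm (ler0n _ 2)).
  rewrite (le_trans (lerD (ler_normB _ _) (lexx _)))// [`|3 * _|]normrM (ger0_norm (ler0n _ 3)).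
  by lra.
Qed.

Lemma ler_normM (a b A B : R) : `|a| <= A -> `|b| <= B -> `|a * b| <= A * B.
Proof. by move=> ha hb; rewrite normrM ler_pM. Qed.

Lemma smA_abs z v : `|smA z v| <= smA z (fun j => `|v j|).
Proof.
rewrite (le_trans (ler_norm_sum _ _ _))//; apply: ler_sum => j _.
by rewrite normrM gtr0_norm// smW_gt0.
Qed.

Lemma smA_ge0 z v : (forall j, 0 <= v j) -> 0 <= smA z v.
Proof. by move=> h; apply: sumr_ge0 => j _; rewrite mulr_ge0// ltW// smW_gt0. Qed.

Lemma smA_le z v x : (forall j, v j <= x j) -> smA z v <= smA z x.
Proof. by move=> h; apply: ler_sum => j _; rewrite ler_wpM2l// ltW// smW_gt0. Qed.

Lemma smA_cst z (c : R) : smA z (fun=> c) = c * smS z.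
Proof. by rewrite /smA -mulr_suml mulrC. Qed.

Lemma smA_bound z v (c : R) : (forall j, `|v j| <= c) -> `|smA z v| <= c * smS z.
Proof. by move=> h; rewrite (le_trans (smA_abs _ _))// -smA_cst smA_le. Qed.

Lemma smQ_bound z M v x : (forall j k, `|M j k| <= v j * x k) ->
  `|smQ z M| <= smA z v * smA z x.
Proof.
move=> h; rewrite -smQ_prod (le_trans (ler_norm_sum _ _ _))//; apply: ler_sum => j _.
rewrite (le_trans (ler_norm_sum _ _ _))//; apply: ler_sum => k _.
have w0 : 0 < smW z j * smW z k by rewrite mulr_gt0 ?smW_gt0.
by rewrite normrM (gtr0_norm w0) ler_wpM2r// ltW.
Qed.

Lemma smT_bound z M v : (forall j, `|M j j| <= v j) -> `|smT z M| <= smA z v.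
Proof.
move=> h; rewrite (le_trans (ler_norm_sum _ _ _))//; apply: ler_sum => j _.
by rewrite normrM (gtr0_norm (smW_gt0 _ _)) mulrC ler_wpM2l// ltW// smW_gt0.
Qed.

Lemma smD1_bound z v (c : R) : (forall j, `|v j| <= c) ->
  `|smD1 z v| <= smK * beta * c * (strip (4 * smw) smw z)%:R.
Proof.
move=> vc; case: (boolP (strip _ _ z)) => [_|/smH_out[h _ _]]; last first.
  by rewrite /smD1 h mul0r mulr0 normr0 mulr0.
have S0 := smS_gt0 z; have [b1 _ _] := smH_bound S0.
rewrite mulr1 /smD1 normrM (gtr0_norm beta0) normrM.
apply: (@le_trans _ _ (beta * (smK * (smS z)^-1 * (c * smS z)))).
  by rewrite ler_wpM2l ?(ltW beta0)// ler_pM// smA_bound.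
by rewrite le_eqVlt; apply/orP; left; apply/eqP; field; rewrite gt_eqF.
Qed.

Lemma smD2_bound z M (c : R) : (forall j k, `|M j k| <= c) ->
  `|smD2 z M| <= 2 * smK * beta ^+ 2 * c * (strip (4 * smw) smw z)%:R.
Proof.
move=> Mc; case: (boolP (strip _ _ z)) => [_|/smH_out[h1 h2 _]]; last first.
  by rewrite /smD2 h1 h2 !mul0r addr0 mulr0 normr0 mulr0.
have S0 := smS_gt0 z; have [b1 b2 _] := smH_bound S0.
rewrite mulr1 /smD2 normrM ger0_norm ?sqr_ge0//.
have q : `|smQ z M| <= c * smS z ^+ 2.
  have := @smQ_bound z M (fun=> c) (fun=> 1).
  rewrite !smA_cst mul1r -mulrA -expr2; apply => j k; rewrite mulr1//.
have t : `|smT z M| <= c * smS z by rewrite -smA_cst; apply: smT_bound.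
apply: (@le_trans _ _ (beta ^+ 2 * (smK * (smS z)^-1 ^+ 2 * (c * smS z ^+ 2) +
   smK * (smS z)^-1 * (c * smS z)))).
  rewrite ler_wpM2l ?sqr_ge0// (le_trans (ler_normD _ _))//.
  by apply: lerD; exact: ler_normM.
by rewrite le_eqVlt; apply/orP; left; apply/eqP; field; rewrite gt_eqF.
Qed.

(** The hypotheses say that every term has the size of [X] once the weights are normalised. The
    constant 5 counts 1 for the term with [smH3], 2 + 1 for those with [smH2] and 1 for the one with
    [smH1]. *)
Lemma smD3_bound z M x (X : R) :
  `|smQ z M| * `|smA z x| <= smS z ^+ 2 * X ->
  `|smQ z (fun j k => M j k * (x j + x k))| <= 2 * smS z * X ->
  `|smT z M| * `|smA z x| <= smS z * X ->
  `|smT z (fun j k => M j k * x j)| <= X ->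
  `|smD3 z M x| <= 5 * smK * beta ^+ 3 * (X / smS z) * (strip (4 * smw) smw z)%:R.
Proof.
move=> q1 q2 t1 t2; case: (boolP (strip _ _ z)) => [_|/smH_out[h1 h2 h3]]; last first.
  by rewrite /smD3 h1 h2 h3 !mul0r !addr0 mulr0 normr0 mulr0.
have S0 := smS_gt0 z; have [b1 b2 b3] := smH_bound S0.
have b30 : 0 <= beta ^+ 3 by rewrite exprn_ge0// ltW.
rewrite mulr1 /smD3 normrM (ger0_norm b30).
apply: (@le_trans _ _ (beta ^+ 3 * (smK * (smS z)^-1 ^+ 3 * (smS z ^+ 2 * X) +
   smK * (smS z)^-1 ^+ 2 * (2 * smS z * X + smS z * X) + smK * (smS z)^-1 * X))).
  rewrite ler_wpM2l// (le_trans (ler_normD _ _))// lerD//.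
    rewrite (le_trans (ler_normD _ _))// lerD//.
      by rewrite -mulrA ler_normM// normrM.
    apply: ler_normM => //; rewrite (le_trans (ler_normD _ _))// lerD//.
    by rewrite normrM.
  exact: ler_normM.
by rewrite le_eqVlt; apply/orP; left; apply/eqP; field; rewrite gt_eqF.
Qed.

Lemma smD3_bound_cst z M x (c : R) : (forall j k, `|M j k| <= c) ->
  `|smD3 z M x| <= 5 * smK * beta ^+ 3 * (c * smA z (fun j => `|x j|) / smS z) *
     (strip (4 * smw) smw z)%:R.
Proof.
move=> Mc; have S0 := smS_gt0 z.
have /card_gt0P[i0 _] := I0.
have c0 : 0 <= c by apply: le_trans (Mc i0 i0).
have ax0 : 0 <= smA z (fun j => `|x j|) by exact: smA_ge0.
have q : `|smQ z M| <= c * smS z ^+ 2.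
  have := @smQ_bound z M (fun=> c) (fun=> 1).
  rewrite !smA_cst mul1r -mulrA -expr2; apply => j k; rewrite mulr1//.
have t : `|smT z M| <= c * smS z by rewrite -smA_cst; apply: smT_bound.
have a := smA_abs z x.
apply: smD3_bound.
- apply: (@le_trans _ _ (c * smS z ^+ 2 * smA z (fun j => `|x j|))); first exact: ler_pM.
  by rewrite mulrAC mulrC.
- apply: (@le_trans _ _ (`|smQ z (fun j k => M j k * x j)| + `|smQ z (fun j k => M j k * x k)|)).
    rewrite (_ : smQ z (fun j k => M j k * (x j + x k)) =
      smQ z (fun j k => M j k * x j) + smQ z (fun j k => M j k * x k)) ?ler_normD//.
    rewrite -big_split; apply: eq_bigr => j _; rewrite -big_split; apply: eq_bigr => k _ /=.
    by rewrite mulrDr mulrDl.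
  have h1 := @smQ_bound z (fun j k => M j k * x j) (fun j => `|x j|) (fun=> c).
  have h2 := @smQ_bound z (fun j k => M j k * x k) (fun=> c) (fun j => `|x j|).
  rewrite smA_cst in h1; rewrite smA_cst in h2.
  rewrite (_ : 2 * smS z * _ = smA z (fun j => `|x j|) * (c * smS z) +
    c * smS z * smA z (fun j => `|x j|)); last by ring.
  apply: lerD.
    by apply: h1 => j k; rewrite normrM mulrC ler_wpM2l.
  by apply: h2 => j k; rewrite normrM ler_wpM2r.
- apply: (@le_trans _ _ (c * smS z * smA z (fun j => `|x j|))); first exact: ler_pM.
  by rewrite mulrAC mulrC.
- have := @smT_bound z (fun j k => M j k * x j) (fun j => c * `|x j|).
  rewrite (_ : smA z (fun j => c * `|x j|) = c * smA z (fun j => `|x j|)).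
    by apply => j; rewrite normrM ler_wpM2r.
  by rewrite /smA mulr_sumr; apply: eq_bigr => j _; rewrite mulrCA.
Qed.

(** The bound is an average of [|v j|^3] under the weights and not the maximum over [j]: once [z] is
    independent of [v], its expectation is at most the largest coordinatewise third moment. That
    every other term is dominated by this average is the power-mean inequality. *)
Lemma smD3_bound_cube z v :
  `|smD3 z (fun j k => v j * v k) v| <=
   5 * smK * beta ^+ 3 * (smA z (fun j => `|v j| ^+ 3) / smS z) *
     (strip (4 * smw) smw z)%:R.
Proof.
have S0 := smS_gt0 z.
set A3 := smA z (fun j => `|v j| ^+ 3); set A1 := smA z (fun j => `|v j|).
have A10 : 0 <= A1 by exact: smA_ge0.
have A30 : 0 <= A3 by apply: smA_ge0 => j; rewrite exprn_ge0.
pose A2 := smA z (fun j => `|v j| ^+ 2).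
have A20 : 0 <= A2 by apply: smA_ge0 => j; rewrite exprn_ge0.
have a1 := smA_abs z v; rewrite -/A1 in a1.
(* Jensen for the cube, by its tangent [3 m^2 x - 2 m^3 <= x^3] at the weighted mean [m]. *)
have A1c : A1 ^+ 3 <= smS z ^+ 2 * A3.
  pose m := A1 / smS z; have m0 : 0 <= m by rewrite divr_ge0// ltW.
  have mA : A1 = m * smS z by rewrite /m divfK// gt_eqF.
  have : 3 * m ^+ 2 * A1 - 2 * m ^+ 3 * smS z <= A3.
    rewrite /A1 /A3 /smA /smS !mulr_sumr -sumrB; apply: ler_sum => j _.
    have w0 := ltW (smW_gt0 z j).
    rewrite (_ : _ - _ = smW z j * (3 * m ^+ 2 * `|v j| - 2 * m ^+ 3)); last by ring.
    rewrite ler_wpM2l// -subr_ge0.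
    rewrite (_ : _ - _ = (`|v j| - m) ^+ 2 * (`|v j| + 2 * m)); last by ring.
    by rewrite mulr_ge0 ?sqr_ge0// addr_ge0// mulr_ge0.
  rewrite mA (_ : _ - _ = m ^+ 3 * smS z); last by ring.
  move=> h; rewrite (_ : (m * smS z) ^+ 3 = smS z ^+ 2 * (m ^+ 3 * smS z)); last by ring.
  by rewrite ler_wpM2l ?sqr_ge0.
(* Follows from [x^2 y <= (2 x^3 + y^3) / 3], summed over pairs of indices. *)
have A21 : A2 * A1 <= smS z * A3.
  rewrite /A2 /A1 /smA mulr_suml.
  apply: (@le_trans _ _ (\sum_j \sum_k smW z j * smW z k *
      ((2 * `|v j| ^+ 3 + `|v k| ^+ 3) / 3))).
    apply: ler_sum => j _; rewrite mulr_sumr; apply: ler_sum => k _.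
    rewrite (_ : smW z j * `|v j| ^+ 2 * (smW z k * `|v k|) =
      smW z j * smW z k * (`|v j| ^+ 2 * `|v k|)); last by ring.
    rewrite ler_wpM2l ?mulr_ge0 ?(ltW (smW_gt0 _ _))//.
    have a0 := normr_ge0 (v j); have b0 := normr_ge0 (v k).
    rewrite ler_pdivlMr// -subr_ge0.
    rewrite (_ : _ - _ = (`|v j| - `|v k|) ^+ 2 * (2 * `|v j| + `|v k|)); last by ring.
    by rewrite mulr_ge0 ?sqr_ge0// addr_ge0// mulr_ge0.
  rewrite le_eqVlt; apply/orP; left; apply/eqP.
  transitivity (\sum_j \sum_k (2 / 3 * (smW z j * `|v j| ^+ 3 * smW z k) +
      1 / 3 * (smW z j * (smW z k * `|v k| ^+ 3)))).
    by apply: eq_bigr => j _; apply: eq_bigr => k _; field.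
  under eq_bigr => j _ do rewrite big_split /= -!mulr_sumr.
  rewrite big_split /= -!mulr_sumr -!mulr_suml -/(smS z) -/(smA z (fun j => `|v j| ^+ 3)) -/A3.
  by field.
have qv : `|smQ z (fun j k => v j * v k)| <= A1 ^+ 2.
  by apply: smQ_bound => j k; rewrite normrM.
have tv : `|smT z (fun j k => v j * v k)| <= A2.
  by apply: smT_bound => j; rewrite normrM -expr2.
apply: smD3_bound.
- apply: le_trans A1c; rewrite [leRHS]exprSr; exact: ler_pM.
- apply: (@le_trans _ _ (`|smQ z (fun j k => v j ^+ 2 * v k)| + `|smQ z (fun j k => v j * v k ^+ 2)|)).
    rewrite (_ : smQ z (fun j k => v j * v k * (v j + v k)) =
      smQ z (fun j k => v j ^+ 2 * v k) + smQ z (fun j k => v j * v k ^+ 2)) ?ler_normD//.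
    rewrite -big_split; apply: eq_bigr => j _; rewrite -big_split; apply: eq_bigr => k _ /=.
    by ring.
  rewrite (_ : 2 * smS z * A3 = smS z * A3 + smS z * A3); last by ring.
  apply: lerD.
    apply: le_trans A21; apply: smQ_bound => j k; rewrite normrM normrX//.
  apply: le_trans A21; rewrite mulrC; apply: smQ_bound => j k; rewrite normrM normrX//.
- by apply: le_trans A21; exact: ler_pM.
- by apply: smT_bound => j; rewrite !normrM -expr2 -exprSr.
Qed.

Section stability.
Variables (z u : I -> R).
Hypothesis hu : forall j, beta * `|u j| <= 1.

Lemma smW_stable j : expR (-1) * smW z j <= smW (fun j => z j + u j) j <= expR 1 * smW z j.
Proof.
have := hu j; have := ler_norm (u j); have := ler_norm (- u j); rewrite normrN => h1 h2 h3.
have b1 := ler_wpM2l (ltW beta0) h1; have b2 := ler_wpM2l (ltW beta0) h2.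
by rewrite /smW -!expRD !ler_expR; apply/andP; split; lra.
Qed.

(** Each weight changes by a factor between 1 / e and e, so the normalised average by at most e^2.
    Third derivatives along a segment can thus be evaluated at its starting point, which will be
    independent of the increment. *)
Lemma smA_stable v : (forall j, 0 <= v j) ->
  smA (fun j => z j + u j) v / smS (fun j => z j + u j) <=
  expR 2 * (smA z v / smS z).
Proof.
move=> v0; have S0 := smS_gt0 z; have S1 := smS_gt0 (fun j => z j + u j).
have h1 : smA (fun j => z j + u j) v <= expR 1 * smA z v.
  rewrite /smA mulr_sumr; apply: ler_sum => j _; rewrite mulrA ler_wpM2r//.
  by have /andP[] := smW_stable j.
have h2 : expR (-1) * smS z <= smS (fun j => z j + u j).
  rewrite /smS mulr_sumr; apply: ler_sum => j _.
  by have /andP[] := smW_stable j.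
have a0 : 0 <= smA z v by exact: smA_ge0.
rewrite ler_pdivrMr// (le_trans h1)//.
have -> : expR 2 * (smA z v / smS z) * smS (fun j => z j + u j) =
   (expR 2 * (smA z v / smS z)) * smS (fun j => z j + u j) by [].
apply: (@le_trans _ _ ((expR 2 * (smA z v / smS z)) * (expR (-1) * smS z))); last first.
  by rewrite ler_wpM2l// mulr_ge0 ?expR_ge0// divr_ge0// ltW.
rewrite le_eqVlt; apply/orP; left; apply/eqP.
rewrite (_ : 2 = 1 + 1 :> R) ?natr1// expRD expRN.
by field; rewrite !gt_eqF// expR_gt0.
Qed.

(** The displacement is at most [1 / beta], hence at most [smw] because [Lam >= 1]. *)
Lemma strip_shift a b : strip a b (fun j => z j + u j) -> strip (a + smw) (b + smw) z.
Proof.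
have hu' j : `|u j| <= smw.
  by rewrite /smw ler_pdivlMr// mulrC (le_trans (hu j)).
move=> /andP[/forallP h1]; rewrite negb_forall => /existsP[k hk].
apply/andP; split.
  by apply/forallP => j; have := h1 j; have := hu' j; rewrite ler_norml => /andP[? ?]; lra.
rewrite negb_forall; apply/existsP; exists k; move: hk; rewrite -!ltNge => hk.
by have := hu' k; rewrite ler_norml => /andP[? ?]; lra.
Qed.

End stability.

End smooth_max.

(** * Taylor remainders of the smooth maximum *)

Section smooth_max_measurable.
Context {R : realType} (I : finType) {d : measure_display} {T : measurableType d}.
Variables (y : I -> R) (beta Lam : R).
Hypothesis beta0 : 0 < beta.
Hypothesis Lam1 : 1 <= Lam.
Hypothesis cardI : #|I|%:R <= expR Lam.
Hypothesis I0 : (0 < #|I|)%N.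
Variables (z : T -> I -> R).
Hypothesis mz : forall j, measurable_fun setT (fun t => z t j).

Local Notation W := (smW y beta).

Lemma measurable_smW j : measurable_fun setT (fun t => W (z t) j).
Proof.
apply: measurableT_comp => //; apply: measurable_funM => //.
by apply: measurable_funB.
Qed.

Lemma measurable_bigsum (J : finType) (F : J -> T -> R) :
  (forall j, measurable_fun setT (F j)) -> measurable_fun setT (fun t => \sum_j F j t).
Proof. by move=> h; apply: measurable_sum. Qed.

Lemma measurable_smS : measurable_fun setT (fun t => smS y beta (z t)).
Proof. by apply: measurable_bigsum => j; exact: measurable_smW. Qed.

Lemma measurable_smA (v : T -> I -> R) : (forall j, measurable_fun setT (fun t => v t j)) ->
  measurable_fun setT (fun t => smA y beta (z t) (v t)).
Proof.
by move=> h; apply: measurable_bigsum => j; apply: measurable_funM => //; exact: measurable_smW.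
Qed.

Lemma measurable_smQ (M : T -> I -> I -> R) :
  (forall j k, measurable_fun setT (fun t => M t j k)) ->
  measurable_fun setT (fun t => smQ y beta (z t) (M t)).
Proof.
move=> h; apply: measurable_bigsum => j; apply: measurable_bigsum => k.
apply: measurable_funM => //; apply: measurable_funM; exact: measurable_smW.
Qed.

Lemma measurable_smT (M : T -> I -> I -> R) :
  (forall j k, measurable_fun setT (fun t => M t j k)) ->
  measurable_fun setT (fun t => smT y beta (z t) (M t)).
Proof.
move=> h; apply: measurable_bigsum => j.
apply: measurable_funM => //; exact: measurable_smW.
Qed.

Lemma measurable_smSV : measurable_fun setT (fun t => (smS y beta (z t))^-1).
Proof.
rewrite (_ : (fun _ => _) = fun t => (smS y beta (z t)) `^ (-1)).
  apply: (measurableT_comp (measurable_powR (-1))); exact: measurable_smS.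
by apply/funext => t; rewrite powR_inv1// ltW// smS_gt0.
Qed.

Lemma measurable_lnS : measurable_fun setT (fun t => ln (smS y beta (z t)) / Lam).
Proof.
apply: measurable_funM => //; apply: (measurableT_comp (@measurable_ln R)).
exact: measurable_smS.
Qed.

Lemma derivable_measurable (g dg : R -> R) : (forall x : R, is_derive x 1 g (dg x)) ->
  measurable_fun setT g.
Proof.
move=> h; apply: continuous_measurable_fun => x.
by apply: differentiable_continuous; apply/derivable1_diffP; have [] := h x.
Qed.

Lemma measurable_smf : measurable_fun setT (fun t => smf y beta Lam (z t)).
Proof.
apply: (measurableT_comp (derivable_measurable (@is_derive_g0 R))).
exact: measurable_lnS.
Qed.

Lemma measurable_smH1 : measurable_fun setT (fun t => smH1 Lam (smS y beta (z t))).
Proof.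
apply: measurable_funM; last exact: measurable_smSV.
apply: measurable_funM => //.
apply: (measurableT_comp (derivable_measurable (@is_derive_g1 R))).
exact: measurable_lnS.
Qed.

Lemma measurable_smH2 : measurable_fun setT (fun t => smH2 Lam (smS y beta (z t))).
Proof.
apply: measurable_funM; last by apply: measurable_funX; exact: measurable_smSV.
apply: measurable_funB; apply: measurable_funM => //.
  apply: (measurableT_comp (derivable_measurable (@is_derive_g2 R))).
  exact: measurable_lnS.
apply: (measurableT_comp (derivable_measurable (@is_derive_g1 R))).
exact: measurable_lnS.
Qed.

Lemma measurable_smD1 (v : T -> I -> R) : (forall j, measurable_fun setT (fun t => v t j)) ->
  measurable_fun setT (fun t => smD1 y beta Lam (z t) (v t)).
Proof.
move=> h; apply: measurable_funM => //; apply: measurable_funM; first exact: measurable_smH1.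
exact: measurable_smA.
Qed.

Lemma measurable_smD2 (M : T -> I -> I -> R) :
  (forall j k, measurable_fun setT (fun t => M t j k)) ->
  measurable_fun setT (fun t => smD2 y beta Lam (z t) (M t)).
Proof.
move=> h; apply: measurable_funM => //; apply: measurable_funD; apply: measurable_funM.
- exact: measurable_smH2.
- exact: measurable_smQ.
- exact: measurable_smH1.
- exact: measurable_smT.
Qed.

Lemma mb_strip a b : mb (fun t => strip y a b (z t)).
Proof.
apply: mb_and; last apply: mb_neg.
  by apply: mb_forall => j; exact: mb_le.
by apply: mb_forall => j; exact: mb_le.
Qed.

End smooth_max_measurable.

Lemma linear_quadratic_le {R : realType} (x y : R) : 0 <= x -> 1 <= y ->
  x + x + 2 * x * y <= 4 * x * y ^+ 2.
Proof.
move=> x0 y1; rewrite -subr_ge0.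
have -> : 4 * x * y ^+ 2 - (x + x + 2 * x * y) = x * (2 * (y - 1) * (2 * y + 1)) by ring.
by rewrite mulr_ge0// mulr_ge0; lra.
Qed.

Section expansion.
Context {R : realType} (I : finType).
Variables (y : I -> R) (beta Lam : R).
Hypothesis beta0 : 0 < beta.
Hypothesis Lam1 : 1 <= Lam.
Hypothesis cardI : #|I|%:R <= expR Lam.
Hypothesis I0 : (0 < #|I|)%N.
Implicit Types (z v x : I -> R) (M : I -> I -> R).

Local Notation D1 := (smD1 y beta Lam).
Local Notation D2 := (smD2 y beta Lam).
Local Notation D3 := (smD3 y beta Lam).
Local Notation K := (smK Lam).
Local Notation w := (smw beta Lam).
Local Notation stripn a b z := ((strip y (a * w) (b * w) z)%:R : R).

Lemma smD1D z v x : D1 z (fun j => v j + x j) = D1 z v + D1 z x.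
Proof.
rewrite /smD1 /smA -mulrDr -mulrDr -big_split; congr (_ * (_ * _)).
by apply: eq_bigr => j _; rewrite mulrDr.
Qed.

Lemma smD1Z z v (c : R) : D1 z (fun j => c * v j) = c * D1 z v.
Proof.
rewrite /smD1 /smA (_ : \sum_j _ = c * \sum_j smW y beta z j * v j); first by ring.
by rewrite mulr_sumr; apply: eq_bigr => j _; ring.
Qed.

Lemma smD2Z z M (c : R) : D2 z (fun j k => c * M j k) = c * D2 z M.
Proof.
rewrite /smD2 /smQ /smT.
rewrite (_ : \sum_j \sum_k c * M j k * _ =
   c * \sum_j \sum_k M j k * (smW y beta z j * smW y beta z k)); last first.
  rewrite mulr_sumr; apply: eq_bigr => j _; rewrite mulr_sumr.
  by apply: eq_bigr => k _; ring.
rewrite (_ : \sum_j c * M j j * _ = c * \sum_j M j j * smW y beta z j); last first.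
  by rewrite mulr_sumr; apply: eq_bigr => j _; ring.
by ring.
Qed.

Lemma smD2D z M M' : D2 z (fun j k => M j k + M' j k) = D2 z M + D2 z M'.
Proof.
rewrite /smD2 /smQ /smT.
rewrite (_ : \sum_j \sum_k (M j k + M' j k) * _ =
   (\sum_j \sum_k M j k * (smW y beta z j * smW y beta z k)) +
   (\sum_j \sum_k M' j k * (smW y beta z j * smW y beta z k))); last first.
  rewrite -big_split; apply: eq_bigr => j _; rewrite -big_split.
  by apply: eq_bigr => k _ /=; ring.
rewrite (_ : \sum_j (M j j + M' j j) * _ =
  (\sum_j M j j * smW y beta z j) + (\sum_j M' j j * smW y beta z j)); last first.
  by rewrite -big_split; apply: eq_bigr => j _ /=; ring.
by ring.
Qed.

Lemma is_derive_line z u (t : R) j : is_derive t 1 (fun t => z j + t * u j) (u j).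
Proof. by apply: is_derive_eq; rewrite /GRing.scale /=; ring. Qed.

Lemma smD2_lip z u M (B : R) :
  (forall t, 0 <= t <= 1 -> `|D3 (fun j => z j + t * u j) M u| <= B) ->
  `|D2 (fun j => z j + u j) M - D2 z M| <= B.
Proof.
move=> hB; pose F t := D2 (fun j => z j + t * u j) M.
have := @mean_value_le R F (fun t => D3 (fun j => z j + t * u j) M u) 0 1 B ler01.
rewrite /F subr0 mulr1.
have -> : (fun j => z j + 1 * u j) = (fun j => z j + u j).
  by apply/funext => j; rewrite mul1r.
have -> : (fun j => z j + 0 * u j) = z by apply/funext => j; rewrite mul0r addr0.
apply; last by move=> t /hB.
by move=> t _; apply: is_derive_smD2 => // j; exact: is_derive_line.
Qed.

Lemma smD1_taylor z u (B : R) :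
  (forall t, 0 <= t <= 1 -> `|D3 (fun j => z j + t * u j) (fun j k => u j * u k) u| <= B) ->
  `|D1 (fun j => z j + u j) u - D1 z u - D2 z (fun j k => u j * u k)| <= B.
Proof.
move=> hB; pose F t := D1 (fun j => z j + t * u j) u - t * D2 z (fun j k => u j * u k).
have := @mean_value_le R F (fun t => D2 (fun j => z j + t * u j) (fun j k => u j * u k)
   - D2 z (fun j k => u j * u k)) 0 1 B ler01.
rewrite /F subr0 mulr1 mul1r mul0r subr0.
have -> : (fun j => z j + 1 * u j) = (fun j => z j + u j).
  by apply/funext => j; rewrite mul1r.
have -> : (fun j => z j + 0 * u j) = z by apply/funext => j; rewrite mul0r addr0.
rewrite addrAC; apply.
  move=> t _.
  have d1 := @is_derive_smD1 R I y beta Lam I0 t (fun t j => z j + t * u j) u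
    (is_derive_line z u t) (fun=> u) (fun=> 0) (fun j => is_derive_cst (u j) t 1).
  have D10 : D1 (fun j => z j + t * u j) (fun=> 0) = 0.
    by rewrite /smD1 smA_cst mul0r !mulr0.
  rewrite D10 addr0 in d1.
  by apply: is_derive_eq; rewrite /GRing.scale /=; ring.
move=> t /andP[t0 t1].
have := @smD2_lip z (fun j => t * u j) (fun j k => u j * u k) B.
apply => r /andP[r0 r1].
have -> : (fun j => z j + r * (t * u j)) = (fun j => z j + (r * t) * u j).
  by apply/funext => j; rewrite mulrA.
have D3Z M x (c : R) z' : D3 z' M (fun j => c * x j) = c * D3 z' M x.
  rewrite /smD3.
  have -> : smA y beta z' (fun j => c * x j) = c * smA y beta z' x.
    by rewrite /smA mulr_sumr; apply: eq_bigr => j _; ring.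
  have -> : smQ y beta z' (fun j k => M j k * (c * x j + c * x k)) =
     c * smQ y beta z' (fun j k => M j k * (x j + x k)).
    rewrite /smQ mulr_sumr; apply: eq_bigr => j _; rewrite mulr_sumr.
    by apply: eq_bigr => k _; ring.
  have -> : smT y beta z' (fun j k => M j k * (c * x j)) =
     c * smT y beta z' (fun j k => M j k * x j).
    by rewrite /smT mulr_sumr; apply: eq_bigr => j _; ring.
  by ring.
rewrite D3Z normrM (ger0_norm t0).
have B0 : 0 <= B by apply: le_trans (hB 0 _); rewrite // lexx ler01.
have rt : 0 <= r * t <= 1 by rewrite mulr_ge0// mulr_ile1.
by rewrite -[leRHS]mul1r ler_pM// hB.
Qed.

(* [u] is the increment [eps v]; the first case is the stable regime, where all
   quantities may be evaluated at the base point [z]. *)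
Lemma smD1_rem z u (m : R) : (forall j, `|u j| <= m) ->
  `|D1 (fun j => z j + u j) u - D1 z u - D2 z (fun j k => u j * u k)| <=
  K * beta ^+ 3 * (5 * expR 2 * (smA y beta z (fun j => `|u j| ^+ 3) / smS y beta z)
     * stripn 5 2 z
   + 4 * m ^+ 3 * (1 < beta * m)%R%:R).
Proof.
move=> um.
have K0 : 0 <= K := smK_ge0 Lam1.
have b30 : 0 <= beta ^+ 3 by rewrite exprn_ge0// ltW.
have Kb : 0 <= K * beta ^+ 3 by exact: mulr_ge0.
have E0 : 0 <= smA y beta z (fun j => `|u j| ^+ 3) / smS y beta z.
  by rewrite divr_ge0 ?(ltW (smS_gt0 _ _ I0 _))// smA_ge0// => j; exact: exprn_ge0.
case: (leP (beta * m) 1) => bm1.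
  rewrite mulr0 addr0; apply: smD1_taylor => t /andP[t0 t1].
  have hu j : beta * `|t * u j| <= 1.
    apply: le_trans bm1; rewrite ler_wpM2l ?(ltW beta0)// normrM (ger0_norm t0).
    by apply: le_trans (um j); rewrite ler_piMl.
  apply: (le_trans (smD3_bound_cube _ beta0 Lam1 cardI I0 _ _)).
  have A := smA_stable y beta0 I0 z hu (fun j => exprn_ge0 3 (normr_ge0 (u j))).
  have St := @strip_shift R I y beta Lam beta0 Lam1 z _ hu (4 * w) w.
  have e5 : 4 * w + w = 5 * w by ring.
  have e2 : w + w = 2 * w by ring.
  rewrite e5 e2 in St.
  case: (boolP (strip _ _ _ (fun j => z j + t * u j))) => [sz|_].
    have -> : strip y (5 * w) (2 * w) z by exact: St.
    rewrite !mulr1; have -> : K * beta ^+ 3 * (5 * expR 2 *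
      (smA y beta z (fun j => `|u j| ^+ 3) / smS y beta z)) = 5 * K * beta ^+ 3 *
      (expR 2 * (smA y beta z (fun j => `|u j| ^+ 3) / smS y beta z)) by ring.
    apply: ler_wpM2l A.
    exact: mulr_ge0 (mulr_ge0 (ler0n _ 5) K0) b30.
  rewrite mulr0; apply: (mulr_ge0 Kb).
  exact: mulr_ge0 (mulr_ge0 (mulr_ge0 (ler0n _ 5) (expR_ge0 2)) E0) (ler0n _ _).
(* Here [beta * m > 1]. The three terms are bounded separately and inflated to the order
   [(beta * m) ^+ 3], which is affordable because large increments are rare. *)
have m0 : 0 < m by rewrite -(pmulr_rgt0 _ beta0) (lt_trans ltr01).
have c1 := smD1_bound y beta0 Lam1 cardI I0 (fun j => z j + u j) um.
have c2 := smD1_bound y beta0 Lam1 cardI I0 z um.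
have c3 : `|D2 z (fun j k => u j * u k)| <= 2 * K * beta ^+ 2 * m ^+ 2.
  have h j k : `|u j * u k| <= m ^+ 2 by rewrite expr2; exact: ler_normM.
  apply: le_trans (smD2_bound y beta0 Lam1 cardI I0 z h) _.
  apply: ler_piMr; last exact: natb_le1.
  exact: mulr_ge0 (mulr_ge0 (mulr_ge0 (ler0n _ 2) K0) (sqr_ge0 _)) (sqr_ge0 _).
have s1 c : 0 <= c -> c * (strip y (4 * w) w z)%:R <= c :> R.
  by move=> c0; rewrite ler_piMr ?natb_le1.
have s2 c : 0 <= c -> c * (strip y (4 * w) w (fun j => z j + u j))%:R <= c :> R.
  by move=> c0; rewrite ler_piMr ?natb_le1.
have Kbm : 0 <= K * beta * m := mulr_ge0 (mulr_ge0 K0 (ltW beta0)) (ltW m0).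
have {}c1 := le_trans c1 (s2 _ Kbm); have {}c2 := le_trans c2 (s1 _ Kbm).
apply: (@le_trans _ _ (K * beta * m + K * beta * m + 2 * K * beta ^+ 2 * m ^+ 2)).
  rewrite (le_trans (ler_normB _ _))// lerD//.
  by rewrite (le_trans (ler_normB _ _))// lerD.
apply: (@le_trans _ _ (K * beta ^+ 3 * (4 * m ^+ 3 * 1))); last first.
  apply: (ler_wpM2l Kb); rewrite lerDr.
  exact: mulr_ge0 (mulr_ge0 (mulr_ge0 (ler0n _ 5) (expR_ge0 2)) E0) (ler0n _ _).
have -> : K * beta ^+ 3 * (4 * m ^+ 3 * 1) = 4 * (K * beta * m) * (beta * m) ^+ 2 by ring.
have -> : 2 * K * beta ^+ 2 * m ^+ 2 = 2 * (K * beta * m) * (beta * m) by ring.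
exact: linear_quadratic_le Kbm (ltW bm1).
Qed.

(** The expansion for [u = eps v], with one power of [eps] cancelled by linearity of the derivatives
    in [v]; two powers remain, and these provide the factor [1 / n] per observation. *)
Lemma smD1_rem_eps z v (eps m : R) : 0 <= eps -> (forall j, `|v j| <= m) ->
  `|D1 (fun j => z j + eps * v j) v - D1 z v - eps * D2 z (fun j k => v j * v k)| <=
  eps ^+ 2 * (K * beta ^+ 3 * (5 * expR 2 * (smA y beta z (fun j => `|v j| ^+ 3) / smS y beta z)
     * stripn 5 2 z
   + 4 * m ^+ 3 * (1 < beta * (eps * m))%R%:R)).
Proof.
rewrite le_eqVlt => /predU1P[<-|eps0] vm.
  rewrite (_ : (fun j => z j + 0 * v j) = z) ?mul0r ?subr0 ?subrr ?normr0 ?expr0n ?mul0r//.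
  by apply/funext => j; rewrite mul0r addr0.
have um j : `|eps * v j| <= eps * m by rewrite normrM (gtr0_norm eps0) ler_pM2l.
have := smD1_rem z um; rewrite !smD1Z.
have -> : D2 z (fun j k => eps * v j * (eps * v k)) = eps ^+ 2 * D2 z (fun j k => v j * v k).
  by rewrite -smD2Z; congr smD2; apply/funext => j; apply/funext => k; ring.
have -> : smA y beta z (fun j => `|eps * v j| ^+ 3) = eps ^+ 3 * smA y beta z (fun j => `|v j| ^+ 3).
  rewrite /smA mulr_sumr; apply: eq_bigr => j _.
  by rewrite normrM (gtr0_norm eps0); ring.
move=> h; rewrite -(ler_pM2l eps0) -[X in X * _ <= _](gtr0_norm eps0) -normrM.
rewrite (_ : eps * (_ - _ - _) = eps * D1 (fun j => z j + eps * v j) v - eps * D1 z v -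
  eps ^+ 2 * D2 z (fun j k => v j * v k)); last by ring.
by apply: (le_trans h); rewrite le_eqVlt; apply/orP; left; apply/eqP; ring.
Qed.

(** The same two regimes as for [smD1_rem]. The matrix stays fixed, so the increment enters linearly
    and first absolute moments suffice. *)
Lemma smD2_rem z u (m : R) M (c : R) : (forall j, `|u j| <= m) ->
  (forall j k, `|M j k| <= c) ->
  `|D2 (fun j => z j + u j) M - D2 z M| <=
  K * beta ^+ 3 * (5 * expR 2 * c * (smA y beta z (fun j => `|u j|) / smS y beta z)
     * stripn 5 2 z)
   + 4 * K * beta ^+ 2 * c * (1 < beta * m)%R%:R.
Proof.
move=> um Mc.
have K0 : 0 <= K := smK_ge0 Lam1.
have /card_gt0P[i0 _] := I0.
have c0 : 0 <= c by apply: le_trans (Mc i0 i0).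
have b30 : 0 <= beta ^+ 3 by rewrite exprn_ge0// ltW.
have Kb : 0 <= K * beta ^+ 3 by exact: mulr_ge0.
have E0 : 0 <= smA y beta z (fun j => `|u j|) / smS y beta z.
  by rewrite divr_ge0 ?(ltW (smS_gt0 _ _ I0 _))// smA_ge0.
case: (leP (beta * m) 1) => bm1.
  rewrite mulr0 addr0; apply: smD2_lip => t /andP[t0 t1].
  have hu j : beta * `|t * u j| <= 1.
    apply: le_trans bm1; rewrite ler_wpM2l ?(ltW beta0)// normrM (ger0_norm t0).
    by apply: le_trans (um j); rewrite ler_piMl.
  apply: (le_trans (smD3_bound_cst _ beta0 Lam1 cardI I0 _ _ Mc)).
  have A := smA_stable y beta0 I0 z hu (fun j => normr_ge0 (u j)).
  have St := @strip_shift R I y beta Lam beta0 Lam1 z _ hu (4 * w) w.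
  have e5 : 4 * w + w = 5 * w by ring.
  have e2 : w + w = 2 * w by ring.
  rewrite e5 e2 in St.
  case: (boolP (strip _ _ _ (fun j => z j + t * u j))) => [sz|_].
    have -> : strip y (5 * w) (2 * w) z by exact: St.
    rewrite !mulr1; have -> : K * beta ^+ 3 * (5 * expR 2 * c *
      (smA y beta z (fun j => `|u j|) / smS y beta z)) = 5 * K * beta ^+ 3 * (c *
      (expR 2 * (smA y beta z (fun j => `|u j|) / smS y beta z))) by ring.
    rewrite -[X in _ * X <= _]mulrA; apply: ler_wpM2l; last exact: (ler_wpM2l c0 A).
    exact: mulr_ge0 (mulr_ge0 (ler0n _ 5) K0) b30.
  rewrite mulr0; apply: (mulr_ge0 Kb).
  exact: mulr_ge0 (mulr_ge0 (mulr_ge0 (mulr_ge0 (ler0n _ 5) (expR_ge0 2)) c0) E0) (ler0n _ _).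
have c1 := smD2_bound y beta0 Lam1 cardI I0 (fun j => z j + u j) Mc.
have c2 := smD2_bound y beta0 Lam1 cardI I0 z Mc.
have c3 : 0 <= 2 * K * beta ^+ 2 * c.
  exact: mulr_ge0 (mulr_ge0 (mulr_ge0 (ler0n _ 2) K0) (sqr_ge0 _)) c0.
apply: (@le_trans _ _ (2 * K * beta ^+ 2 * c + 2 * K * beta ^+ 2 * c)).
  rewrite (le_trans (ler_normB _ _))// lerD//.
    by apply: (le_trans c1); apply: (ler_piMr c3); exact: natb_le1.
  by apply: (le_trans c2); apply: (ler_piMr c3); exact: natb_le1.
rewrite mulr1 (_ : 4 * K * _ * _ = 2 * K * beta ^+ 2 * c + 2 * K * beta ^+ 2 * c); last by ring.
rewrite lerDr; apply: (mulr_ge0 Kb).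
exact: mulr_ge0 (mulr_ge0 (mulr_ge0 (mulr_ge0 (ler0n _ 5) (expR_ge0 2)) c0) E0) (ler0n _ _).
Qed.

End expansion.

(** * Gaussian comparison on orthants *)

Section square_integrable.
Context {R : realType} {d : measure_display} {T : measurableType d}.
Variable m : probability T R.
Implicit Types f g : T -> R.

(** Gaussian coordinates are not bounded. Second moments are enough for them, because the second
    derivative along the interpolation path is quadratic in the path. *)
Definition sq f := measurable_fun setT f /\ itg m (fun x => f x ^+ 2).

Lemma bm_sq f : bm f -> sq f.
Proof. by move=> bf; split; [exact: bf.1|exact/bm_itg/bmX]. Qed.

Lemma sqD f g : sq f -> sq g -> sq (fun x => f x + g x).
Proof.
move=> [mf sf] [mg sg]; split; first exact: measurable_funD.
apply: (@itg_dom _ _ _ _ _ (fun x => 2 * f x ^+ 2 + 2 * g x ^+ 2)).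
- by apply: measurable_funX; exact: measurable_funD.
- by move=> x; rewrite ger0_norm ?sqr_ge0//; have := sqr_ge0 (f x - g x); nra.
- by apply: itgD; exact: itgZ.
Qed.

Lemma sqZ c f : sq f -> sq (fun x => c * f x).
Proof.
move=> [mf sf]; split; first exact: measurable_funM.
rewrite (_ : (fun _ => _) = fun x => c ^+ 2 * f x ^+ 2); first exact: itgZ.
by apply/funext => x; rewrite exprMn.
Qed.

Lemma sq_abs f : sq f -> sq (fun x => `|f x|).
Proof.
move=> [mf sf]; split; first exact: measurableT_comp.
rewrite (_ : (fun _ => _) = fun x => f x ^+ 2)//.
by apply/funext => x; rewrite real_normK ?num_real.
Qed.

Lemma sq_sum (J : Type) (r : seq J) (P : pred J) (F : J -> T -> R) :
  (forall j, sq (F j)) -> sq (fun x => \sum_(j <- r | P j) F j x).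
Proof.
move=> h; elim: r => [|j r IH].
  rewrite (_ : (fun _ => _) = fun=> 0); first exact/bm_sq/bm_cst.
  by apply/funext => x; rewrite big_nil.
rewrite (_ : (fun _ => _) = fun x => (if P j then F j x else 0) +
    \sum_(j <- r | P j) F j x).
  by apply: sqD => //; case: (P j) => //; exact/bm_sq/bm_cst.
by apply/funext => x; rewrite big_cons; case: ifP => // _; rewrite add0r.
Qed.

Lemma sq_itg f : sq f -> itg m f.
Proof.
move=> [mf sf]; apply: (@itg_dom _ _ _ _ _ (fun x => 1 + f x ^+ 2)) => //.
  move=> x; rewrite -[X in 1 + X]real_normK ?num_real//.
  by have := sqr_ge0 (`|f x| - 1); have := normr_ge0 (f x); nra.
by apply: itgD => //; exact: itg_cst.
Qed.

End square_integrable.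

Lemma is_derive_continuous {R : realType} (F F1 : R -> R) :
  (forall x : R, is_derive x 1 F (F1 x)) -> continuous F.
Proof.
by move=> h x; apply: differentiable_continuous; apply/derivable1_diffP; have [] := h x.
Qed.

Lemma second_order {R : realType} (F F1 F2 : R -> R) (t t' B : R) : t <= t' ->
  (forall x : R, is_derive x 1 F (F1 x)) -> (forall x : R, is_derive x 1 F1 (F2 x)) ->
  (forall x, `|F2 x| <= B) ->
  `|F t' - F t - (t' - t) * F1 t| <= B * (t' - t) ^+ 2.
Proof.
move=> tt' d0 d1 hB.
have h1 x : t <= x <= t' -> `|F1 x - F1 t| <= B * (t' - t).
  move=> /andP[tx xt]; apply: (le_trans (mean_value_le tx (fun x _ => d1 x) (fun x _ => hB x))).
  by rewrite ler_wpM2l ?lerD2r//; apply: le_trans (hB 0).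
have h2 x : t <= x <= t' -> is_derive x 1 (fun x => F x - x * F1 t) (F1 x - F1 t).
  move=> _; have dd := d0 x.
  by apply: is_derive_eq; rewrite /GRing.scale /=; ring.
have := mean_value_le tt' h2 h1.
rewrite (_ : F t' - t' * F1 t - (F t - t * F1 t) = F t' - F t - (t' - t) * F1 t); last by ring.
by move=> /le_trans; apply; rewrite expr2 mulrA.
Qed.

(* Avoids differentiating under the expectation: first-order expansions of [u]
   with a uniform quadratic error suffice. *)
Lemma increments {R : realType} (u k : R -> R) (b K C : R) : 0 <= b -> 0 <= C ->
  (forall t t', 0 <= t -> t <= t' -> t' <= b ->
    `|u t' - u t - (t' - t) * k t| <= C * (t' - t) ^+ 2) ->
  (forall t, 0 <= t <= b -> `|k t| <= K) -> `|u b - u 0| <= K * b.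
Proof.
move=> b0 C0 H hk.
(* Telescoping over [N] equal steps leaves a total error [C b^2 / N], and [N] is arbitrary. *)
have key N : (0 < N)%N -> `|u b - u 0| <= K * b + C * b ^+ 2 / N%:R.
  move=> N0; have N0' : 0 < N%:R :> R by rewrite ltr0n.
  have step i : (i <= N)%N -> `|u (i%:R * (b / N%:R)) - u 0| <=
      i%:R * (K * (b / N%:R) + C * (b / N%:R) ^+ 2).
    elim: i => [|i IH] iN; first by rewrite !mul0r subrr normr0.
    have h0 : 0 <= b / N%:R by rewrite divr_ge0// ltW.
    have ti : 0 <= i%:R * (b / N%:R) by rewrite mulr_ge0.
    have iE : i.+1%:R * (b / N%:R) = i%:R * (b / N%:R) + b / N%:R by rewrite -natr1 mulrDl mul1r.
    have tib : i.+1%:R * (b / N%:R) <= b.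
      by rewrite mulrCA ler_piMr// ler_pdivrMr// mul1r ler_nat.
    have h1 := H _ _ ti _ tib.
    have {h1} : `|u (i.+1%:R * (b / N%:R)) - u (i%:R * (b / N%:R))| <=
       K * (b / N%:R) + C * (b / N%:R) ^+ 2.
      rewrite iE; set t := i%:R * (b / N%:R) in h1 *; rewrite iE -/t in h1.
      have tE : t + b / N%:R - t = b / N%:R by rewrite addrAC subrr add0r.
      rewrite lerDl tE in h1; have {}h1 := h1 h0.
      have h2 : `|k t| <= K.
        by apply: hk; rewrite ti (le_trans _ tib)// iE lerDl.
      rewrite -[X in `|X|](subrK (b / N%:R * k t)).
      rewrite (le_trans (ler_normD _ _))// addrC lerD//.
      by rewrite normrM (ger0_norm h0) mulrC ler_wpM2r.
    move=> h4; have h3 := IH (ltnW iN).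
    rewrite -[X in `|X|](subrKA (u (i%:R * (b / N%:R)))) (le_trans (ler_normD _ _))//.
    rewrite addrC; apply: (le_trans (lerD h3 h4)).
    by rewrite -natr1 [leRHS]mulrDl mul1r.
  have := step N (leqnn _).
  have -> : N%:R * (b / N%:R) = b by rewrite mulrC divfK// gt_eqF.
  move=> /le_trans; apply; rewrite le_eqVlt; apply/orP; left; apply/eqP.
  by field; rewrite gt_eqF.
apply/ler_addgt0Pr => e e0.
pose N := (Num.truncn (C * b ^+ 2 / e)).+1.
apply: (le_trans (key N isT)); rewrite lerD2l ler_pdivrMr ?ltr0n// [leRHS]mulrC -ler_pdivrMr//.
by apply: ltW; exact: truncnS_gt.
Qed.

Lemma sandwich {R : realType} (P G Gp Gm u1 u2 v1 v2 D k E : R) :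
  P <= u1 -> `|u1 - u2| <= D -> u2 <= Gp -> v1 <= P -> `|v1 - v2| <= D -> Gm <= v2 ->
  Gp - G <= k -> G - Gm <= k -> k + D <= E -> `|P - G| <= E.
Proof. by rewrite !ler_norml => ? /andP[? ?] ? ? /andP[? ?] ? ? ? ?; apply/andP; split; lra. Qed.

(** The budget of one improvement step: the widths contribute 5 + 9 / 4 <= 8 units of [w * k], and
    [2 r / 4] is the halved distance. *)
Lemma sandwich_budget {R : realType} (w k r o : R) : 0 <= w * k ->
  k * (5 * w) + ((2 * r + 9 * w * k) / 4 + 2 * o) <= r / 2 + (8 * w * k + 2 * o).
Proof. by move=> wk; lra. Qed.

Section interpolation.
Context {R : realType} {d : measure_display} {T : measurableType d}.
Variables (mu : probability T R) (n : nat) (I : finType).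
Variables (xi : T -> I -> R) (a : 'I_n -> I -> R).
Hypothesis bxi : forall j, bm (fun x => xi x j).
Hypothesis xi0 : forall j, Ex mu (fun x => xi x j) = 0.
Hypothesis n0 : (0 < n)%N.
Hypothesis I0 : (0 < #|I|)%N.

Local Notation gN := (pow (@N01 R) n).
Local Notation gmu := (pow mu n).
Local Notation PP := (pprod gmu gN).
Local Notation Om := (n.-tuple T * n.-tuple R)%type.
Local Notation rn := ((Num.sqrt n%:R)^-1 : R).

Definition ssum (s : n.-tuple T) j : R := rn * \sum_(i < n) xi (tnth s i) j.
Definition gsum (e : n.-tuple R) j : R := dot (fun i => rn * a i j) e.
(** The trigonometric form of the path has bounded coefficients and derivatives on the whole
    interval, whereas square roots of time would be singular at an end point. *)
Definition Zp (th : R) (se : Om) j : R := sin th * ssum se.1 j + cos th * gsum se.2 j.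
Definition dZp (th : R) (se : Om) j : R := cos th * ssum se.1 j - sin th * gsum se.2 j.

Lemma rn_gt0 : 0 < rn. Proof. by rewrite invr_gt0 sqrtr_gt0 ltr0n. Qed.

Lemma rn_sqr : rn ^+ 2 = n%:R^-1.
Proof. by rewrite exprVn sqr_sqrtr// ler0n. Qed.

Lemma bm_ssum j : bm (fun s => ssum s j).
Proof. by apply: bmM; [exact: bm_cst|apply: bm_sum => i; apply: (bm_tnth i (bxi j))]. Qed.

Lemma bm_fst (f : n.-tuple T -> R) : bm f -> bm (fun se : Om => f se.1).
Proof. by move=> bf; apply: bm_pre. Qed.

Lemma sq_coord (i : 'I_n) : sq PP (fun se : Om => tnth se.2 i).
Proof.
split.
  by apply: (measurableT_comp (measurable_tnth _)); exact: measurable_snd.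
have h1 := law_itg (law_tnth (@N01 R) i) (@N01_itg_sqr R).
exact: (law_itg (law_snd gmu gN) h1).
Qed.

Lemma measurable_gsum j : measurable_fun setT (fun e => gsum e j).
Proof. exact: measurable_dot. Qed.

Lemma sq_gsum j : sq PP (fun se : Om => gsum se.2 j).
Proof.
apply: sq_sum => i; apply: sqZ; exact: sq_coord.
Qed.

Lemma sq_ssum j : sq PP (fun se : Om => ssum se.1 j).
Proof. apply: bm_sq; exact: (bm_fst (bm_ssum j)). Qed.

Lemma measurable_Zp th j : measurable_fun setT (fun se : Om => Zp th se j).
Proof.
have [m1 _] := sq_ssum j; have [m2 _] := sq_gsum j.
by apply: measurable_funD; apply: measurable_funM.
Qed.

Lemma measurable_dZp th j : measurable_fun setT (fun se : Om => dZp th se j).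
Proof.
have [m1 _] := sq_ssum j; have [m2 _] := sq_gsum j.
by apply: measurable_funB; apply: measurable_funM.
Qed.

Let env (se : Om) : R := \sum_j (`|ssum se.1 j| + `|gsum se.2 j|).

Let sq_env : sq PP env.
Proof.
by apply: sq_sum => j; apply: sqD; apply: sq_abs; [exact: sq_ssum|exact: sq_gsum].
Qed.

Let env_ge0 se : 0 <= env se.
Proof. by apply: sumr_ge0 => j _; rewrite addr_ge0. Qed.

Let env_le se j : `|ssum se.1 j| + `|gsum se.2 j| <= env se.
Proof.
by rewrite /env (bigD1 j)//= lerDl sumr_ge0// => k _; rewrite addr_ge0.
Qed.

Let sc1 (x : R) : `|sin x| <= 1 /\ `|cos x| <= 1.
Proof. by rewrite !ler_norml sin_geN1 sin_le1 cos_geN1 cos_le1. Qed.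

Let Zp_env th se j : `|Zp th se j| <= env se.
Proof.
have [s1 c1] := sc1 th; apply: le_trans (env_le se j).
rewrite (le_trans (ler_normD _ _))// lerD// normrM ler_piMl//.
Qed.

Let dZp_env th se j : `|dZp th se j| <= env se.
Proof.
have [s1 c1] := sc1 th; apply: le_trans (env_le se j).
rewrite (le_trans (ler_normB _ _))// lerD// normrM ler_piMl//.
Qed.

Section smoothed.
Variables (y : I -> R) (beta Lam : R).
Hypothesis beta0 : 0 < beta.
Hypothesis Lam1 : 1 <= Lam.
Hypothesis cardI : #|I|%:R <= expR Lam.

Local Notation D1 := (smD1 y beta Lam).
Local Notation D2 := (smD2 y beta Lam).
Local Notation K := (smK Lam).
Local Notation w := (smw beta Lam).

Definition uf th : R := Ex PP (fun se => smf y beta Lam (Zp th se)).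
Definition kf th : R := Ex PP (fun se => D1 (Zp th se) (dZp th se)).

Let K0 : 0 <= K := smK_ge0 Lam1.

Lemma bm_smf {d'} {T' : measurableType d'} (z : T' -> I -> R) :
  (forall j, measurable_fun setT (fun t => z t j)) -> bm (fun t => smf y beta Lam (z t)).
Proof.
move=> mz; split; first exact: measurable_smf.
by exists 1 => x; have /andP[? ?] := smf_itv y beta Lam (z x); rewrite ger0_norm.
Qed.

Lemma itg_D1 th (v : Om -> I -> R) (g : Om -> R) :
  (forall j, measurable_fun setT (fun se => v se j)) ->
  (forall se j, `|v se j| <= g se) -> itg PP g ->
  itg PP (fun se => D1 (Zp th se) (v se)).
Proof.
move=> mv vg ig; apply: (@itg_dom _ _ _ _ _ (fun se => (K * beta) * g se)).
- by apply: measurable_smD1 => // j; exact: measurable_Zp.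
- move=> se; apply: (le_trans (smD1_bound y beta0 Lam1 cardI I0 _ (vg se))).
  rewrite ler_piMr ?natb_le1//.
  have /card_gt0P[j _] := I0.
  have g0 : 0 <= g se := le_trans (normr_ge0 _) (vg se j).
  exact: mulr_ge0 (mulr_ge0 K0 (ltW beta0)) g0.
- exact: itgZ.
Qed.

(** Dominates the second derivative in the angle. As the second derivative of [Zp] is [- Zp], only
    [smD2] at the velocity and [smD1] at [- Zp] occur. *)
Let Q (se : Om) : R := 2 * K * beta ^+ 2 * (env se ^+ 2) + K * beta * env se.

Let itg_Q : itg PP Q.
Proof.
apply: itgD; apply: itgZ; last exact: sq_itg.
by have [] := sq_env.
Qed.

Lemma uf_increment t t' : t <= t' ->
  `|uf t' - uf t - (t' - t) * kf t| <= Ex PP Q * (t' - t) ^+ 2.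
Proof.
move=> tt'.
have bf th : bm (fun se => smf y beta Lam (Zp th se)).
  by apply: bm_smf => j; exact: measurable_Zp.
have ik : itg PP (fun se => D1 (Zp t se) (dZp t se)).
  apply: (@itg_D1 t _ env); [by move=> j; exact: measurable_dZp|by move=> *; exact: dZp_env|exact: sq_itg].
rewrite /uf /kf -ExB; [|exact/bm_itg..].
rewrite -ExZ// -ExB; [|by apply: itgB; exact/bm_itg|exact: itgZ].
rewrite mulrC -ExZ//.
have i1 : itg PP (fun se => smf y beta Lam (Zp t' se) - smf y beta Lam (Zp t se) -
    (t' - t) * D1 (Zp t se) (dZp t se)).
  by apply: itgB; [apply: itgB; exact/bm_itg|exact: itgZ].
apply: (le_trans (Ex_abs i1)); apply: Ex_le; [exact: itg_abs|exact: itgZ|move=> se].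
rewrite [leRHS]mulrC.
have dZ (x : R) j : is_derive x 1 (fun x => Zp x se j) (dZp x se j).
  by apply: is_derive_eq; rewrite /dZp /GRing.scale /=; ring.
have ddZ (x : R) j : is_derive x 1 (fun x => dZp x se j) (- Zp x se j).
  by apply: is_derive_eq; rewrite /Zp /GRing.scale /=; ring.
apply: (@second_order R (fun x => smf y beta Lam (Zp x se)) (fun x => D1 (Zp x se) (dZp x se))
  (fun x => D2 (Zp x se) (fun j k => dZp x se j * dZp x se k) + D1 (Zp x se) (fun j => - Zp x se j))
  t t' (Q se) tt').
- by move=> x; apply: is_derive_smf.
- by move=> x; apply: is_derive_smD1.
- move=> x; rewrite (le_trans (ler_normD _ _))// lerD//.
    have h j k : `|dZp x se j * dZp x se k| <= env se ^+ 2 by rewrite expr2; exact: ler_normM.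
    apply: (le_trans (smD2_bound y beta0 Lam1 cardI I0 _ h)).
    apply: ler_piMr; last exact: natb_le1.
    exact: mulr_ge0 (mulr_ge0 (mulr_ge0 (ler0n _ 2) K0) (sqr_ge0 _)) (sqr_ge0 _).
  have h j : `|- Zp x se j| <= env se by rewrite normrN.
  apply: (le_trans (smD1_bound y beta0 Lam1 cardI I0 _ h)).
  apply: ler_piMr; last exact: natb_le1.
  exact: mulr_ge0 (mulr_ge0 K0 (ltW beta0)) (env_ge0 se).
Qed.

Lemma uf_bound (b k : R) : 0 <= b -> (forall t, 0 <= t <= b -> `|kf t| <= k) ->
  `|uf b - uf 0| <= k * b.
Proof.
move=> b0 hk; apply: (@increments _ uf kf b k (Ex PP Q)) => //.
  apply: Ex_ge0 => se; apply: addr_ge0.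
    exact: mulr_ge0 (mulr_ge0 (mulr_ge0 (ler0n _ 2) K0) (sqr_ge0 _)) (sqr_ge0 _).
  exact: mulr_ge0 (mulr_ge0 K0 (ltW beta0)) (env_ge0 se).
by move=> t t' _ tt' _; exact: uf_increment.
Qed.

Variables (m : T -> R) (Gam : I -> I -> R) (M3 G2 M1 pi3 tau3 : R).
Hypothesis bmm : bm m.
Hypothesis xim : forall x j, `|xi x j| <= m x.
Hypothesis GamE : forall j k, Gam j k = Ex mu (fun x => xi x j * xi x k).
Hypothesis xiM3 : forall j, Ex mu (fun x => `|xi x j| ^+ 3) <= M3.
Hypothesis GamG2 : forall j k, `|Gam j k| <= G2.
Hypothesis xiM1 : forall j, Ex mu (fun x => `|xi x j|) <= M1.

Lemma Zp_upds th se i x j : Zp th (upd se.1 i x, se.2) j =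
  Zp th se j - sin th * rn * xi (tnth se.1 i) j + sin th * rn * xi x j.
Proof.
rewrite /Zp /ssum /= (bigD1 i)//= [in RHS](bigD1 i)//= tnth_upd eqxx.
rewrite (eq_bigr (fun k => xi (tnth se.1 k) j)); last first.
  by move=> k ki; rewrite tnth_upd (negbTE ki).
by ring.
Qed.

Lemma Zp_upde th s e i x j : Zp th (s, upd e i x) j =
  Zp th (s, upd e i 0) j + x * (cos th * rn * a i j).
Proof.
rewrite /Zp /gsum /dot /= (bigD1 i)//= [in RHS](bigD1 i)//= !tnth_upd eqxx.
rewrite (eq_bigr (fun k => rn * a k j * tnth e k)); last first.
  by move=> k ki; rewrite tnth_upd (negbTE ki).
rewrite [in RHS](eq_bigr (fun k => rn * a k j * tnth e k)); last first.
  by move=> k ki; rewrite tnth_upd (negbTE ki).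
by ring.
Qed.

Lemma bm_smD1 {d'} {T' : measurableType d'} (z v : T' -> I -> R) (g : T' -> R) :
  (forall j, measurable_fun setT (fun t => z t j)) ->
  (forall j, measurable_fun setT (fun t => v t j)) ->
  (forall t j, `|v t j| <= g t) -> bm g ->
  bm (fun t => D1 (z t) (v t)).
Proof.
move=> mz mv vg bg; apply: (@bm_dom _ _ _ _ (fun t => K * beta * g t)).
- exact: measurable_smD1.
- by apply: bmM => //; exact: bm_cst.
- move=> t; apply: (le_trans (smD1_bound y beta0 Lam1 cardI I0 _ (vg t))).
  have /card_gt0P[j _] := I0.
  apply: ler_piMr; last exact: natb_le1.
  exact: mulr_ge0 (mulr_ge0 K0 (ltW beta0)) (le_trans (normr_ge0 _) (vg t j)).
Qed.

Lemma bm_smD2 {d'} {T' : measurableType d'} (z : T' -> I -> R) (M : T' -> I -> I -> R)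
    (g : T' -> R) :
  (forall j, measurable_fun setT (fun t => z t j)) ->
  (forall j k, measurable_fun setT (fun t => M t j k)) ->
  (forall t j k, `|M t j k| <= g t) -> bm g ->
  bm (fun t => D2 (z t) (M t)).
Proof.
move=> mz mv vg bg; apply: (@bm_dom _ _ _ _ (fun t => 2 * K * beta ^+ 2 * g t)).
- exact: measurable_smD2.
- by apply: bmM => //; exact: bm_cst.
- move=> t; apply: (le_trans (smD2_bound y beta0 Lam1 cardI I0 _ (vg t))).
  have /card_gt0P[j _] := I0.
  apply: ler_piMr; last exact: natb_le1.
  have g0 := le_trans (normr_ge0 _) (vg t j j).
  exact: mulr_ge0 (mulr_ge0 (mulr_ge0 (ler0n _ 2) K0) (sqr_ge0 _)) g0.
Qed.

(** Gaussian integration by parts in the single weight [e_i], the others and the sample being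
    frozen. The path moves along [e_i] with velocity [cos th * rn * a i], whence the prefactor. *)
Lemma stein_coord th (i : 'I_n) :
  Ex PP (fun se => tnth se.2 i * D1 (Zp th se) (a i)) =
  cos th * rn * Ex PP (fun se => D2 (Zp th se) (fun j k => a i j * a i k)).
Proof.
have /card_gt0P[j0 _] := I0.
pose A := \sum_j `|a i j|.
have aA j : `|a i j| <= A by rewrite /A (bigD1 j)//= lerDl sumr_ge0.
have aA2 j k : `|a i j * a i k| <= A ^+ 2 by rewrite expr2; exact: ler_normM.
have A0 : 0 <= A := le_trans (normr_ge0 _) (aA j0).
have mZs s j : measurable_fun setT (fun e => Zp th (s, e) j).
  exact: measurableT_comp (measurable_Zp th j) (pair1_measurable _).
have b1 : bm (fun se => D1 (Zp th se) (a i)).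
  by apply: (@bm_smD1 _ _ _ (fun=> a i) (fun=> A)) => // *; [exact: measurable_Zp|exact: bm_cst].
have b2 : bm (fun se => D2 (Zp th se) (fun j k => a i j * a i k)).
  by apply: (@bm_smD2 _ _ _ (fun _ j k => a i j * a i k) (fun=> A ^+ 2)) => // *;
    [exact: measurable_Zp|exact: bm_cst].
have i1 : itg PP (fun se => tnth se.2 i * D1 (Zp th se) (a i)).
  by apply: itg_bmM => //; exact/sq_itg/sq_coord.
have i1s s : itg gN (fun e => tnth e i * D1 (Zp th (s, e)) (a i)).
  apply: itg_bmM; last exact: (bm_sec1 s b1).
  exact: (law_itg (law_tnth (@N01 R) i) (@N01_itg_id R)).
rewrite Ex_pprod// [in RHS]Ex_pprod; [|exact: bm_itg|by move=> s; exact/bm_itg/(bm_sec1 s b2)].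
rewrite -ExZ; last by apply: bm_itg; exact: (bm_Ex gmu gN b2).
apply: Ex_ext => s.
have b2s := bm_sec1 s b2.
have b1s := bm_sec1 s b1.
have ZE e x : Zp th (s, upd e i x) =
    (fun j => Zp th (s, upd e i 0) j + x * (cos th * rn * a i j)).
  by apply/funext => j; exact: Zp_upde.
have dF e (x : R) : is_derive x 1 (fun x => D1 (Zp th (s, upd e i x)) (a i))
    (cos th * rn * D2 (Zp th (s, upd e i x)) (fun j k => a i j * a i k)).
  under eq_fun do rewrite ZE.
  have := @is_derive_smD1 R I y beta Lam I0 x
    (fun t j => Zp th (s, upd e i 0) j + t * (cos th * rn * a i j)) _
    (is_derive_line _ _ x) (fun=> a i) (fun=> 0) (fun j => is_derive_cst (a i j) x 1).
  rewrite -ZE {2}/smD1 smA_cst mul0r !mulr0 addr0 -smD2Z.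
  by congr (is_derive _ _ _ (smD2 _ _ _ _ _)); apply/funext => j; apply/funext => k; ring.
have cG e : continuous (fun x : R => cos th * rn *
    D2 (Zp th (s, upd e i x)) (fun j k => a i j * a i k)).
  have dG : forall x : R, is_derive x 1
      (fun x => D2 (Zp th (s, upd e i x)) (fun j k => a i j * a i k))
      (smD3 y beta Lam (Zp th (s, upd e i x)) (fun j k => a i j * a i k)
        (fun j => cos th * rn * a i j)).
    move=> x; under eq_fun do rewrite ZE.
    have := @is_derive_smD2 R I y beta Lam I0 x
      (fun t j => Zp th (s, upd e i 0) j + t * (cos th * rn * a i j)) _
      (is_derive_line _ _ x) (fun j k => a i j * a i k).
    by rewrite -ZE.
  have cD := is_derive_continuous dG.
  by move=> x; apply: cvgM; [exact: cvg_cst|exact: cD].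
have [M1' hM1] := b1s.2; have [M2' hM2] := b2s.2.
rewrite (@Ex_upd_itg R _ _ (@N01 R) n i _ (i1s s)); last first.
  move=> e; rewrite (_ : (fun _ => _) = fun x => x * D1 (Zp th (s, upd e i x)) (a i)).
    by apply: itg_bmM; [exact: N01_itg_id|exact: (bm_updx i e b1s)].
  by apply/funext => x; rewrite tnth_upd eqxx.
rewrite (Ex_upd (@N01 R) i b2s) -ExZ; last by apply: bm_itg; exact: (bm_Ex2 (@N01 R) gN (bm_upd i b2s)).
apply: Ex_ext => e.
rewrite -ExZ; last by apply: bm_itg; exact: (bm_updx i e b2s).
rewrite -(@stein_N01 R _ _ (Num.max M1' (`|cos th * rn| * M2')) (dF e) (cG e)).
- by apply: Ex_ext => x; rewrite tnth_upd eqxx.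
- by move=> x; rewrite le_max hM1.
- by move=> x; rewrite le_max normrM ler_wpM2l ?orbT.
Qed.

Lemma Ex_smA z (v : T -> I -> R) : (forall j, itg mu (fun x => v x j)) ->
  Ex mu (fun x => smA y beta z (v x)) = smA y beta z (fun j => Ex mu (fun x => v x j)).
Proof.
move=> iv; rewrite /smA Ex_sum; last by move=> j; exact: itgZ.
by apply: eq_bigr => j _; rewrite ExZ.
Qed.

Lemma itg_smA z (v : T -> I -> R) : (forall j, itg mu (fun x => v x j)) ->
  itg mu (fun x => smA y beta z (v x)).
Proof. by move=> iv; apply: itg_sum => j; exact: itgZ. Qed.

Lemma Ex_smD1 z : Ex mu (fun x => D1 z (xi x)) = 0.
Proof.
have i1 : itg mu (fun x => smA y beta z (xi x)).
  by apply: itg_smA => j; exact/bm_itg.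
rewrite /smD1 ExZ; last exact: itgZ.
rewrite ExZ// Ex_smA; last by move=> j; exact/bm_itg.
rewrite /smA big1 ?mulr0// => j _; by rewrite xi0 mulr0.
Qed.

Lemma Ex_smD2 z : Ex mu (fun x => D2 z (fun j k => xi x j * xi x k)) = D2 z Gam.
Proof.
have i2 j k : itg mu (fun x => xi x j * xi x k) by apply/bm_itg/bmM.
have i3 j k (c : R) : itg mu (fun x => xi x j * xi x k * c).
  by apply: itg_bmM; [exact: i2|exact: bm_cst].
have i4 : itg mu (fun x => smQ y beta z (fun j k => xi x j * xi x k)).
  by apply: itg_sum => j; apply: itg_sum => k; exact: i3.
have i5 : itg mu (fun x => smT y beta z (fun j k => xi x j * xi x k)).
  by apply: itg_sum => j; exact: i3.
have E3 j k (c : R) : Ex mu (fun x => xi x j * xi x k * c) = Gam j k * c.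
  rewrite GamE mulrC -ExZ; last exact: i2.
  by apply: Ex_ext => x; rewrite mulrC.
rewrite /smD2 ExZ; last by apply: itgD; exact: itgZ.
rewrite ExD; [|exact: itgZ|exact: itgZ].
rewrite ExZ// ExZ//; congr (_ * (_ * _ + _ * _)).
  rewrite /smQ Ex_sum; last by move=> j; apply: itg_sum => k; exact: i3.
  apply: eq_bigr => j _; rewrite Ex_sum; last by move=> k; exact: i3.
  by apply: eq_bigr => k _; exact: E3.
rewrite /smT Ex_sum; last by move=> j; exact: i3.
by apply: eq_bigr => j _; exact: E3.
Qed.

Variable p : R.
Hypothesis mpi3 : Pr mu (fun x => 1 < beta * (rn * m x)) <= pi3.
Hypothesis mtau3 : Ex mu (fun x => m x ^+ 3 * (1 < beta * (rn * m x))%R%:R) <= tau3.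

Let MM := M3 + G2 * M1.

(** Here [z] plays the path without its [i]-th observation, so that [xi x] is independent of it. The
    first-order term vanishes by centring and the second-order terms cancel because [Gam] is the
    covariance of [xi]; what survives are the Taylor remainders [rem1] and [rem2]. *)
Lemma remainder_pointwise z (eps : R) : 0 <= eps <= rn ->
  `|Ex mu (fun x => D1 (fun j => z j + eps * xi x j) (xi x) -
      eps * D2 (fun j => z j + eps * xi x j) Gam)| <=
  eps ^+ 2 * (K * beta ^+ 3 * (5 * expR 2 * MM * (strip y (5 * w) (2 * w) z)%:R + 4 * tau3)) +
  eps * (4 * K * beta ^+ 2 * G2 * pi3).
Proof.
move=> /andP[e0 en].
have /card_gt0P[j0 _] := I0.
have G20 : 0 <= G2 := le_trans (normr_ge0 _) (GamG2 j0 j0).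
have mxi j : measurable_fun setT (fun x => xi x j) by have [] := bxi j.
have mzx j : measurable_fun setT (fun x => z j + eps * xi x j).
  by apply: measurable_funD => //; apply: measurable_funM.
have m0 x : 0 <= m x := le_trans (normr_ge0 _) (xim x j0).
have mm : mb (fun x => 1 < beta * (rn * m x)).
  by apply: mb_lt => //; apply: measurable_funM => //; apply: measurable_funM => //; have [] := bmm.
have b1 : bm (fun x => D1 (fun j => z j + eps * xi x j) (xi x)) by exact: (bm_smD1 mzx mxi xim).
have b2 : bm (fun x => D2 (fun j => z j + eps * xi x j) Gam).
  by apply: (bm_smD2 mzx _ (fun _ => GamG2)) => //; exact: bm_cst.
have b3 : bm (fun x => D1 z (xi x)).
  by apply: (@bm_smD1 _ _ (fun=> z) _ m) => //.
have b4 : bm (fun x => D2 z (fun j k => xi x j * xi x k)).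
  apply: (@bm_smD2 _ _ (fun=> z) _ (fun x => m x ^+ 2)) => //.
  - by move=> j k; apply: measurable_funM.
  - by move=> x j k; rewrite expr2; exact: ler_normM.
  - exact: bmX.
pose rem1 x := D1 (fun j => z j + eps * xi x j) (xi x) - D1 z (xi x) -
  eps * D2 z (fun j k => xi x j * xi x k).
pose rem2 x := D2 (fun j => z j + eps * xi x j) Gam - D2 z Gam.
have br1 : bm rem1 by apply: bmB; [apply: bmB|apply: bmM => //; exact: bm_cst].
have br2 : bm rem2 by apply: bmB => //; exact: bm_cst.
have be2 : bm (fun x => eps * D2 (fun j => z j + eps * xi x j) Gam).
  by apply: bmM => //; exact: bm_cst.
have be4 : bm (fun x => eps * D2 z (fun j k => xi x j * xi x k)).
  by apply: bmM => //; exact: bm_cst.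
have -> : Ex mu (fun x => D1 (fun j => z j + eps * xi x j) (xi x) -
      eps * D2 (fun j => z j + eps * xi x j) Gam) = Ex mu rem1 - eps * Ex mu rem2.
  rewrite /rem1 /rem2 ExB; [|exact: bm_itg..].
  rewrite ExZ; last exact: bm_itg.
  rewrite [in RHS]ExB; [|by apply: bm_itg; exact: bmB|exact: bm_itg].
  rewrite [in RHS]ExB; [|exact: bm_itg..].
  rewrite [in RHS]ExZ; last exact: bm_itg.
  rewrite [in RHS]ExB; [|exact: bm_itg|exact: itg_cst].
  by rewrite Ex_smD1 Ex_smD2 Ex_cst; ring.
have S0 := smS_gt0 y beta I0 z.
pose c1 := 5 * expR 2 * (strip y (5 * w) (2 * w) z)%:R / smS y beta z.
have c10 : 0 <= c1.
  exact: divr_ge0 (mulr_ge0 (mulr_ge0 (ler0n _ 5) (expR_ge0 2)) (ler0n _ _)) (ltW S0).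
have b30 : 0 <= beta ^+ 3 by rewrite exprn_ge0// ltW.
have Kb3 : 0 <= K * beta ^+ 3 := mulr_ge0 K0 b30.
have Kb2 : 0 <= 4 * K * beta ^+ 2 * G2.
  exact: mulr_ge0 (mulr_ge0 (mulr_ge0 (ler0n _ 4) K0) (sqr_ge0 _)) G20.
have indle x : ((1 < beta * (eps * m x))%R%:R : R) <= (1 < beta * (rn * m x))%R%:R.
  rewrite ler_nat; case: (boolP (1 < beta * (eps * m x))) => // h.
  rewrite (lt_le_trans h)//; apply: ler_wpM2l; first exact: ltW.
  exact: ler_wpM2r.
pose B1 x := eps ^+ 2 * (K * beta ^+ 3 * (c1 * smA y beta z (fun j => `|xi x j| ^+ 3) +
  4 * (m x ^+ 3 * (1 < beta * (rn * m x))%R%:R))).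
pose B2 x := K * beta ^+ 3 * (eps * G2 * c1 * smA y beta z (fun j => `|xi x j|)) +
  4 * K * beta ^+ 2 * G2 * (1 < beta * (rn * m x))%R%:R.
have h1 x : `|rem1 x| <= B1 x.
  apply: (le_trans (smD1_rem_eps y beta0 Lam1 cardI I0 z e0 (xim x))).
  apply: ler_wpM2l; first exact: sqr_ge0.
  apply: (ler_wpM2l Kb3); apply: lerD.
    by rewrite le_eqVlt; apply/orP; left; apply/eqP; rewrite /c1; field; rewrite gt_eqF.
  rewrite -mulrA; apply: ler_wpM2l => //; apply: ler_wpM2l; last exact: indle.
  exact: exprn_ge0.
have h2 x : `|rem2 x| <= B2 x.
  have um j : `|eps * xi x j| <= eps * m x.
    by rewrite normrM (ger0_norm e0); exact: ler_wpM2l.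
  apply: (le_trans (smD2_rem y beta0 Lam1 cardI I0 z um GamG2)).
  apply: lerD; last exact: ler_wpM2l.
  rewrite le_eqVlt; apply/orP; left; apply/eqP.
  have -> : smA y beta z (fun j => `|eps * xi x j|) = eps * smA y beta z (fun j => `|xi x j|).
    rewrite /smA mulr_sumr; apply: eq_bigr => j _.
    by rewrite normrM (ger0_norm e0); ring.
  by rewrite /c1; field; rewrite gt_eqF.
have ix3 j : itg mu (fun x => `|xi x j| ^+ 3) by apply/bm_itg/bmX/bm_abs.
have ix1 j : itg mu (fun x => `|xi x j|) by apply/bm_itg/bm_abs.
have iA3 := itg_smA z ix3; have iA1 := itg_smA z ix1.
have im3 : itg mu (fun x => m x ^+ 3 * (1 < beta * (rn * m x))%R%:R).
  by apply/bm_itg/bmM; [exact: bmX|exact: mb_bm].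
have imm : itg mu (fun x => (1 < beta * (rn * m x))%R%:R : R) by exact/bm_itg/mb_bm.
have iB1' : itg mu (fun x => c1 * smA y beta z (fun j => `|xi x j| ^+ 3) +
  4 * (m x ^+ 3 * (1 < beta * (rn * m x))%R%:R)) by apply: itgD; exact: itgZ.
have iB1 : itg mu B1 by apply: itgZ; exact: itgZ.
have iB2 : itg mu B2 by apply: itgD; apply: itgZ => //; exact: itgZ.
have E1 : Ex mu B1 <= eps ^+ 2 * (K * beta ^+ 3 *
    (5 * expR 2 * M3 * (strip y (5 * w) (2 * w) z)%:R + 4 * tau3)).
  rewrite /B1 ExZ; last exact: itgZ.
  rewrite ExZ// ExD; [|exact: itgZ..].
  rewrite !ExZ// Ex_smA//.
  apply: ler_wpM2l; first exact: sqr_ge0.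
  apply: (ler_wpM2l Kb3); apply: lerD; last exact: ler_wpM2l.
  have : smA y beta z (fun j => Ex mu (fun x => `|xi x j| ^+ 3)) <= M3 * smS y beta z.
    by rewrite -smA_cst; exact: smA_le.
  move=> /(ler_wpM2l c10)/le_trans; apply.
  by rewrite le_eqVlt; apply/orP; left; apply/eqP; rewrite /c1; field; rewrite gt_eqF.
have E2 : Ex mu B2 <= K * beta ^+ 3 * (eps * G2 * (5 * expR 2 * M1 *
    (strip y (5 * w) (2 * w) z)%:R)) + 4 * K * beta ^+ 2 * G2 * pi3.
  rewrite /B2 ExD; [|by apply: itgZ; exact: itgZ|exact: itgZ].
  rewrite ExZ; last exact: itgZ.
  rewrite !ExZ// Ex_smA//; apply: lerD; last exact: ler_wpM2l.
  apply: (ler_wpM2l Kb3).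
  have : smA y beta z (fun j => Ex mu (fun x => `|xi x j|)) <= M1 * smS y beta z.
    by rewrite -smA_cst; exact: smA_le.
  move=> /(ler_wpM2l (mulr_ge0 (mulr_ge0 e0 G20) c10))/le_trans; apply.
  by rewrite le_eqVlt; apply/orP; left; apply/eqP; rewrite /c1; field; rewrite gt_eqF.
apply: (le_trans (ler_normB _ _)).
have R1 : `|Ex mu rem1| <= Ex mu B1.
  apply: (le_trans (Ex_abs (bm_itg mu br1))); apply: Ex_le => //.
  exact/itg_abs/bm_itg.
have R2 : `|Ex mu rem2| <= Ex mu B2.
  apply: (le_trans (Ex_abs (bm_itg mu br2))); apply: Ex_le => //.
  exact/itg_abs/bm_itg.
rewrite normrM (ger0_norm e0).
apply: (le_trans (lerD (le_trans R1 E1) (ler_wpM2l e0 (le_trans R2 E2)))).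
by rewrite le_eqVlt; apply/orP; left; apply/eqP; rewrite /MM; ring.
Qed.

(** Puts the removed observation back: the strip event for the reduced path implies the one for the
    full path with both margins wider by [w], unless the observation is large, which costs [pi3]. *)
Lemma strip_pointwise z (eps : R) : 0 <= eps <= rn ->
  (strip y (5 * w) (2 * w) z)%:R <=
  Ex mu (fun x => (strip y (6 * w) (3 * w) (fun j => z j + eps * xi x j))%:R) + pi3.
Proof.
move=> /andP[e0 en].
have mz j : measurable_fun setT (fun x => z j + eps * xi x j).
  by apply: measurable_funD => //; apply: measurable_funM => //; have [] := bxi j.
have mst := mb_strip y mz (6 * w) (3 * w).
have mm : mb (fun x => 1 < beta * (rn * m x)).
  by apply: mb_lt => //; apply: measurable_funM => //; apply: measurable_funM => //; have [] := bmm.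
apply: le_trans (lerD (lexx _) mpi3); rewrite -ExD; [|exact/bm_itg/mb_bm..].
rewrite -[leLHS](Ex_cst mu); apply: Ex_le; first exact: itg_cst.
  by apply: itgD; exact/bm_itg/mb_bm.
move=> x; case: (ltP 1) => [_|bm1].
  by rewrite (le_trans (natb_le1 _))// lerDr ler0n.
rewrite addr0 ler_nat; case: (boolP (strip _ _ _ z)) => // sz.
have hu j : beta * `|- (eps * xi x j)| <= 1.
  apply: le_trans bm1; apply: ler_wpM2l; first exact: ltW.
  rewrite normrN normrM (ger0_norm e0); apply: ler_pM => //; exact: xim.
have := @strip_shift R I y beta Lam beta0 Lam1 (fun j => z j + eps * xi x j) _ hu (5 * w) (2 * w).
have -> : (fun j => z j + eps * xi x j - eps * xi x j) = z.
  by apply/funext => j; rewrite addrK.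
have -> : 5 * w + w = 6 * w by ring.
have -> : 2 * w + w = 3 * w by ring.
by move=> /(_ sz) ->.
Qed.

Lemma bm_PP_upd (i : 'I_n) (F : Om -> R) : bm F ->
  bm (fun q : T * Om => F (upd q.2.1 i q.1, q.2.2)).
Proof.
move=> bF; apply: (bm_pre _ bF); apply: measurable_fun_pair; last first.
  by apply: measurableT_comp => //; exact: measurable_snd.
apply: (measurableT_comp (f := fun xs : T * n.-tuple T => upd xs.2 i xs.1)
  (g := fun q : T * Om => (q.1, q.2.1)) (measurable_upd i)).
apply: measurable_fun_pair => //.
by apply: measurableT_comp => //; exact: measurable_fst.
Qed.

Lemma Ex_PP_upd (i : 'I_n) (F : Om -> R) : bm F ->
  Ex PP F = Ex PP (fun se => Ex mu (fun x => F (upd se.1 i x, se.2))).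
Proof.
move=> bF; have bU := bm_Ex2 mu PP (bm_PP_upd i bF).
rewrite Ex_pprod2; [|exact: bm_itg|by move=> e; exact/bm_itg/(bm_sec2 e bF)].
rewrite [in RHS]Ex_pprod2; [|exact: bm_itg|by move=> e; exact/bm_itg/(bm_sec2 e bU)].
by apply: Ex_ext => e; rewrite (Ex_upd mu i (bm_sec2 e bF)).
Qed.

(** The [i]-th observation is resampled, so the leave-one-out expansion applies under the
    expectation, and the strip probability of the reduced path becomes that of the full path plus
    [pi3]. *)
Lemma remainder_bound th i : 0 <= sin th ->
  Pr PP (fun se => strip y (6 * w) (3 * w) (Zp th se)) <= p ->
  `|Ex PP (fun se => D1 (Zp th se) (xi (tnth se.1 i))) -
    sin th * rn * Ex PP (fun se => D2 (Zp th se) Gam)| <=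
  rn ^+ 2 * (K * beta ^+ 3 * (5 * expR 2 * MM * (p + pi3) + 4 * tau3)) +
  rn * (4 * K * beta ^+ 2 * G2 * pi3).
Proof.
move=> s0 hp.
have /card_gt0P[j0 _] := I0.
have rn0 := ltW rn_gt0.
have [s1 _] := sc1 th; rewrite (ger0_norm s0) in s1.
have en : 0 <= sin th * rn <= rn by rewrite mulr_ge0//= ler_piMl.
have mZ j := measurable_Zp th j.
have m0 x : 0 <= m x := le_trans (normr_ge0 _) (xim x j0).
have mxi j : measurable_fun setT (fun se : Om => xi (tnth se.1 i) j).
  by have [] := bm_fst (bm_tnth i (bxi j)).
have b1 : bm (fun se => D1 (Zp th se) (xi (tnth se.1 i))).
  apply: (@bm_smD1 _ _ _ (fun se => xi (tnth se.1 i)) (fun se => m (tnth se.1 i))) => //.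
  exact: (bm_fst (bm_tnth i bmm)).
have b2 : bm (fun se => D2 (Zp th se) Gam).
  by apply: (@bm_smD2 _ _ _ (fun=> Gam) (fun=> G2)) => //; exact: bm_cst.
have b3 : bm (fun se => sin th * rn * D2 (Zp th se) Gam) by apply: bmM => //; exact: bm_cst.
have b4 := bmB b1 b3.
rewrite -ExZ; last exact: bm_itg.
rewrite -ExB; [|exact: bm_itg..].
pose z (se : Om) j := Zp th se j - sin th * rn * xi (tnth se.1 i) j.
have Zz se x : Zp th (upd se.1 i x, se.2) = (fun j => z se j + sin th * rn * xi x j).
  by apply/funext => j; rewrite Zp_upds.
have mz j : measurable_fun setT (fun se => z se j).
  by apply: measurable_funB => //; apply: measurable_funM.
have mst := mb_strip y mZ (6 * w) (3 * w).
have mst5 := mb_strip y mz (5 * w) (2 * w).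
have bU := bm_Ex2 mu PP (bm_PP_upd i b4).
have bV := bm_Ex2 mu PP (bm_PP_upd i (mb_bm mst)).
have hp5 : Ex PP (fun se => (strip y (5 * w) (2 * w) (z se))%:R) <= p + pi3.
  apply: (@le_trans _ _ (Ex PP (fun se => Ex mu (fun x => ((strip y (6 * w) (3 * w)
      (Zp th (upd se.1 i x, se.2)))%:R : R)) + pi3))).
    apply: Ex_le; [exact/bm_itg/mb_bm|by apply: itgD; [exact: bm_itg|exact: itg_cst]|move=> se].
    apply: (le_trans (strip_pointwise (z se) en)); rewrite lerD2r le_eqVlt.
    by apply/orP; left; apply/eqP; apply: Ex_ext => x; rewrite Zz.
  rewrite ExD; [|exact: bm_itg|exact: itg_cst].
  by rewrite Ex_cst lerD2r -(Ex_PP_upd i (mb_bm mst)).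
rewrite (Ex_PP_upd i b4).
apply: (le_trans (Ex_abs (bm_itg PP bU))).
have Kb3 : 0 <= K * beta ^+ 3 by apply: (mulr_ge0 K0); rewrite exprn_ge0// ltW.
have G20 : 0 <= G2 := le_trans (normr_ge0 _) (GamG2 j0 j0).
have M30 : 0 <= M3 by apply: le_trans (xiM3 j0); apply: Ex_ge0 => x; exact: exprn_ge0.
have M10 : 0 <= M1 by apply: le_trans (xiM1 j0); apply: Ex_ge0.
have MM0 : 0 <= MM := addr_ge0 M30 (mulr_ge0 G20 M10).
have pi30 : 0 <= pi3 := le_trans (Pr_ge0 _ _) mpi3.
have tau30 : 0 <= tau3.
  by apply: le_trans mtau3; apply: Ex_ge0 => x; apply: mulr_ge0 => //; exact: exprn_ge0.
have e5 : 0 <= 5 * expR 2 * MM := mulr_ge0 (mulr_ge0 (ler0n _ 5) (expR_ge0 2)) MM0.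
pose C1 := (sin th * rn) ^+ 2 * (K * beta ^+ 3 * (5 * expR 2 * MM)).
pose C2 := (sin th * rn) ^+ 2 * (K * beta ^+ 3 * (4 * tau3)) +
  sin th * rn * (4 * K * beta ^+ 2 * G2 * pi3).
apply: (@le_trans _ _ (Ex PP (fun se => C1 * (strip y (5 * w) (2 * w) (z se))%:R + C2))).
  apply: Ex_le; [exact/itg_abs/bm_itg| |move=> se].
    by apply: itgD; [exact/itgZ/bm_itg/mb_bm|exact: itg_cst].
  have := remainder_pointwise (z se) en.
  have -> : Ex mu (fun x => D1 (fun j => z se j + sin th * rn * xi x j) (xi x) -
      sin th * rn * D2 (fun j => z se j + sin th * rn * xi x j) Gam) =
      Ex mu (fun x => D1 (Zp th (upd se.1 i x, se.2)) (xi (tnth (upd se.1 i x, se.2).1 i)) -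
        sin th * rn * D2 (Zp th (upd se.1 i x, se.2)) Gam).
    by apply: Ex_ext => x; rewrite Zz tnth_upd eqxx.
  move=> /le_trans; apply; rewrite le_eqVlt; apply/orP; left; apply/eqP.
  by rewrite /C1 /C2; ring.
rewrite ExD; [|exact/itgZ/bm_itg/mb_bm|exact: itg_cst].
rewrite Ex_cst ExZ; last exact/bm_itg/mb_bm.
have [e0 e1] := andP en.
have ee : (sin th * rn) ^+ 2 <= rn ^+ 2 by rewrite ler_sqr ?nnegrE.
have C10 : 0 <= C1 := mulr_ge0 (sqr_ge0 _) (mulr_ge0 Kb3 e5).
have ppi : 0 <= p + pi3 by apply: addr_ge0 => //; exact: le_trans (Pr_ge0 _ _) hp.
apply: (le_trans (lerD (ler_wpM2l C10 hp5) (lexx C2))).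
rewrite /C1 /C2 addrA; apply: lerD; last first.
  apply: ler_wpM2r => //.
  exact: mulr_ge0 (mulr_ge0 (mulr_ge0 (mulr_ge0 (ler0n _ 4) K0) (sqr_ge0 _)) G20) pi30.
set e2 := (sin th * rn) ^+ 2 in ee *; set kb := K * beta ^+ 3 in Kb3 *.
have -> : e2 * (kb * (5 * expR 2 * MM)) * (p + pi3) + e2 * (kb * (4 * tau3)) =
  e2 * (kb * (5 * expR 2 * MM * (p + pi3) + 4 * tau3)) by ring.
apply: ler_wpM2r => //; apply: (mulr_ge0 Kb3).
exact: addr_ge0 (mulr_ge0 e5 ppi) (mulr_ge0 (ler0n _ 4) tau30).
Qed.

Lemma smD1_bigsum z (v : 'I_n -> I -> R) :
  D1 z (fun j => \sum_i v i j) = \sum_i D1 z (v i).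
Proof.
rewrite /smD1 -mulr_sumr -mulr_sumr; congr (_ * (_ * _)).
rewrite /smA exchange_big; apply: eq_bigr => j _; exact: mulr_sumr.
Qed.

Lemma smD2_bigsum z (v : 'I_n -> I -> I -> R) :
  D2 z (fun j k => \sum_i v i j k) = \sum_i D2 z (v i).
Proof.
rewrite /smD2 -mulr_sumr big_split /= -!mulr_sumr; congr (_ * (_ * _ + _ * _)).
  rewrite /smQ [RHS]exchange_big; apply: eq_bigr => j _; rewrite [RHS]exchange_big.
  by apply: eq_bigr => k _; exact: mulr_suml.
rewrite /smT [RHS]exchange_big; apply: eq_bigr => j _; exact: mulr_suml.
Qed.

(** After integration by parts the Gaussian half of the derivative is a second-order term with the
    covariance of [gsum]. Adding and subtracting the same term with [Gam] separates the error of the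
    expansion from the mismatch of the two covariances. *)
Lemma kf_split th : kf th =
  cos th * rn * (\sum_i (Ex PP (fun se => D1 (Zp th se) (xi (tnth se.1 i))) -
    sin th * rn * Ex PP (fun se => D2 (Zp th se) Gam))) +
  sin th * cos th * Ex PP (fun se => D2 (Zp th se)
    (fun j k => Gam j k - n%:R^-1 * \sum_i a i j * a i k)).
Proof.
have mZ j := measurable_Zp th j.
have b1 i : bm (fun se => D1 (Zp th se) (xi (tnth se.1 i))).
  apply: (@bm_smD1 _ _ _ (fun se => xi (tnth se.1 i)) (fun se => m (tnth se.1 i))) => //.
    by move=> j; have [] := bm_fst (bm_tnth i (bxi j)).
  exact: (bm_fst (bm_tnth i bmm)).
have b2 M : bm (fun se => D2 (Zp th se) M).
  apply: (@bm_smD2 _ _ _ (fun=> M) (fun=> \sum_j \sum_k `|M j k|)) => //; last exact: bm_cst.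
  move=> _ j k; rewrite (bigD1 j)//= (bigD1 k)//= -addrA lerDl addr_ge0//.
    by apply: sumr_ge0.
  by apply: sumr_ge0 => ? _; exact: sumr_ge0.
have b3 i : itg PP (fun se => tnth se.2 i * D1 (Zp th se) (a i)).
  apply: itg_bmM; first exact/sq_itg/sq_coord.
  apply: (@bm_smD1 _ _ _ (fun=> a i) (fun=> \sum_j `|a i j|)) => //; last exact: bm_cst.
  by move=> _ j; rewrite (bigD1 j)//= lerDl sumr_ge0.
have i1 i : itg PP (fun se => cos th * rn * D1 (Zp th se) (xi (tnth se.1 i))).
  by apply: itgZ; exact: bm_itg.
have i2 i : itg PP (fun se => sin th * rn * (tnth se.2 i * D1 (Zp th se) (a i))).
  exact: itgZ.
transitivity (\sum_i (cos th * rn * Ex PP (fun se => D1 (Zp th se) (xi (tnth se.1 i))) -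
    sin th * rn * Ex PP (fun se => tnth se.2 i * D1 (Zp th se) (a i)))).
  rewrite /kf; transitivity (Ex PP (fun se => \sum_i (cos th * rn *
      D1 (Zp th se) (xi (tnth se.1 i)) -
      sin th * rn * (tnth se.2 i * D1 (Zp th se) (a i))))).
    apply: Ex_ext => se; 
    have -> : dZp th se = fun j => \sum_i (cos th * rn * xi (tnth se.1 i) j +
        - (sin th * rn * tnth se.2 i) * a i j).
      apply/funext => j; rewrite big_split /= /dZp /ssum /gsum /dot !mulr_sumr -sumrN.
      by congr (_ + _); apply: eq_bigr => i _; ring.
    by rewrite smD1_bigsum; apply: eq_bigr => i _; rewrite smD1D !smD1Z; ring.
  rewrite Ex_sum; last by move=> i; exact: itgB.
  apply: eq_bigr => i _; rewrite ExB// ExZ; last exact: bm_itg.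
  by rewrite ExZ.
under eq_bigr do rewrite stein_coord.
have -> : Ex PP (fun se => D2 (Zp th se)
    (fun j k => Gam j k - n%:R^-1 * \sum_i a i j * a i k)) =
  Ex PP (fun se => D2 (Zp th se) Gam) - n%:R^-1 *
    \sum_i Ex PP (fun se => D2 (Zp th se) (fun j k => a i j * a i k)).
  rewrite -Ex_sum; last by move=> i; exact: bm_itg.
  rewrite -ExZ; last by apply: itg_sum => i; exact: bm_itg.
  rewrite -ExB; [|exact: bm_itg|by apply: itgZ; apply: itg_sum => i; exact: bm_itg].
  apply: Ex_ext => se.
  rewrite -smD2_bigsum -mulN1r -!smD2Z -smD2D; congr (smD2 _ _ _ _ _).
  by apply/funext => j; apply/funext => k; rewrite mulN1r.
rewrite !sumrB -!mulr_sumr sumr_const card_ord.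
rewrite -rn_sqr; set S0 := Ex PP (fun se => D2 _ Gam); set S1 := \sum_(i < n) Ex PP _.
set S2 := \sum_(i < n) Ex PP _.
have nrn : n%:R * rn ^+ 2 = 1 by rewrite rn_sqr divff// pnatr_eq0 -lt0n.
rewrite -(mulr_natr S0).
transitivity (cos th * rn * S1 - sin th * cos th * (n%:R * rn ^+ 2) * S0
   + sin th * cos th * (S0 - rn ^+ 2 * S2)); last by ring.
by rewrite nrn; ring.
Qed.

Lemma kf_bound (Del : R) th : 0 <= sin th -> 0 <= cos th -> 0 <= Del ->
  (forall j k, `|Gam j k - n%:R^-1 * \sum_i a i j * a i k| <= Del) ->
  Pr PP (fun se => strip y (6 * w) (3 * w) (Zp th se)) <= p ->
  `|kf th| <= 2 * K * beta ^+ 2 * Del * p +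
    rn * (K * beta ^+ 3 * (5 * expR 2 * MM * (p + pi3) + 4 * tau3)) +
    4 * K * beta ^+ 2 * G2 * pi3.
Proof.
move=> s0 c0 Del0 hDel hp; rewrite kf_split.
have rn0 := ltW rn_gt0.
have [s1 c1] := sc1 th; rewrite (ger0_norm s0) in s1; rewrite (ger0_norm c0) in c1.
have mZ j := measurable_Zp th j.
rewrite addrC -addrA; apply: (le_trans (ler_normD _ _)); apply: lerD.
  rewrite normrM ger0_norm ?mulr_ge0//.
  rewrite -[leRHS]mul1r; apply: ler_pM; [exact: mulr_ge0|exact: normr_ge0|exact: mulr_ile1|].
  have bD : bm (fun se => D2 (Zp th se)
    (fun j k => Gam j k - n%:R^-1 * \sum_i a i j * a i k)).
    by apply: (@bm_smD2 _ _ _ (fun=> _) (fun=> Del)) => //; exact: bm_cst.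
  have K2 : 0 <= 2 * K * beta ^+ 2 * Del.
    exact: mulr_ge0 (mulr_ge0 (mulr_ge0 (ler0n _ 2) K0) (sqr_ge0 _)) Del0.
  apply: (le_trans (Ex_abs (bm_itg PP bD))).
  apply: le_trans (ler_wpM2l K2 hp).
  rewrite -ExZ; last exact/bm_itg/mb_bm/mb_strip.
  apply: Ex_le; [exact/itg_abs/bm_itg|exact/itgZ/bm_itg/mb_bm/mb_strip|move=> se].
  apply: (le_trans (smD2_bound y beta0 Lam1 cardI I0 _ hDel)).
  apply: ler_wpM2l => //; rewrite ler_nat; case: (boolP (strip _ (4 * w) _ _)) => // st.
  suff -> : strip y (6 * w) (3 * w) (Zp th se) by [].
  move: st => /andP[/forallP h1]; rewrite negb_forall => /existsP[k hk].
  have w0 : 0 < w := smw_gt0 beta0 Lam1.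
  apply/andP; split; first by apply/forallP => j; have := h1 j; lra.
  by rewrite negb_forall; apply/existsP; exists k; move: hk; rewrite -!ltNge; lra.
rewrite !normrM (ger0_norm c0) (ger0_norm rn0).
set E := (K * beta ^+ 3 * _).
set E' := 4 * K * beta ^+ 2 * G2 * pi3.
apply: (@le_trans _ _ (rn * \sum_(i < n) (rn ^+ 2 * E + rn * E'))).
  apply: ler_pM => //; first exact: mulr_ge0.
    by rewrite ler_piMl.
  apply: (le_trans (ler_norm_sum _ _ _)); apply: ler_sum => i _.
  exact: remainder_bound.
rewrite sumr_const card_ord -(mulr_natr (_ + _)).
have nrn : n%:R * rn ^+ 2 = 1 by rewrite rn_sqr divff// pnatr_eq0 -lt0n.
have -> : rn * ((rn ^+ 2 * E + rn * E') * n%:R) = (n%:R * rn ^+ 2) * (rn * E + E') by ring.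
by rewrite nrn mul1r.
Qed.

End smoothed.

Section conclusion.
Variables (beta Lam : R) (m : T -> R) (Gam : I -> I -> R) (M3 G2 M1 pi3 tau3 Del kap : R).
Hypothesis beta0 : 0 < beta.
Hypothesis Lam1 : 1 <= Lam.
Hypothesis cardI : #|I|%:R <= expR Lam.
Hypothesis bmm : bm m.
Hypothesis xim : forall x j, `|xi x j| <= m x.
Hypothesis GamE : forall j k, Gam j k = Ex mu (fun x => xi x j * xi x k).
Hypothesis xiM3 : forall j, Ex mu (fun x => `|xi x j| ^+ 3) <= M3.
Hypothesis GamG2 : forall j k, `|Gam j k| <= G2.
Hypothesis xiM1 : forall j, Ex mu (fun x => `|xi x j|) <= M1.
Hypothesis mpi3 : Pr mu (fun x => 1 < beta * (rn * m x)) <= pi3.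
Hypothesis mtau3 : Ex mu (fun x => m x ^+ 3 * (1 < beta * (rn * m x))%R%:R) <= tau3.
Hypothesis kap0 : 0 <= kap.
Hypothesis Del0 : 0 <= Del.
Hypothesis GamDel : forall j k, `|Gam j k - n%:R^-1 * \sum_i a i j * a i k| <= Del.
Hypothesis anti : forall (y : I -> R) (t : R), 0 <= t ->
  Pr gN (fun e => [forall j, gsum e j <= y j + t]) -
  Pr gN (fun e => [forall j, gsum e j <= y j]) <= kap * t.

Local Notation K := (smK Lam).
Local Notation w := (smw beta Lam).
(** [slope] multiplies the strip probability and so has to be small; [offset] gathers the
    contributions of large observations and is added as it stands. *)
Local Notation B3 := (5 * expR 2 * (rn * (K * beta ^+ 3 * (M3 + G2 * M1)))).
Local Notation slope := (2 * K * beta ^+ 2 * Del + B3).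
Local Notation offset := (B3 * pi3 + 4 * (rn * (K * beta ^+ 3 * tau3)) +
  4 * K * beta ^+ 2 * G2 * pi3).

Let dist y th : R := `|Pr PP (fun se => [forall j, Zp th se j <= y j]) -
  Pr gN (fun e => [forall j, gsum e j <= y j])|.

Let mbZ th y : mb (fun se => [forall j, Zp th se j <= y j]).
Proof. by apply: mb_forall => j; apply: mb_le => //; exact: measurable_Zp. Qed.

Let mbG y : mb (fun e => [forall j, gsum e j <= y j]).
Proof. by apply: mb_forall => j; apply: mb_le => //; exact: measurable_gsum. Qed.

Let bZ th y : bm (fun se => ([forall j, Zp th se j <= y j])%:R : R).
Proof. by apply: mb_bm; exact: mbZ. Qed.

Let bG y : bm (fun e => ([forall j, gsum e j <= y j])%:R : R).
Proof. by apply: mb_bm; exact: mbG. Qed.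

Let smf_Pr_le (y : I -> R) th :
  Pr PP (fun se => [forall j, Zp th se j <= y j - w]) <= uf y beta Lam th.
Proof.
apply: Ex_le; [exact: (bm_itg PP (bZ th (fun j => y j - w)))| |move=> se].
  by apply/bm_itg/bm_smf => // j; exact: measurable_Zp.
exact: smf_ge.
Qed.

Let smf_le_Pr (y : I -> R) th :
  uf y beta Lam th <= Pr PP (fun se => [forall j, Zp th se j <= y j + 4 * w]).
Proof.
apply: Ex_le; [|exact: (bm_itg PP (bZ th (fun j => y j + 4 * w)))|move=> se].
  by apply/bm_itg/bm_smf => // j; exact: measurable_Zp.
exact: smf_le.
Qed.

Let Zp0 y : Pr PP (fun se => [forall j, Zp 0 se j <= y j]) =
  Pr gN (fun e => [forall j, gsum e j <= y j]).
Proof.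
rewrite -[RHS](law_Ex (law_snd gmu gN)); last exact: (bm_itg gN (bG y)).
apply: Ex_ext => se; congr (_%:R); congr (_ : bool); apply: eq_forallb => j.
by rewrite /Zp sin0 cos0 mul0r add0r mul1r.
Qed.

(** A strip is a difference of two orthants at distance [9 * w], so its probability is at most
    [2 * r + 9 * w * kap]. The angle ranges over an interval shorter than 2 and [slope <= 1 / 8], so
    the coefficient of [r] that comes back is at most 2 * 2 / 8 = 1 / 2. *)
Let improve r : 8 * slope <= 1 ->
  (forall y th, 0 <= th <= pi / 2 -> dist y th <= r) ->
  (forall y th, 0 <= th <= pi / 2 -> dist y th <= r / 2 + (8 * w * kap + 2 * offset)).
Proof.
move=> sl hr y th /andP[th0 th1].
have w0 : 0 < w := smw_gt0 beta0 Lam1.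
have strip_le (y' : I -> R) th' : 0 <= th' <= pi / 2 ->
    Pr PP (fun se => strip y' (6 * w) (3 * w) (Zp th' se)) <= 2 * r + 9 * w * kap.
  move=> hth.
  have -> : Pr PP (fun se => strip y' (6 * w) (3 * w) (Zp th' se)) =
    Pr PP (fun se => [forall j, Zp th' se j <= y' j + 6 * w]) -
    Pr PP (fun se => [forall j, Zp th' se j <= y' j - 3 * w]).
    rewrite -ExB; [|exact: (bm_itg PP (bZ th' (fun j => y' j + 6 * w)))
      |exact: (bm_itg PP (bZ th' (fun j => y' j - 3 * w)))].
    apply: Ex_ext => se; rewrite /strip.
    case: (boolP [forall j, Zp th' se j <= y' j - 3 * w]) => [/forallP h|_] /=.
      have -> : [forall j, Zp th' se j <= y' j + 6 * w].
        by apply/forallP => j; have := h j; lra.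
      by rewrite subrr.
    by rewrite andbT subr0.
  have h1 := hr (fun j => y' j + 6 * w) th' hth.
  have h2 := hr (fun j => y' j - 3 * w) th' hth.
  have w9 : 0 <= 9 * w by rewrite mulr_ge0// ltW.
  have h3 := @anti (fun j => y' j - 3 * w) (9 * w) w9.
  have E9 : (fun e => [forall j, gsum e j <= y' j - 3 * w + 9 * w]) =
            (fun e => [forall j, gsum e j <= y' j + 6 * w]).
    apply/funext => e; apply: eq_forallb => j; congr (_ <= _); ring.
  rewrite E9 in h3.
  move: h1 h2; rewrite /dist !ler_norml => /andP[_ h1] /andP[h2 _]; lra.
have kf_le (y' : I -> R) th' : 0 <= th' <= pi / 2 ->
    `|kf y' beta Lam th'| <= slope * (2 * r + 9 * w * kap) + offset.
  move=> hth; have /andP[t0 t1] := hth.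
  have s0 : 0 <= sin th' by apply: sin_ge0_pi; have := pi_ge0 R; lra.
  have c0 : 0 <= cos th' by apply: cos_ge0_pihalf; have := pi_ge0 R; lra.
  have := kf_bound beta0 Lam1 cardI bmm xim GamE xiM3 GamG2 xiM1 mpi3 mtau3 s0 c0 Del0 GamDel
    (strip_le y' th' hth).
  move=> /le_trans; apply; rewrite le_eqVlt; apply/orP; left; apply/eqP; ring.
have uf_le (y' : I -> R) : `|uf y' beta Lam th - uf y' beta Lam 0| <=
    2 * (slope * (2 * r + 9 * w * kap) + offset).
  have := @uf_bound y' beta Lam beta0 Lam1 cardI th (slope * (2 * r + 9 * w * kap) + offset) th0 _.
  move=> h; apply: (le_trans (h _)) => [t /andP[t0 t1]|].
    by apply: kf_le; rewrite t0 (le_trans t1).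
  rewrite mulrC; apply: ler_wpM2r.
    apply: (le_trans (normr_ge0 (kf y beta Lam 0))); apply: kf_le.
    by rewrite lexx divr_ge0// pi_ge0.
  apply: (le_trans th1); exact/ltW/pihalf_lt2.
have q0 : 0 <= 2 * r + 9 * w * kap.
  apply: le_trans (strip_le y th _); first exact: Pr_ge0.
  by rewrite th0.
have D_le : 2 * (slope * (2 * r + 9 * w * kap) + offset) <=
    (2 * r + 9 * w * kap) / 4 + 2 * offset.
  have sl8 : slope <= 8^-1 by lra.
  have := ler_wpM2r q0 sl8; lra.
have wk : 0 <= w * kap by rewrite mulr_ge0// ltW.
have w5 : 0 <= 5 * w by rewrite mulr_ge0// ltW.
have up1 := smf_Pr_le (fun j => y j + w) th.
have up2 := uf_le (fun j => y j + w).
have up3 := smf_le_Pr (fun j => y j + w) 0.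
have lo1 := smf_le_Pr (fun j => y j - 4 * w) th.
have lo2 := uf_le (fun j => y j - 4 * w).
have lo3 := smf_Pr_le (fun j => y j - 4 * w) 0.
have an1 := @anti y (5 * w) w5.
have an2 := @anti (fun j => y j - 5 * w) (5 * w) w5.
have eq_event (f : 'I_n -> I -> R) (T' : Type) (z : T' -> I -> R) (y1 y2 : I -> R) :
    (forall j, y1 j = y2 j) -> (fun t => [forall j, z t j <= y1 j]) = (fun t => [forall j, z t j <= y2 j]).
  by move=> /funext ->.
rewrite (eq_event a _ _ _ y) in up1; last by move=> j; ring.
rewrite (eq_event a _ _ _ (fun j => y j + 5 * w)) in up3; last by move=> j; ring.
rewrite (eq_event a _ _ _ y) in lo1; last by move=> j; ring.
rewrite (eq_event a _ _ _ (fun j => y j - 5 * w)) in lo3; last by move=> j; ring.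
rewrite (eq_event a _ gsum _ y) in an2; last by move=> j; ring.
rewrite Zp0 in up3; rewrite Zp0 in lo3.
apply: (sandwich up1 (up2) up3 lo1 lo2 lo3 an1 an2).
apply: (le_trans (lerD (lexx (kap * (5 * w))) D_le)).
exact: sandwich_budget wk.
Qed.

(* With [r] a bound on the distance valid for all [y] and [theta], the
   interpolation argument returns the bound [r / 2 + c]; iterating gives [2 c]. *)
Lemma interpolation_bound (y : I -> R) : 8 * slope <= 1 ->
  `|Pr gmu (fun s => [forall j, ssum s j <= y j]) -
    Pr gN (fun e => [forall j, gsum e j <= y j])| <= 2 * (8 * w * kap + 2 * offset).
Proof.
move=> sl; set c := 8 * w * kap + 2 * offset.
(* The iteration starts from the trivial bound 1; the map [r -> r / 2 + c] has fixed point [2 * c]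
   and halves the distance to it. *)
have iterate N : forall y' th, 0 <= th <= pi / 2 ->
    dist y' th <= 2^-1 ^+ N * (1 - 2 * c) + 2 * c.
  elim: N => [|N IH] y' th hth.
    rewrite expr0 mul1r subrK /dist ler_norml.
    have := Pr_ge0 PP (fun se => [forall j, Zp th se j <= y' j]).
    have := Pr_ge0 gN (fun e => [forall j, gsum e j <= y' j]).
    have := Pr_le1 PP (mbZ th y'); have := Pr_le1 gN (mbG y').
    by move=> *; apply/andP; split; lra.
  have := improve sl IH y' hth; rewrite -/c exprS -mulrA.
  by set x := _ * (1 - 2 * c) => h; apply: (le_trans h); lra.
have -> : Pr gmu (fun s => [forall j, ssum s j <= y j]) =
    Pr PP (fun se => [forall j, Zp (pi / 2) se j <= y j]).
  have mS : mb (fun s => [forall j, ssum s j <= y j]).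
    by apply: mb_forall => j; apply: mb_le => //; have [] := bm_ssum j.
  rewrite -[LHS](law_Ex (law_fst gmu gN)); last exact/bm_itg/mb_bm.
  apply: Ex_ext => se; congr (_%:R); congr (_ : bool); apply: eq_forallb => j.
  by rewrite /Zp sin_pihalf cos_pihalf mul0r addr0 mul1r.
apply/ler_addgt0Pl => e e0.
pose e' := e / (1 + 2 * `|c|).
have c0 : 0 < 1 + 2 * `|c| by rewrite ltr_wpDr// mulr_ge0.
have e'0 : 0 < e' by rewrite divr_gt0.
pose N := (Num.truncn e'^-1).+1.
have hN : 2^-1 ^+ N <= e'.
  rewrite exprVn -[leRHS]invrK lef_pV2 ?posrE ?invr_gt0 ?exprn_gt0//.
  apply: (le_trans (ltW (truncnS_gt _))); rewrite -natrX ler_nat.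
  exact/ltnW/ltn_expl.
have h2 : 2^-1 ^+ N * (1 - 2 * c) <= e.
  apply: (@le_trans _ _ (2^-1 ^+ N * (1 + 2 * `|c|))).
    by rewrite ler_wpM2l ?exprn_ge0// lerD2l -mulrN ler_wpM2l// -normrN ler_norm.
  by move: hN; rewrite /e' ler_pdivlMr.
apply: (@le_trans _ _ (2^-1 ^+ N * (1 - 2 * c) + 2 * c)); last by rewrite lerD2r.
by apply: iterate; rewrite lexx andbT divr_ge0 ?pi_ge0.
Qed.

End conclusion.

End interpolation.

(** * Moment inequalities *)

Section exponential_inequalities.
Context {R : realType}.
Implicit Types u x : R.

(** Inverting [1 - u <= expR (- u)] gives [expR u <= 1 / (1 - u)]. No lower bound on [u] is imposed,
    which is what lets the Bernstein argument truncate from above only. *)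
Lemma expR_quadratic u : u <= 2^-1 -> expR u <= 1 + u + 2 * u ^+ 2.
Proof.
move=> u2; have h := expR_ge1Dx (- u); rewrite expRN in h.
have p : 0 < 1 - u by lra.
have : expR u <= (1 - u)^-1 by rewrite -[leLHS]invrK lef_pV2 ?posrE ?invr_gt0 ?expR_gt0.
move=> /le_trans; apply; rewrite -[leLHS]mul1r ler_pdivrMr//; nra.
Qed.

Lemma cosh_le x : (expR x + expR (- x)) / 2 <= expR (2 * x ^+ 2).
Proof.
wlog x0 : x / 0 <= x.
  move=> h; have [|x0] := leP 0 x; first exact: h.
  by have := h (- x); rewrite opprK sqrrN addrC; apply; rewrite oppr_ge0 ltW.
have [x2|x2] := leP x 2^-1.
  have h1 := expR_quadratic x2.
  have h2 : expR (- x) <= 1 - x + 2 * x ^+ 2.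
    by have := @expR_quadratic (- x); rewrite sqrrN; apply; lra.
  by apply: le_trans (expR_ge1Dx _); lra.
apply: (@le_trans _ _ (expR x)); last by rewrite ler_expR; nra.
have : expR (- x) <= expR x by rewrite ler_expR; lra.
lra.
Qed.

(** The tangent line at [s] lies below a convex power; it is Young's inequality for [a / s] and 1
    with exponents [p] and [p / (p - 1)]. Both Jensen inequalities below are sums or integrals of
    it. *)
Lemma powR_tangent (p s a : R) : 1 <= p -> 0 <= s -> 0 <= a ->
  s `^ p + p * s `^ (p - 1) * (a - s) <= a `^ p.
Proof.
rewrite le_eqVlt => /predU1P[<-|p1] s0 a0.
  by rewrite subrr powRr0 !powRr1// !mul1r addrC subrK.
move: s0; rewrite le_eqVlt => /predU1P[<-|s0].
  rewrite !powR0 ?gt_eqF//; [|by rewrite subr_gt0|by rewrite (lt_trans _ p1)].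
  by rewrite mulr0 mul0r addr0 powR_ge0.
have p0 : 0 < p by rewrite (lt_trans _ p1).
have q0 : 0 < p / (p - 1) by rewrite divr_gt0// subr_gt0.
have pq : p^-1 + (p / (p - 1))^-1 = 1 by rewrite invf_div; field; rewrite !gt_eqF// subr_gt0.
have as0 : 0 <= a / s by rewrite divr_ge0// ltW.
have := conjugate_powR as0 ler01 p0 q0 pq.
rewrite mulr1 powR1 invf_div => h.
have {}h : 1 + p * (a / s - 1) <= (a / s) `^ p.
  move: h; rewrite -(ler_pM2l p0) mulrDr => h.
  have e1 : p * ((a / s) `^ p / p) = (a / s) `^ p by field; rewrite gt_eqF.
  have e2 : p * (1 * ((p - 1) / p)) = p - 1 by field; rewrite gt_eqF.
  by move: h; rewrite e1 e2; lra.
have {h} := ler_wpM2l (powR_ge0 s p) h.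
rewrite -powRM ?(ltW s0)// mulrCA divff ?gt_eqF// mulr1.
move=> h; apply: le_trans h; rewrite -(mulr_powRB1 (ltW s0) p0).
by rewrite le_eqVlt; apply/orP; left; apply/eqP; field; rewrite gt_eqF.
Qed.

(** For [x = y / t > 1] one has [x^r <= x^Q <= expR (Q (x - 1))], since [ln x <= x - 1]. It trades a
    power of a maximum for exponentials, which can be summed over the coordinates. *)
Lemma powR_le_exp (t y r Q : R) : 0 < t -> 0 <= y -> 0 < r -> r <= Q ->
  y `^ r <= t `^ r * (1 + expR (Q * (y / t - 1))).
Proof.
move=> t0 y0 r0 rQ; have -> : y = t * (y / t) by field; rewrite gt_eqF.
set x := y / t; have x0 : 0 <= x by rewrite divr_ge0// ltW.
rewrite powRM// ?(ltW t0)// mulrAC divff ?gt_eqF// mul1r.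
apply: ler_wpM2l; first exact: powR_ge0.
have [x1|x1] := leP x 1.
  apply: (@le_trans _ _ 1); last by rewrite lerDl expR_ge0.
  apply: (@le_trans _ _ (1 `^ r)); last by rewrite powR1.
  by apply: ge0_ler_powR => //; rewrite ?nnegrE//; exact: ltW.
apply: (@le_trans _ _ (x `^ Q)); first exact/ler_powR/rQ/ltW.
rewrite /powR gt_eqF ?(lt_trans _ x1)//.
apply: (@le_trans _ _ (expR (Q * (x - 1)))); last by rewrite lerDr.
rewrite ler_expR ler_wpM2l//; first by rewrite (le_trans (ltW r0)).
have h := @le_ln1Dx R (x - 1); have e1 : 1 + (x - 1) = x by ring.
by rewrite e1 in h; apply: h; lra.
Qed.

Lemma mean_powR n (a : 'I_n -> R) (p : R) : (0 < n)%N -> 1 <= p -> (forall i, 0 <= a i) ->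
  (n%:R^-1 * \sum_i a i) `^ p <= n%:R^-1 * \sum_i a i `^ p.
Proof.
move=> n0 p1 a0; set s := n%:R^-1 * _.
have n0' : (0 : R) < n%:R by rewrite ltr0n.
have s0 : 0 <= s by rewrite mulr_ge0 ?invr_ge0 ?sumr_ge0// ltW.
have : \sum_(i < n) (s `^ p + p * s `^ (p - 1) * (a i - s)) <= \sum_i a i `^ p.
  by apply: ler_sum => i _; exact: powR_tangent.
rewrite big_split /= -mulr_sumr sumrB !sumr_const card_ord.
have -> : \sum_i a i - s *+ n = 0.
  by rewrite -mulr_natr /s mulrC mulrA divff ?gt_eqF// mul1r subrr.
rewrite mulr0 addr0 -(mulr_natl (s `^ p)) => h.
by rewrite -(ler_pM2l n0') mulrA divff ?gt_eqF// mul1r.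
Qed.

End exponential_inequalities.

Section jensen.
Context {R : realType} {d : measure_display} {T : measurableType d}.
Variable m : probability T R.

Lemma bm_powR (f : T -> R) (p : R) : bm f -> 0 <= p -> bm (fun x => f x `^ p).
Proof.
move=> bf p0; apply: (bm_post (phi := fun x => x `^ p) (measurable_powR p)) => // M.
exists (1 + `|M| `^ p) => x xM; rewrite ger0_norm ?powR_ge0//.
have [x0|x0] := ltP x 0; first by rewrite lt0_powR1// lerDl powR_ge0.
apply: (@le_trans _ _ (`|M| `^ p)); last by rewrite lerDr.
apply: ge0_ler_powR => //; rewrite ?nnegrE//.
by rewrite -(ger0_norm x0) (le_trans xM)// ler_norm.
Qed.

Lemma Ex_powR (f : T -> R) (p : R) : bm f -> (forall x, 0 <= f x) -> 1 <= p ->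
  Ex m f `^ p <= Ex m (fun x => f x `^ p).
Proof.
move=> bf f0 p1; set s := Ex m f.
have s0 : 0 <= s by exact: Ex_ge0.
have p0 : 0 <= p by rewrite (le_trans _ p1).
have i1 : itg m (fun x => p * s `^ (p - 1) * (f x - s)).
  by apply: itgZ; apply: itgB; [exact: bm_itg|exact: itg_cst].
have -> : s `^ p = Ex m (fun x => s `^ p + p * s `^ (p - 1) * (f x - s)).
  rewrite ExD//; last exact: itg_cst.
  rewrite Ex_cst ExZ; last by apply: itgB; [exact: bm_itg|exact: itg_cst].
  by rewrite ExB; [rewrite Ex_cst subrr mulr0 addr0|exact: bm_itg|exact: itg_cst].
apply: Ex_le => [||x]; [by apply: itgD => //; exact: itg_cst|exact/bm_itg/bm_powR|].
exact: powR_tangent.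
Qed.

End jensen.

Section pow_product.
Context {R : realType} {d : measure_display} {T : measurableType d}.
Variable mu : probability T R.

Lemma law_cons n : law (pprod mu (pow mu n)) (pow mu n.+1)
  (fun xs => [the n.+1.-tuple T of xs.1 :: tval xs.2]).
Proof. by split => //; exact: measurable_cons_pair. Qed.

Lemma Ex_cons n (F : n.+1.-tuple T -> R) : bm F -> Ex (pow mu n.+1) F =
  Ex mu (fun x => Ex (pow mu n) (fun s => F [the n.+1.-tuple T of x :: tval s])).
Proof.
move=> bF; rewrite -(law_Ex (law_cons n)); last exact: bm_itg.
have b2 := bm_pre (@measurable_cons_pair _ T n) bF.
rewrite Ex_pprod//; first exact: bm_itg.
by move=> x; exact/bm_itg/(bm_sec1 x b2).
Qed.

Lemma bm_prod (J : Type) (r : seq J) (P : pred J) (F : J -> T -> R) :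
  (forall j, bm (F j)) -> bm (fun x => \prod_(j <- r | P j) F j x).
Proof.
move=> h; elim: r => [|j r IH].
  by rewrite (_ : (fun _ => _) = fun=> 1); [exact: bm_cst|apply/funext => x; rewrite big_nil].
rewrite (_ : (fun _ => _) = fun x => (if P j then F j x else 1) * \prod_(j <- r | P j) F j x).
  by apply: bmM => //; case: (P j) => //; exact: bm_cst.
by apply/funext => x; rewrite big_cons; case: ifP => // _; rewrite mul1r.
Qed.

End pow_product.

Lemma Ex_prod {R : realType} {d : measure_display} {T : measurableType d}
    (mu : probability T R) n (phi : 'I_n -> T -> R) : (forall i, bm (phi i)) ->
  Ex (pow mu n) (fun s => \prod_i phi i (tnth s i)) = \prod_i Ex mu (phi i).
Proof.
elim: n phi => [|n IH] phi bphi.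
  rewrite big_ord0 -[RHS](Ex_cst (pow mu 0)); apply: Ex_ext => s; exact: big_ord0.
have bS : bm (fun s : n.+1.-tuple T => \prod_i phi i (tnth s i)).
  by apply: bm_prod => i; exact: (bm_tnth i (bphi i)).
have bS' : bm (fun s : n.-tuple T => \prod_i phi (lift ord0 i) (tnth s i)).
  by apply: bm_prod => i; exact: (bm_tnth i (bphi (lift ord0 i))).
rewrite Ex_cons// big_ord_recl -IH//.
rewrite mulrC -ExZ; last exact: bm_itg.
apply: Ex_ext => x; rewrite mulrC -ExZ; last exact: bm_itg.
by apply: Ex_ext => s; rewrite big_ord_recl; congr (_ * _); apply: eq_bigr => i _; rewrite tnth_consS.
Qed.

Section fair_coin.
Context {R : realType}.

Definition rad : probability bool R := bernoulli_prob 2^-1.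

Definition sg (b : bool) : R := if b then 1 else -1.

Lemma bm_bool (f : bool -> R) : bm f.
Proof.
split; first by [].
by exists (`|f true| + `|f false|) => -[]; rewrite ?lerDl ?lerDr.
Qed.

Lemma Ex_rad (f : bool -> R) : Ex rad f = 2^-1 * (f true + f false).
Proof.
have half : 0 <= (2^-1 : R) <= 1 by rewrite invr_ge0 ler0n invf_le1 ?ler1n.
have nn (g : bool -> R) : (forall b, 0 <= g b) -> Ex rad g = 2^-1 * (g true + g false).
  move=> g0; rewrite /Ex /rad integral_bernoulli_prob//=.
    rewrite /unstable.onem; have -> : 1 - 2^-1 = 2^-1 :> R by field.
    by rewrite mulrDr.
pose M := `|f true| + `|f false|.
have -> : Ex rad f = Ex rad (fun b => f b + M) - M.
  rewrite ExD; [by rewrite Ex_cst addrK|exact/bm_itg/bm_bool|exact: itg_cst].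
rewrite nn; first by field.
have := normr_ge0 (f true); have := normr_ge0 (f false).
have := ler_norm (- f true); have := ler_norm (- f false); rewrite !normrN /M.
by move=> ? ? ? ? [] /=; lra.
Qed.

End fair_coin.

Section max_norm.
Context {R : realType} (J : finType).
Implicit Types u v : J -> R.

Definition mx v : R := \big[Num.max/0]_j `|v j|.

Lemma mx_ge0 v : 0 <= mx v.
Proof. by rewrite /mx; elim/big_ind : _ => // x y x0 y0; rewrite le_max x0. Qed.

Lemma le_mx v j : `|v j| <= mx v.
Proof. by rewrite /mx (bigD1 j)//= le_max lexx. Qed.

Lemma mx_le v c : 0 <= c -> (forall j, `|v j| <= c) -> mx v <= c.
Proof.
move=> c0 h; rewrite /mx; elim/big_ind : _ => // x y xc yc.
by rewrite ge_max xc.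
Qed.

Lemma mxZ c v : mx (fun j => c * v j) = `|c| * mx v.
Proof.
apply/eqP; rewrite eq_le; apply/andP; split.
  apply: mx_le; first by rewrite mulr_ge0// mx_ge0.
  by move=> j; rewrite normrM ler_wpM2l// le_mx.
have [->|c0] := eqVneq c 0; first by rewrite normr0 mul0r mx_ge0.
rewrite mulrC -ler_pdivlMr ?normr_gt0//; apply: mx_le.
  by rewrite divr_ge0// mx_ge0.
by move=> j; rewrite ler_pdivlMr ?normr_gt0// mulrC -normrM (le_mx (fun j => c * v j)).
Qed.

Lemma mx_mono u v : (forall j, `|u j| <= `|v j|) -> mx u <= mx v.
Proof. by move=> h; apply: mx_le (mx_ge0 v) _ => j; exact: le_trans (h j) (le_mx v j). Qed.

Lemma mxD u v : mx (fun j => u j + v j) <= mx u + mx v.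
Proof.
apply: mx_le => [|j]; first by rewrite addr_ge0// mx_ge0.
by rewrite (le_trans (ler_normD _ _))// lerD// le_mx.
Qed.

Lemma bm_mx {d : measure_display} {T : measurableType d} (v : T -> J -> R) :
  (forall j, bm (fun x => v x j)) -> bm (fun x => mx (v x)).
Proof. by move=> bv; apply: bm_bigmax => j; exact: bm_abs. Qed.

Lemma ler_mx_powR (r : R) v c : 0 <= r -> mx v <= c -> mx v `^ r <= c `^ r.
Proof.
move=> r0 vc; apply: ge0_ler_powR => //; rewrite nnegrE ?mx_ge0//.
exact: le_trans (mx_ge0 v) vc.
Qed.

Lemma mx_Ex {d : measure_display} {T : measurableType d} (m : probability T R)
    (v : T -> J -> R) : (forall j, bm (fun x => v x j)) ->
  mx (fun j => Ex m (fun x => v x j)) <= Ex m (fun x => mx (v x)).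
Proof.
move=> bv; apply: mx_le => [|j]; first by apply: Ex_ge0 => x; exact: mx_ge0.
apply: (le_trans (Ex_abs (bm_itg m (bv j)))).
by apply: Ex_le => [||x]; [exact/itg_abs/bm_itg|exact/bm_itg/bm_mx|exact: le_mx].
Qed.

Lemma mx_Ex_powR {d : measure_display} {T : measurableType d} (m : probability T R)
    (v : T -> J -> R) (r : R) : 1 <= r -> (forall j, bm (fun x => v x j)) ->
  mx (fun j => Ex m (fun x => v x j)) `^ r <= Ex m (fun x => mx (v x) `^ r).
Proof.
move=> r1 bv; apply: le_trans (Ex_powR m (bm_mx bv) (fun x => mx_ge0 (v x)) r1).
by apply: ler_mx_powR (mx_Ex m bv); rewrite (le_trans _ r1).
Qed.

End max_norm.

(** * Symmetrisation by random signs *)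

Section symmetrization.
Context {R : realType} (J : finType) {d : measure_display} {T : measurableType d}.
Variables (mu : probability T R) (r : R).
Hypothesis r1 : 1 <= r.

Let r0 : 0 <= r := le_trans ler01 r1.

Lemma half_powR (a b : R) : 0 <= a -> 0 <= b -> (2^-1 * (a + b)) `^ r <= 2^-1 * (a `^ r + b `^ r).
Proof.
move=> a0 b0; have := @mean_powR R 2 (fun i => if i == ord0 then a else b) r isT r1.
rewrite !big_ord_recl !big_ord0 /= !addr0; apply => i; by case: ifP.
Qed.

(** As [g] is centred, [A + g x] is the mean over an independent [y] of the midpoint of [A + 2 g x]
    and [A - 2 g y]. Jensen and convexity separate the two halves, each of which involves a single
    observation again; this is where the factor 2 comes from. *)
Lemma symmetrize_coord (A : J -> R) (g : T -> J -> R) :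
  (forall j, bm (fun x => g x j)) -> (forall j, Ex mu (fun x => g x j) = 0) ->
  Ex mu (fun x => mx (fun j => A j + g x j) `^ r) <=
  2^-1 * (Ex mu (fun x => mx (fun j => A j + 2 * g x j) `^ r) +
          Ex mu (fun x => mx (fun j => A j + - 2 * g x j) `^ r)).
Proof.
move=> bg g0.
have bA (c : R) : forall j, bm (fun x => A j + c * g x j).
  by move=> j; apply: bmD; [exact: bm_cst|apply: bmM => //; exact: bm_cst].
have bP (c : R) : bm (fun x => mx (fun j => A j + c * g x j) `^ r).
  by apply: bm_powR => //; apply: bm_mx; exact: bA.
have b1 : bm (fun x => mx (fun j => A j + g x j) `^ r).
  by apply: bm_powR => //; apply: bm_mx => j; apply: bmD => //; exact: bm_cst.
have ih (c : R) : itg mu (fun x => 2^-1 * mx (fun j => A j + c * g x j) `^ r).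
  by apply: itgZ; exact: bm_itg.
set E2 := Ex mu (fun x => mx (fun j => A j + - 2 * g x j) `^ r).
have -> : 2^-1 * (Ex mu (fun x => mx (fun j => A j + 2 * g x j) `^ r) + E2) =
    Ex mu (fun x => 2^-1 * mx (fun j => A j + 2 * g x j) `^ r + 2^-1 * E2).
  rewrite ExD//; last exact: itg_cst.
  by rewrite Ex_cst ExZ ?mulrDr//; exact: bm_itg.
apply: Ex_le; [exact: bm_itg|by apply: itgD => //; exact: itg_cst|move=> x].
set a2 := mx (fun j => A j + 2 * g x j) `^ r.
have -> : 2^-1 * a2 + 2^-1 * E2 =
    Ex mu (fun y => 2^-1 * (a2 + mx (fun j => A j + - 2 * g y j) `^ r)).
  rewrite ExZ; last by apply: itgD; [exact: itg_cst|exact: bm_itg].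
  by rewrite ExD; [rewrite Ex_cst mulrDr|exact: itg_cst|exact: bm_itg].
pose u y j : R := 2^-1 * ((A j + 2 * g x j) + (A j + - 2 * g y j)).
have bu j : bm (fun y => u y j).
  by apply: bmM; [exact: bm_cst|apply: bmD; [exact: bm_cst|exact: bA]].
have -> : (fun j => A j + g x j) = (fun j => Ex mu (fun y => u y j)).
  apply/funext => j; rewrite /u ExZ; last by apply: itgD; [exact: itg_cst|exact/bm_itg/bA].
  rewrite ExD; [|exact: itg_cst|exact/bm_itg/bA].
  rewrite Ex_cst ExD; [|exact: itg_cst|exact/itgZ/bm_itg].
  by rewrite Ex_cst ExZ ?g0; [field|exact/bm_itg].
apply: (le_trans (mx_Ex_powR mu r1 bu)); apply: Ex_le => [||y].
- exact/bm_itg/bm_powR/r0/bm_mx.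
- by apply: itgZ; apply: itgD; [exact: itg_cst|exact/bm_itg].
- apply: le_trans (half_powR (mx_ge0 _) (mx_ge0 _)).
  apply: ler_mx_powR => //; rewrite /u mxZ ger0_norm ?invr_ge0//.
  by rewrite ler_wpM2l ?invr_ge0//; exact: mxD.
Qed.

Variables (n : nat) (f : 'I_n -> T -> J -> R).
Hypothesis bf : forall i j, bm (fun x => f i x j).
Hypothesis f0 : forall i j, Ex mu (fun x => f i x j) = 0.

(** Hybrid coefficients: the summands of index below [k] already carry twice a random sign, the
    others are untouched. *)
Let c (k : nat) (i : 'I_n) (b : bool) : R := if (i < k)%N then 2 * sg b else 1.
Let S k (e : n.-tuple bool) (s : n.-tuple T) j : R :=
  \sum_i c k i (tnth e i) * f i (tnth s i) j.
Let G k e := Ex (pow mu n) (fun s => mx (S k e s) `^ r).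
Let V k := Ex (pow rad n) (G k).

Let bS k j : bm (fun es : n.-tuple bool * n.-tuple T => S k es.1 es.2 j).
Proof.
apply: bm_sum => i; apply: bmM.
  have b1 := bm_tnth i (bm_bool (c k i)).
  by apply: (bm_pre _ b1); exact: measurable_fst.
have b2 := bm_tnth i (bf i j).
by apply: (bm_pre _ b2); exact: measurable_snd.
Qed.

Let bPhi k : bm (fun es : n.-tuple bool * n.-tuple T => mx (S k es.1 es.2) `^ r).
Proof. by apply: bm_powR => //; apply: bm_mx; exact: bS. Qed.

Let V_step k : (k < n)%N -> V k <= V k.+1.
Proof.
move=> kn; pose i0 := Ordinal kn.
have bG k' : bm (G k') := bm_Ex (pow rad n) (pow mu n) (bPhi k').
have bGU := bm_Ex2 rad (pow rad n) (bm_upd i0 (bG k.+1)).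
have VE : V k.+1 = Ex (pow rad n) (fun e => Ex rad (fun b => G k.+1 (upd e i0 b))).
  exact: (Ex_upd rad i0 (bG k.+1)).
rewrite VE; apply: Ex_le; [exact: bm_itg|exact: bm_itg|move=> e].
rewrite Ex_rad.
have bs k' e' := bm_sec1 e' (bPhi k').
have b0 e' := bm_Ex2 mu (pow mu n) (bm_upd i0 (bs k.+1 e')).
have GE k' e' : G k' e' = Ex (pow mu n) (fun s => Ex mu (fun x => mx (S k' e' (upd s i0 x)) `^ r)).
  exact: (Ex_upd mu i0 (bs k' e')).
rewrite !GE.
rewrite -ExD; [|exact/bm_itg/b0..].
rewrite -ExZ; last by apply: itgD; exact/bm_itg/b0.
apply: Ex_le; [exact/bm_itg/(bm_Ex2 mu (pow mu n) (bm_upd i0 (bs k e)))| |move=> s].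
  by apply: itgZ; apply: itgD; exact/bm_itg/b0.
pose A j := \sum_(i < n | i != i0) c k i (tnth e i) * f i (tnth s i) j.
have E1 x : S k e (upd s i0 x) = fun j => A j + f i0 x j.
  apply/funext => j; rewrite /S (bigD1 i0)//= tnth_upd eqxx /c ltnn mul1r addrC.
  by congr (_ + _); apply: eq_bigr => i ii; rewrite tnth_upd (negbTE ii).
have E2 b x : S k.+1 (upd e i0 b) (upd s i0 x) = fun j => A j + (2 * sg b) * f i0 x j.
  apply/funext => j; rewrite /S (bigD1 i0)//= !tnth_upd eqxx /c ltnSn addrC.
  congr (_ + _); apply: eq_bigr => i ii; rewrite !tnth_upd (negbTE ii).
  have -> // : (i < k.+1)%N = (i < k)%N.
  by move: ii; rewrite -val_eqE /= => ii; rewrite ltnS leq_eqVlt (negbTE ii).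
have E3 b : Ex mu (fun x => mx (S k.+1 (upd e i0 b) (upd s i0 x)) `^ r) =
    Ex mu (fun x => mx (fun j => A j + (2 * sg b) * f i0 x j) `^ r).
  by apply: Ex_ext => x; rewrite E2.
have E4 : Ex mu (fun x => mx (S k e (upd s i0 x)) `^ r) =
    Ex mu (fun x => mx (fun j => A j + f i0 x j) `^ r).
  by apply: Ex_ext => x; rewrite E1.
have sgt : 2 * sg true = 2 :> R by rewrite /sg mulr1.
have sgf : 2 * sg false = - 2 :> R by rewrite /sg mulrN1.
rewrite (E3 true) (E3 false) E4 sgt sgf; exact: symmetrize_coord (bf i0) (f0 i0).
Qed.

Lemma symmetrization :
  Ex (pow mu n) (fun s => mx (fun j => \sum_i f i (tnth s i) j) `^ r) <=
  Ex (pow rad n) (fun e => Ex (pow mu n)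
    (fun s => mx (fun j => \sum_i 2 * sg (tnth e i) * f i (tnth s i) j) `^ r)).
Proof.
have h k : (k <= n)%N -> V 0 <= V k.
  elim: k => [_|k IH kn]; [exact: lexx|exact: le_trans (IH (ltnW kn)) (V_step kn)].
have V0 : Ex (pow mu n) (fun s => mx (fun j => \sum_i f i (tnth s i) j) `^ r) = V 0.
  rewrite -[LHS](Ex_cst (pow rad n)); apply: Ex_ext => e; apply: Ex_ext => s.
  by congr (mx _ `^ _); apply/funext => j; apply: eq_bigr => i _; rewrite /c mul1r.
have VN : Ex (pow rad n) (fun e => Ex (pow mu n)
    (fun s => mx (fun j => \sum_i 2 * sg (tnth e i) * f i (tnth s i) j) `^ r)) = V n.
  apply: Ex_ext => e; apply: Ex_ext => s; congr (mx _ `^ _); apply/funext => j.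
  by apply: eq_bigr => i _; rewrite /c ltn_ord.
by rewrite V0 VN; exact: h.
Qed.

End symmetrization.

Section rademacher_max.
Context {R : realType} (J : finType).
Hypothesis J0 : (0 < #|J|)%N.

Lemma mx_attained (v : J -> R) : exists j, mx v = `|v j|.
Proof.
have /card_gt0P[j0 _] := J0.
have [j _ hj] := @arg_maxP _ _ J j0 xpredT (fun j => `|v j|) isT.
exists j; apply/eqP; rewrite eq_le le_mx andbT; apply: mx_le => // k.
exact: hj.
Qed.

Variables (n : nat) (a : 'I_n -> J -> R) (sig2 r Q : R).
Hypothesis asig : forall j, \sum_i a i j ^+ 2 <= sig2.
Hypothesis r0 : 0 < r.
Hypothesis rQ : r <= Q.
Hypothesis cardJ : 2 * #|J|%:R <= expR (Q / 2).

Let S (e : n.-tuple bool) j : R := \sum_i sg (tnth e i) * a i j.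

Let bS j : bm (fun e => S e j).
Proof.
apply: bm_sum => i; apply: bmM; last exact: bm_cst.
exact: (bm_tnth i (bm_bool sg)).
Qed.

Let b_exp (lam : R) j : bm (fun e => expR (lam * S e j)).
Proof.
have b1 : bm (fun e => lam * S e j) by apply: bmM; [exact: bm_cst|exact: bS].
apply: (bm_post (phi := expR)) b1 => // M; exists (expR M) => x.
by rewrite ler_norml => /andP[_ xM]; rewrite ger0_norm ?expR_ge0// ler_expR.
Qed.

Let exp_rad (lam : R) j : Ex (pow rad n) (fun e => expR (lam * S e j)) <= expR (2 * lam ^+ 2 * sig2).
Proof.
have -> : (fun e => expR (lam * S e j)) =
    (fun e : n.-tuple bool => \prod_i expR (lam * (sg (tnth e i) * a i j))).
  by apply/funext => e; rewrite /S mulr_sumr expR_sum.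
rewrite (@Ex_prod R _ _ rad n (fun i b => expR (lam * (sg b * a i j)))); last first.
  by move=> i; exact: bm_bool.
apply: (@le_trans _ _ (\prod_i expR (2 * (lam * a i j) ^+ 2))).
  apply: ler_prod => i _; rewrite Ex_ge0 /=; last by move=> b; exact: expR_ge0.
  rewrite Ex_rad /= mul1r mulN1r mulrN mulrC; exact: cosh_le.
rewrite -expR_sum ler_expR -mulr_sumr -mulrA; apply: ler_wpM2l => //.
under eq_bigr do rewrite exprMn.
by rewrite -mulr_sumr ler_wpM2l ?sqr_ge0.
Qed.

(** With [t = sqrt (4 Q sig2)] and [lam = Q / t] the exponential moment of each signed coordinate is
    at most [expR (Q / 2)]. The union over [2 #|J|] signed coordinates costs another [expR (Q / 2)],
    and the factor [expR (- Q)] left by [powR_le_exp] cancels both, so the total is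
    [(1 + 1) t^r]. *)
Lemma rademacher_max : Ex (pow rad n) (fun e => mx (S e) `^ r) <=
  2 * Num.sqrt (4 * Q * sig2) `^ r.
Proof.
have Q0 : 0 < Q by exact: lt_le_trans rQ.
have /card_gt0P[j0 _] := J0.
have s0 : 0 <= sig2.
  by apply: le_trans (asig j0); apply: sumr_ge0 => i _; exact: sqr_ge0.
move: (s0); rewrite le_eqVlt => /predU1P[s0E|s0'].
  have a0 i j : a i j = 0.
    apply/eqP; rewrite -sqrf_eq0 eq_le sqr_ge0 andbT s0E; apply: le_trans (asig j).
    by rewrite (bigD1 i)//= lerDl sumr_ge0// => k _; exact: sqr_ge0.
  have -> : (fun e => mx (S e) `^ r) = fun=> 0.
    apply/funext => e; have -> : mx (S e) = 0.
      apply/eqP; rewrite eq_le mx_ge0 andbT; apply: mx_le => // j.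
      by rewrite /S big1 ?normr0// => i _; rewrite a0 mulr0.
    by rewrite powR0// gt_eqF.
  by rewrite Ex_cst mulr_ge0// powR_ge0.
set t := Num.sqrt _.
have t0 : 0 < t by rewrite sqrtr_gt0 !mulr_gt0.
have t2 : t ^+ 2 = 4 * Q * sig2 by rewrite sqr_sqrtr// !mulr_ge0// ltW.
pose lam := Q / t.
have lam0 : 0 <= lam by rewrite divr_ge0// ltW.
have lam2 : 2 * lam ^+ 2 * sig2 = Q / 2.
  rewrite /lam exprMn exprVn t2; field; by rewrite !gt_eqF.
have bm1 : bm (fun e => mx (S e) `^ r) by apply: bm_powR (ltW r0); exact: bm_mx.
pose E e := \sum_j (expR (lam * S e j) + expR (- lam * S e j)).
have iE : itg (pow rad n) E by apply/bm_itg/bm_sum => j; apply: bmD; exact: b_exp.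
have pw e : mx (S e) `^ r <= t `^ r * (1 + expR (- Q) * E e).
  apply: (le_trans (powR_le_exp t0 (mx_ge0 _) r0 rQ)).
  apply: ler_wpM2l; first exact: powR_ge0.
  rewrite lerD2l.
  have -> : Q * (mx (S e) / t - 1) = - Q + lam * mx (S e) by rewrite /lam; ring.
  rewrite expRD; apply: ler_wpM2l; first exact: expR_ge0.
  have [j ->] := mx_attained (S e).
  rewrite /E (bigD1 j)//=; apply: (@le_trans _ _ (expR (lam * S e j) + expR (- lam * S e j))).
    have [s1|s1] := leP 0 (S e j); first by rewrite ger0_norm// lerDl expR_ge0.
    by rewrite ltr0_norm// mulrN mulNr lerDr expR_ge0.
  by rewrite lerDl sumr_ge0// => k _; rewrite addr_ge0// expR_ge0.
apply: (@le_trans _ _ (Ex (pow rad n) (fun e => t `^ r * (1 + expR (- Q) * E e)))).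
  apply: Ex_le => //; first exact: bm_itg.
  by apply: itgZ; apply: itgD; [exact: itg_cst|exact: itgZ].
rewrite ExZ; last by apply: itgD; [exact: itg_cst|exact: itgZ].
rewrite ExD; [|exact: itg_cst|exact: itgZ].
rewrite Ex_cst ExZ// mulrC; apply: ler_wpM2r; first exact: powR_ge0.
rewrite -[leRHS]/(1 + 1) lerD2l.
have : Ex (pow rad n) E <= 2 * #|J|%:R * expR (Q / 2).
  rewrite /E Ex_sum; last by move=> j; apply: itgD; exact/bm_itg/b_exp.
  apply: (@le_trans _ _ (\sum_(j : J) (2 * expR (Q / 2)))).
    apply: ler_sum => j _; rewrite ExD; [|exact/bm_itg/b_exp..].
    rewrite [leRHS]mulr_natl mulr2n; apply: lerD; rewrite -lam2; first exact: exp_rad.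
    by apply: (le_trans (exp_rad (- lam) j)); rewrite sqrrN.
  by rewrite sumr_const -[leLHS]mulr_natr mulrAC.
move=> /(ler_wpM2l (expR_ge0 (- Q)))/le_trans; apply.
apply: (@le_trans _ _ (expR (- Q) * (expR (Q / 2) * expR (Q / 2)))).
  by apply: ler_wpM2l; [exact: expR_ge0|apply: ler_wpM2r; [exact: expR_ge0|]].
rewrite -!expRD; have -> : - Q + (Q / 2 + Q / 2) = 0 by field.
by rewrite expR0.
Qed.

End rademacher_max.

(** * Type-2 moment bounds and decoupling *)

Section type2.
Context {R : realType} (J : finType) {d : measure_display} {T : measurableType d}.
Variables (mu : probability T R) (r Q : R).
Hypothesis J0 : (0 < #|J|)%N.
Hypothesis r2 : 2 <= r.
Hypothesis rQ : r <= Q.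
Hypothesis cardJ : 2 * #|J|%:R <= expR (Q / 2).

Let r0 : 0 < r. Proof. exact: lt_le_trans r2. Qed.
Let r1 : 1 <= r. Proof. by apply: le_trans r2; rewrite ler1n. Qed.
Let Q0 : 0 < Q. Proof. exact: lt_le_trans rQ. Qed.

Lemma sqrt_powR (x : R) : 0 <= x -> Num.sqrt x `^ r = x `^ (r / 2).
Proof. by move=> x0; rewrite -powR12_sqrt// -powRrM mulrC. Qed.

(** After symmetrisation the observations are frozen and the signs averaged, with variance proxy
    [4 \sum_i (m i)^2]. As [r / 2 >= 1], the power-mean inequality converts this sum into [r]-th
    moments of the envelopes. The dimension enters only through [Q], which is logarithmic in it. *)
Lemma type2 n (f : 'I_n -> T -> J -> R) (m : 'I_n -> T -> R) (W : R) : (0 < n)%N ->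
  (forall i j, bm (fun x => f i x j)) -> (forall i j, Ex mu (fun x => f i x j) = 0) ->
  (forall i, bm (m i)) -> (forall i x j, `|f i x j| <= m i x) ->
  (forall i, Ex mu (fun x => m i x `^ r) <= W) ->
  Ex (pow mu n) (fun s => mx (fun j => \sum_i f i (tnth s i) j) `^ r) <=
  2 * (4 * Num.sqrt (Q * n%:R)) `^ r * W.
Proof.
move=> n0 bf f0 bmm fm mW.
have /card_gt0P[j0 _] := J0.
have m0 i x : 0 <= m i x := le_trans (normr_ge0 _) (fm i x j0).
apply: (le_trans (symmetrization r1 bf f0)).
have bS : bm (fun es : n.-tuple bool * n.-tuple T =>
    mx (fun j => \sum_i 2 * sg (tnth es.1 i) * f i (tnth es.2 i) j) `^ r).
  apply: bm_powR; last exact: ltW.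
  apply: bm_mx => j; apply: bm_sum => i; apply: bmM.
    have b1 := bm_tnth i (bm_bool (fun b => 2 * sg b : R)).
    by apply: (bm_pre _ b1); exact: measurable_fst.
  have b2 := bm_tnth i (bf i j).
  by apply: (bm_pre _ b2); exact: measurable_snd.
rewrite (Ex_swap (pow rad n) (pow mu n) bS) /=.
have bmr i : bm (fun x => m i x `^ r) by apply: bm_powR => //; exact: ltW.
have bmrs i := bm_tnth i (bmr i).
set c := (4 * Num.sqrt (Q * n%:R)) `^ r.
have c0 : 0 <= c by exact: powR_ge0.
have n0' : (0 : R) < n%:R by rewrite ltr0n.
apply: (@le_trans _ _ (Ex (pow mu n) (fun s => 2 * c * n%:R^-1 * \sum_i m i (tnth s i) `^ r))).
  have bM : bm (fun s : n.-tuple T => \sum_i m i (tnth s i) `^ r) by apply: bm_sum => i; exact: bmrs.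
  apply: Ex_le => [||s]; [exact/bm_itg/(bm_Ex2 (pow rad n) (pow mu n) bS)|exact/itgZ/bm_itg|].
  pose sig2 := 4 * \sum_i m i (tnth s i) ^+ 2.
  have asig j : \sum_i (2 * f i (tnth s i) j) ^+ 2 <= sig2.
    rewrite /sig2 mulr_sumr; apply: ler_sum => i _; rewrite exprMn.
    have -> : (2 : R) ^+ 2 = 4 by ring.
    apply: ler_wpM2l => //; rewrite -[leLHS]real_normK ?num_real//.
    by rewrite ler_sqr ?nnegrE.
  have := rademacher_max J0 asig r0 rQ cardJ.
  have -> : (fun e : n.-tuple bool => mx (fun j => \sum_i sg (tnth e i) * (2 * f i (tnth s i) j)) `^ r) =
    (fun e => mx (fun j => \sum_i 2 * sg (tnth e i) * f i (tnth s i) j) `^ r).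
    apply/funext => e; congr (mx _ `^ _); apply/funext => j; apply: eq_bigr => i _; ring.
  move=> /le_trans; apply; rewrite -!mulrA; apply: ler_wpM2l => //.
  pose avg := n%:R^-1 * \sum_i m i (tnth s i) ^+ 2.
  have avg0 : 0 <= avg.
    by rewrite mulr_ge0 ?invr_ge0 ?(ltW n0')// sumr_ge0// => i _; exact: sqr_ge0.
  have -> : Num.sqrt (4 * (Q * sig2)) = (4 * Num.sqrt (Q * n%:R)) * Num.sqrt avg.
    have -> : 4 * (Q * sig2) = 4 ^+ 2 * (Q * n%:R) * avg.
      rewrite /sig2 /avg; field; by rewrite gt_eqF.
    have q0 : 0 <= Q * n%:R by rewrite mulr_ge0// ltW.
    rewrite sqrtrM; last by rewrite mulr_ge0// sqr_ge0.
    by rewrite sqrtrM ?sqr_ge0// sqrtr_sqr ger0_norm.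
  rewrite powRM ?sqrtr_ge0//.
  rewrite -/c; apply: ler_wpM2l => //.
  rewrite sqrt_powR// /avg.
  have rh : 1 <= r / 2 by rewrite ler_pdivlMr// mul1r.
  apply: (le_trans (mean_powR n0 rh _)) => [i|]; first exact: sqr_ge0.
  rewrite le_eqVlt; apply/orP; left; apply/eqP; congr (_ * _); apply: eq_bigr => i _.
  by rewrite -powR_mulrn// -powRrM; congr (_ `^ _); field.
rewrite ExZ; last by apply: itg_sum => i; exact: bm_itg.
rewrite Ex_sum; last by move=> i; exact: bm_itg.
rewrite -!mulrA; apply: ler_wpM2l => //; apply: ler_wpM2l => //.
rewrite ler_pdivrMl//.
apply: (@le_trans _ _ (\sum_(i < n) W)); last by rewrite sumr_const card_ord mulr_natl.
by apply: ler_sum => i _; rewrite (Ex_coord (mu := mu) i (bm_itg mu (bmr i))).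
Qed.

(* Averaging over all subsets of the index set separates each ordered pair with
   probability [1 / 4]; given the subset, the two groups of observations are
   independent and the type-2 inequality applies twice. *)
Lemma decoupling n (w : T * T -> J -> R) (m : T * T -> R) : (0 < n)%N ->
  (forall j, bm (fun xy => w xy j)) ->
  (forall y j, Ex mu (fun x => w (x, y) j) = 0) ->
  (forall x j, Ex mu (fun y => w (x, y) j) = 0) ->
  bm m -> (forall xy j, `|w xy j| <= m xy) ->
  Ex (pow mu n) (fun s => mx (fun j => \sum_i \sum_(l | l != i) w (tnth s i, tnth s l) j) `^ r) <=
  4 * (64 * (Q * n%:R)) `^ r * Ex (pprod mu mu) (fun xy => m xy `^ r).
Proof.
move=> n0 bw wx wy bmm wm.
pose D (b : n.-tuple bool) (s : n.-tuple T) j : R :=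
  \sum_i \sum_l (tnth b i && ~~ tnth b l)%:R * w (tnth s i, tnth s l) j.
have /card_gt0P[j0 _] := J0.
have n0' : (0 : R) < n%:R by rewrite ltr0n.
have m0 xy : 0 <= m xy := le_trans (normr_ge0 _) (wm xy j0).
have bwil i l j : bm (fun s : n.-tuple T => w (tnth s i, tnth s l) j).
  apply: (bm_pre _ (bw j)); apply: measurable_fun_pair; exact: measurable_tnth.
have bD j : bm (fun bs : n.-tuple bool * n.-tuple T => D bs.1 bs.2 j).
  apply: bm_sum => i; apply: bm_sum => l; apply: bmM.
    have b1 : bm (fun b : n.-tuple bool => (tnth b i && ~~ tnth b l)%:R : R).
      rewrite (_ : (fun _ => _) = fun b : n.-tuple bool => (tnth b i)%:R * (~~ tnth b l)%:R).
        apply: bmM; first exact: (bm_tnth i (bm_bool (fun b => b%:R))).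
        exact: (bm_tnth l (bm_bool (fun b => (~~ b)%:R))).
      by apply/funext => b; rewrite -natrM mulnb.
    by apply: (bm_pre _ b1); exact: measurable_fst.
  by apply: (bm_pre _ (bwil i l j)); exact: measurable_snd.
have b_and i l : bm (fun b : n.-tuple bool => (tnth b i && ~~ tnth b l)%:R : R).
  rewrite (_ : (fun _ => _) = fun b : n.-tuple bool => (tnth b i)%:R * (~~ tnth b l)%:R).
    apply: bmM; first exact: (bm_tnth i (bm_bool (fun b => b%:R))).
    exact: (bm_tnth l (bm_bool (fun b => (~~ b)%:R))).
  by apply/funext => b; rewrite -natrM mulnb.
have pair_law (i l : 'I_n) : l != i ->
    Ex (pow rad n) (fun b => (tnth b i && ~~ tnth b l)%:R : R) = 4^-1.
  move=> li; pose phi (k : 'I_n) (b : bool) : R :=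
    if k == i then b%:R else if k == l then (~~ b)%:R else 1.
  have -> : (fun b => (tnth b i && ~~ tnth b l)%:R : R) =
      (fun b : n.-tuple bool => \prod_k phi k (tnth b k)).
    apply/funext => b; rewrite (bigD1 i)//= (bigD1 l)//= big1 => [|k /andP[ki kl]].
      by rewrite /phi eqxx (negbTE li) eqxx mulr1 -natrM mulnb.
    by rewrite /phi (negbTE ki) (negbTE kl).
  rewrite (@Ex_prod R _ _ rad n phi); last by move=> k; exact: bm_bool.
  rewrite (bigD1 i)//= (bigD1 l)//= big1 => [|k /andP[ki kl]].
    by rewrite !Ex_rad /phi eqxx (negbTE li) eqxx /=; field.
  by rewrite Ex_rad /phi (negbTE ki) (negbTE kl); field.
(* Four times the average over random subsets restores the full double sum; by Jensen the bound may
   then be proved for each subset separately. *)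
have avg s j : \sum_i \sum_(l | l != i) w (tnth s i, tnth s l) j =
    Ex (pow rad n) (fun b => 4 * D b s j).
  have ib i l : itg (pow rad n) (fun b => (tnth b i && ~~ tnth b l)%:R * w (tnth s i, tnth s l) j).
    by apply: bm_itg; apply: bmM => //; exact: bm_cst.
  rewrite ExZ; last by apply: itg_sum => i; exact: itg_sum.
  rewrite Ex_sum; last by move=> i; exact: itg_sum.
  rewrite mulr_sumr; apply: eq_bigr => i _; rewrite Ex_sum// mulr_sumr.
  rewrite [RHS](bigD1 i)//= [X in X + _](_ : _ = 0) ?add0r; last first.
    have -> : (fun b : n.-tuple bool => (tnth b i && ~~ tnth b i)%:R * w (tnth s i, tnth s i) j) = fun=> 0.
      by apply/funext => b; rewrite andbN mul0r.
    by rewrite Ex_cst mulr0.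
  apply: eq_bigr => l li.
  have -> : (fun b : n.-tuple bool => (tnth b i && ~~ tnth b l)%:R * w (tnth s i, tnth s l) j) =
     (fun b => w (tnth s i, tnth s l) j * (tnth b i && ~~ tnth b l)%:R).
    by apply/funext => b; rewrite mulrC.
  by rewrite ExZ ?pair_law//; [field|exact: bm_itg].
have bP : bm (fun bs : n.-tuple bool * n.-tuple T => mx (D bs.1 bs.2) `^ r).
  by apply: bm_powR; [exact: bm_mx|exact: ltW].
have bP4 : bm (fun bs : n.-tuple bool * n.-tuple T => 4 `^ r * mx (D bs.1 bs.2) `^ r).
  by apply: bmM => //; exact: bm_cst.
apply: (@le_trans _ _ (Ex (pow mu n) (fun s => Ex (pow rad n) (fun b => 4 `^ r * mx (D b s) `^ r)))).
  have bU : bm (fun s : n.-tuple T =>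
      mx (fun j => \sum_i \sum_(l | l != i) w (tnth s i, tnth s l) j) `^ r).
    apply: bm_powR; last exact: ltW.
    by apply: bm_mx => j; apply: bm_sum => i; apply: bm_sum => l.
  apply: Ex_le => [||s]; [exact: bm_itg|exact/bm_itg/(bm_Ex2 (pow rad n) (pow mu n) bP4)|].
  have -> : (fun j => \sum_i \sum_(l | l != i) w (tnth s i, tnth s l) j) =
    (fun j => Ex (pow rad n) (fun b => 4 * D b s j)) by apply/funext => j; exact: avg.
  have b4 j : bm (fun b => 4 * D b s j).
    by apply: bmM; [exact: bm_cst|exact: (bm_sec2 s (bD j))].
  apply: (le_trans (mx_Ex_powR (pow rad n) r1 b4)).
  rewrite le_eqVlt; apply/orP; left; apply/eqP; apply: Ex_ext => b.
  by rewrite mxZ ger0_norm// powRM// mx_ge0.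
(* Each use of [type2] costs [2 (4 sqrt (Q n))^r]; two of them give [4 (16 Q n)^r], and the factor 4
   from the averaging finally turns 16 into 64. *)
have step b : Ex (pow mu n) (fun s => mx (D b s) `^ r) <=
    4 * (16 * (Q * n%:R)) `^ r * Ex (pprod mu mu) (fun xy => m xy `^ r).
  have bDb := bm_sec1 b bP.
  rewrite (Ex_splice mu (fun i => tnth b i) bDb) /=.
  pose G (s2 : n.-tuple T) x j : R := \sum_l (~~ tnth b l)%:R * w (x, tnth s2 l) j.
  have DE s1 s2 : D b (splice (fun i => tnth b i) s1 s2) =
      fun j => \sum_i (tnth b i)%:R * G s2 (tnth s1 i) j.
    apply/funext => j; apply: eq_bigr => i _; rewrite mulr_sumr; apply: eq_bigr => l _.
    rewrite !tnth_splice; case: (tnth b i) => /=; last by rewrite !mul0r.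
    by case: (tnth b l); rewrite /= !(mul0r, mul1r).
  have bG j : bm (fun q : T * n.-tuple T => G q.2 q.1 j).
    apply: bm_sum => l; apply: bmM; first exact: bm_cst.
    apply: (bm_pre _ (bw j)); apply: measurable_fun_pair; first exact: measurable_fst.
    by apply: (measurableT_comp (@measurable_tnth _ T n l)); exact: measurable_snd.
  have bGr : bm (fun q : T * n.-tuple T => mx (G q.2 q.1) `^ r).
    by apply: bm_powR; [exact: bm_mx|exact: ltW].
  set c := (4 * Num.sqrt (Q * n%:R)) `^ r.
  have c0 : 0 <= 2 * c by rewrite mulr_ge0// powR_ge0.
  pose W s2 := Ex mu (fun x => mx (G s2 x) `^ r).
  have bW : bm W := bm_Ex2 mu (pow mu n) bGr.
  have bmr : bm (fun xy => m xy `^ r) by apply: bm_powR => //; exact: ltW.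
  apply: (@le_trans _ _ (Ex (pow mu n) (fun s2 => 2 * c * W s2))).
    have bM2 : bm (fun s2 => Ex (pow mu n) (fun s1 =>
        mx (D b (splice (fun i => tnth b i) s1 s2)) `^ r)).
      apply: (@bm_Ex2 _ _ _ _ _ (pow mu n) (pow mu n)
        (fun q => mx (D b (splice (fun i => tnth b i) q.1 q.2)) `^ r)).
      by apply: (bm_pre _ bDb); exact: measurable_splice.
    apply: Ex_le => [||s2]; [exact: bm_itg|exact/itgZ/bm_itg|].
    have E1 : Ex (pow mu n) (fun s1 => mx (D b (splice (fun i => tnth b i) s1 s2)) `^ r) =
        Ex (pow mu n) (fun s1 => mx (fun j => \sum_i (tnth b i)%:R * G s2 (tnth s1 i) j) `^ r).
      by apply: Ex_ext => s1; rewrite DE.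
    rewrite E1.
    apply: (@type2 n (fun i x j => (tnth b i)%:R * G s2 x j) (fun _ x => mx (G s2 x)) (W s2));
      [exact: n0| | | | |by move=> _; exact: lexx].
    - by move=> i j; apply: bmM; [exact: bm_cst|exact: (bm_sec2 s2 (bG j))].
    - move=> i j; rewrite ExZ; last exact: (bm_itg mu (bm_sec2 s2 (bG j))).
      rewrite Ex_sum; last first.
        by move=> l; apply/itgZ/bm_itg; exact: (bm_sec2 (tnth s2 l) (bw j)).
      rewrite big1; first exact: mulr0.
      move=> l _; rewrite ExZ; first by rewrite wx mulr0.
      exact: (bm_itg mu (bm_sec2 (tnth s2 l) (bw j))).
    - by move=> i; apply: bm_mx => j; exact: (bm_sec2 s2 (bG j)).
    - move=> i x j; rewrite normrM; apply: le_trans (le_mx (G s2 x) j).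
      apply: ler_piMl; first exact: normr_ge0.
      by rewrite ger0_norm; [exact: natb_le1|exact: ler0n].
  rewrite ExZ; last exact: bm_itg.
  rewrite /W -(Ex_swap mu (pow mu n) bGr) /=.
  have bX := bm_Ex mu (pow mu n) bGr.
  apply: (@le_trans _ _ (2 * c * Ex mu (fun x => 2 * c * Ex mu (fun y => m (x, y) `^ r)))).
    apply: ler_wpM2l => //.
    have bXY := bm_Ex mu mu bmr.
    apply: Ex_le => [||x]; [exact: bm_itg|exact/itgZ/bm_itg|].
    apply: (@type2 n (fun l y j => (~~ tnth b l)%:R * w (x, y) j) (fun _ y => m (x, y))
      (Ex mu (fun y => m (x, y) `^ r)));
      [exact: n0| | | | |by move=> _; exact: lexx].
    - by move=> i j; apply: bmM; [exact: bm_cst|exact: (bm_sec1 x (bw j))].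
    - move=> i j; rewrite ExZ; first by rewrite wy mulr0.
      exact: (bm_itg mu (bm_sec1 x (bw j))).
    - by move=> i; exact: (bm_sec1 x bmm).
    - move=> i y j; rewrite normrM; apply: le_trans (wm (x, y) j).
      apply: ler_piMl; first exact: normr_ge0.
      by rewrite ger0_norm; [exact: natb_le1|exact: ler0n].
  rewrite ExZ; last exact/bm_itg/(bm_Ex mu mu bmr).
  have -> : Ex mu (fun x => Ex mu (fun y => m (x, y) `^ r)) = Ex (pprod mu mu) (fun xy => m xy `^ r).
    by rewrite Ex_pprod; [by []|exact: bm_itg|move=> x; exact/bm_itg/(bm_sec1 x bmr)].
  rewrite mulrA le_eqVlt; apply/orP; left; apply/eqP; congr (_ * _).
  have qn : 0 <= Q * n%:R by rewrite mulr_ge0// ltW.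
  have -> : 2 * c * (2 * c) = 4 * (c * c) by ring.
  congr (_ * _); rewrite /c -powRM ?mulr_ge0 ?sqrtr_ge0//; congr (_ `^ _).
  have -> : 4 * Num.sqrt (Q * n%:R) * (4 * Num.sqrt (Q * n%:R)) = 16 * Num.sqrt (Q * n%:R) ^+ 2 by ring.
  by rewrite sqr_sqrtr.
rewrite -(Ex_swap (pow rad n) (pow mu n) bP4) /=.
set m_r := Ex (pprod mu mu) _ in step *.
rewrite -[leRHS](Ex_cst (pow rad n)); apply: Ex_le => [||b].
- exact/bm_itg/(bm_Ex (pow rad n) (pow mu n) bP4).
- exact: itg_cst.
- rewrite ExZ; last exact: (bm_itg (pow mu n) (bm_sec1 b bP)).
  apply: (le_trans (ler_wpM2l (powR_ge0 _ _) (step b))).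
  have qn : 0 <= Q * n%:R by rewrite mulr_ge0// ltW.
  have -> : 64 * (Q * n%:R) = 4 * (16 * (Q * n%:R)) by ring.
  have qn16 : 0 <= 16 * (Q * n%:R) := mulr_ge0 (ler0n _ 16) qn.
  rewrite (powRM r (ler0n _ 4) qn16).
  by rewrite le_eqVlt; apply/orP; left; apply/eqP; ring.
Qed.

End type2.

(** * Truncated Bernstein inequality *)

Section bernstein.
Context {R : realType} {d : measure_display} {T : measurableType d}.
Variable mu : probability T R.

Lemma bm_expR (f : T -> R) : bm f -> bm (fun x => expR (f x)).
Proof.
move=> bf; apply: (bm_post (phi := expR)) bf => // M; exists (expR M) => x.
by rewrite ler_norml => /andP[_ xM]; rewrite ger0_norm ?expR_ge0// ler_expR.
Qed.

Lemma Pr_powR_markov (f : T -> R) (r a W : R) : bm f -> (forall x, 0 <= f x) -> 0 <= r -> 0 < a ->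
  Ex mu (fun x => f x `^ r) <= W -> Pr mu (fun x => a <= f x) <= W / a `^ r.
Proof.
move=> bf f0 r0 a0 fW; have ar0 : 0 < a `^ r by exact: powR_gt0.
have bfr := bm_powR bf r0.
apply: (@le_trans _ _ (Ex mu (fun x => f x `^ r) / a `^ r)); last first.
  by rewrite ler_pM2r ?invr_gt0.
apply: le_trans (Pr_markov (bm_itg mu bfr) (fun x => powR_ge0 _ _) ar0).
apply: Pr_mono; [by apply: mb_le => //; have [] := bf|by apply: mb_le => //; have [] := bfr|move=> x af].
by apply: ge0_ler_powR => //; rewrite nnegrE// ltW.
Qed.

(* The truncated exponential moment: on the event where all summands stay below
   [M] nothing is lost by replacing [v] with [min v M]. *)
Lemma bernstein_tail n (v m : T -> R) (V M t lam : R) : bm v -> bm m ->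
  (forall x, v x <= m x) -> Ex mu (fun x => v x ^+ 2) <= V -> 0 <= M ->
  0 <= lam -> lam * M <= 2^-1 ->
  Pr (pow mu n) (fun s => [forall i, m (tnth s i) <= M] &&
    (t <= \sum_i v (tnth s i) - n%:R * Ex mu v)) <=
  expR (- (lam * t) + 2 * n%:R * lam ^+ 2 * V).
Proof.
move=> bv bmm vm vV M0 lam0 lamM.
pose u x := Num.min (v x) M.
have bu : bm u.
  rewrite (_ : u = fun x => - Num.max (- v x) (- M)).
    by apply: bmN; apply: bm_max; [exact: bmN|exact: bm_cst].
  by apply/funext => x; rewrite /u oppr_max !opprK.
have blu : bm (fun x => expR (lam * u x)).
  by apply: bm_expR; apply: bmM => //; exact: bm_cst.
pose W := expR (lam * Ex mu v + 2 * lam ^+ 2 * V).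
have EW : Ex mu (fun x => expR (lam * u x)) <= W.
  apply: (@le_trans _ _ (Ex mu (fun x => 1 + (lam * v x + 2 * lam ^+ 2 * v x ^+ 2)))).
    apply: Ex_le; [exact: bm_itg| |move=> x].
      apply: itgD; first exact: itg_cst.
      by apply: itgD; apply: itgZ; apply: bm_itg => //; exact: bmX.
    have ux : lam * u x <= 2^-1.
      by apply: le_trans lamM; rewrite ler_wpM2l// ge_min lexx orbT.
    apply: (le_trans (expR_quadratic ux)).
    rewrite -addrA lerD2l; apply: lerD; first by rewrite ler_wpM2l// ge_min lexx.
    rewrite exprMn mulrA ler_wpM2l ?mulr_ge0 ?sqr_ge0//.
    rewrite -[leLHS]real_normK ?num_real// -[leRHS]real_normK ?num_real//.
    rewrite ler_sqr ?nnegrE// /u; case: (leP (v x) M) => // Mv.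
    by rewrite !ger0_norm// ltW// (le_lt_trans M0).
  have i1 : itg mu (fun x => lam * v x) by apply: itgZ; exact: bm_itg.
  have i2 : itg mu (fun x => 2 * lam ^+ 2 * v x ^+ 2) by apply/itgZ/bm_itg/bmX.
  rewrite ExD; [|exact: itg_cst|exact: itgD].
  rewrite ExD// Ex_cst ExZ; last exact: bm_itg.
  rewrite ExZ; last exact/bm_itg/bmX.
  apply: le_trans (expR_ge1Dx _); rewrite lerD2l lerD2l ler_wpM2l//.
  by rewrite mulr_ge0// sqr_ge0.
have bP : bm (fun s : n.-tuple T => \prod_i expR (lam * u (tnth s i))).
  by apply: bm_prod => i; exact: (bm_tnth i blu).
pose c := expR (- (lam * (t + n%:R * Ex mu v))).
apply: (@le_trans _ _ (Ex (pow mu n) (fun s => c * \prod_i expR (lam * u (tnth s i))))).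
  have mE : mb (fun s : n.-tuple T => [forall i, m (tnth s i) <= M] &&
      (t <= \sum_i v (tnth s i) - n%:R * Ex mu v)).
    apply: mb_and.
      by apply: mb_forall => i; apply: mb_le => //; have [] := bm_tnth i bmm.
    apply: mb_le => //; apply: measurable_funB => //.
    by apply: measurable_sum => i; have [] := bm_tnth i bv.
  apply: Ex_le; [exact/bm_itg/mb_bm|by apply: itgZ; exact: bm_itg|move=> s].
  case: (boolP (_ && _)) => [/andP[/forallP sM st]|_]; last first.
    by rewrite mulr_ge0 ?expR_ge0// prodr_ge0// => i _; exact: expR_ge0.
  rewrite -expR_sum -expRD -[leLHS]expR0 ler_expR -mulr_sumr.
  rewrite (eq_bigr (fun i => v (tnth s i))); last first.
    by move=> i _; rewrite /u min_l// (le_trans (vm _)).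
  rewrite -mulrN -mulrDr; apply: mulr_ge0 => //; lra.
rewrite ExZ; last exact: bm_itg.
rewrite (Ex_prod mu (fun=> blu)) prodr_const card_ord.
apply: (@le_trans _ _ (c * W ^+ n)).
  apply: ler_wpM2l; first exact: expR_ge0.
  apply: lerXn2r; rewrite ?nnegrE ?expR_ge0//; apply: Ex_ge0 => x; exact: expR_ge0.
rewrite /c /W -expRM_natl -expRD ler_expR le_eqVlt; apply/orP; left; apply/eqP; ring.
Qed.

Lemma bernstein_max n (J : finType) (v : T -> J -> R) (m : T -> R) (V M x : R) :
  (forall j, bm (fun x => v x j)) -> bm m -> (forall x j, `|v x j| <= m x) ->
  (forall j, Ex mu (fun x => v x j ^+ 2) <= V) -> 0 < V -> 0 < M -> 0 < x -> (0 < n)%N ->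
  Pr (pow mu n) (fun s => [forall i, m (tnth s i) <= M] &&
    [exists j, 4 * M * x + 2 * Num.sqrt (2 * n%:R * V * x) <=
      `|\sum_i v (tnth s i) j - n%:R * Ex mu (fun x => v x j)|]) <=
  2 * #|J|%:R * expR (- x).
Proof.
move=> bv bmm vm vV V0 M0 x0 n0.
have n0' : (0 : R) < n%:R by rewrite ltr0n.
(* With this [a] the threshold equals [2 x (2 M + a)]. For [lam = 1 / (2 M + a)] the linear part of
   the exponent is [- 2 x] and the quadratic part at most [x], while [lam M <= 1 / 2] as the tail
   bound demands. *)
pose a := Num.sqrt (2 * n%:R * V / x).
have a0 : 0 < a by rewrite sqrtr_gt0 divr_gt0// !mulr_gt0.
have a2 : a ^+ 2 = 2 * n%:R * V / x by rewrite sqr_sqrtr// divr_ge0 ?(ltW x0)// !mulr_ge0// ltW.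
have ax : a * x = Num.sqrt (2 * n%:R * V * x).
  have -> : 2 * n%:R * V * x = (2 * n%:R * V / x) * x ^+ 2 by field; rewrite gt_eqF.
  by rewrite sqrtrM ?sqrtr_sqr ?ger0_norm// ?(ltW x0)// divr_ge0 ?(ltW x0)// !mulr_ge0// ltW.
set t := 4 * M * x + _.
pose lam := (2 * M + a)^-1.
have d0 : 0 < 2 * M + a by rewrite addr_gt0// mulr_gt0.
have lam0 : 0 <= lam by rewrite invr_ge0 ltW.
have lamM : lam * M <= 2^-1.
  by rewrite /lam mulrC ler_pdivrMr// mulrDr mulrA mulVf ?mul1r ?lerDl ?mulr_ge0 ?invr_ge0 ?(ltW a0)// pnatr_eq0.
have lamt : lam * t = 2 * x.
  have -> : t = 2 * x * (2 * M + a) by rewrite /t -ax; ring.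
  by rewrite /lam; field; rewrite gt_eqF.
have lamV : 2 * n%:R * lam ^+ 2 * V <= x.
  have -> : 2 * n%:R * lam ^+ 2 * V = lam ^+ 2 * (a ^+ 2 * x) by rewrite a2; field; rewrite gt_eqF.
  rewrite mulrA -exprMn ler_piMl ?(ltW x0)// expr_le1// ?mulr_ge0 ?(ltW a0)//.
  by rewrite /lam mulrC ler_pdivrMr// mul1r lerDr mulr_ge0// ltW.
have tail (s : R) (j : J) : s ^+ 2 = 1 ->
  Pr (pow mu n) (fun s' => [forall i, m (tnth s' i) <= M] &&
    (t <= \sum_i s * v (tnth s' i) j - n%:R * Ex mu (fun x => s * v x j))) <= expR (- x).
  move=> s2.
  have sn : `|s| = 1 by apply/eqP; rewrite -sqrp_eq1// real_normK ?num_real// s2.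
  have := @bernstein_tail n (fun x => s * v x j) m V M t lam.
  move=> h; apply: (le_trans (h _ bmm _ _ (ltW M0) lam0 lamM)).
  - by apply: bmM => //; exact: bm_cst.
  - by move=> y; apply: le_trans (vm y j); rewrite (le_trans (ler_norm _))// normrM sn mul1r.
  - by under Ex_ext do rewrite exprMn s2 mul1r.
  - by rewrite ler_expR lamt; lra.
have mA : mb (fun s : n.-tuple T => [forall i, m (tnth s i) <= M]).
  by apply: mb_forall => i; apply: mb_le => //; have [] := bm_tnth i bmm.
have mT (s : R) j : mb (fun s' : n.-tuple T => [forall i, m (tnth s' i) <= M] &&
    (t <= \sum_i s * v (tnth s' i) j - n%:R * Ex mu (fun x => s * v x j))).
  apply: mb_and => //; apply: mb_le => //; apply: measurable_funB => //.
  apply: measurable_sum => i; apply: measurable_funM => //.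
  by have [] := bm_tnth i (bv j).
have msum j : measurable_fun setT (fun s : n.-tuple T => \sum_i v (tnth s i) j).
  by apply: measurable_sum => i; have [] := bm_tnth i (bv j).
apply: (@le_trans _ _ (Pr (pow mu n) (fun s' => [exists j,
    ([forall i, m (tnth s' i) <= M] &&
    (t <= \sum_i 1 * v (tnth s' i) j - n%:R * Ex mu (fun x => 1 * v x j))) ||
    ([forall i, m (tnth s' i) <= M] &&
    (t <= \sum_i -1 * v (tnth s' i) j - n%:R * Ex mu (fun x => -1 * v x j)))]))).
  apply: Pr_mono.
  - apply: mb_and => //; apply: mb_exists => j; apply: mb_le => //.
    by apply: measurableT_comp => //; apply: measurable_funB.
  - by apply: mb_exists => j; apply: mb_or.
  - move=> s /andP[sM /existsP[j hj]]; apply/existsP; exists j; rewrite sM /=.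
    rewrite -!mulr_sumr ExZ; last exact/bm_itg.
    rewrite ExZ; last exact/bm_itg.
    move: hj; set A := \sum_i _; set E := Ex mu _ => hj.
    have [D0|D0] := leP 0 (A - n%:R * E).
      by rewrite ger0_norm// in hj; rewrite !mul1r hj.
    rewrite ltr0_norm// in hj.
    have -> : -1 * A - n%:R * (-1 * E) = - (A - n%:R * E) by ring.
    by rewrite hj orbT.
apply: (le_trans (Pr_exists _ _)) => [j|]; first by apply: mb_or.
apply: (@le_trans _ _ (\sum_(j : J) (expR (- x) + expR (- x)))).
  apply: ler_sum => j _; apply: (le_trans (Pr_or _ (mT 1 j) (mT (-1) j))).
  by apply: lerD; apply: tail; rewrite ?expr1n ?sqrrN ?expr1n.
by rewrite sumr_const -mulr2n -[leLHS]mulr_natr -mulr_natl; rewrite le_eqVlt; apply/orP; left; apply/eqP; ring.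
Qed.

End bernstein.

(** * Hoeffding decomposition *)

Section hoeffding_decomposition.
Context {R : realType} {d : measure_display} {T : measurableType d} (J : finType).
Variables (mu : probability T R) (h : T * T -> J -> R).
Hypothesis bh : forall j, bm (fun xy => h xy j).

Definition hmean j : R := Ex (pprod mu mu) (fun xy => h xy j).
Definition hproj x j : R := Ex mu (fun y => h (x, y) j) - hmean j.
(** Centred given the first argument only; given the second one its mean is the projection. This is
    the form suited to the row averages, in which the first argument is fixed. [k2] removes the
    second projection as well and is completely degenerate. *)
Definition k1 xy j : R := h xy j - hmean j - hproj xy.1 j.
Definition k2 xy j : R := k1 xy j - hproj xy.2 j.

Lemma bm_hproj j : bm (fun x => hproj x j).
Proof. by apply: bmB; [exact: (bm_Ex mu mu (bh j))|exact: bm_cst]. Qed.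

Lemma bm_on_fst (f : T -> R) : bm f -> bm (fun xy : T * T => f xy.1).
Proof. by move=> bf; apply: (bm_pre _ bf); exact: measurable_fst. Qed.

Lemma bm_on_snd (f : T -> R) : bm f -> bm (fun xy : T * T => f xy.2).
Proof. by move=> bf; apply: (bm_pre _ bf); exact: measurable_snd. Qed.

Lemma bm_k1 j : bm (fun xy => k1 xy j).
Proof.
apply: bmB; first by apply: bmB => //; exact: bm_cst.
exact: (bm_on_fst (bm_hproj j)).
Qed.

Lemma bm_k2 j : bm (fun xy => k2 xy j).
Proof. by apply: bmB; [exact: bm_k1|exact: (bm_on_snd (bm_hproj j))]. Qed.

Lemma hmeanE j : hmean j = Ex mu (fun x => Ex mu (fun y => h (x, y) j)).
Proof.
rewrite /hmean Ex_pprod; [by []|exact: (bm_itg _ (bh j))|].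
by move=> x; exact: (bm_itg mu (bm_sec1 x (bh j))).
Qed.

Lemma Ex_hproj j : Ex mu (fun x => hproj x j) = 0.
Proof.
rewrite ExB; [|exact: (bm_itg mu (bm_Ex mu mu (bh j)))|exact: itg_cst].
by rewrite Ex_cst hmeanE subrr.
Qed.

Lemma Ex_k1 x j : Ex mu (fun y => k1 (x, y) j) = 0.
Proof.
have i1 := bm_itg mu (bm_sec1 x (bh j)).
have -> : (fun y => k1 (x, y) j) = fun y => h (x, y) j - (hmean j + hproj x j).
  by apply/funext => y; rewrite /k1 /=; ring.
by rewrite ExB//; [rewrite Ex_cst /hproj; ring|exact: itg_cst].
Qed.

Hypothesis sym : forall x y j, h (x, y) j = h (y, x) j.

Lemma Ex_k1_fst y j : Ex mu (fun x => k1 (x, y) j) = hproj y j.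
Proof.
have i1 := bm_itg mu (bm_sec2 y (bh j)).
rewrite ExB; [|by apply: itgB => //; exact: itg_cst|exact: (bm_itg mu (bm_hproj j))].
rewrite ExB//; last exact: itg_cst.
rewrite Ex_cst Ex_hproj subr0 /hproj; congr (_ - _).
by apply: Ex_ext => x; exact: sym.
Qed.

Lemma Ex_k2 x j : Ex mu (fun y => k2 (x, y) j) = 0.
Proof.
rewrite ExB; [|exact: (bm_itg mu (bm_sec1 x (bm_k1 j)))|exact: (bm_itg mu (bm_hproj j))].
by rewrite Ex_k1 Ex_hproj subrr.
Qed.

Lemma Ex_k2_fst y j : Ex mu (fun x => k2 (x, y) j) = 0.
Proof.
have -> : (fun x => k2 (x, y) j) = fun x => k1 (x, y) j - hproj y j by [].
rewrite ExB; [|exact: (bm_itg mu (bm_sec2 y (bm_k1 j)))|exact: itg_cst].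
by rewrite Ex_k1_fst Ex_cst subrr.
Qed.

Lemma half_sum_le (a b A : R) : a <= A -> b <= A -> 2^-1 * (a + b) <= A.
Proof. by move=> ? ?; lra. Qed.

Section moments.
Variables (r W : R).
Hypothesis r1 : 1 <= r.
Hypothesis hW : Ex (pprod mu mu) (fun xy => mx (h xy) `^ r) <= W.

Let r0 : 0 <= r := le_trans ler01 r1.

Lemma mxD_powR (u v : J -> R) :
  mx (fun j => u j + v j) `^ r <= 2 `^ r * (2^-1 * (mx u `^ r + mx v `^ r)).
Proof.
apply: (le_trans (ler_mx_powR r0 (mxD u v))).
have -> : mx u + mx v = 2 * (2^-1 * (mx u + mx v)) by field.
have uv0 : 0 <= 2^-1 * (mx u + mx v).
  by apply: mulr_ge0; rewrite ?invr_ge0// addr_ge0// mx_ge0.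
rewrite (powRM r (ler0n _ 2) uv0).
by apply: ler_wpM2l; [exact: powR_ge0|apply: half_powR => //; exact: mx_ge0].
Qed.

Let bhr : bm (fun xy => mx (h xy) `^ r).
Proof. by apply: bm_powR => //; exact: bm_mx. Qed.

Lemma mx_hmean : mx hmean `^ r <= W.
Proof. exact: le_trans (mx_Ex_powR (pprod mu mu) r1 bh) hW. Qed.

Lemma mx_condE : Ex mu (fun x => mx (fun j => Ex mu (fun y => h (x, y) j)) `^ r) <= W.
Proof.
apply: le_trans hW; rewrite Ex_pprod; [|exact: bm_itg|]; last first.
  by move=> x; exact: (bm_itg mu (bm_sec1 x bhr)).
apply: Ex_le => [||x].
- apply/bm_itg/bm_powR => //; apply: bm_mx => j; exact: (bm_Ex mu mu (bh j)).
- exact: (bm_itg mu (bm_Ex mu mu bhr)).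
- by apply: mx_Ex_powR => // j; exact: (bm_sec1 x (bh j)).
Qed.

Lemma mxN (v : J -> R) : mx (fun j => - v j) = mx v.
Proof. by rewrite /mx; apply: eq_bigr => j _; rewrite normrN. Qed.

Lemma Ex_mxD_powR d' (T' : measurableType d') (m : probability T' R) (u v : T' -> J -> R) (A : R) :
  (forall j, bm (fun x => u x j)) -> (forall j, bm (fun x => v x j)) ->
  Ex m (fun x => mx (u x) `^ r) <= A -> Ex m (fun x => mx (v x) `^ r) <= A ->
  Ex m (fun x => mx (fun j => u x j + v x j) `^ r) <= 2 `^ r * A.
Proof.
move=> bu bv uA vA.
have b1 : bm (fun x => mx (u x) `^ r) by apply: bm_powR => //; exact: bm_mx.
have b2 : bm (fun x => mx (v x) `^ r) by apply: bm_powR => //; exact: bm_mx.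
have i12 : itg m (fun x => mx (u x) `^ r + mx (v x) `^ r) by apply: itgD; exact: bm_itg.
apply: (@le_trans _ _ (Ex m (fun x => 2 `^ r * (2^-1 * (mx (u x) `^ r + mx (v x) `^ r))))).
  apply: Ex_le => [||x]; [|by apply: itgZ; exact: itgZ|exact: mxD_powR].
  by apply/bm_itg/bm_powR => //; apply: bm_mx => j; exact: bmD.
rewrite ExZ; last exact: itgZ.
rewrite ExZ// ExD; [|exact: bm_itg..].
apply: ler_wpM2l; [exact: powR_ge0|exact: half_sum_le].
Qed.

Lemma hproj_moment : Ex mu (fun x => mx (hproj x) `^ r) <= 2 `^ r * W.
Proof.
apply: (@Ex_mxD_powR _ _ mu (fun x j => Ex mu (fun y => h (x, y) j)) (fun _ j => - hmean j)).
- by move=> j; exact: (bm_Ex mu mu (bh j)).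
- by move=> j; exact: bm_cst.
- exact: mx_condE.
- by rewrite Ex_cst mxN; exact: mx_hmean.
Qed.

Lemma k1_moment : Ex (pprod mu mu) (fun xy => mx (k1 xy) `^ r) <= 2 `^ r * W.
Proof.
have -> : (fun xy => mx (k1 xy) `^ r) =
   (fun xy => mx (fun j => h xy j + - Ex mu (fun y => h (xy.1, y) j)) `^ r).
  by apply/funext => xy; congr (mx _ `^ _); apply/funext => j; rewrite /k1 /hproj; ring.
have bc j : bm (fun x => Ex mu (fun y => h (x, y) j)) := bm_Ex mu mu (bh j).
apply: (@Ex_mxD_powR _ _ (pprod mu mu) h (fun xy j => - Ex mu (fun y => h (xy.1, y) j))).
- exact: bh.
- by move=> j; apply: bmN; exact: (bm_on_fst (bc j)).
- exact: hW.
have -> : (fun xy : T * T => mx (fun j => - Ex mu (fun y => h (xy.1, y) j)) `^ r) =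
  (fun xy => (fun x => mx (fun j => Ex mu (fun y => h (x, y) j)) `^ r) xy.1).
  by apply/funext => xy; rewrite mxN.
have ic : itg mu (fun x => mx (fun j => Ex mu (fun y => h (x, y) j)) `^ r).
  by apply/bm_itg/bm_powR/r0; exact: bm_mx.
by rewrite (law_Ex (law_fst mu mu) ic); exact: mx_condE.
Qed.

Lemma k2_moment : Ex (pprod mu mu) (fun xy => mx (k2 xy) `^ r) <= 4 `^ r * W.
Proof.
have -> : 4 `^ r * W = 2 `^ r * (2 `^ r * W).
  by rewrite mulrA -powRM//; congr (_ `^ _ * _); ring.
apply: (@Ex_mxD_powR _ _ (pprod mu mu) k1 (fun xy j => - hproj xy.2 j)).
- exact: bm_k1.
- by move=> j; apply: bmN; exact: (bm_on_snd (bm_hproj j)).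
- exact: k1_moment.
- have -> : (fun xy : T * T => mx (fun j => - hproj xy.2 j) `^ r) =
    (fun xy => (fun x => mx (hproj x) `^ r) xy.2) by apply/funext => xy; rewrite mxN.
  have ip : itg mu (fun x => mx (hproj x) `^ r).
    by apply/bm_itg/bm_powR/r0/bm_mx => j; exact: bm_hproj.
  by rewrite (law_Ex (law_snd mu mu) ip); exact: hproj_moment.
Qed.

End moments.

End hoeffding_decomposition.

Section coordinate_moments.
Context {R : realType} {d : measure_display} {T : measurableType d} (J : finType).
Variables (mu : probability T R) (h : T * T -> J -> R).
Hypothesis bh : forall j, bm (fun xy => h xy j).

Lemma mx_unit (v : unit -> R) : mx v = `|v tt|.
Proof. by apply/eqP; rewrite eq_le le_mx andbT; apply: mx_le => // -[]. Qed.

(** The bound for the maximum norm, applied to a single coordinate by taking [unit] as the index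
    set. *)
Lemma hproj_moment_nat (p : nat) (j : J) (W : R) : (0 < p)%N ->
  Ex (pprod mu mu) (fun xy => `|h xy j| ^+ p) <= W ->
  Ex mu (fun x => `|hproj mu h x j| ^+ p) <= 2 ^+ p * W.
Proof.
move=> p0 hW.
have := @hproj_moment R _ T unit mu (fun xy _ => h xy j) (fun _ => bh j) p%:R W.
rewrite ler1n powR_mulrn// => /(_ p0).
have -> : (fun xy => mx (fun _ : unit => h xy j) `^ p%:R) = fun xy => `|h xy j| ^+ p.
  by apply/funext => xy; rewrite powR_mulrn ?mx_ge0// mx_unit.
move=> /(_ hW).
have -> // : (fun x => mx (hproj mu (fun xy (_ : unit) => h xy j) x) `^ p%:R) =
  fun x => `|hproj mu h x j| ^+ p.
by apply/funext => xy; rewrite powR_mulrn ?mx_ge0// mx_unit.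
Qed.

Lemma k1_moment_nat (p : nat) (j : J) (W : R) : (0 < p)%N ->
  Ex (pprod mu mu) (fun xy => `|h xy j| ^+ p) <= W ->
  Ex (pprod mu mu) (fun xy => `|k1 mu h xy j| ^+ p) <= 2 ^+ p * W.
Proof.
move=> p0 hW.
have := @k1_moment R _ T unit mu (fun xy _ => h xy j) (fun _ => bh j) p%:R W.
rewrite ler1n powR_mulrn// => /(_ p0).
have -> : (fun xy => mx (fun _ : unit => h xy j) `^ p%:R) = fun xy => `|h xy j| ^+ p.
  by apply/funext => xy; rewrite powR_mulrn ?mx_ge0// mx_unit.
move=> /(_ hW).
have -> // : (fun x => mx (k1 mu (fun xy (_ : unit) => h xy j) x) `^ p%:R) =
  fun x => `|k1 mu h x j| ^+ p.
by apply/funext => xy; rewrite powR_mulrn ?mx_ge0// mx_unit.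
Qed.

End coordinate_moments.

Lemma triangle5 {R : realType} (G p1 c1 c2 p4 p5 A B a4 a5 : R) :
  `|p1 - G| <= A -> `|c1| <= B -> `|c2| <= B -> `|p4| <= a4 -> `|p5| <= 2 * a4 + 2 * a5 ->
  `|G - (p1 + c1 + c2 + p4 - p5)| <= A + 2 * B + 3 * a4 + 2 * a5.
Proof.
rewrite !ler_norml => /andP[? ?] /andP[? ?] /andP[? ?] /andP[? ?] /andP[? ?].
by apply/andP; split; lra.
Qed.

(** * Decomposition of the jackknife covariance *)

Section empirical_covariance.
Context {R : realType} {d : measure_display} {T : measurableType d} (J : finType).
Variables (mu : probability T R) (h : T * T -> J -> R) (n : nat).
Hypothesis bh : forall j, bm (fun xy => h xy j).
Hypothesis n2 : (1 < n)%N.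
Implicit Types s : n.-tuple T.

Definition rowavg s i j : R := n.-1%:R^-1 * \sum_(l | l != i) h (tnth s i, tnth s l) j.
Definition uavg s j : R :=
  (n%:R * n.-1%:R)^-1 * \sum_i \sum_(l | l != i) h (tnth s i, tnth s l) j.
Definition wt s i j : R := rowavg s i j - uavg s j.
Definition Ghat s j k : R := n%:R^-1 * \sum_i wt s i j * wt s i k.
Definition Gam j k : R := Ex mu (fun x => hproj mu h x j * hproj mu h x k).
Definition rsum s i j : R := n.-1%:R^-1 * \sum_(l | l != i) k1 mu h (tnth s i, tnth s l) j.
(** A product of a projection and a term of a row remainder, centred in its second argument.
    Subtracting [psi], its mean over the first argument, leaves [crossd], which is degenerate in
    both arguments and so accessible to decoupling, while [psi] itself yields a sum of independent
    centred terms. *)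
Definition cross (jk : J * J) (xy : T * T) : R := hproj mu h xy.1 jk.1 * k1 mu h xy jk.2.
Definition psi (jk : J * J) y : R := Ex mu (fun x => cross jk (x, y)).
Definition crossd (jk : J * J) xy : R := cross jk xy - psi jk xy.2.

Let n0 : (0 : R) < n%:R. Proof. by rewrite ltr0n ltnW. Qed.
Let n10 : (0 : R) < n.-1%:R. Proof. by rewrite ltr0n -subn1 subn_gt0. Qed.
Let N0 : n%:R != 0 :> R. Proof. by rewrite gt_eqF. Qed.
Let N1 : n.-1%:R != 0 :> R. Proof. by rewrite gt_eqF. Qed.

Lemma sum_neq_cst (i : 'I_n) (c : R) : \sum_(l < n | l != i) c = n.-1%:R * c.
Proof. by rewrite sumr_const cardC1 card_ord mulr_natl. Qed.

Lemma sum_neq_swap (F : 'I_n -> R) : \sum_i \sum_(l | l != i) F l = n.-1%:R * \sum_l F l.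
Proof.
rewrite (exchange_big_dep xpredT)//= mulr_sumr; apply: eq_bigr => l _.
by rewrite -(sum_neq_cst l); apply: eq_bigl => i; rewrite eq_sym.
Qed.

Lemma rowavgE s i j : rowavg s i j = hmean mu h j + (hproj mu h (tnth s i) j + rsum s i j).
Proof.
rewrite /rowavg /rsum.
have -> : \sum_(l | l != i) h (tnth s i, tnth s l) j =
    \sum_(l | l != i) (hmean mu h j + hproj mu h (tnth s i) j) +
    \sum_(l | l != i) k1 mu h (tnth s i, tnth s l) j.
  by rewrite -big_split; apply: eq_bigr => l _ /=; rewrite /k1 /=; ring.
rewrite sum_neq_cst; field; exact: N1.
Qed.

Lemma uavgE s j : uavg s j = n%:R^-1 * \sum_i rowavg s i j.
Proof. by rewrite /uavg /rowavg -mulr_sumr invfM mulrA. Qed.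

Lemma uavg_hmean s j : uavg s j =
  hmean mu h j + n%:R^-1 * \sum_i (hproj mu h (tnth s i) j + rsum s i j).
Proof.
rewrite uavgE (eq_bigr _ (fun i _ => rowavgE s i j)) big_split /= sumr_const card_ord.
by rewrite -mulr_natl; field.
Qed.

Lemma centered_covariance (u v : 'I_n -> R) :
  n%:R^-1 * \sum_i (u i - n%:R^-1 * \sum_l u l) * (v i - n%:R^-1 * \sum_l v l) =
  n%:R^-1 * (\sum_i u i * v i) - (n%:R^-1 * \sum_l u l) * (n%:R^-1 * \sum_l v l).
Proof.
set a := n%:R^-1 * \sum_l u l; set b := n%:R^-1 * \sum_l v l.
have -> : \sum_i (u i - a) * (v i - b) =
    \sum_i u i * v i - b * \sum_i u i - a * \sum_i v i + n%:R * (a * b).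
  have <- : \sum_(i < n) a * b = n%:R * (a * b) by rewrite sumr_const card_ord mulr_natl.
  rewrite !mulr_sumr -!sumrB -big_split.
  by apply: eq_bigr => i _ /=; ring.
by rewrite /a /b; field.
Qed.

(** The constant [hmean] cancels from [wt], which becomes projection plus row remainder, centred by
    their common average. *)
Lemma GhatE s j k :
  let g i := hproj mu h (tnth s i) in let r i := rsum s i in
  let m j := n%:R^-1 * \sum_i (g i j + r i j) in
  Ghat s j k = n%:R^-1 * (\sum_i g i j * g i k) + n%:R^-1 * (\sum_i g i j * r i k) +
    n%:R^-1 * (\sum_i g i k * r i j) + n%:R^-1 * (\sum_i r i j * r i k) - m j * m k.
Proof.
move=> g r m; rewrite /Ghat.
have wtE i q : wt s i q = (g i q + r i q) - m q.
  by rewrite /wt rowavgE uavg_hmean /m /g /r; ring.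
under eq_bigr do rewrite !wtE.
rewrite centered_covariance -/(m j) -/(m k) -!mulrDr -!big_split; congr (_ * _ - _).
by apply: eq_bigr => i _ /=; ring.
Qed.

(** The Hoeffding decomposition of the mixed term: a linear statistic for Bernstein's inequality and
    a degenerate one for decoupling. *)
Lemma crossE s j k : n%:R^-1 * (\sum_i hproj mu h (tnth s i) j * rsum s i k) =
  n%:R^-1 * \sum_l psi (j, k) (tnth s l) +
  (n%:R * n.-1%:R)^-1 * \sum_i \sum_(l | l != i) crossd (j, k) (tnth s i, tnth s l).
Proof.
have -> : \sum_i \sum_(l | l != i) crossd (j, k) (tnth s i, tnth s l) =
    \sum_i \sum_(l | l != i) cross (j, k) (tnth s i, tnth s l) -
    n.-1%:R * \sum_l psi (j, k) (tnth s l).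
  rewrite -sum_neq_swap -sumrB; apply: eq_bigr => i _; rewrite -sumrB.
  by apply: eq_bigr.
have -> : \sum_i \sum_(l | l != i) cross (j, k) (tnth s i, tnth s l) =
    n.-1%:R * \sum_i hproj mu h (tnth s i) j * rsum s i k.
  rewrite mulr_sumr; apply: eq_bigr => i _.
  transitivity (hproj mu h (tnth s i) j * \sum_(l | l != i) k1 mu h (tnth s i, tnth s l) k).
    by rewrite mulr_sumr.
  rewrite /rsum; field; exact: N1.
by field; rewrite N0 N1.
Qed.

Lemma sqr_mean_le (x : 'I_n -> R) : (n%:R^-1 * \sum_i x i) ^+ 2 <= n%:R^-1 * \sum_i x i ^+ 2.
Proof.
have := centered_covariance x x.
set a := n%:R^-1 * \sum_i x i; rewrite -!expr2 => e.
have : 0 <= n%:R^-1 * \sum_i (x i - a) ^+ 2.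
  by rewrite mulr_ge0 ?invr_ge0 ?(ltW n0)// sumr_ge0// => i _; exact: sqr_ge0.
have -> : \sum_i (x i - a) ^+ 2 = \sum_i (x i - a) * (x i - a) by apply: eq_bigr => i _; rewrite expr2.
have -> : \sum_i x i ^+ 2 = \sum_i x i * x i by apply: eq_bigr => i _; rewrite expr2.
by rewrite e subr_ge0.
Qed.

Lemma mul_mx_le (v : J -> R) j k : `|v j * v k| <= mx v ^+ 2.
Proof. by rewrite normrM expr2; apply: ler_pM => //; exact: le_mx. Qed.

(** The row remainders [a4] occur once in the product of two remainders and twice in the squared
    average, hence [3 * a4]; the projections occur in that square with factor 2, hence [2 * a5]. *)
Lemma Ghat_close s j k (a1 a2 a3 a4 a5 : R) :
  `|\sum_i hproj mu h (tnth s i) j * hproj mu h (tnth s i) k - n%:R * Gam j k| <= a1 ->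
  (forall jk, `|\sum_l psi jk (tnth s l)| <= a2) ->
  (forall jk, `|\sum_i \sum_(l | l != i) crossd jk (tnth s i, tnth s l)| <= a3) ->
  n%:R^-1 * (\sum_i mx (rsum s i) ^+ 2) <= a4 ->
  mx (fun j => \sum_i hproj mu h (tnth s i) j) ^+ 2 <= n%:R ^+ 2 * a5 ->
  `|Gam j k - Ghat s j k| <=
    a1 / n%:R + 2 * (a2 / n%:R + a3 / (n%:R * n.-1%:R)) + 3 * a4 + 2 * a5.
Proof.
move=> h1 h2 h3 h4 h5.
rewrite GhatE (crossE s j k) (crossE s k j).
set g := fun i => hproj mu h (tnth s i).
set m := fun j => n%:R^-1 * \sum_i (g i j + rsum s i j).
have iN : 0 <= (n%:R^-1 : R) by rewrite invr_ge0 ltW.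
have iN2 : 0 <= ((n%:R * n.-1%:R)^-1 : R) by rewrite invr_ge0 mulr_ge0// ltW.
have p1 : `|n%:R^-1 * (\sum_i g i j * g i k) - Gam j k| <= a1 / n%:R.
  have -> : n%:R^-1 * (\sum_i g i j * g i k) - Gam j k =
      n%:R^-1 * (\sum_i g i j * g i k - n%:R * Gam j k) by field.
  by rewrite normrM (ger0_norm iN) mulrC ler_wpM2r.
have p2 jk : `|n%:R^-1 * \sum_l psi jk (tnth s l) + (n%:R * n.-1%:R)^-1 *
    \sum_i \sum_(l | l != i) crossd jk (tnth s i, tnth s l)| <=
    a2 / n%:R + a3 / (n%:R * n.-1%:R).
  apply: (le_trans (ler_normD _ _)); rewrite !normrM (ger0_norm iN) (ger0_norm iN2).
  by apply: lerD; rewrite mulrC ler_wpM2r.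
have p4 : `|n%:R^-1 * (\sum_i rsum s i j * rsum s i k)| <= a4.
  apply: le_trans h4; rewrite normrM (ger0_norm iN) ler_wpM2l//.
  by apply: (le_trans (ler_norm_sum _ _ _)); apply: ler_sum => i _; exact: mul_mx_le.
have p5 : `|m j * m k| <= 2 * a4 + 2 * a5.
  apply: (le_trans (mul_mx_le m j k)).
  pose A := n%:R^-1 * mx (fun j => \sum_i g i j).
  pose C := n%:R^-1 * \sum_i mx (rsum s i).
  have A0 : 0 <= A by rewrite mulr_ge0// mx_ge0.
  have C0 : 0 <= C by rewrite mulr_ge0// sumr_ge0// => i _; exact: mx_ge0.
  have mAC : mx m <= A + C.
    apply: mx_le => [|q]; first exact: addr_ge0.
    rewrite /m big_split mulrDr; apply: (le_trans (ler_normD _ _)).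
    rewrite !normrM (ger0_norm iN); apply: lerD; apply: ler_wpM2l => //.
      exact: (le_mx (fun j => \sum_i g i j)).
    apply: (le_trans (ler_norm_sum _ _ _)); apply: ler_sum => i _; exact: le_mx.
  have A2 : A ^+ 2 <= a5.
    by rewrite /A exprMn exprVn mulrC ler_pdivrMr ?exprn_gt0// mulrC.
  have C2 : C ^+ 2 <= a4 by exact: le_trans (sqr_mean_le _) h4.
  apply: (@le_trans _ _ ((A + C) ^+ 2)).
    by rewrite ler_sqr ?nnegrE ?mx_ge0 ?addr_ge0.
  by have := sqr_ge0 (A - C); rewrite !expr2 in A2 C2 *; lra.
exact: triangle5 p1 (p2 (j, k)) (p2 (k, j)) p4 p5.
Qed.

End empirical_covariance.

(** * Concentration of the jackknife covariance *)

Lemma twice_bounds {R : realType} (r : R) : 2 <= r -> 1 <= 2 * r /\ 0 < 2 * r.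
Proof. by move=> ?; split; lra. Qed.

Section tails.
Context {R : realType} {d : measure_display} {T : measurableType d}.
Variables (m : probability T R) (gam : R).
Hypothesis gam0 : 0 < gam.

(** Markov's inequality of order [r], solved for the level: a small [gam] inflates it only by the
    power [1 / r]. *)
Lemma Pr_tail (f : T -> R) (r A c c' : R) : bm f -> (forall x, 0 <= f x) -> 1 <= r -> 0 < A ->
  0 <= c -> 0 < c' -> Ex m (fun x => f x `^ r) <= c * A `^ r ->
  Pr m (fun x => A * (c' / gam) `^ r^-1 <= f x) <= c / c' * gam.
Proof.
move=> bf f0 r1 A0 c0 c'0 h; have r0 : 0 < r by rewrite (lt_le_trans _ r1).
have cg : 0 < c' / gam by rewrite divr_gt0.
have t0 : 0 < A * (c' / gam) `^ r^-1 by rewrite mulr_gt0// powR_gt0.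
apply: (le_trans (Pr_powR_markov bf f0 (ltW r0) t0 h)).
rewrite (powRM r (ltW A0) (powR_ge0 _ _)) -powRrM mulVf ?gt_eqF// powRr1 ?(ltW cg)//.
rewrite le_eqVlt; apply/orP; left; apply/eqP.
by field; rewrite !gt_eqF// powR_gt0.
Qed.

Lemma sqr_powR (x r : R) : 0 <= x -> (x ^+ 2) `^ r = x `^ (2 * r).
Proof. by move=> x0; rewrite -powR_mulrn// -powRrM. Qed.

Lemma mul_powR_le (r a b : R) : 1 <= r -> 0 <= a -> 0 <= b ->
  (a * b) `^ r <= 2^-1 * (a `^ (2 * r) + b `^ (2 * r)).
Proof.
move=> r1 a0 b0; rewrite -!sqr_powR//.
apply: le_trans (half_powR r1 (sqr_ge0 a) (sqr_ge0 b)).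
apply: ge0_ler_powR; rewrite ?nnegrE ?mulr_ge0 ?addr_ge0 ?sqr_ge0//.
  exact: le_trans r1.
by have := sqr_ge0 (a - b); rewrite !expr2; lra.
Qed.

End tails.

Lemma Pr_exists_coord {R : realType} {d : measure_display} {T : measurableType d}
    (mu : probability T R) n (b : T -> bool) : mb b ->
  Pr (pow mu n) (fun s => [exists i, b (tnth s i)]) <= n%:R * Pr mu b.
Proof.
move=> hb; have hbi i : mb (fun s : n.-tuple T => b (tnth s i)).
  by apply: mb_pre hb; exact: measurable_tnth.
apply: (le_trans (Pr_exists _ hbi)).
rewrite le_eqVlt; apply/orP; left; apply/eqP.
rewrite (eq_bigr (fun _ => Pr mu b)); first by rewrite sumr_const card_ord mulr_natl.
by move=> i _; exact: (Ex_coord i (bm_itg mu (mb_bm hb))).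
Qed.

Lemma Ex_sqr {R : realType} {d : measure_display} {T : measurableType d}
    (m : probability T R) (f : T -> R) : bm f -> Ex m f ^+ 2 <= Ex m (fun x => f x ^+ 2).
Proof.
move=> bf; have := Ex_powR m (bm_abs bf) (fun x => normr_ge0 (f x)) (ler1n R 2).
rewrite powR_mulrn; last by apply: Ex_ge0.
have -> : (fun x => `|f x| `^ 2) = (fun x => f x ^+ 2).
  by apply/funext => x; rewrite powR_mulrn// real_normK ?num_real.
apply: le_trans; rewrite -[leLHS]real_normK ?num_real// ler_sqr ?nnegrE//; last exact: Ex_ge0.
exact: (Ex_abs (bm_itg m bf)).
Qed.

Lemma sqr_mul_le {R : realType} (a b : R) : (a * b) ^+ 2 <= 2^-1 * (`|a| ^+ 4 + `|b| ^+ 4).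
Proof.
have e (x : R) : `|x| ^+ 4 = (x ^+ 2) ^+ 2.
  by rewrite -[X in _ = X ^+ 2]real_normK ?num_real//; ring.
by rewrite !e exprMn; have := sqr_ge0 (a ^+ 2 - b ^+ 2); rewrite !expr2; lra.
Qed.

Lemma seven_eighths {R : realType} (x : R) : 0 <= x -> 7 * (x / 8) <= x.
Proof. by move=> ?; lra. Qed.

Lemma Pr_or_add {R : realType} {d : measure_display} {T : measurableType d}
    (m : probability T R) (a b : T -> bool) (c : R) (k : nat) : mb a -> mb b ->
  Pr m a <= c -> Pr m b <= k%:R * c -> Pr m (fun x => a x || b x) <= k.+1%:R * c.
Proof.
move=> ma mb_b ac bc; apply: (le_trans (Pr_or m ma mb_b)).
by rewrite -natr1 mulrDl mul1r addrC lerD.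
Qed.

Lemma Pr_or7 {R : realType} {d : measure_display} {T : measurableType d}
    (m : probability T R) (e1 e2 e3 e4 e5 e6 e7 : T -> bool) (c : R) :
  mb e1 -> mb e2 -> mb e3 -> mb e4 -> mb e5 -> mb e6 -> mb e7 ->
  Pr m e1 <= c -> Pr m e2 <= c -> Pr m e3 <= c -> Pr m e4 <= c -> Pr m e5 <= c ->
  Pr m e6 <= c -> Pr m e7 <= c ->
  Pr m (fun s => e1 s || (e2 s || (e3 s || (e4 s || (e5 s || (e6 s || e7 s)))))) <= 7 * c.
Proof.
move=> m1 m2 m3 m4 m5 m6 m7 p1 p2 p3 p4 p5 p6 p7.
have m67 := mb_or m6 m7; have m57 := mb_or m5 m67; have m47 := mb_or m4 m57.
have m37 := mb_or m3 m47; have m27 := mb_or m2 m37.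
have p7' : Pr m e7 <= 1%:R * c by rewrite mul1r.
exact: Pr_or_add m1 m27 p1 (Pr_or_add m2 m37 p2 (Pr_or_add m3 m47 p3 (Pr_or_add m4 m57 p4
  (Pr_or_add m5 m67 p5 (Pr_or_add m6 m7 p6 p7'))))).
Qed.

Section covariance_concentration.
Context {R : realType} {d : measure_display} {T : measurableType d} (J : finType).
Variables (mu : probability T R) (h : T * T -> J -> R) (n : nat) (r D B gam Q : R).
Hypothesis bh : forall j, bm (fun xy => h xy j).
Hypothesis sym : forall x y j, h (x, y) j = h (y, x) j.
Hypothesis J0 : (0 < #|J|)%N.
Hypothesis n2 : (1 < n)%N.
Hypothesis r2 : 2 <= r.
Hypothesis D0 : 0 < D.
Hypothesis B0 : 0 < B.
Hypothesis gam0 : 0 < gam.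
Hypothesis hD : Ex (pprod mu mu) (fun xy => mx (h xy) `^ (2 * r)) <= D `^ (2 * r).
Hypothesis hB : forall j, Ex (pprod mu mu) (fun xy => `|h xy j| ^+ 4) <= B ^+ 2.
Hypothesis rQ : 2 * r <= Q.
Hypothesis cardQ : 2 * (#|J| * #|J|)%:R <= expR (Q / 2).
Implicit Types s : n.-tuple T.

Local Notation g := (hproj mu h).
Local Notation mg := (fun x => mx (g x)).
Local Notation mk := (fun xy => mx (k1 mu h xy)).

Definition mpsi y : R := Ex mu (fun x => mg x * mk (x, y)).

Let r1 : 1 <= r. Proof. by apply: le_trans r2; rewrite ler1n. Qed.
Let r0 : 0 < r. Proof. exact: lt_le_trans r1. Qed.
Let rr1 : 1 <= 2 * r. Proof. by have [] := twice_bounds r2. Qed.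
Let n0 : (0 : R) < n%:R. Proof. by rewrite ltr0n ltnW. Qed.
Let n10 : (0 : R) < n.-1%:R. Proof. by rewrite ltr0n -subn1 subn_gt0. Qed.
Let rr0 : 0 < 2 * r. Proof. by have [] := twice_bounds r2. Qed.
Let Q0 : 0 < Q. Proof. exact: lt_le_trans rQ. Qed.

Let bg j : bm (fun x => g x j). Proof. exact: bm_hproj. Qed.
Let bk j : bm (fun xy => k1 mu h xy j). Proof. exact: bm_k1. Qed.
Let bmg : bm mg. Proof. exact: bm_mx. Qed.
Let bmk : bm mk. Proof. exact: bm_mx. Qed.
Let bmgk : bm (fun xy => mg xy.1 * mk xy).
Proof. by apply: bmM => //; exact: (bm_on_fst bmg). Qed.
Let bmpsi : bm mpsi. Proof. exact: (bm_Ex2 mu mu bmgk). Qed.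
Let mpsi0 y : 0 <= mpsi y.
Proof. by apply: Ex_ge0 => x; rewrite mulr_ge0// mx_ge0. Qed.
Let mg0 x : 0 <= mg x. Proof. exact: mx_ge0. Qed.
Let mk0 x : 0 <= mk x. Proof. exact: mx_ge0. Qed.

Let D4 : 2 `^ (2 * r) * D `^ (2 * r) = (4 * D ^+ 2) `^ r.
Proof.
rewrite -(powRM _ (ler0n _ 2) (ltW D0)) -sqr_powR ?mulr_ge0 ?(ltW D0)//; congr (_ `^ _); ring.
Qed.

Lemma hproj_max_moment : Ex mu (fun x => mg x `^ (2 * r)) <= (4 * D ^+ 2) `^ r.
Proof. by rewrite -D4; exact: hproj_moment. Qed.

Let mkq : Ex (pprod mu mu) (fun xy => mk xy `^ (2 * r)) <= (4 * D ^+ 2) `^ r.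
Proof. by rewrite -D4; exact: k1_moment. Qed.

Let mgq2 : Ex mu (fun x => (mg x ^+ 2) `^ r) <= (4 * D ^+ 2) `^ r.
Proof. by apply: le_trans hproj_max_moment; under Ex_ext do rewrite sqr_powR//. Qed.

Let bpow d' (T'' : measurableType d') (f : T'' -> R) : bm f -> bm (fun x => f x `^ r).
Proof. by move=> bf; apply: bm_powR => //; exact: ltW. Qed.

Let bmgkr : bm (fun xy => (mg xy.1 * mk xy) `^ r).
Proof. by apply: bm_powR (ltW r0). Qed.

Let mgkq : Ex (pprod mu mu) (fun xy => (mg xy.1 * mk xy) `^ r) <= (4 * D ^+ 2) `^ r.
Proof.
have bk2 : bm (fun xy => mk xy `^ (2 * r)) by apply: bm_powR => //; exact: ltW.
have bg2 : bm (fun x => mg x `^ (2 * r)) by apply: bm_powR => //; exact: ltW.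
have bg2' := bm_on_fst bg2.
apply: (@le_trans _ _ (Ex (pprod mu mu) (fun xy => 2^-1 * (mg xy.1 `^ (2 * r) + mk xy `^ (2 * r))))).
  apply: Ex_le => [||xy]; [exact: bm_itg|by apply: itgZ; apply: itgD; exact: bm_itg|].
  exact: mul_powR_le.
rewrite ExZ; last by apply: itgD; exact: bm_itg.
rewrite ExD; [|exact: bm_itg..].
have -> : Ex (pprod mu mu) (fun xy => mg xy.1 `^ (2 * r)) = Ex mu (fun x => mg x `^ (2 * r)).
  exact: (law_Ex (law_fst mu mu) (bm_itg mu bg2)).
exact: (half_sum_le hproj_max_moment mkq).
Qed.

Let mpsiq : Ex mu (fun y => mpsi y `^ r) <= (4 * D ^+ 2) `^ r.
Proof.
apply: le_trans mgkq; rewrite (Ex_pprod2 (bm_itg (pprod mu mu) bmgkr)); last first.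
  by move=> y; exact: (bm_itg mu (bm_sec2 y bmgkr)).
apply: Ex_le => [||y]; [exact: (bm_itg mu (bpow bmpsi))|exact: (bm_itg mu (bm_Ex2 mu mu bmgkr))|].
apply: Ex_powR => // [|x]; first exact: (bm_sec2 y bmgk).
by rewrite mulr_ge0.
Qed.

Let D40 : 0 < 4 * D ^+ 2. Proof. by rewrite mulr_gt0// exprn_gt0. Qed.

(** For a non-negative variable whose [r]-th moment is at most [(4 D^2)^r], exceeding this level has
    probability at most [gam / (8 n)], which leaves room for a union over the sample. Both the
    squared envelope of the projection and [mpsi] are of this kind. *)
Definition trunc : R := 4 * D ^+ 2 * (8 * n%:R / gam) `^ r^-1.

Lemma trunc_tail (f : T -> R) : bm f -> (forall x, 0 <= f x) ->
  Ex mu (fun x => f x `^ r) <= (4 * D ^+ 2) `^ r ->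
  Pr (pow mu n) (fun s => [exists i, trunc < f (tnth s i)]) <= gam / 8.
Proof.
move=> bf f0 fr.
have m1 : mb (fun x => trunc < f x) by apply: mb_lt => //; exact: bf.1.
have m2 : mb (fun x => trunc <= f x) by apply: mb_le => //; exact: bf.1.
apply: (le_trans (Pr_exists_coord mu n m1)).
apply: (@le_trans _ _ (n%:R * (1 / (8 * n%:R) * gam))).
  apply: ler_wpM2l; first exact: ltW.
  apply: (@le_trans _ _ (Pr mu (fun x => trunc <= f x))).
    by apply: Pr_mono => // x; exact: ltW.
  apply: Pr_tail => //; [by rewrite mulr_gt0|by rewrite mul1r].
by rewrite le_eqVlt; apply/orP; left; apply/eqP; field; rewrite gt_eqF.
Qed.

Hypothesis gam1 : gam < 1.

Let card1 : (1 : R) <= (#|J| * #|J|)%:R.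
Proof. by rewrite ler1n muln_gt0 J0. Qed.

Let card0 : (0 : R) < (#|J| * #|J|)%:R.
Proof. exact: lt_le_trans card1. Qed.

(** Chosen so that the union over signs and pairs of coordinates, [2 #|J|^2 expR (- xlog)], equals
    [gam / 8]. *)
Definition xlog : R := ln (16 * (#|J| * #|J|)%:R / gam).

Let arg1 : 1 < 16 * (#|J| * #|J|)%:R / gam.
Proof.
rewrite ltr_pdivlMr// mul1r (lt_le_trans gam1)//.
by apply: (le_trans card1); rewrite ler_peMl ?(ltW card0)// ler1n.
Qed.

Let xlog0 : 0 < xlog. Proof. exact: ln_gt0. Qed.

Let union_bound : 2 * #|{: J * J}|%:R * expR (- xlog) = gam / 8.
Proof.
rewrite expRN lnK ?posrE ?(lt_trans _ arg1)// card_prod; field.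
by rewrite (gt_eqF gam0) pnatr_eq0 -lt0n J0.
Qed.

(** Bounds the fourth moments of the projections and of [k1] coordinatewise, hence the second
    moments of products of two of them. The moments of the maximum, through [D], enter Bernstein's
    inequality only via [trunc]. *)
Let V : R := 16 * B ^+ 2.
Let V0 : 0 < V. Proof. by rewrite mulr_gt0// exprn_gt0. Qed.
Let trunc0 : 0 < trunc. Proof. by rewrite mulr_gt0// powR_gt0// divr_gt0// mulr_gt0. Qed.

Definition dev : R := 4 * trunc * xlog + 2 * Num.sqrt (2 * n%:R * V * xlog).

Let g4 j : Ex mu (fun x => `|g x j| ^+ 4) <= V.
Proof.
have := @hproj_moment_nat R _ T J mu h bh 4 j (B ^+ 2) isT (hB j).
by move=> /le_trans; apply; rewrite /V le_eqVlt; apply/orP; left; apply/eqP; ring.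
Qed.

Let k4 j : Ex (pprod mu mu) (fun xy => `|k1 mu h xy j| ^+ 4) <= V.
Proof.
have := @k1_moment_nat R _ T J mu h bh 4 j (B ^+ 2) isT (hB j).
by move=> /le_trans; apply; rewrite /V le_eqVlt; apply/orP; left; apply/eqP; ring.
Qed.

Lemma product_deviation : Pr (pow mu n) (fun s => [forall i, mg (tnth s i) ^+ 2 <= trunc] &&
  [exists jk : J * J, dev <= `|\sum_i g (tnth s i) jk.1 * g (tnth s i) jk.2 -
    n%:R * Ex mu (fun x => g x jk.1 * g x jk.2)|]) <= gam / 8.
Proof.
rewrite -union_bound.
apply: (@bernstein_max R _ T mu n _ (fun x (jk : J * J) => g x jk.1 * g x jk.2)
  (fun x => mg x ^+ 2) V trunc xlog) => //.
- by move=> jk; exact: bmM.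
- exact: bmX.
- by move=> x jk; exact: mul_mx_le.
- move=> jk.
  have b4 j : bm (fun x => `|g x j| ^+ 4) by apply/bmX/bm_abs.
  have i4 : itg mu (fun x => `|g x jk.1| ^+ 4 + `|g x jk.2| ^+ 4) by apply: itgD; exact: bm_itg.
  apply: (@le_trans _ _ (Ex mu (fun x => 2^-1 * (`|g x jk.1| ^+ 4 + `|g x jk.2| ^+ 4)))).
    apply: Ex_le => [||x]; [by apply/bm_itg/bmX/bmM|exact: itgZ|exact: sqr_mul_le].
  rewrite ExZ// ExD; [|exact: bm_itg..].
  exact: half_sum_le.
- exact: ltnW.
Qed.

Let bcross jk : bm (fun xy => cross mu h jk xy).
Proof. by apply: bmM => //; exact: (bm_on_fst (bg jk.1)). Qed.

Let bpsi jk : bm (fun y => psi mu h jk y).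
Proof. exact: (bm_Ex2 mu mu (bcross jk)). Qed.

Let Ex_cross_snd jk x : Ex mu (fun y => cross mu h jk (x, y)) = 0.
Proof.
rewrite /cross /= ExZ; last exact: (bm_itg mu (bm_sec1 x (bk jk.2))).
by rewrite Ex_k1// mulr0.
Qed.

Let Ex_psi jk : Ex mu (fun y => psi mu h jk y) = 0.
Proof.
rewrite /psi -(Ex_swap mu mu (bcross jk)) -[RHS](Ex_cst mu).
by apply: Ex_ext => x; exact: Ex_cross_snd.
Qed.

Let psi_mpsi jk y : `|psi mu h jk y| <= mpsi y.
Proof.
have bc := bm_sec2 y (bcross jk).
apply: (le_trans (Ex_abs (bm_itg mu bc))); apply: Ex_le => [||x].
- exact/itg_abs/bm_itg.
- exact: (bm_itg mu (bm_sec2 y bmgk)).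
- by rewrite normrM; apply: ler_pM => //; exact: le_mx.
Qed.

Let psi2 jk : Ex mu (fun y => psi mu h jk y ^+ 2) <= V.
Proof.
have bc2 : bm (fun xy => cross mu h jk xy ^+ 2) by exact: bmX.
apply: (@le_trans _ _ (Ex (pprod mu mu) (fun xy => cross mu h jk xy ^+ 2))).
  rewrite (Ex_pprod2 (bm_itg (pprod mu mu) bc2)); last first.
    by move=> y; exact: (bm_itg mu (bm_sec2 y bc2)).
  apply: Ex_le => [||y]; [by apply/bm_itg/bmX|exact: (bm_itg mu (bm_Ex2 mu mu bc2))|].
  exact: (Ex_sqr mu (bm_sec2 y (bcross jk))).
have b4 : bm (fun x => `|g x jk.1| ^+ 4) by apply/bmX/bm_abs.
have b4' : bm (fun xy => `|k1 mu h xy jk.2| ^+ 4) by apply/bmX/bm_abs.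
have b4f := bm_on_fst b4.
have i4 : itg (pprod mu mu) (fun xy => `|g xy.1 jk.1| ^+ 4 + `|k1 mu h xy jk.2| ^+ 4).
  by apply: itgD; exact: bm_itg.
apply: (@le_trans _ _ (Ex (pprod mu mu) (fun xy => 2^-1 * (`|g xy.1 jk.1| ^+ 4 + `|k1 mu h xy jk.2| ^+ 4)))).
  by apply: Ex_le => [||xy]; [exact: bm_itg|exact: itgZ|exact: sqr_mul_le].
rewrite ExZ// ExD; [|exact: bm_itg..].
apply: half_sum_le => //.
by rewrite (law_Ex (law_fst mu mu) (bm_itg mu b4)).
Qed.

Lemma psi_deviation : Pr (pow mu n) (fun s => [forall i, mpsi (tnth s i) <= trunc] &&
  [exists jk : J * J, dev <= `|\sum_i psi mu h jk (tnth s i) -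
    n%:R * Ex mu (fun x => psi mu h jk x)|]) <= gam / 8.
Proof.
rewrite -union_bound.
apply: (@bernstein_max R _ T mu n _ (fun x (jk : J * J) => psi mu h jk x) mpsi V trunc xlog) => //.
exact: ltnW.
Qed.

(** 512 = 64 * 8: [decoupling] supplies 64, and the envelope of [crossd], a sum of two functions of
    size [4 D^2], supplies 8. The 32 turns the prefactor 4 of the moment bound into probability
    [gam / 8]. *)
Definition degdev : R := 512 * (Q * n%:R) * D ^+ 2 * (32 / gam) `^ r^-1.

Let csum s (jk : J * J) : R :=
  \sum_i \sum_(l | l != i) crossd mu h jk (tnth s i, tnth s l).

Let bcrossd jk : bm (fun xy => crossd mu h jk xy).
Proof. by apply: bmB => //; exact: (bm_on_snd (bpsi jk)). Qed.

Let bcsum jk : bm (fun s => csum s jk).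
Proof.
apply: bm_sum => i; apply: bm_sum => l.
by apply: (bm_pre _ (bcrossd jk)); apply: measurable_fun_pair; exact: measurable_tnth.
Qed.

Lemma degenerate_deviation : Pr (pow mu n) (fun s => degdev <= mx (csum s)) <= gam / 8.
Proof.
pose m xy := mg xy.1 * mk xy + mpsi xy.2.
have bms : bm (fun xy : T * T => mpsi xy.2) := bm_on_snd bmpsi.
have bmm : bm m by exact: bmD.
have rQ' : r <= Q by apply: le_trans rQ; rewrite mulr_natl mulr2n lerDl ltW.
have cJ : 2 * #|{: J * J}|%:R <= expR (Q / 2) by rewrite card_prod.
have J0' : (0 < #|{: J * J}|)%N by rewrite card_prod muln_gt0 J0.
have mr : Ex (pprod mu mu) (fun xy => m xy `^ r) <= (8 * D ^+ 2) `^ r.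
  have -> : (8 * D ^+ 2) `^ r = 2 `^ r * (4 * D ^+ 2) `^ r.
    by rewrite -powRM ?(ltW D40)//; congr (_ `^ _); ring.
  have := @Ex_mxD_powR R unit r r1 _ _ (pprod mu mu) (fun xy _ => mg xy.1 * mk xy)
    (fun xy _ => mpsi xy.2) ((4 * D ^+ 2) `^ r) (fun _ => bmgk) (fun _ => bms).
  have e1 : (fun xy : T * T => mx (fun _ : unit => mg xy.1 * mk xy) `^ r) =
      (fun xy => (mg xy.1 * mk xy) `^ r).
    by apply/funext => xy; rewrite mx_unit ger0_norm// mulr_ge0.
  have e2 : (fun xy : T * T => mx (fun _ : unit => mpsi xy.2) `^ r) = (fun xy => mpsi xy.2 `^ r).
    by apply/funext => xy; rewrite mx_unit ger0_norm.
  have e3 : (fun xy : T * T => mx (fun _ : unit => mg xy.1 * mk xy + mpsi xy.2) `^ r) =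
      (fun xy => m xy `^ r).
    by apply/funext => xy; rewrite mx_unit ger0_norm// addr_ge0// mulr_ge0.
  move=> H; rewrite -e3; apply: H; first by rewrite e1; exact: mgkq.
  by rewrite e2 (law_Ex (law_snd mu mu) (bm_itg mu (bpow bmpsi))); exact: mpsiq.
have dec := @decoupling R _ _ T mu r Q J0' r2 rQ' cJ n (fun xy jk => crossd mu h jk xy) m
  (ltnW n2) bcrossd.
have {}dec : Ex (pow mu n) (fun s => mx (csum s) `^ r) <=
    4 * (64 * (Q * n%:R)) `^ r * Ex (pprod mu mu) (fun xy => m xy `^ r).
  apply: dec => //.
  - move=> y jk.
    have -> : (fun x => crossd mu h jk (x, y)) = fun x => cross mu h jk (x, y) - psi mu h jk y by [].
    rewrite ExB; [|exact: (bm_itg mu (bm_sec2 y (bcross jk)))|exact: itg_cst].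
    by rewrite Ex_cst subrr.
  - move=> x jk; rewrite ExB; [|exact: (bm_itg mu (bm_sec1 x (bcross jk)))|exact: (bm_itg mu (bpsi jk))].
    by rewrite Ex_cross_snd Ex_psi subrr.
  - move=> xy jk; apply: (le_trans (ler_normB _ _)); apply: lerD => //.
    by rewrite normrM; apply: ler_pM => //; exact: le_mx.
have qn : 0 < 64 * (Q * n%:R) by rewrite !mulr_gt0.
have A0 : 0 < 512 * (Q * n%:R) * D ^+ 2.
  exact: mulr_gt0 (mulr_gt0 (ltr0n _ 512) (mulr_gt0 Q0 n0)) (exprn_gt0 2 D0).
have h4 : Ex (pow mu n) (fun s => mx (csum s) `^ r) <= 4 * (512 * (Q * n%:R) * D ^+ 2) `^ r.
  apply: (le_trans dec); rewrite -mulrA; apply: ler_wpM2l => //.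
  have -> : 512 * (Q * n%:R) * D ^+ 2 = (64 * (Q * n%:R)) * (8 * D ^+ 2) by ring.
  rewrite [leRHS](powRM r (ltW qn) (mulr_ge0 (ler0n _ 8) (sqr_ge0 D))).
  by apply: ler_wpM2l => //; exact: powR_ge0.
have := @Pr_tail R _ _ (pow mu n) gam gam0 (fun s => mx (csum s)) r _ 4 32
  (bm_mx bcsum) (fun s => mx_ge0 _) r1 A0 (ler0n _ 4) (ltr0n _ 32) h4.
move=> /le_trans; apply; rewrite le_eqVlt; apply/orP; left; apply/eqP.
by field.
Qed.

Let cardJ1 : 2 * #|J|%:R <= expR (Q / 2).
Proof.
apply: le_trans cardQ; rewrite natrM mulrA ler_peMr ?mulr_ge0//.
by rewrite ler1n.
Qed.

(** 64 = 4^2 * 4: the squared constant of [type2] times the 4 in [4 D^2]. The 16 turns the prefactor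
    2 of that bound into probability [gam / 8]. *)
Definition rowdev : R := 64 * (Q * n%:R) * D ^+ 2 / n.-1%:R ^+ 2 * (16 / gam) `^ r^-1.

Let brsum i j : bm (fun s => rsum mu h s i j).
Proof.
apply: bmM; first exact: bm_cst.
apply: bm_sum => l.
by apply: (bm_pre _ (bk j)); apply: measurable_fun_pair; exact: measurable_tnth.
Qed.

(** Given the [i]-th observation, the row is a sum of independent centred vectors. Its missing
    summand is set to zero, so that all [n] coordinates can be used. *)
Let rsum_moment i : Ex (pow mu n) (fun s => mx (rsum mu h s i) `^ (2 * r)) <=
  2 * (64 * (Q * n%:R) * D ^+ 2 / n.-1%:R ^+ 2) `^ r.
Proof.
have b1 : bm (fun s => mx (rsum mu h s i) `^ (2 * r)).
  by apply: bm_powR; [apply: bm_mx => j; exact: brsum|exact: ltW].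
have bkr : bm (fun xy => mk xy `^ (2 * r)) by apply: bm_powR => //; exact: ltW.
set c := (4 * Num.sqrt (Q * n%:R)) `^ (2 * r).
have c0 : 0 <= c by exact: powR_ge0.
pose f x (l : 'I_n) y j : R := n.-1%:R^-1 * ((l != i)%:R * k1 mu h (x, y) j).
have iN : 0 <= (n.-1%:R^-1 : R) by rewrite invr_ge0 ltW.
have rE s x : rsum mu h (upd s i x) i = fun j => \sum_l f x l (tnth s l) j.
  apply/funext => j; rewrite /rsum mulr_sumr big_mkcond; apply: eq_bigr => l _.
  rewrite !tnth_upd eqxx /f; case: eqP => [->|/eqP li]; first by rewrite /= mul0r mulr0.
  by rewrite mul1r.
rewrite (Ex_upd mu i b1).
pose W x := Ex mu (fun y => (n.-1%:R^-1 * mk (x, y)) `^ (2 * r)).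
have bWr : bm (fun xy => (n.-1%:R^-1 * mk xy) `^ (2 * r)).
  by apply: bm_powR; [apply: bmM => //; exact: bm_cst|exact: ltW].
have bW : bm W := bm_Ex mu mu bWr.
have step x : Ex (pow mu n) (fun s => mx (rsum mu h (upd s i x) i) `^ (2 * r)) <= 2 * c * W x.
  have -> : (fun s => mx (rsum mu h (upd s i x) i) `^ (2 * r)) =
      fun s => mx (fun j => \sum_l f x l (tnth s l) j) `^ (2 * r).
    by apply/funext => s; rewrite rE.
  have r22 : 2 <= 2 * r by apply: le_trans r2 _; rewrite mulr_natl mulr2n lerDl ltW.
  apply: (@type2 R J _ T mu (2 * r) Q J0 r22 rQ cardJ1 n (f x) (fun _ y => n.-1%:R^-1 * mk (x, y)) (W x));
    [exact: ltnW| | | | |by move=> _; exact: lexx].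
  - move=> l j; apply: bmM; first exact: bm_cst.
    by apply: bmM; [exact: bm_cst|exact: (bm_sec1 x (bk j))].
  - move=> l j; have ik := bm_itg mu (bm_sec1 x (bk j)).
    by rewrite /f ExZ ?ExZ// ?Ex_k1 ?mulr0//; exact: itgZ.
  - by move=> _; apply: bmM; [exact: bm_cst|exact: (bm_sec1 x bmk)].
  - move=> l y j; rewrite /f normrM (ger0_norm iN); apply: ler_wpM2l => //.
    rewrite normrM; apply: le_trans (le_mx (k1 mu h (x, y)) j).
    by apply: ler_piMl; [exact: normr_ge0|rewrite ger0_norm; [exact: natb_le1|exact: ler0n]].
have bU := bm_upd i b1.
rewrite -(Ex_swap mu (pow mu n) bU).
apply: (@le_trans _ _ (Ex mu (fun x => 2 * c * W x))).
  apply: Ex_le => [||x]; [exact: (bm_itg mu (bm_Ex mu (pow mu n) bU))|exact/itgZ/bm_itg|exact: step].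
rewrite ExZ; last exact: bm_itg.
have -> : Ex mu W = Ex (pprod mu mu) (fun xy => (n.-1%:R^-1 * mk xy) `^ (2 * r)).
  by rewrite Ex_pprod; [by []|exact: bm_itg|move=> x; exact: (bm_itg mu (bm_sec1 x bWr))].
have -> : (fun xy => (n.-1%:R^-1 * mk xy) `^ (2 * r)) =
    (fun xy => n.-1%:R^-1 `^ (2 * r) * mk xy `^ (2 * r)).
  by apply/funext => xy; rewrite powRM.
rewrite ExZ; last exact: bm_itg.
rewrite -mulrA; apply: ler_wpM2l => //.
have qn : 0 <= Q * n%:R by rewrite mulr_ge0// ltW.
apply: (@le_trans _ _ (c * (n.-1%:R^-1 `^ (2 * r) * (4 * D ^+ 2) `^ r))).
  by apply: (ler_wpM2l c0); apply: ler_wpM2l; [exact: powR_ge0|exact: mkq].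
have s0 : 0 <= 4 * Num.sqrt (Q * n%:R) by rewrite mulr_ge0// sqrtr_ge0.
rewrite /c -!sqr_powR//.
rewrite -(powRM _ (sqr_ge0 _) (ltW D40)) -(powRM _ (sqr_ge0 _)); last first.
  by rewrite mulr_ge0 ?sqr_ge0// ltW.
rewrite le_eqVlt; apply/orP; left; apply/eqP; congr (_ `^ _).
by rewrite exprMn sqr_sqrtr// exprVn; field; rewrite gt_eqF.
Qed.

Lemma row_deviation :
  Pr (pow mu n) (fun s => rowdev <= n%:R^-1 * \sum_i mx (rsum mu h s i) ^+ 2) <= gam / 8.
Proof.
have b2 i : bm (fun s => mx (rsum mu h s i) ^+ 2).
  by apply: bmX; apply: bm_mx => j; exact: brsum.
have bS : bm (fun s => n%:R^-1 * \sum_i mx (rsum mu h s i) ^+ 2).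
  by apply: bmM; [exact: bm_cst|exact: bm_sum].
have iN : 0 <= (n%:R^-1 : R) by rewrite invr_ge0 ltW.
have S0 s : 0 <= n%:R^-1 * \sum_i mx (rsum mu h s i) ^+ 2.
  by rewrite mulr_ge0// sumr_ge0// => i _; exact: sqr_ge0.
set A := 64 * (Q * n%:R) * D ^+ 2 / n.-1%:R ^+ 2.
have A0 : 0 < A by rewrite divr_gt0 ?exprn_gt0// !mulr_gt0 ?exprn_gt0.
have h2 : Ex (pow mu n) (fun s => (n%:R^-1 * \sum_i mx (rsum mu h s i) ^+ 2) `^ r) <= 2 * A `^ r.
  have br i : bm (fun s => mx (rsum mu h s i) `^ (2 * r)).
    by apply: bm_powR; [apply: bm_mx => j; exact: brsum|exact: ltW].
  apply: (@le_trans _ _ (Ex (pow mu n) (fun s => n%:R^-1 * \sum_i mx (rsum mu h s i) `^ (2 * r)))).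
    apply: Ex_le => [||s]; [exact: (bm_itg (pow mu n) (bpow bS))| |].
      by apply: itgZ; apply: itg_sum => i; exact: bm_itg.
    apply: (le_trans (mean_powR (ltnW n2) r1 _)) => [i|]; first exact: sqr_ge0.
    apply: ler_wpM2l => //; apply: ler_sum => i _; rewrite sqr_powR ?mx_ge0//.
  rewrite ExZ; last by apply: itg_sum => i; exact: bm_itg.
  rewrite Ex_sum; last by move=> i; exact: bm_itg.
  rewrite ler_pdivrMl//; apply: (@le_trans _ _ (\sum_(i < n) 2 * A `^ r)).
    by apply: ler_sum => i _; exact: rsum_moment.
  by rewrite sumr_const card_ord -[leLHS]mulr_natl.
have := @Pr_tail R _ _ (pow mu n) gam gam0 _ r A 2 16 bS S0 r1 A0 (ler0n _ 2) (ltr0n _ 16) h2.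
move=> /le_trans; apply; rewrite le_eqVlt; apply/orP; left; apply/eqP; by field.
Qed.

Definition avgdev : R := 64 * (Q * n%:R) * D ^+ 2 * (16 / gam) `^ r^-1.

Lemma mean_deviation :
  Pr (pow mu n) (fun s => avgdev <= mx (fun j => \sum_i g (tnth s i) j) ^+ 2) <= gam / 8.
Proof.
have r22 : 2 <= 2 * r by apply: le_trans r2 _; rewrite mulr_natl mulr2n lerDl ltW.
have bS : bm (fun s : n.-tuple T => mx (fun j => \sum_i g (tnth s i) j) ^+ 2).
  by apply: bmX; apply: bm_mx => j; apply: bm_sum => i; exact: (bm_tnth i (bg j)).
have t2 := @type2 R J _ T mu (2 * r) Q J0 r22 rQ cardJ1 n (fun _ => g) (fun _ => mg)
  ((4 * D ^+ 2) `^ r) (ltnW n2) (fun _ => bg) (fun _ => Ex_hproj mu bh) (fun _ => bmg)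
  (fun _ x => le_mx (g x)) (fun _ => hproj_max_moment).
set A := 64 * (Q * n%:R) * D ^+ 2.
have A0 : 0 < A by rewrite !mulr_gt0 ?exprn_gt0.
have h2 : Ex (pow mu n) (fun s => (mx (fun j => \sum_i g (tnth s i) j) ^+ 2) `^ r) <= 2 * A `^ r.
  have -> : (fun s : n.-tuple T => (mx (fun j => \sum_i g (tnth s i) j) ^+ 2) `^ r) =
      fun s => mx (fun j => \sum_i g (tnth s i) j) `^ (2 * r).
    by apply/funext => s; rewrite sqr_powR ?mx_ge0.
  apply: (le_trans t2); rewrite -mulrA; apply: ler_wpM2l => //.
  have s0 : 0 <= 4 * Num.sqrt (Q * n%:R) by rewrite mulr_ge0// sqrtr_ge0.
  have qn : 0 <= Q * n%:R by rewrite mulr_ge0// ltW.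
  rewrite -sqr_powR// -(powRM _ (sqr_ge0 _) (ltW D40)).
  rewrite le_eqVlt; apply/orP; left; apply/eqP; congr (_ `^ _).
  by rewrite exprMn sqr_sqrtr// /A; ring.
have := @Pr_tail R _ _ (pow mu n) gam gam0 _ r A 2 16 bS (fun s => sqr_ge0 _) r1 A0
  (ler0n _ 2) (ltr0n _ 16) h2.
move=> /le_trans; apply; rewrite le_eqVlt; apply/orP; left; apply/eqP; by field.
Qed.

Definition covdev : R := dev / n%:R + 2 * (dev / n%:R + degdev / (n%:R * n.-1%:R)) +
  3 * rowdev + 2 * (avgdev / n%:R ^+ 2).

Let mbE (f : n.-tuple T -> R) (c : R) : bm f -> mb (fun s => c <= f s).
Proof. by move=> bf; apply: mb_le => //; exact: bf.1. Qed.

Let mbAll (f : T -> R) (c : R) : bm f -> mb (fun s : n.-tuple T => [forall i, f (tnth s i) <= c]).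
Proof. by move=> bf; apply: mb_forall => i; apply: mb_le => //; exact: (bm_tnth i bf).1. Qed.

(** Seven exceptional events of probability [gam / 8] each: two for the truncation, two from
    Bernstein's inequality, three from moment bounds. On the complement the estimate is the
    deterministic [Ghat_close]. *)
Lemma covariance_bound :
  Pr (pow mu n) (fun s => [exists j, [exists k, covdev < `|Gam mu h j k - Ghat h s j k|]]) <= gam.
Proof.
pose e1 s := [exists i, trunc < mg (tnth s i) ^+ 2].
pose e2 s := [exists i, trunc < mpsi (tnth s i)].
pose e3 s := [forall i, mg (tnth s i) ^+ 2 <= trunc] &&
  [exists jk : J * J, dev <= `|\sum_i g (tnth s i) jk.1 * g (tnth s i) jk.2 -
    n%:R * Ex mu (fun x => g x jk.1 * g x jk.2)|].
pose e4 s := [forall i, mpsi (tnth s i) <= trunc] &&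
  [exists jk : J * J, dev <= `|\sum_i psi mu h jk (tnth s i) -
    n%:R * Ex mu (fun x => psi mu h jk x)|].
pose e5 s := degdev <= mx (csum s).
pose e6 s := rowdev <= n%:R^-1 * \sum_i mx (rsum mu h s i) ^+ 2.
pose e7 s := avgdev <= mx (fun j => \sum_i g (tnth s i) j) ^+ 2.
have bmg2 : bm (fun x => mg x ^+ 2) by exact: bmX.
have m1 : mb e1.
  by apply: mb_exists => i; apply: mb_lt => //; exact: (bm_tnth i bmg2).1.
have m2 : mb e2.
  by apply: mb_exists => i; apply: mb_lt => //; exact: (bm_tnth i bmpsi).1.
have m3 : mb e3.
  apply: mb_and; first exact: (@mbAll (fun x => mg x ^+ 2) trunc bmg2).
  apply: mb_exists => jk; apply: mbE; apply: bm_abs; apply: bmB; last exact: bm_cst.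
  have bb : bm (fun x => g x jk.1 * g x jk.2) by exact: bmM.
  by apply: bm_sum => i; exact: (bm_tnth i bb).
have m4 : mb e4.
  apply: mb_and; first exact: (@mbAll mpsi trunc bmpsi).
  apply: mb_exists => jk; apply: mbE; apply: bm_abs; apply: bmB; last exact: bm_cst.
  by apply: bm_sum => i; exact: (bm_tnth i (bpsi jk)).
have m5 : mb e5 by apply: mbE; exact: bm_mx.
have m6 : mb e6.
  apply: mbE; apply: bmM; first exact: bm_cst.
  by apply: bm_sum => i; apply: bmX; apply: bm_mx => j; exact: brsum.
have m7 : mb e7.
  by apply: mbE; apply: bmX; apply: bm_mx => j; apply: bm_sum => i; exact: (bm_tnth i (bg j)).
have bGhat j k : bm (fun s => Ghat h s j k).
  have bhil i l q : bm (fun s : n.-tuple T => h (tnth s i, tnth s l) q).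
    by apply: (bm_pre _ (bh q)); apply: measurable_fun_pair; exact: measurable_tnth.
  have bwt i q : bm (fun s : n.-tuple T => wt h s i q).
    apply: bmB; apply: bmM; try exact: bm_cst; first by apply: bm_sum => l.
    by apply: bm_sum => i'; apply: bm_sum => l.
  by apply: bmM; [exact: bm_cst|apply: bm_sum => i; exact: bmM].
have P1 : Pr (pow mu n) e1 <= gam / 8 by exact: (trunc_tail bmg2 (fun x => sqr_ge0 _) mgq2).
have P2 : Pr (pow mu n) e2 <= gam / 8 := trunc_tail bmpsi mpsi0 mpsiq.
have P3 : Pr (pow mu n) e3 <= gam / 8 := product_deviation.
have P4 : Pr (pow mu n) e4 <= gam / 8 := psi_deviation.
have P5 : Pr (pow mu n) e5 <= gam / 8 := degenerate_deviation.
have P6 : Pr (pow mu n) e6 <= gam / 8 := row_deviation.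
have P7 : Pr (pow mu n) e7 <= gam / 8 := mean_deviation.
apply: (@le_trans _ _ (Pr (pow mu n)
    (fun s => e1 s || (e2 s || (e3 s || (e4 s || (e5 s || (e6 s || e7 s)))))))).
  apply: Pr_mono; [|by do 6 apply: mb_or => //|].
    apply: mb_exists => j; apply: mb_exists => k; apply: mb_lt => //.
    by apply: measurableT_comp => //; apply: measurable_funB => //; exact: (bGhat j k).1.
  move=> s; apply: contraTT; rewrite !negb_or.
  move=> /and5P[n1 n2' n3 n4 /and3P[n5 n6 n7]].
  rewrite negb_exists; apply/forallP => j; rewrite negb_exists; apply/forallP => k.
  rewrite -leNgt.
  move: n1; rewrite negb_exists => /forallP n1; move: n2'; rewrite negb_exists => /forallP n2'.
  have t1 : [forall i, mg (tnth s i) ^+ 2 <= trunc] by apply/forallP => i; rewrite leNgt.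
  have t2 : [forall i, mpsi (tnth s i) <= trunc] by apply/forallP => i; rewrite leNgt.
  move: n3; rewrite /e3 t1 /= negb_exists => /forallP n3.
  move: n4; rewrite /e4 t2 /= negb_exists => /forallP n4.
  rewrite -!ltNge in n5 n6 n7.
  apply: Ghat_close => //.
  - by have := n3 (j, k); rewrite -ltNge => /ltW.
  - by move=> jk; have := n4 jk; rewrite -ltNge Ex_psi mulr0 subr0 => /ltW.
  - by move=> jk; apply: ltW; apply: le_lt_trans n5; exact: (le_mx (csum s) jk).
  - exact: ltW.
  - by rewrite mulrCA divff ?mulr1 ?ltW// expf_neq0// gt_eqF.
apply: (@le_trans _ _ (7 * (gam / 8))); last exact: seven_eighths (ltW gam0).
exact: Pr_or7.
Qed.

End covariance_concentration.

Section roots.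
Context {R : realType}.
Variable r : R.
Hypothesis r1 : 1 <= r.

Lemma root_scale (a y : R) : 1 <= a -> 0 <= y -> (a * y) `^ r^-1 <= a * y `^ r^-1.
Proof.
move=> a1 y0; have a0 : 0 <= a := le_trans ler01 a1.
have r0 : 0 < r := lt_le_trans ltr01 r1.
rewrite powRM//; apply: ler_wpM2r; first exact: powR_ge0.
by rewrite -[leRHS](powRr1 a0); apply: ler_powR => //; rewrite invf_le1.
Qed.

Lemma root_mono (x y : R) : 0 <= x -> x <= y -> x `^ r^-1 <= y `^ r^-1.
Proof.
move=> x0 xy; have r0 : 0 <= r := le_trans ler01 r1.
by apply: ge0_ler_powR; rewrite ?nnegrE ?invr_ge0// (le_trans x0).
Qed.

End roots.

(* Bounds for the four pieces of the covariance deviation in terms of [omega];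
   [E] stands for [D ^ 2 * (n / gamma) ^ (1 / r) / n], [l ^ 2] for [log (n d)]. *)
Section deviation_arithmetic.
Context {R : realType}.
Variables (n n1 l om B c q E D2 : R).
Hypothesis n0 : 0 < n.
Hypothesis nn1 : n <= 2 * n1.
Hypothesis l1 : 1 <= l.
Hypothesis om0 : 0 < om.
Hypothesis B0 : 0 < B.
Hypothesis c1 : 1 <= c.
Hypothesis q0 : 0 < q.
Hypothesis D20 : 0 <= D2.
Hypothesis hE : E * l ^+ 6 <= om ^+ 3.
Hypothesis hB : B * l ^+ 7 <= om ^+ 3 * Num.sqrt n.

Let l0 : 0 < l := lt_le_trans ltr01 l1.

(** The truncation term is paid for by [hE] and contributes 128, the variance term by [hB] and
    contributes 64. *)
Lemma bernstein_piece (tr x : R) : 0 <= x -> x <= c * l ^+ 2 -> 0 <= tr -> tr <= 32 * (E * n) ->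
  (4 * tr * x + 2 * Num.sqrt (2 * n * (16 * B ^+ 2) * x)) / n <= 192 * c * (om ^+ 3 / l ^+ 4).
Proof.
move=> x0 xc tr0 trE.
have om3 : 0 < om ^+ 3 by exact: exprn_gt0.
have l4 : 0 < l ^+ 4 by exact: exprn_gt0.
have sn0 : 0 < Num.sqrt n by rewrite sqrtr_gt0.
have sn2 : Num.sqrt n ^+ 2 = n by rewrite sqr_sqrtr// ltW.
have c0 : 0 < c := lt_le_trans ltr01 c1.
have p1 : 4 * tr * x / n <= 128 * c * (om ^+ 3 / l ^+ 4).
  apply: (@le_trans _ _ (4 * (32 * (E * n)) * (c * l ^+ 2) / n)).
    apply: ler_wpM2r; first by rewrite invr_ge0 ltW.
    apply: ler_pM => //; first exact: mulr_ge0.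
    exact: ler_wpM2l.
  have -> : 4 * (32 * (E * n)) * (c * l ^+ 2) / n = 128 * c * (E * l ^+ 6 / l ^+ 4).
    by field; rewrite !gt_eqF.
  apply: ler_wpM2l; first by apply: mulr_ge0 => //; exact: ltW.
  by apply: ler_wpM2r => //; rewrite invr_ge0 ltW.
have p2 : 2 * Num.sqrt (2 * n * (16 * B ^+ 2) * x) / n <= 64 * c * (om ^+ 3 / l ^+ 4).
  have : Num.sqrt (2 * n * (16 * B ^+ 2) * x) <= 32 * c * B * l * Num.sqrt n.
    have rhs0 : 0 <= 32 * c * B * l * Num.sqrt n.
      exact: mulr_ge0 (mulr_ge0 (mulr_ge0 (mulr_ge0 (ler0n _ 32) (ltW c0)) (ltW B0)) (ltW l0)) (ltW sn0).
    rewrite -[leRHS](ger0_norm rhs0) -sqrtr_sqr; apply: ler_wsqrtr.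
    have -> : (32 * c * B * l * Num.sqrt n) ^+ 2 = (n * B ^+ 2) * (1024 * c ^+ 2 * l ^+ 2).
      by rewrite !exprMn sn2; ring.
    have -> : 2 * n * (16 * B ^+ 2) * x = (n * B ^+ 2) * (32 * x) by ring.
    apply: ler_wpM2l; first by apply: mulr_ge0; [exact: ltW|exact: sqr_ge0].
    apply: (@le_trans _ _ (32 * (c * l ^+ 2))); first exact: ler_wpM2l.
    have cc : c <= c ^+ 2 by rewrite expr2 ler_peMl// ltW.
    have l20 : 0 <= l ^+ 2 := sqr_ge0 l.
    have := ler_wpM2r l20 cc; have := mulr_ge0 (ltW c0) l20; lra.
  move=> h; apply: (@le_trans _ _ (2 * (32 * c * B * l * Num.sqrt n) / n)).
    by apply: ler_wpM2r; [rewrite invr_ge0 ltW|exact: ler_wpM2l].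
  have -> : 2 * (32 * c * B * l * Num.sqrt n) / n = 64 * c * (B * l ^+ 7 / (Num.sqrt n * l ^+ 6)).
    by rewrite -[X in _ / X = _]sn2; field; rewrite !gt_eqF.
  apply: ler_wpM2l; first by apply: mulr_ge0 => //; exact: ltW.
  apply: (@le_trans _ _ (om ^+ 3 * Num.sqrt n / (Num.sqrt n * l ^+ 6))).
    by apply: ler_wpM2r => //; rewrite invr_ge0 mulr_ge0 ?exprn_ge0// ltW.
  have -> : om ^+ 3 * Num.sqrt n / (Num.sqrt n * l ^+ 6) = om ^+ 3 / l ^+ 6.
    by field; rewrite !gt_eqF.
  apply: ler_wpM2l; first exact: ltW.
  by rewrite lef_pV2 ?posrE ?exprn_gt0// ler_weXn2l.
have -> : 192 * c * (om ^+ 3 / l ^+ 4) = 128 * c * (om ^+ 3 / l ^+ 4) + 64 * c * (om ^+ 3 / l ^+ 4) by ring.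
by rewrite mulrDl; exact: lerD.
Qed.

Lemma moment_piece (k X : R) : 0 <= k -> X <= k * (q * l ^+ 2) * E -> X <= k * q * (om ^+ 3 / l ^+ 4).
Proof.
move=> k0 /le_trans; apply.
have l4 : 0 < l ^+ 4 by exact: exprn_gt0.
have -> : k * (q * l ^+ 2) * E = k * q * (E * l ^+ 6 / l ^+ 4) by field; rewrite gt_eqF.
apply: ler_wpM2l; first by apply: mulr_ge0 => //; exact: ltW.
by apply: ler_wpM2r => //; rewrite invr_ge0 ltW.
Qed.

End deviation_arithmetic.

Section covariance_rate.
Context {R : realType}.
Variables (cardJ n : nat) (r D B gam Q l om K lam : R).
Hypothesis cJ : (0 < cardJ)%N.
Hypothesis n2 : (1 < n)%N.
Hypothesis r2 : 2 <= r.
Hypothesis D0 : 0 < D.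
Hypothesis B0 : 0 < B.
Hypothesis gam01 : 0 < gam < 1.
Hypothesis K0 : 0 < K.
Hypothesis lam0 : 0 < lam.
Hypothesis l1 : 1 <= l.
Hypothesis om0 : 0 < om.
Hypothesis QE : Q = (lam + 6) * l ^+ 2.
Hypothesis xl : ln (16 * (cardJ * cardJ)%:R / gam) <= (4 + K) * l ^+ 2.
Hypothesis x0 : 0 <= ln (16 * (cardJ * cardJ)%:R / gam).
Hypothesis H2 : D ^+ 2 * l ^+ 6 * (n%:R / gam) `^ r^-1 <= om ^+ 3 * n%:R.
Hypothesis H3 : B * l ^+ 7 <= om ^+ 3 * Num.sqrt n%:R.

(** 576 = 3 * 192, since the Bernstein deviation occurs three times in the covariance bound; the
    other three deviations keep their multiplicities 2, 3 and 2. *)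
Definition covariance_const : R := 576 * (4 + K) + (2 * 2 ^+ 15 + 3 * 2 ^+ 12 + 2 * 2 ^+ 10) * (lam + 6).

Lemma covdev_pieces (dev degdev rowdev avgdev : R) :
  dev = 4 * (4 * D ^+ 2 * (8 * n%:R / gam) `^ r^-1) * ln (16 * (cardJ * cardJ)%:R / gam) +
    2 * Num.sqrt (2 * n%:R * (16 * B ^+ 2) * ln (16 * (cardJ * cardJ)%:R / gam)) ->
  degdev = 512 * (Q * n%:R) * D ^+ 2 * (32 / gam) `^ r^-1 ->
  rowdev = 64 * (Q * n%:R) * D ^+ 2 / n.-1%:R ^+ 2 * (16 / gam) `^ r^-1 ->
  avgdev = 64 * (Q * n%:R) * D ^+ 2 * (16 / gam) `^ r^-1 ->
  dev / n%:R + 2 * (dev / n%:R + degdev / (n%:R * n.-1%:R)) +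
  3 * rowdev + 2 * (avgdev / n%:R ^+ 2) <= covariance_const * (om ^+ 3 / l ^+ 4).
Proof.
move=> hdev hdeg hrow havg; have [gam0 gam1] := andP gam01.
have n0 : (0 : R) < n%:R by rewrite ltr0n ltnW.
have n10 : (0 : R) < n.-1%:R by rewrite ltr0n -subn1 subn_gt0.
have nn1 : n%:R <= 2 * n.-1%:R :> R.
  by rewrite -natrM ler_nat; case: n n2 => // -[] // k _ /=; rewrite mul2n -addnn addSn addnS !ltnS leq_addr.
have r1 : 1 <= r by apply: le_trans r2; rewrite ler1n.
pose P := (n%:R / gam) `^ r^-1.
have P0 : 0 <= P := powR_ge0 _ _.
pose E := D ^+ 2 * P / n%:R.
have E0 : 0 <= E.
  by apply: mulr_ge0; [apply: mulr_ge0 => //; exact: sqr_ge0|rewrite invr_ge0 ltW].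
have p2 k : 0 <= 2 ^+ k :> R := exprn_ge0 k (ler0n R 2).
have hE : E * l ^+ 6 <= om ^+ 3.
  have -> : E * l ^+ 6 = D ^+ 2 * l ^+ 6 * P / n%:R by rewrite /E; field; rewrite gt_eqF.
  by rewrite ler_pdivrMr.
have DP : D ^+ 2 * P = E * n%:R by rewrite /E divfK// gt_eqF.
have P8 : (8 * n%:R / gam) `^ r^-1 <= 8 * P.
  rewrite -mulrA; apply: root_scale => //; first by rewrite ler1n.
  by apply: divr_ge0; exact: ltW.
have Pk (k : nat) : (0 < k)%N -> (k%:R / gam) `^ r^-1 <= k%:R * P.
  move=> k0; apply: (@le_trans _ _ ((k%:R * (n%:R / gam)) `^ r^-1)).
    apply: root_mono => //; first by apply: divr_ge0; [exact: ler0n|exact: ltW].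
    rewrite mulrA ler_pM2r ?invr_gt0// ler_peMr// ?ler0n// ler1n; exact: ltnW.
  by apply: root_scale => //; [rewrite ler1n|apply: divr_ge0; exact: ltW].
have c1 : 1 <= 4 + K by have := K0; lra.
have q0 : 0 < lam + 6 by have := lam0; lra.
have h1 : dev / n%:R <= 192 * (4 + K) * (om ^+ 3 / l ^+ 4).
  rewrite hdev; apply: (bernstein_piece n0 l1 om0 B0 c1 hE H3 x0 xl).
    by apply: mulr_ge0; [apply: mulr_ge0 => //; exact: sqr_ge0|exact: powR_ge0].
  have -> : 32 * (E * n%:R) = 4 * D ^+ 2 * (8 * P) by rewrite -DP; ring.
  by apply: ler_wpM2l P8; apply: mulr_ge0 => //; exact: sqr_ge0.
have Q0 : 0 < Q by rewrite QE; apply: mulr_gt0 => //; rewrite exprn_gt0// (lt_le_trans _ l1).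
have QD0 : 0 <= Q * D ^+ 2 := mulr_ge0 (ltW Q0) (sqr_ge0 D).
have h2 : degdev / (n%:R * n.-1%:R) <= 2 ^+ 15 * (lam + 6) * (om ^+ 3 / l ^+ 4).
  apply: (moment_piece l1 q0 hE); first exact: p2.
  rewrite -QE hdeg.
  have -> : 512 * (Q * n%:R) * D ^+ 2 * (32 / gam) `^ r^-1 / (n%:R * n.-1%:R) =
     512 * (Q * D ^+ 2) * (32 / gam) `^ r^-1 / n.-1%:R by field; rewrite !gt_eqF.
  rewrite ler_pdivrMr//.
  apply: (@le_trans _ _ (512 * (Q * D ^+ 2) * (32 * P))).
    apply: ler_wpM2l; [exact: mulr_ge0 (ler0n _ _) QD0|exact: (Pk 32%N isT)].
  have -> : 512 * (Q * D ^+ 2) * (32 * P) = 2 ^+ 14 * Q * E * n%:R.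
    have -> : 2 ^+ 14 * Q * E * n%:R = 2 ^+ 14 * Q * (E * n%:R) by ring.
    by rewrite -DP; ring.
  have -> : 2 ^+ 15 * Q * E * n.-1%:R = 2 ^+ 14 * Q * E * (2 * n.-1%:R) by ring.
  apply: ler_wpM2l => //; exact: mulr_ge0 (mulr_ge0 (p2 _) (ltW Q0)) E0.
have h3 : rowdev <= 2 ^+ 12 * (lam + 6) * (om ^+ 3 / l ^+ 4).
  apply: (moment_piece l1 q0 hE); first exact: p2.
  rewrite -QE hrow.
  have n12 : 0 < n.-1%:R ^+ 2 :> R by exact: exprn_gt0.
  rewrite mulrAC ler_pdivrMr//.
  apply: (@le_trans _ _ (64 * (Q * n%:R) * D ^+ 2 * (16 * P))).
    apply: ler_wpM2l; last exact: (Pk 16%N isT).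
    exact: mulr_ge0 (mulr_ge0 (ler0n _ _) (mulr_ge0 (ltW Q0) (ltW n0))) (sqr_ge0 D).
  have -> : 64 * (Q * n%:R) * D ^+ 2 * (16 * P) = 2 ^+ 10 * Q * E * n%:R ^+ 2.
    have -> : 2 ^+ 10 * Q * E * n%:R ^+ 2 = 2 ^+ 10 * Q * n%:R * (E * n%:R) by ring.
    by rewrite -DP; ring.
  have -> : 2 ^+ 12 * Q * E * n.-1%:R ^+ 2 = 2 ^+ 10 * Q * E * (2 * n.-1%:R) ^+ 2 by ring.
  apply: ler_wpM2l; first exact: mulr_ge0 (mulr_ge0 (p2 _) (ltW Q0)) E0.
  by rewrite ler_sqr ?nnegrE ?mulr_ge0 ?ler0n.
have h4 : avgdev / n%:R ^+ 2 <= 2 ^+ 10 * (lam + 6) * (om ^+ 3 / l ^+ 4).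
  apply: (moment_piece l1 q0 hE); first exact: p2.
  rewrite -QE havg ler_pdivrMr ?exprn_gt0//.
  apply: (@le_trans _ _ (64 * (Q * n%:R) * D ^+ 2 * (16 * P))).
    apply: ler_wpM2l; last exact: (Pk 16%N isT).
    exact: mulr_ge0 (mulr_ge0 (ler0n _ _) (mulr_ge0 (ltW Q0) (ltW n0))) (sqr_ge0 D).
  have -> : 2 ^+ 10 * Q * E * n%:R ^+ 2 = 2 ^+ 10 * Q * n%:R * (E * n%:R) by ring.
  by rewrite -DP le_eqVlt; apply/orP; left; apply/eqP; ring.
apply: (@le_trans _ _ (192 * (4 + K) * (om ^+ 3 / l ^+ 4) + 2 * (192 * (4 + K) * (om ^+ 3 / l ^+ 4) +
   2 ^+ 15 * (lam + 6) * (om ^+ 3 / l ^+ 4)) + 3 * (2 ^+ 12 * (lam + 6) * (om ^+ 3 / l ^+ 4)) +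
   2 * (2 ^+ 10 * (lam + 6) * (om ^+ 3 / l ^+ 4)))).
  apply: lerD; last exact: ler_wpM2l.
  apply: lerD; last exact: ler_wpM2l.
  by apply: lerD => //; apply: ler_wpM2l => //; exact: lerD.
by rewrite le_eqVlt; apply/orP; left; apply/eqP; rewrite /covariance_const; ring.
Qed.

End covariance_rate.

(** * Comparison for bounded kernels *)

Section rate_arithmetic.
Context {R : realType}.
Variables (n l om B b K lam : R).
Hypothesis n0 : 0 < n.
Hypothesis l1 : 1 <= l.
Hypothesis om01 : 0 < om <= 1.
Hypothesis B1 : 1 <= B.
Hypothesis b0 : 0 < b.
Hypothesis K0 : 0 < K.
Hypothesis lam0 : 0 < lam.
Hypothesis H3 : B * l ^+ 7 <= om ^+ 3 * Num.sqrt n.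

(** The coefficients of the slope: 2400 = 2 * 1200 from the covariance error and 96 * 10^3 = 5 *
    1200 * (8 + 8) from the third-order error, with 16 bounding [expR 2]. For
    [Abeta = 1 / (8 cbeta)] the slope is at most [Abeta^2 * cbeta = Abeta / 8], below the 1 / 8 that
    absorption needs. *)
Definition cbeta : R := 2400 * covariance_const K lam + 96 * 10 ^+ 3 * 16.
Definition Abeta : R := (8 * cbeta)^-1.
(** Balances two demands. The width [l^2 / beta_] is of order [om / l], which anticoncentration of
    strength [l] turns into [om]; the third-order coefficient is of order [B l^7 / (om^3 sqrt n)],
    at most a constant by [H3]. *)
Definition beta_ : R := Abeta * l ^+ 3 / om.
(** On the good event the covariance error is at most [b / 2], so half of the lower bound [b] on the
    variances survives. *)
Definition sdev : R := Num.sqrt (b / 2).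
(** Anticoncentration with parameter [2 * l]: it is at least 2, and [(2 l)^2 / 2] exceeds the
    logarithm [l^2] of the number of orthant coordinates. *)
Definition kap_ : R := 3 * expR 2 * (2 * l) / sdev.
Definition Del_ : R := covariance_const K lam * (om ^+ 3 / l ^+ 4).
(** A bound on the moment of order [2 r] of the scaled envelope [beta_ m / sqrt n], hence by Markov
    on the probability that it exceeds 1. On that event its cube is smaller still, which explains
    [tau3_]. *)
Definition pi3_ : R := om ^+ 2 / n.
Definition tau3_ : R := (beta_ / Num.sqrt n) ^- 3 * pi3_.
Definition orthant_const : R := 2 * (8 * (96 / (Abeta * sdev)) + 2 * (44 * 10 ^+ 3)).

Let l0 : 0 < l := lt_le_trans ltr01 l1.
Let om0 : 0 < om. Proof. by case/andP: om01. Qed.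
Let om1 : om <= 1. Proof. by case/andP: om01. Qed.
Let B0 : 0 < B := lt_le_trans ltr01 B1.
Let sn0 : 0 < Num.sqrt n. Proof. by rewrite sqrtr_gt0. Qed.
Let sn2 : Num.sqrt n ^+ 2 = n. Proof. by rewrite sqr_sqrtr// ltW. Qed.

Lemma expR2_le : expR 2 <= 16 :> R.
Proof.
have h : expR (2^-1 : R) <= 2.
  apply: (le_trans (expR_quadratic (lexx _))); lra.
have e2 : expR (2 : R) = expR 2^-1 ^+ 4 by rewrite -expRM_natl; congr expR; lra.
rewrite e2; have -> : (16 : R) = 2 ^+ 4 by ring.
by apply: lerXn2r; rewrite ?nnegrE ?expR_ge0.
Qed.

Lemma covariance_const_ge : 1 <= covariance_const K lam.
Proof.
have p2 k : 0 <= 2 ^+ k :> R := exprn_ge0 k (ler0n R 2).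
rewrite /covariance_const; have h : 0 <= (2 * 2 ^+ 15 + 3 * 2 ^+ 12 + 2 * 2 ^+ 10) * (lam + 6).
  apply: mulr_ge0; last by have := lam0; lra.
  by rewrite !addr_ge0// mulr_ge0.
by apply: (@le_trans _ _ (576 * (4 + K))); [have := K0; lra|rewrite lerDl].
Qed.

Let N0 : 0 <= 96 * 10 ^+ 3 :> R := mulr_ge0 (ler0n R 96) (exprn_ge0 3 (ler0n R 10)).
Let N160 : 0 <= 96 * 10 ^+ 3 * 16 :> R := mulr_ge0 N0 (ler0n R 16).

Lemma cbeta_ge : 1 <= cbeta.
Proof.
rewrite /cbeta; have := covariance_const_ge => h.
apply: (@le_trans _ _ (2400 * covariance_const K lam)); last by rewrite lerDl; exact: N160.
by rewrite -[leLHS]mul1r; apply: ler_pM => //; rewrite ?ler1n.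
Qed.

Lemma Abeta_gt0 : 0 < Abeta.
Proof. by rewrite invr_gt0 mulr_gt0// (lt_le_trans ltr01)// cbeta_ge. Qed.

Lemma Abeta_le : Abeta <= 8^-1.
Proof.
have c0 : 0 < cbeta by rewrite (lt_le_trans ltr01)// cbeta_ge.
by rewrite lef_pV2 ?posrE ?mulr_gt0// ler_peMr// cbeta_ge.
Qed.

Let A0 := Abeta_gt0.
Let A1 : Abeta <= 1. Proof. by apply: (le_trans Abeta_le); rewrite invf_le1// ler1n. Qed.

Lemma beta_gt0 : 0 < beta_.
Proof. by rewrite divr_gt0// mulr_gt0// exprn_gt0. Qed.

Lemma sdev_gt0 : 0 < sdev.
Proof. by rewrite sqrtr_gt0 divr_gt0. Qed.

Lemma kap_gt0 : 0 < kap_.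
Proof.
by rewrite divr_gt0 ?sdev_gt0// mulr_gt0 ?mulr_gt0// expR_gt0.
Qed.

Lemma Del_ge0 : 0 <= Del_.
Proof.
apply: mulr_ge0; first exact: le_trans covariance_const_ge.
by rewrite divr_ge0// exprn_ge0// ltW.
Qed.

Let A2c : Abeta ^+ 2 * cbeta = Abeta / 8.
Proof.
have c0 : 0 < cbeta by rewrite (lt_le_trans ltr01)// cbeta_ge.
by rewrite /Abeta; field; rewrite gt_eqF.
Qed.

Lemma slope1_eq : 2 * smK (l ^+ 2) * beta_ ^+ 2 * Del_ = 2400 * covariance_const K lam * Abeta ^+ 2 * om.
Proof. by rewrite /smK /beta_ /Del_; field; rewrite !gt_eqF. Qed.

Lemma slope3_le : 5 * expR 2 * ((Num.sqrt n)^-1 * (smK (l ^+ 2) * beta_ ^+ 3 * (8 * B + 8 * B))) <=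
  96 * 10 ^+ 3 * 16 * Abeta ^+ 3.
Proof.
have -> : 5 * expR 2 * ((Num.sqrt n)^-1 * (smK (l ^+ 2) * beta_ ^+ 3 * (8 * B + 8 * B))) =
  (96 * 10 ^+ 3 * Abeta ^+ 3) * (expR 2 * (B * l ^+ 7 / (om ^+ 3 * Num.sqrt n))).
  by rewrite /smK /beta_; field; rewrite !gt_eqF.
have -> : 96 * 10 ^+ 3 * 16 * Abeta ^+ 3 = (96 * 10 ^+ 3 * Abeta ^+ 3) * (16 * 1) by ring.
apply: ler_wpM2l; first exact: mulr_ge0 N0 (exprn_ge0 3 (ltW A0)).
apply: ler_pM; [exact: expR_ge0| |exact: expR2_le|].
  by rewrite divr_ge0 ?mulr_ge0 ?exprn_ge0// ltW.
by rewrite ler_pdivrMr ?mul1r// mulr_gt0// exprn_gt0.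
Qed.

Lemma Abeta3_le : 96 * 10 ^+ 3 * 16 * Abeta ^+ 3 <= 96 * 10 ^+ 3 * 16 * Abeta ^+ 2.
Proof.
apply: ler_wpM2l; first exact: N160.
by rewrite exprS ler_piMl// sqr_ge0.
Qed.

Let C24 : 0 <= 2400 * covariance_const K lam := mulr_ge0 (ler0n R 2400) (le_trans ler01 covariance_const_ge).

Lemma slope_le : 8 * (2 * smK (l ^+ 2) * beta_ ^+ 2 * Del_ +
  5 * expR 2 * ((Num.sqrt n)^-1 * (smK (l ^+ 2) * beta_ ^+ 3 * (8 * B + 8 * B)))) <= 1.
Proof.
rewrite slope1_eq.
have h1 : 2400 * covariance_const K lam * Abeta ^+ 2 * om <= 2400 * covariance_const K lam * Abeta ^+ 2.
  by rewrite -[leRHS]mulr1; apply: ler_wpM2l; [exact: mulr_ge0 C24 (sqr_ge0 _)|exact: om1].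
have h2 := le_trans slope3_le Abeta3_le.
have h3 : 2400 * covariance_const K lam * Abeta ^+ 2 + 96 * 10 ^+ 3 * 16 * Abeta ^+ 2 = Abeta / 8.
  by rewrite -A2c /cbeta; ring.
by have := lerD h1 h2; rewrite h3; have := A1; lra.
Qed.

Lemma B3_le : 5 * expR 2 * ((Num.sqrt n)^-1 * (smK (l ^+ 2) * beta_ ^+ 3 * (8 * B + 8 * B))) <= 1.
Proof.
have h2 := le_trans slope3_le Abeta3_le.
have h0 : 0 <= 2400 * covariance_const K lam * Abeta ^+ 2.
  exact: mulr_ge0 C24 (sqr_ge0 _).
have h3 : 2400 * covariance_const K lam * Abeta ^+ 2 + 96 * 10 ^+ 3 * 16 * Abeta ^+ 2 = Abeta / 8.
  by rewrite -A2c /cbeta; ring.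
by have := A1; lra.
Qed.

(** The square of [H3] with surplus powers dropped; it controls the large-observation term that
    carries [G2]. *)
Lemma Bn_le : B * l ^+ 4 / n <= om.
Proof.
have h : (B * l ^+ 7) ^+ 2 <= (om ^+ 3 * Num.sqrt n) ^+ 2.
  rewrite ler_sqr ?nnegrE//; apply: mulr_ge0; try exact: exprn_ge0 (ltW _); exact: ltW.
rewrite ler_pdivrMr//; move: h; rewrite [in X in _ <= X]exprMn sn2 => h.
have h1 : B * l ^+ 4 <= (B * l ^+ 7) ^+ 2.
  rewrite exprMn -exprM; apply: ler_pM; [exact: ltW|by rewrite exprn_ge0// ltW| |].
    by rewrite expr2 ler_peMl// ltW.
  by rewrite ler_weXn2l.
apply: (le_trans h1); apply: (le_trans h); apply: ler_wpM2r; first exact: ltW.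
by rewrite -exprM -[leRHS]expr1 ler_wiXn2l// ltW.
Qed.

Lemma offset_le (G2 : R) : 0 <= G2 -> G2 <= 8 * B ->
  5 * expR 2 * ((Num.sqrt n)^-1 * (smK (l ^+ 2) * beta_ ^+ 3 * (8 * B + 8 * B))) * pi3_ +
  4 * ((Num.sqrt n)^-1 * (smK (l ^+ 2) * beta_ ^+ 3 * tau3_)) +
  4 * smK (l ^+ 2) * beta_ ^+ 2 * G2 * pi3_ <= 44 * 10 ^+ 3 * om.
Proof.
move=> G20 G2B.
have om2 : om ^+ 2 <= om by rewrite expr2 ler_piMl// ltW.
have n1 : 1 <= n.
  have h : 1 <= B * l ^+ 7 by rewrite mulr_ege1// exprn_ege1.
  have h2 : 1 <= Num.sqrt n.
    by apply: (le_trans h); apply: (le_trans H3); rewrite ler_piMl ?exprn_ile1// ltW.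
  by rewrite -sn2 expr_ge1// ltW.
have pi3om : pi3_ <= om by rewrite ler_pdivrMr// (le_trans om2)// ler_peMr// ltW.
have pi30 : 0 <= pi3_ by rewrite divr_ge0 ?sqr_ge0// ltW.
have l21 : 1 <= l ^+ 2 by rewrite exprn_ege1.
have t1 : 5 * expR 2 * ((Num.sqrt n)^-1 * (smK (l ^+ 2) * beta_ ^+ 3 * (8 * B + 8 * B))) * pi3_ <= om.
  rewrite -[leRHS]mul1r; apply: ler_pM => //; last exact: B3_le.
  apply: mulr_ge0; first by rewrite mulr_ge0// expR_ge0.
  apply: mulr_ge0; first by rewrite invr_ge0 ltW.
  apply: mulr_ge0; last by rewrite addr_ge0// mulr_ge0// ltW.
  by apply: mulr_ge0; [exact: smK_ge0|rewrite exprn_ge0// ltW// beta_gt0].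
have t2 : 4 * ((Num.sqrt n)^-1 * (smK (l ^+ 2) * beta_ ^+ 3 * tau3_)) <= 4800 * om.
  have -> : 4 * ((Num.sqrt n)^-1 * (smK (l ^+ 2) * beta_ ^+ 3 * tau3_)) = 4800 * om ^+ 2 / l ^+ 2.
    have bb := beta_gt0; have e : pi3_ = om ^+ 2 / Num.sqrt n ^+ 2 by rewrite sn2.
    by rewrite /smK /tau3_ e; field; rewrite !gt_eqF.
  rewrite ler_pdivrMr; last exact: exprn_gt0.
  rewrite -mulrA; apply: (ler_wpM2l (ler0n R 4800)).
  by apply: (le_trans om2); rewrite ler_peMr// ltW.
have t3 : 4 * smK (l ^+ 2) * beta_ ^+ 2 * G2 * pi3_ <= 4800 * 8 * om.
  have -> : 4 * smK (l ^+ 2) * beta_ ^+ 2 * G2 * pi3_ = 4800 * (Abeta ^+ 2 * (G2 * l ^+ 4 / n)).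
    by rewrite /smK /beta_ /pi3_; field; rewrite !gt_eqF.
  rewrite -[leRHS]mulrA; apply: (ler_wpM2l (ler0n R 4800)).
  have ln0 : 0 <= l ^+ 4 / n by rewrite divr_ge0 ?exprn_ge0// ltW.
  apply: (@le_trans _ _ (G2 * l ^+ 4 / n)).
    rewrite ler_piMl ?exprn_ile1// ?(ltW A0)// -mulrA; exact: mulr_ge0.
  apply: (@le_trans _ _ (8 * (B * l ^+ 4 / n))); last by apply: ler_wpM2l => //; exact: Bn_le.
  by rewrite mulrA mulrA -[leRHS]mulrA -[leLHS]mulrA; apply: ler_wpM2r.
(* The three terms add up to 1 + 4800 + 38400; the remaining 799 rounds the constant to 44000. *)
have -> : 44 * 10 ^+ 3 * om = om + 4800 * om + 4800 * 8 * om + 799 * om by ring.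
apply: (@le_trans _ _ (om + 4800 * om + 4800 * 8 * om)); last by rewrite lerDl; exact: mulr_ge0 (ler0n _ 799) (ltW om0).
by rewrite !lerD.
Qed.

Lemma wkap_le : smw beta_ (l ^+ 2) * kap_ <= 96 / (Abeta * sdev) * om.
Proof.
have s0 := sdev_gt0.
have -> : smw beta_ (l ^+ 2) * kap_ = expR 2 * (6 / (Abeta * sdev) * om).
  by rewrite /smw /beta_ /kap_; field; rewrite !gt_eqF.
have -> : 96 / (Abeta * sdev) * om = 16 * (6 / (Abeta * sdev) * om) by field; rewrite !gt_eqF.
apply: ler_wpM2r; last exact: expR2_le.
by rewrite mulr_ge0// ?divr_ge0// ?mulr_ge0// ltW.
Qed.

Lemma orthant_rate_le (off : R) : off <= 44 * 10 ^+ 3 * om ->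
  2 * (8 * smw beta_ (l ^+ 2) * kap_ + 2 * off) <= orthant_const * om.
Proof.
move=> ho; have hw := wkap_le.
have -> : orthant_const * om = 2 * (8 * (96 / (Abeta * sdev) * om) + 2 * (44 * 10 ^+ 3 * om)).
  by rewrite /orthant_const; ring.
apply: ler_wpM2l => //; apply: lerD; last exact: ler_wpM2l.
by rewrite -mulrA; apply: ler_wpM2l.
Qed.

Lemma kapt_le : kap_ * (om / l) <= 96 / sdev * om.
Proof.
have s0 := sdev_gt0.
have -> : kap_ * (om / l) = expR 2 * (6 / sdev * om) by rewrite /kap_; field; rewrite !gt_eqF.
have -> : 96 / sdev * om = 16 * (6 / sdev * om) by field; rewrite gt_eqF.
apply: ler_wpM2r; last exact: expR2_le.
by rewrite mulr_ge0// ?divr_ge0// ltW.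
Qed.

End rate_arithmetic.

Lemma sg_norm {R : realType} (b : bool) : `|sg b : R| = 1.
Proof. by case: b; rewrite /sg ?normrN normr1. Qed.

Lemma sg_sqr {R : realType} (b : bool) : (sg b : R) ^+ 2 = 1.
Proof. by case: b; rewrite /sg ?sqrrN expr1n. Qed.

Section truncation_moment.
Context {R : realType}.
Variables (n l om D A r gam : R).
Hypothesis n0 : 0 < n.
Hypothesis l1 : 1 <= l.
Hypothesis om01 : 0 < om <= 1.
Hypothesis A0 : 0 < A.
Hypothesis A8 : A <= 8^-1.
Hypothesis r2 : 2 <= r.
Hypothesis gam01 : 0 < gam < 1.
Hypothesis H2 : D ^+ 2 * l ^+ 6 * (n / gam) `^ r^-1 <= om ^+ 3 * n.

(** By [H2] and the smallness of [A] the base is at most [om (gam / n)^(1 / r)]. Its [r]-th power is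
    [om^r gam / n], and [r >= 2] together with [gam < 1] gives the claim. *)
Lemma truncation_scale :
  ((A * l ^+ 3 / om / Num.sqrt n) ^+ 2 * (4 * D ^+ 2)) `^ r <= om ^+ 2 / n.
Proof.
have /andP[om0 om1] := om01; have /andP[gam0 gam1] := gam01.
have r0 : 0 < r by apply: lt_le_trans r2.
have ng0 : 0 < n / gam by rewrite divr_gt0.
have P0 : 0 < (n / gam) `^ r^-1 by rewrite powR_gt0.
have l0 : 0 < l := lt_le_trans ltr01 l1.
have sn0 : 0 < Num.sqrt n by rewrite sqrtr_gt0.
have sn2 : Num.sqrt n ^+ 2 = n by rewrite sqr_sqrtr// ltW.
have -> : (A * l ^+ 3 / om / Num.sqrt n) ^+ 2 * (4 * D ^+ 2) =
    (4 * A ^+ 2) * (D ^+ 2 * l ^+ 6 / (om ^+ 2 * n)).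
  by rewrite -[X in _ / (_ * X)]sn2; field; rewrite !gt_eqF.
have X0 : 0 <= D ^+ 2 * l ^+ 6 / (om ^+ 2 * n).
  apply: divr_ge0; first by apply: mulr_ge0; [exact: sqr_ge0|exact: exprn_ge0 (ltW l0)].
  by apply: mulr_ge0; [exact: sqr_ge0|exact: ltW].
have XP : D ^+ 2 * l ^+ 6 / (om ^+ 2 * n) <= om / (n / gam) `^ r^-1.
  rewrite ler_pdivlMr// mulrAC ler_pdivrMr; last exact: mulr_gt0 (exprn_gt0 2 om0) n0.
  by apply: (le_trans H2); rewrite le_eqVlt; apply/orP; left; apply/eqP; ring.
have A4 : 4 * A ^+ 2 <= 1.
  by have h : A ^+ 2 <= 8^-1 ^+ 2 by [rewrite ler_sqr ?nnegrE// ltW]; lra.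
have le1 : 4 * A ^+ 2 * (D ^+ 2 * l ^+ 6 / (om ^+ 2 * n)) <= om / (n / gam) `^ r^-1.
  by apply: le_trans XP; rewrite ler_piMl.
have Y0 : 0 <= 4 * A ^+ 2 * (D ^+ 2 * l ^+ 6 / (om ^+ 2 * n)).
  by apply: mulr_ge0 => //; apply: mulr_ge0; rewrite ?sqr_ge0.
apply: (@le_trans _ _ ((om / (n / gam) `^ r^-1) `^ r)).
  apply: ge0_ler_powR => //; rewrite ?nnegrE//; first exact: ltW.
  by rewrite divr_ge0// ltW.
rewrite powRM ?invr_ge0 ?(ltW om0) ?(ltW P0)//.
rewrite -powR_inv1 ?(ltW P0)// -2!powRrM.
have -> : r^-1 * (-1 * r) = -1 by field; rewrite gt_eqF.
rewrite powR_inv1 ?(ltW ng0)// invf_div.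
apply: ler_pM; [exact: powR_ge0|by rewrite divr_ge0// ltW| |].
  by rewrite -powR_mulrn ?(ltW om0)//; apply: ger_powR; rewrite ?om0.
by rewrite -[leRHS]mul1r; apply: ler_wpM2r; [rewrite invr_ge0 ltW|exact: ltW].
Qed.

End truncation_moment.

Section orthants.
Context {R : realType} {d : measure_display} {T : measurableType d} (J : finType).
Variables (mu : probability T R) (h : T * T -> J -> R) (n : nat).
Variables (l om B b K lam D r gam : R).
Hypothesis bh : forall j, bm (fun xy => h xy j).
Hypothesis J0 : (0 < #|J|)%N.
Hypothesis n2 : (1 < n)%N.
Hypothesis l1 : 1 <= l.
Hypothesis om01 : 0 < om <= 1.
Hypothesis B1 : 1 <= B.
Hypothesis b0 : 0 < b.
Hypothesis K0 : 0 < K.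
Hypothesis lam0 : 0 < lam.
Hypothesis D0 : 0 < D.
Hypothesis r2 : 2 <= r.
Hypothesis gam01 : 0 < gam < 1.
Hypothesis hD : Ex (pprod mu mu) (fun xy => mx (h xy) `^ (2 * r)) <= D `^ (2 * r).
Hypothesis h3 : forall j, Ex (pprod mu mu) (fun xy => `|h xy j| ^+ 3) <= B.
Hypothesis hb : forall j, b <= Gam mu h j j.
Hypothesis cardJ : (2 * #|J|)%:R <= expR (l ^+ 2).
Hypothesis H2 : D ^+ 2 * l ^+ 6 * (n%:R / gam) `^ r^-1 <= om ^+ 3 * n%:R.
Hypothesis H3 : B * l ^+ 7 <= om ^+ 3 * Num.sqrt n%:R.
Hypothesis H4 : covariance_const K lam * om <= b / 2.

Let n0 : (0 : R) < n%:R. Proof. by rewrite ltr0n ltnW. Qed.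
Let l0 : 0 < l := lt_le_trans ltr01 l1.
Let om0 : 0 < om. Proof. by case/andP: om01. Qed.
Let om1 : om <= 1. Proof. by case/andP: om01. Qed.
Let B0 : 0 < B := lt_le_trans ltr01 B1.
Let beta := beta_ l om K lam.
Let beta0 : 0 < beta := beta_gt0 l1 om01 K0 lam0.
Let rn : R := (Num.sqrt n%:R)^-1.
Let rn0 : 0 < rn. Proof. by rewrite invr_gt0 sqrtr_gt0. Qed.
Let m x : R := mx (hproj mu h x).
Let c := beta * rn.
Let c0 : 0 < c := mulr_gt0 beta0 rn0.
Let m0 x : 0 <= m x := mx_ge0 _.
Let bmm : bm m. Proof. exact: bm_mx (bm_hproj mu bh). Qed.
Let r0 : 0 < r := lt_le_trans (ltr0Sn R 1) r2.
Let r20 : 0 <= 2 * r := mulr_ge0 (ler0n R 2) (ltW r0).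

Lemma scaled_moment : Ex mu (fun x => (c * m x) `^ (2 * r)) <= pi3_ n%:R om.
Proof.
have -> : (fun x => (c * m x) `^ (2 * r)) = fun x => c `^ (2 * r) * m x `^ (2 * r).
  by apply/funext => x; rewrite powRM// ltW.
rewrite ExZ; last exact: bm_itg (bm_powR bmm r20).
have h1 := hproj_max_moment bh r2 D0 hD.
apply: (@le_trans _ _ (c `^ (2 * r) * (4 * D ^+ 2) `^ r)).
  by apply: ler_wpM2l; [exact: powR_ge0|exact: h1].
rewrite -sqr_powR ?(ltW c0)// -powRM; [|exact: sqr_ge0|exact: mulr_ge0 (ler0n _ 4) (sqr_ge0 _)].
exact: (truncation_scale n0 l1 om01 (Abeta_gt0 K0 lam0) (Abeta_le K0 lam0) r2 gam01 H2).
Qed.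

Lemma truncation_prob : Pr mu (fun x => 1 < beta * (rn * m x)) <= pi3_ n%:R om.
Proof.
have bcm : bm (fun x => c * m x) by apply: bmM => //; exact: bm_cst.
apply: (@le_trans _ _ (Pr mu (fun x => 1 <= c * m x))).
  apply: Pr_mono => [||x]; last by rewrite mulrA => /ltW.
  - apply: mb_lt; first exact: measurable_cst.
    have -> : (fun x => beta * (rn * m x)) = fun x => c * m x by apply/funext => x; rewrite mulrA.
    by case: bcm.
  - by apply: mb_le; [exact: measurable_cst|case: bcm].
have := Pr_powR_markov bcm (fun x => mulr_ge0 (ltW c0) (m0 x)) r20 ltr01 scaled_moment.
by rewrite powR1 divr1.
Qed.

(** Where [c m > 1], the cube of [c m] is at most its power of order [2 r >= 4], whose expectation
    is already bounded. *)
Lemma truncation_third :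
  Ex mu (fun x => m x ^+ 3 * (1 < beta * (rn * m x))%R%:R) <= tau3_ n%:R l om K lam.
Proof.
have bcm : bm (fun x => c * m x) by apply: bmM => //; exact: bm_cst.
rewrite /tau3_ -/beta -/rn -/c.
apply: (@le_trans _ _ (Ex mu (fun x => c ^- 3 * (c * m x) `^ (2 * r)))); last first.
  rewrite ExZ; last exact: bm_itg (bm_powR bcm r20).
  by apply: ler_wpM2l; [rewrite invr_ge0 exprn_ge0// ltW|exact: scaled_moment].
apply: Ex_le => [||x].
- apply: bm_itg; apply: bmM; first exact: bmX.
  apply: mb_bm; apply: mb_lt; first exact: measurable_cst.
  have -> : (fun x => beta * (rn * m x)) = fun x => c * m x by apply/funext => x; rewrite mulrA.
  by case: bcm.
- by apply: itgZ; exact: bm_itg (bm_powR bcm r20).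
rewrite mulrA -/c; case: ltP => h1; rewrite ?mulr1 ?mulr0; last first.
  by rewrite mulr_ge0 ?powR_ge0// invr_ge0 exprn_ge0// ltW.
rewrite ler_pdivlMl ?exprn_gt0// -exprMn -powR_mulrn ?(ltW (lt_trans ltr01 h1))//.
by apply: ler_powR; [exact: ltW|have := r2; lra].
Qed.

Variable s0 : n.-tuple T.
Hypothesis good : forall j k, `|Gam mu h j k - Ghat h s0 j k| <= Del_ l om K lam.

Lemma Ghat_diag j : sdev b ^+ 2 <= Ghat h s0 j j.
Proof.
rewrite sqr_sqrtr ?divr_ge0 ?(ltW b0)//.
have h1 : Del_ l om K lam <= b / 2.
  apply: le_trans H4; apply: ler_wpM2l; first exact: le_trans (covariance_const_ge K0 lam0).
  rewrite ler_pdivrMr ?exprn_gt0//; apply: (@le_trans _ _ om).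
    by rewrite exprS ler_piMr ?(ltW om0)// exprn_ile1// ltW.
  by rewrite ler_peMr ?(ltW om0)// exprn_ege1.
have := good j j; have := hb j; rewrite ler_norml => h2 /andP[h4 h5]; lra.
Qed.

(** The doubled vector [(x, - x)], with the sign as a boolean index; the covariance entries change
    only by signs, so all bounds carry over. *)
Let I : finType := (bool * J)%type.
Let xi x (i : I) : R := sg i.1 * hproj mu h x i.2.
Let a (k : 'I_n) (i : I) : R := sg i.1 * wt h s0 k i.2.

Let cardI : #|I|%:R <= expR (l ^+ 2).
Proof. by rewrite card_prod card_bool. Qed.

Lemma gsum_anticoncentration (y : I -> R) (t : R) : 0 <= t ->
  Pr (pow N01 n) (fun e => [forall i, gsum a e i <= y i + t]) -
  Pr (pow N01 n) (fun e => [forall i, gsum a e i <= y i]) <= kap_ l b * t.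
Proof.
move=> t0; have s0' := sdev_gt0 b0.
have -> : kap_ l b * t = 3 * expR 2 * (2 * l) * (t / sdev b) by rewrite /kap_; ring.
apply: gauss_anticoncentration_var => //.
- move=> i; apply: (le_trans (Ghat_diag i.2)); rewrite /Ghat le_eqVlt; apply/orP; left; apply/eqP.
  rewrite mulr_sumr; apply: eq_bigr => k _.
  rewrite /a !exprMn sg_sqr mul1r -expr2; congr (_ * _).
  by rewrite exprVn sqr_sqrtr// ltW.
- by rewrite ler_peMr.
- apply: (le_trans cardI); rewrite ler_expR exprMn.
  have -> : 2 ^+ 2 * l ^+ 2 / 2 = 2 * l ^+ 2 by field.
  by rewrite ler_peMl ?sqr_ge0// ler1n.
Qed.

(** Lyapunov's inequality. With [W = 8 B] the bounds for the first and second moments multiply to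
    [W] again, so the term [G2 * M1] costs no more than the third moment itself. *)
Lemma Ex_cube_root (f : T -> R) (W : R) : bm f -> (forall x, 0 <= f x) ->
  Ex mu (fun x => f x ^+ 3) <= W -> Ex mu f <= W `^ 3^-1 /\ Ex mu (fun x => f x ^+ 2) <= W `^ (2 / 3).
Proof.
move=> bf f0 hW.
have W0 : 0 <= W by apply: le_trans hW; apply: Ex_ge0 => x; exact: exprn_ge0.
have key (p : nat) : (0 < p <= 3)%N -> Ex mu (fun x => f x ^+ p) <= W `^ (p%:R / 3).
  move=> /andP[p0 p3].
  have E0 : 0 <= Ex mu (fun x => f x ^+ p) by apply: Ex_ge0 => x; exact: exprn_ge0.
  have P0 : (0 : R) < p%:R by rewrite ltr0n.
  have q1 : 1 <= 3 / p%:R :> R by rewrite ler_pdivlMr// mul1r ler_nat.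
  have := @Ex_powR _ _ _ mu (fun x => f x ^+ p) (3 / p%:R) (bmX p bf) (fun x => exprn_ge0 p (f0 x)) q1.
  have -> : (fun x => (f x ^+ p) `^ (3 / p%:R)) = fun x => f x ^+ 3.
    apply/funext => x; rewrite -powR_mulrn// -powRrM -[RHS]powR_mulrn//; congr (_ `^ _).
    by field; rewrite gt_eqF.
  move=> h1; have h2 := le_trans h1 hW.
  have -> : Ex mu (fun x => f x ^+ p) = (Ex mu (fun x => f x ^+ p) `^ (3 / p%:R)) `^ (p%:R / 3).
    by rewrite -powRrM -[LHS]powRr1//; congr (_ `^ _); field; rewrite gt_eqF.
  by apply: ge0_ler_powR; rewrite ?nnegrE ?powR_ge0// divr_ge0.
split; last exact: (key 2%N).
have := key 1%N isT; rewrite mul1r; apply: le_trans; rewrite le_eqVlt; apply/orP; left; apply/eqP.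
by apply: Ex_ext => x; rewrite expr1.
Qed.

Let B8 : 0 < 8 * B := mulr_gt0 (ltr0Sn R 7) B0.

Let third j : Ex mu (fun x => `|hproj mu h x j| ^+ 3) <= 8 * B.
Proof.
have -> : 8 * B = 2 ^+ 3 * B by congr (_ * _); rewrite -natrX.
exact: (hproj_moment_nat bh (p := 3)).
Qed.

Lemma orthant_bound (y : bool * J -> R) :
  `|Pr (pow mu n) (fun s => [forall i, ssum xi s i <= y i]) -
    Pr (pow N01 n) (fun e => [forall i, gsum a e i <= y i])| <= orthant_const b K lam * om.
Proof.
have bhp j := bm_hproj mu bh j.
pose G2 := (8 * B) `^ (2 / 3).
pose M1 := (8 * B) `^ 3^-1.
have lyap j := Ex_cube_root (bm_abs (bhp j)) (fun x => normr_ge0 _) (third j).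
have G2M1 : G2 * M1 = 8 * B.
  rewrite /G2 /M1 -powRD; last by rewrite (gt_eqF B8) implybT.
  by rewrite -[RHS]powRr1 ?(ltW B8)//; congr (_ `^ _); field.
have G20 : 0 <= G2 := powR_ge0 _ _.
have G2B : G2 <= 8 * B.
  rewrite -[leRHS]powRr1 ?(ltW B8)//; apply: ler_powR; last by lra.
  by have := B1; lra.
have I0 : (0 < #|I|)%N by rewrite card_prod card_bool muln_gt0.
have l21 : 1 <= l ^+ 2 by rewrite exprn_ege1.
have bxi (i : I) : bm (fun x => xi x i) by apply: bmM; [exact: bm_cst|exact: bhp].
have xi0 (i : I) : Ex mu (fun x => xi x i) = 0.
  by rewrite ExZ; [rewrite (Ex_hproj mu bh) mulr0|exact: bm_itg (bhp _)].
have nxi x (i : I) : `|xi x i| = `|hproj mu h x i.2| by rewrite normrM sg_norm mul1r.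
pose Gs (i k : I) := Ex mu (fun x => xi x i * xi x k).
have GsE (i k : I) : Gs i k = sg i.1 * sg k.1 * Gam mu h i.2 k.2.
  rewrite /Gam -ExZ; last exact/bm_itg/bmM.
  by apply: Ex_ext => x; rewrite /xi; ring.
have GsG2 (i k : I) : `|Gs i k| <= G2.
  rewrite GsE !normrM !sg_norm !mul1r.
  apply: (le_trans (Ex_abs (bm_itg mu (bmM (bhp i.2) (bhp k.2))))).
  have bb j : itg mu (fun x => `|hproj mu h x j| ^+ 2) by apply: bm_itg; exact: bmX (bm_abs (bhp j)).
  apply: (@le_trans _ _ (Ex mu (fun x => 2^-1 * (`|hproj mu h x i.2| ^+ 2 + `|hproj mu h x k.2| ^+ 2)))).
    apply: Ex_le => [||x].
    - by apply: itg_abs; exact: bm_itg (bmM (bhp _) (bhp _)).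
    - by apply: itgZ; exact: itgD.
    rewrite normrM; set u := `|_|; set v := `|_|; have := sqr_ge0 (u - v); rewrite sqrrB => H.
    by move: H; rewrite -mulr_natr; lra.
  rewrite ExZ; last exact: itgD.
  by rewrite ExD//; apply: half_sum_le; [case: (lyap i.2)|case: (lyap k.2)].
have GsDel (i k : I) : `|Gs i k - n%:R^-1 * \sum_p a p i * a p k| <= Del_ l om K lam.
  have -> : n%:R^-1 * \sum_p a p i * a p k = sg i.1 * sg k.1 * Ghat h s0 i.2 k.2.
    rewrite /Ghat !mulr_sumr; apply: eq_bigr => p _; rewrite /a; ring.
  by rewrite GsE -mulrBr normrM normrM !sg_norm !mul1r; exact: good.
have slope : 8 * (2 * smK (l ^+ 2) * beta ^+ 2 * Del_ l om K lam +
    5 * expR 2 * (rn * (smK (l ^+ 2) * beta ^+ 3 * (8 * B + G2 * M1)))) <= 1.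
  rewrite G2M1; exact: (slope_le n0 l1 om01 B1 K0 lam0 H3).
have Ex3 (i : I) : Ex mu (fun x => `|xi x i| ^+ 3) <= 8 * B.
  by apply: le_trans (third i.2); rewrite le_eqVlt; apply/orP; left; apply/eqP; apply: Ex_ext => x; rewrite nxi.
have Ex1 (i : I) : Ex mu (fun x => `|xi x i|) <= M1.
  case: (lyap i.2) => + _; apply: le_trans.
  by rewrite le_eqVlt; apply/orP; left; apply/eqP; apply: Ex_ext => x; rewrite nxi.
have xim x (i : I) : `|xi x i| <= m x by rewrite nxi; exact: (le_mx (hproj mu h x) i.2).
have := @interpolation_bound _ _ _ mu n I xi a bxi xi0 (ltnW n2) I0 beta (l ^+ 2) m Gs (8 * B) G2 M1 _ _ _ _
  beta0 l21 cardI bmm xim (fun _ _ => erefl) Ex3 GsG2 Ex1 truncation_prob truncation_third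
  (ltW (kap_gt0 l1 b0)) (Del_ge0 l1 om01 K0 lam0) GsDel gsum_anticoncentration y slope.
move=> H; apply: (le_trans H); rewrite G2M1.
apply: (orthant_rate_le l1 om01 b0 K0 lam0).
exact: (offset_le n0 l1 om01 B1 K0 lam0 H3 G20 G2B).
Qed.

End orthants.

Definition remainder_const {R : realType} (lam : R) : R := 2 ^+ 18 * (lam + 6) ^+ 2.

(** The left side is the second-order Markov bound for the decoupled degenerate sum at level
    [om / l]; [s] stands for the square root of the sample size and [n1] for that size minus one. *)
Lemma remainder_rate {R : realType} (s n1 l om D lam : R) : 0 < s -> s ^+ 2 / 2 <= n1 -> 0 < l -> 0 < om ->
  D ^+ 2 * l ^+ 6 <= om ^+ 3 * s ^+ 2 ->
  4 * (64 * ((lam + 6) * l ^+ 2 * s ^+ 2)) ^+ 2 * (4 ^+ 2 * D ^+ 2) /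
    (om / l / (s / 2 * (s ^+ 2 * n1)^-1)) ^+ 2 <= remainder_const lam * om.
Proof.
move=> s0 n1s l0 om0 h.
have s20 : 0 < s ^+ 2 by rewrite exprn_gt0.
have n10 : 0 < n1 by apply: lt_le_trans n1s; rewrite divr_gt0.
have -> : 4 * (64 * ((lam + 6) * l ^+ 2 * s ^+ 2)) ^+ 2 * (4 ^+ 2 * D ^+ 2) /
    (om / l / (s / 2 * (s ^+ 2 * n1)^-1)) ^+ 2 =
    (2 ^+ 16 * (lam + 6) ^+ 2) * (D ^+ 2 * l ^+ 6 * (s ^+ 2 / (om ^+ 2 * n1 ^+ 2))).
  by field; rewrite !gt_eqF.
have -> : remainder_const lam * om = (2 ^+ 16 * (lam + 6) ^+ 2) * (om * 4) by rewrite /remainder_const; ring.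
apply: ler_wpM2l; first exact: mulr_ge0 (exprn_ge0 16 (ler0n R 2)) (sqr_ge0 _).
apply: (@le_trans _ _ (om ^+ 3 * s ^+ 2 * (s ^+ 2 / (om ^+ 2 * n1 ^+ 2)))).
  by apply: ler_wpM2r => //; apply: divr_ge0; [exact: ltW|exact: mulr_ge0 (sqr_ge0 _) (sqr_ge0 _)].
have -> : om ^+ 3 * s ^+ 2 * (s ^+ 2 / (om ^+ 2 * n1 ^+ 2)) = om * (s ^+ 2 / n1) ^+ 2.
  by field; rewrite !gt_eqF.
apply: ler_wpM2l; first exact: ltW.
have h1 : s ^+ 2 / n1 <= 2 by rewrite ler_pdivrMr//; move: n1s; lra.
have -> : (4 : R) = 2 ^+ 2 by ring.
by rewrite ler_sqr ?nnegrE// divr_ge0// ltW.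
Qed.

Lemma sandwich_prob {R : realType} (a p1 p2 g g1 g2 c k e : R) :
  a <= p1 + e -> p2 <= a + e -> `|p1 - g1| <= c -> `|p2 - g2| <= c ->
  g1 - g <= k -> g - g2 <= k -> `|a - g| <= c + k + e.
Proof. by rewrite !ler_norml => ? ? /andP[? ?] /andP[? ?] ? ?; apply/andP; split; lra. Qed.

Lemma powR_cancel_le {R : realType} (r x y : R) : 0 < r -> 0 <= x -> 0 <= y -> x `^ r <= y `^ r -> x <= y.
Proof.
move=> r0 x0 y0 h; case: (leP x y) => // yx.
by have := gt0_ltr_powR r0 y0 x0 yx; rewrite ltNge h.
Qed.

Lemma scaled_dev_arith {R : realType} (s n1 m S U : R) : 0 < s -> 0 < n1 ->
  s * (m + s ^- 2 * (S + (n1^-1 * U + S)) - m) / 2 = s^-1 * S + s / 2 * (s ^+ 2 * n1)^-1 * U.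
Proof. by move=> s0 n10; field; rewrite !gt_eqF. Qed.

(** * From orthants to rectangles, with the degenerate part included *)

Section rectangles.
Context {R : realType} {d : measure_display} {T : measurableType d} (J : finType).
Variables (mu : probability T R) (h : T * T -> J -> R) (n : nat).
Variables (l om B b K lam D r gam : R).
Hypothesis bh : forall j, bm (fun xy => h xy j).
Hypothesis sym : forall x y j, h (x, y) j = h (y, x) j.
Hypothesis J0 : (0 < #|J|)%N.
Hypothesis n2 : (1 < n)%N.
Hypothesis l1 : 1 <= l.
Hypothesis om01 : 0 < om <= 1.
Hypothesis B1 : 1 <= B.
Hypothesis b0 : 0 < b.
Hypothesis K0 : 0 < K.
Hypothesis lam0 : 0 < lam.
Hypothesis D0 : 0 < D.
Hypothesis r2 : 2 <= r.
Hypothesis gam01 : 0 < gam < 1.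
Hypothesis hD : Ex (pprod mu mu) (fun xy => mx (h xy) `^ (2 * r)) <= D `^ (2 * r).
Hypothesis h3 : forall j, Ex (pprod mu mu) (fun xy => `|h xy j| ^+ 3) <= B.
Hypothesis hb : forall j, b <= Gam mu h j j.
Hypothesis cardJ : (2 * #|J|)%:R <= expR (l ^+ 2).
Hypothesis H2 : D ^+ 2 * l ^+ 6 * (n%:R / gam) `^ r^-1 <= om ^+ 3 * n%:R.
Hypothesis H3 : B * l ^+ 7 <= om ^+ 3 * Num.sqrt n%:R.
Hypothesis H4 : covariance_const K lam * om <= b / 2.

Definition scaled_dev (s : n.-tuple T) j : R := Num.sqrt n%:R * (uavg h s j - hmean mu h j) / 2.
Definition degenerate_sum (s : n.-tuple T) j : R :=
  \sum_i \sum_(k | k != i) k2 mu h (tnth s i, tnth s k) j.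
Definition remainder s j : R := Num.sqrt n%:R / 2 * (n%:R * n.-1%:R)^-1 * degenerate_sum s j.

Let n0 : (0 : R) < n%:R. Proof. by rewrite ltr0n ltnW. Qed.
Let n10 : (0 : R) < n.-1%:R. Proof. by rewrite ltr0n -subn1 subn_gt0. Qed.
Let sn0 : 0 < Num.sqrt n%:R :> R. Proof. by rewrite sqrtr_gt0. Qed.
Let sn2 : Num.sqrt n%:R ^+ 2 = n%:R :> R. Proof. by rewrite sqr_sqrtr// ltW. Qed.
Let l0 : 0 < l := lt_le_trans ltr01 l1.
Let om0 : 0 < om. Proof. by case/andP: om01. Qed.

(** Summing the row remainders yields the projections a second time, because [k1] is not centred
    given its second argument. The doubled linear term cancels the division by 2 in the
    statistic. *)
Lemma scaled_dev_split s j : scaled_dev s j = ssum (hproj mu h) s j + remainder s j.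
Proof.
rewrite /scaled_dev /remainder (uavg_hmean mu h n2) big_split/=.
have -> : \sum_i rsum mu h s i j =
    n.-1%:R^-1 * degenerate_sum s j + \sum_i hproj mu h (tnth s i) j.
  rewrite /rsum -mulr_sumr.
  have -> : \sum_(i < n) \sum_(k < n | k != i) k1 mu h (tnth s i, tnth s k) j =
      degenerate_sum s j + n.-1%:R * \sum_i hproj mu h (tnth s i) j.
    rewrite -sum_neq_swap -big_split; apply: eq_bigr => i _.
    by rewrite -big_split; apply: eq_bigr => k _; rewrite /k2 /= subrK.
  by rewrite mulrDr mulKf// gt_eqF.
rewrite /ssum; set S := \sum_i _; set U := degenerate_sum s j.
by have := scaled_dev_arith (hmean mu h j) S U sn0 n10; rewrite sn2.
Qed.

Let Q := (lam + 6) * l ^+ 2.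

Let D2 : Ex (pprod mu mu) (fun xy => mx (h xy) `^ 2) <= D `^ 2.
Proof.
have r0 : 0 < r by apply: lt_le_trans r2.
have bmh : bm (fun xy => mx (h xy)) by exact: bm_mx.
have b2 : bm (fun xy => mx (h xy) `^ 2) by apply: bm_powR.
have E0 : 0 <= Ex (pprod mu mu) (fun xy => mx (h xy) `^ 2) by apply: Ex_ge0 => x; exact: powR_ge0.
have r1 : 1 <= r by apply: le_trans r2; rewrite ler1n.
have := Ex_powR (pprod mu mu) b2 (fun x => powR_ge0 _ _) r1.
have -> : (fun xy => (mx (h xy) `^ 2) `^ r) = fun xy => mx (h xy) `^ (2 * r).
  by apply/funext => xy; rewrite powRrM.
move=> /le_trans /(_ hD); rewrite powRrM => hh.
exact: powR_cancel_le r0 E0 (powR_ge0 _ _) hh.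
Qed.

Lemma bm_degenerate_sum j : bm (fun s => degenerate_sum s j).
Proof.
apply: bm_sum => i; apply: bm_sum => k.
by apply: (bm_pre _ (bm_k2 mu bh j)); apply: measurable_fun_pair; exact: measurable_tnth.
Qed.

Lemma bm_remainder j : bm (fun s => remainder s j).
Proof. by apply: bmM; [exact: bm_cst|exact: bm_degenerate_sum]. Qed.

Lemma bm_scaled_dev j : bm (fun s => scaled_dev s j).
Proof.
have -> : (fun s => scaled_dev s j) = fun s => ssum (hproj mu h) s j + remainder s j.
  by apply/funext => s; exact: scaled_dev_split.
by apply: bmD; [exact: (bm_ssum n (bm_hproj mu bh))|exact: bm_remainder].
Qed.

Lemma remainder_tail : Pr (pow mu n) (fun s => om / l <= mx (remainder s)) <= remainder_const lam * om.
Proof.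
have Q2 : 2 <= Q.
  have h1 : 1 <= l ^+ 2 by rewrite exprn_ege1.
  rewrite /Q; apply: (@le_trans _ _ (2 * 1)); first by rewrite mulr1.
  by apply: ler_pM => //; have := lam0; lra.
have cQ : 2 * #|J|%:R <= expR (Q / 2).
  move: cardJ; rewrite natrM => /le_trans; apply; rewrite ler_expR /Q.
  have -> : (lam + 6) * l ^+ 2 / 2 = (lam / 2 + 2) * l ^+ 2 + l ^+ 2 by field.
  by rewrite lerDr; apply: mulr_ge0 (sqr_ge0 _); have := lam0; lra.
have bk2 j := bm_k2 mu bh j.
have bm2 : bm (fun xy => mx (k2 mu h xy)) by exact: bm_mx.
have := decoupling (mu := mu) (r := 2) J0 (lexx _) Q2 cQ (ltnW n2) bk2
  (Ex_k2_fst mu bh sym) (Ex_k2 mu bh) bm2 (fun xy j => le_mx (k2 mu h xy) j).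
have e12 : 1 <= 2 :> R by rewrite ler1n.
have k2m := k2_moment bh (r := 2) e12 D2.
pose c : R := Num.sqrt n%:R / 2 * (n%:R * n.-1%:R)^-1.
have c0 : 0 < c by rewrite mulr_gt0 ?invr_gt0 ?mulr_gt0// divr_gt0.
rewrite -/(degenerate_sum) => dec.
have bdeg := bm_degenerate_sum.
have mE s : mx (remainder s) = c * mx (degenerate_sum s) by rewrite /remainder mxZ gtr0_norm.
have -> : (fun s => om / l <= mx (remainder s)) = fun s => om / l / c <= mx (degenerate_sum s).
  by apply/funext => s; rewrite mE (ler_pdivrMr _ _ c0) [_ * c]mulrC.
have a0 : 0 < om / l / c by apply: divr_gt0 => //; exact: divr_gt0.
apply: (le_trans (Pr_powR_markov (bm_mx bdeg) (fun s => mx_ge0 _) (ler0n R 2) a0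
  (le_trans dec (ler_wpM2l _ k2m)))).
  by apply: mulr_ge0; [exact: ler0n|exact: powR_ge0].
rewrite !powR_mulrn ?(ltW a0)//; last 2 first.
- by rewrite ltW.
- exact: mulr_ge0 (ler0n R 64) (mulr_ge0 (le_trans (ler0n R 2) Q2) (ltW n0)).
have nn1 : Num.sqrt n%:R ^+ 2 / 2 <= n.-1%:R :> R.
  by rewrite sn2 ler_pdivrMr// -natrM ler_nat; case: (n) n2 => // k; rewrite ltnS /= => k1; rewrite muln2 -addnn -(addn1 k) leq_add2l.
have hom : D ^+ 2 * l ^+ 6 <= om ^+ 3 * Num.sqrt n%:R ^+ 2.
  rewrite sn2; apply: le_trans H2; rewrite ler_peMr//.
    exact: mulr_ge0 (sqr_ge0 _) (exprn_ge0 6 (ltW l0)).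
  have /andP[g0 g1] := gam01.
  have h1 : 1 <= n%:R / gam by rewrite ler_pdivlMr// mul1r (le_trans (ltW g1))// ler1n ltnW.
  have ir : 0 <= r^-1 by rewrite invr_ge0 (le_trans _ r2).
  apply: (@le_trans _ _ (1 `^ r^-1)); first by rewrite powR1.
  by apply: ge0_ler_powR => //; rewrite nnegrE// (le_trans ler01 h1).
by have := remainder_rate lam sn0 nn1 l0 om0 hom; rewrite sn2 -/c.
Qed.

Variable s0 : n.-tuple T.
Hypothesis good : forall j k, `|Gam mu h j k - Ghat h s0 j k| <= Del_ l om K lam.
(** A statistic that is close to the one of the bounded kernel outside an event of probability [om].
    It will be the statistic of the unclipped kernel. *)
Variable T' : n.-tuple T -> J -> R.
Hypothesis mT' : forall j, measurable_fun setT (fun s => T' s j).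
Hypothesis hT' : Pr (pow mu n) (fun s => [exists j, om / l < `|T' s j - scaled_dev s j|]) <= om.

Definition rectangle_const : R := orthant_const b K lam + 2 * (96 / sdev b) + (remainder_const lam + 1).

Let rectE (z lo hi : J -> R) : [forall j, lo j <= z j <= hi j] =
  [forall i : bool * J, sg i.1 * z i.2 <= if i.1 then hi i.2 else - lo i.2].
Proof.
apply/forallP/forallP => [H [[] j] /=|H j].
- by rewrite mul1r; case/andP: (H j).
- by rewrite mulN1r lerN2; case/andP: (H j).
- have := H (true, j); have := H (false, j); rewrite /= mul1r mulN1r lerN2 => -> ->//.
Qed.

Lemma rect_bound (lo hi : J -> R) :
  `|Pr (pow mu n) (fun s => [forall j, lo j <= T' s j <= hi j]) -
    Pr (pow N01 n) (fun e => [forall j, lo j <= gsum (wt h s0) e j <= hi j])| <= rectangle_const * om.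
Proof.
pose y (i : bool * J) : R := if i.1 then hi i.2 else - lo i.2.
pose xi x (i : bool * J) : R := sg i.1 * hproj mu h x i.2.
pose a (k : 'I_n) (i : bool * J) : R := sg i.1 * wt h s0 k i.2.
have gE e i : gsum a e i = sg i.1 * gsum (wt h s0) e i.2.
  by rewrite /gsum /dot mulr_sumr; apply: eq_bigr => k _; rewrite /a; ring.
have sE (s : n.-tuple T) i : ssum xi s i = sg i.1 * ssum (hproj mu h) s i.2.
  by rewrite /ssum [RHS]mulrCA; congr (_ * _); rewrite mulr_sumr.
have -> : (fun e => [forall j, lo j <= gsum (wt h s0) e j <= hi j]) = fun e => [forall i, gsum a e i <= y i].
  by apply/funext => e; rewrite rectE; apply: eq_forallb => i; rewrite gE.
(* One [om / l] for the degenerate remainder and one for the distance between [T'] and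
   [scaled_dev]. *)
pose t := 2 * (om / l).
have t0 : 0 <= t by rewrite mulr_ge0// divr_ge0// ltW.
have bxi i : bm (fun x => xi x i) by apply: bmM; [exact: bm_cst|exact: bm_hproj].
have mS (z : bool * J -> R) : mb (fun s : n.-tuple T => [forall i, ssum xi s i <= z i]).
  by apply: mb_forall => i; apply: mb_le => //; case: (bm_ssum n bxi i).
have mT (lo' hi' : J -> R) : mb (fun s => [forall j, lo' j <= T' s j <= hi' j]).
  by apply: mb_forall => j; apply: mb_and; apply: mb_le => //; exact: mT'.
have mtst j : measurable_fun setT (fun s => scaled_dev s j) by case: (bm_scaled_dev j).
have mrem := bm_remainder.
pose bad s := (om / l <= mx (remainder s)) || [exists j, om / l < `|T' s j - scaled_dev s j|].
have mbad1 : mb (fun s => om / l <= mx (remainder s)) by apply: mb_le => //; case: (bm_mx mrem).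
have mbad2 : mb (fun s => [exists j, om / l < `|T' s j - scaled_dev s j|]).
  apply: mb_exists => j; apply: mb_lt => //; apply: measurableT_comp => //.
  by apply: measurable_funB.
have mbad : mb bad by apply: mb_or.
have Pbad : Pr (pow mu n) bad <= (remainder_const lam + 1) * om.
  apply: (le_trans (Pr_or _ mbad1 mbad2)); rewrite mulrDl mul1r; apply: lerD => //; exact: remainder_tail.
have close s i : ~~ bad s -> `|sg i.1 * T' s i.2 - ssum xi s i| <= t.
  rewrite negb_or -ltNge => /andP[h1 /existsPn h2].
  rewrite sE -mulrBr normrM sg_norm mul1r.
  have -> : T' s i.2 - ssum (hproj mu h) s i.2 = (T' s i.2 - scaled_dev s i.2) + remainder s i.2.
    by rewrite scaled_dev_split; ring.
  apply: (le_trans (ler_normD _ _)); rewrite /t mulr_natl mulr2n; apply: lerD.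
    by have := h2 i.2; rewrite -leNgt.
  exact: le_trans (le_mx _ _) (ltW h1).
have orth := orthant_bound bh J0 n2 l1 om01 B1 b0 K0 lam0 D0 r2 gam01 hD h3 hb cardJ H2 H3 H4 good.
have anti := gsum_anticoncentration l1 om01 b0 K0 lam0 hb cardJ H4 good.
have -> : rectangle_const * om = orthant_const b K lam * om + 2 * (96 / sdev b) * om + (remainder_const lam + 1) * om.
  by rewrite /rectangle_const; ring.
have kt : kap_ l b * t <= 2 * (96 / sdev b) * om.
  by rewrite /t mulrCA -mulrA; apply: ler_wpM2l => //; exact: kapt_le.
apply: (sandwich_prob (p1 := Pr (pow mu n) (fun s => [forall i, ssum xi s i <= y i + t]))
  (p2 := Pr (pow mu n) (fun s => [forall i, ssum xi s i <= y i - t])) _ _ (orth _) (orth _)).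
- apply: (@le_trans _ _ (Pr (pow mu n) (fun s => [forall i, ssum xi s i <= y i + t] || bad s))).
    apply: Pr_mono => [||s]; [exact: mT|exact: mb_or|].
    rewrite rectE; case: (boolP (bad s)) => [_|nb] H; rewrite ?orbT ?orbF//.
    apply/forallP => i; have := close s i nb; have := forallP H i; rewrite -/(y i) ler_norml.
    by move=> h1 /andP[h2 h4]; lra.
  by apply: (le_trans (Pr_or _ (mS _) mbad)); rewrite lerD2l.
- apply: (@le_trans _ _ (Pr (pow mu n) (fun s => [forall j, lo j <= T' s j <= hi j] || bad s))).
    apply: Pr_mono => [||s]; [exact: mS|exact: mb_or|].
    rewrite rectE; case: (boolP (bad s)) => [_|nb] H; rewrite ?orbT ?orbF//.
    apply/forallP => i; have := close s i nb; have := forallP H i; rewrite -/(y i) ler_norml.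
    by move=> h1 /andP[h2 h4]; lra.
  by apply: (le_trans (Pr_or _ (mT _ _) mbad)); rewrite lerD2l.
- exact: le_trans (anti y t t0) kt.
- have := anti (fun i => y i - t) t t0.
  have -> : (fun e => [forall i, gsum a e i <= y i - t + t]) = fun e => [forall i, gsum a e i <= y i].
    by apply/funext => e; apply: eq_forallb => i; rewrite subrK.
  by move=> h1; exact: le_trans h1 kt.
Qed.

End rectangles.

(** * Clipping unbounded kernels *)

Section clip.
Context {R : realType}.
Implicit Types M x : R.

Definition clip M x : R := Num.max (- M) (Num.min M x).

Lemma clip_id M x : `|x| <= M -> clip M x = x.
Proof. by rewrite ler_norml => /andP[h1 h2]; rewrite /clip min_r// max_r. Qed.

Lemma clipE M x : 0 <= M -> M < `|x| -> clip M x = if 0 <= x then M else - M.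
Proof.
move=> M0; rewrite /clip; case: (lerP 0 x) => x0.
  by rewrite ger0_norm// => h; rewrite min_l ?(ltW h)// max_r//; lra.
by rewrite ltr0_norm// => h; rewrite min_r ?max_l//; lra.
Qed.

Lemma clip_bound M x : 0 <= M -> `|clip M x| <= M.
Proof.
move=> M0; case: (lerP `|x| M) => h; first by rewrite clip_id.
by rewrite clipE//; case: ifP; rewrite ?normrN ger0_norm.
Qed.

Lemma clip_le M x : 0 <= M -> `|clip M x| <= `|x|.
Proof.
move=> M0; case: (lerP `|x| M) => h; first by rewrite clip_id.
by apply: (le_trans (clip_bound x M0)); exact: ltW.
Qed.

Lemma clip_dist M x : 0 <= M -> M < `|x| -> `|x - clip M x| <= `|x|.
Proof.
move=> M0 h; rewrite clipE//; move: h; case: (lerP 0 x) => x0.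
  by rewrite [in X in _ < X]ger0_norm// => h; rewrite !ger0_norm//; lra.
rewrite [in X in _ < X]ltr0_norm// => h; rewrite [leRHS]ltr0_norm// opprK.
by rewrite ler0_norm; lra.
Qed.

(** Clipping acts only where [|x| > M], and there each missing power up to the fourth can be
    supplied by a factor [|x| / M]. *)
Lemma clip_tail M x k : 0 < M -> (0 < k <= 4)%N -> `|x - clip M x| ^+ k <= `|x| ^+ 4 / M ^+ (4 - k).
Proof.
move=> M0 /andP[k0 k4]; case: (lerP `|x| M) => h.
  by rewrite clip_id// subrr normr0 expr0n gtn_eqF// divr_ge0// exprn_ge0// ltW.
apply: (@le_trans _ _ (`|x| ^+ k)); first by apply: lerXn2r; rewrite ?nnegrE// clip_dist// ltW.
rewrite ler_pdivlMr ?exprn_gt0// -[in leRHS](subnKC k4) exprD.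
by apply: ler_wpM2l; [exact: exprn_ge0|apply: lerXn2r; rewrite ?nnegrE// ltW].
Qed.

Lemma measurable_clip M {d : measure_display} {T : measurableType d} (f : T -> R) :
  measurable_fun setT f -> measurable_fun setT (fun y => clip M (f y)).
Proof.
by move=> mf; apply: measurable_maxr; [exact: measurable_cst|apply: measurable_minr => //; exact: measurable_cst].
Qed.

End clip.

Lemma Ex_sqr_itg {R : realType} {d : measure_display} {T : measurableType d} (m : probability T R)
    (f : T -> R) : itg m f -> itg m (fun x => f x ^+ 2) -> Ex m f ^+ 2 <= Ex m (fun x => f x ^+ 2).
Proof.
move=> if1 if2; set a := Ex m f.
have i3 : itg m (fun x => 2 * a * f x - a ^+ 2) by apply: itgB; [exact: itgZ|exact: itg_cst].
apply: (@le_trans _ _ (Ex m (fun x => 2 * a * f x - a ^+ 2))).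
  rewrite ExB; [|exact: itgZ|exact: itg_cst]; rewrite Ex_cst ExZ// -/a le_eqVlt; apply/orP; left.
  by apply/eqP; ring.
by apply: Ex_le => // x; have := sqr_ge0 (f x - a); rewrite sqrrB -[_ *+ 2]mulr_natl; lra.
Qed.

Lemma sqr_split_le {R : realType} (g u v c : R) : g = u + (v - c) -> g ^+ 2 <= 2 * u ^+ 2 + 4 * c ^+ 2 + 4 * v ^+ 2.
Proof. by move=> ->; have := sqr_ge0 (u - (v - c)); have := sqr_ge0 (v + c); lra. Qed.

Section clipped_variance.
Context {R : realType} {d : measure_display} {T : measurableType d}.
Variables (mu : probability T R) (f : T * T -> R) (B M b : R).
Hypothesis mf : measurable_fun setT f.
Hypothesis i4 : itg (pprod mu mu) (fun xy => `|f xy| ^+ 4).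
Hypothesis f4 : Ex (pprod mu mu) (fun xy => `|f xy| ^+ 4) <= B ^+ 2.
Hypothesis M0 : 0 < M.

Let fM xy : R := clip M (f xy).
Let H xy : R := (f xy - fM xy) ^+ 2.

Lemma bm_clip : bm fM.
Proof. by split; [exact: measurable_clip|exists M => x; exact: clip_bound (ltW M0)]. Qed.

Let mfM : measurable_fun setT fM. Proof. by case: bm_clip. Qed.
Let mH : measurable_fun setT H.
Proof. by apply: measurable_funX; exact: measurable_funB. Qed.

Lemma itg_low_power k : (k <= 4)%N -> itg (pprod mu mu) (fun xy => `|f xy| ^+ k).
Proof.
move=> k4; apply: (itg_dom (g := fun xy => 1 + `|f xy| ^+ 4)).
- by apply: measurable_funX; exact: measurableT_comp.
- move=> x; rewrite ger0_norm ?exprn_ge0//; case: (lerP `|f x| 1) => h.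
    by apply: (@le_trans _ _ 1); [exact: exprn_ile1|rewrite lerDl exprn_ge0].
  by apply: (@le_trans _ _ (`|f x| ^+ 4)); [apply: ler_weXn2l => //; exact: ltW|rewrite lerDr].
- by apply: itgD => //; exact: itg_cst.
Qed.

Lemma itg_main : itg (pprod mu mu) f.
Proof.
apply: (itg_dom (g := fun xy => `|f xy| ^+ 1)) => //.
exact: itg_low_power.
Qed.

Lemma clip_moment k : (0 < k <= 4)%N -> itg (pprod mu mu) (fun xy => `|f xy - fM xy| ^+ k) /\
  Ex (pprod mu mu) (fun xy => `|f xy - fM xy| ^+ k) <= B ^+ 2 / M ^+ (4 - k).
Proof.
move=> k4.
have i : itg (pprod mu mu) (fun xy => (M ^+ (4 - k))^-1 * `|f xy| ^+ 4) by exact: itgZ.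
have le1 x : `|f x - fM x| ^+ k <= (M ^+ (4 - k))^-1 * `|f x| ^+ 4.
  by rewrite mulrC; exact: clip_tail.
have i' : itg (pprod mu mu) (fun xy => `|f xy - fM xy| ^+ k).
  apply: itg_dom i => [|x]; last by rewrite ger0_norm ?exprn_ge0.
  by apply: measurable_funX; apply: measurableT_comp => //; exact: measurable_funB.
split => //; apply: (le_trans (Ex_le i' i le1)).
by rewrite ExZ// mulrC; apply: ler_wpM2r => //; rewrite invr_ge0 exprn_ge0// ltW.
Qed.

Let HE : H = fun xy => `|f xy - fM xy| ^+ 2.
Proof. by apply/funext => xy; rewrite real_normK// num_real. Qed.

Let iH : itg (pprod mu mu) H. Proof. by rewrite HE; exact: (clip_moment (k := 2) isT).1. Qed.
Let EH : Ex (pprod mu mu) H <= B ^+ 2 / M ^+ 2.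
Proof. by rewrite HE; exact: (clip_moment (k := 2) isT).2. Qed.

Let th := Ex (pprod mu mu) f.
Let thM := Ex (pprod mu mu) fM.

Lemma clip_mean : `|th - thM| <= B ^+ 2 / M ^+ 3.
Proof.
have ifM := bm_itg (pprod mu mu) bm_clip.
have [i1 e1] := clip_moment (k := 1) isT.
rewrite -ExB//; last exact: itg_main.
apply: (le_trans (Ex_abs _)); first by apply: itgB => //; exact: itg_main.
apply: le_trans e1; rewrite le_eqVlt; apply/orP; left; apply/eqP.
by apply: Ex_ext => xy; rewrite expr1.
Qed.

Lemma clip_tail_prob : Pr (pprod mu mu) (fun xy => M < `|f xy|) <= B ^+ 2 / M ^+ 4.
Proof.
have mnf : measurable_fun setT (fun xy => `|f xy|) by exact: measurableT_comp.
apply: (@le_trans _ _ (Pr (pprod mu mu) (fun xy => M ^+ 4 <= `|f xy| ^+ 4))).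
  apply: Pr_mono => [||xy h]; [exact: mb_lt|by apply: mb_le => //; exact: measurable_funX|].
  by apply: lerXn2r; rewrite ?nnegrE// ltW.
have M4 : 0 < M ^+ 4 by rewrite exprn_gt0.
apply: (le_trans (Pr_markov i4 (fun x => exprn_ge0 _ (normr_ge0 _)) M4)).
by apply: ler_wpM2r => //; rewrite invr_ge0 ltW.
Qed.

Let g x : R := Ex mu (fun y => f (x, y)) - th.
Let gM x : R := Ex mu (fun y => fM (x, y)) - thM.

Lemma measurable_condE : measurable_fun setT g.
Proof.
apply: measurable_funB; last exact: measurable_cst.
by apply: measurableT_comp => //; exact: (measurable_fubini_F itg_main).
Qed.

Let c := th - thM.

(** Stated in the extended reals so that it holds for every [x]: where the inner integral is
    infinite the claim is trivial, and elsewhere the section of [f] is integrable. *)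
Let pointwise x : ((g x ^+ 2)%:E <= (2 * gM x ^+ 2 + 4 * c ^+ 2)%:E + 4%:E * \int[mu]_y (H (x, y))%:E)%E.
Proof.
have mHx : measurable_fun setT (fun y => H (x, y)).
  by apply: (measurableT_comp mH); exact: pair1_measurable.
have I0 : (0 <= \int[mu]_y (H (x, y))%:E)%E by apply: integral_ge0 => y _; rewrite lee_fin sqr_ge0.
have [fin|] := boolP ((\int[mu]_y (H (x, y))%:E)%E \is a fin_num); last first.
  rewrite ge0_fin_numE// -leNgt leye_eq => /eqP ->.
  by rewrite mulry gtr0_sg// mul1e addey// leey.
have iHx : itg mu (fun y => H (x, y)).
  apply/integrableP; split; first exact/measurable_EFinP.
  by under eq_integral do rewrite /= ger0_norm ?sqr_ge0//; rewrite -ge0_fin_numE.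
have mfx : measurable_fun setT (fun y => f (x, y)).
  by apply: (measurableT_comp mf); exact: pair1_measurable.
have bMx := bm_sec1 x bm_clip; have ifMx := bm_itg mu bMx.
have iDx : itg mu (fun y => f (x, y) - fM (x, y)).
  apply: (itg_dom (g := fun y => 1 + H (x, y))).
  - by apply: measurable_funB => //; case: bMx.
  - move=> y; rewrite /H -real_normK ?num_real//; set u := `|_|.
    by have := sqr_ge0 (u - 2^-1); rewrite sqrrB -[_ *+ 2]mulr_natl; lra.
  - by apply: itgD => //; exact: itg_cst.
have ifx : itg mu (fun y => f (x, y)).
  have -> : (fun y => f (x, y)) = fun y => (f (x, y) - fM (x, y)) + fM (x, y).
    by apply/funext => y; rewrite subrK.
  exact: itgD.
rewrite -Ex_EFin// -EFinM -EFinD lee_fin.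
have ge : g x = gM x + (Ex mu (fun y => f (x, y) - fM (x, y)) - c).
  by rewrite ExB// /g /gM /c; ring.
apply: (le_trans (sqr_split_le ge)).
by rewrite lerD2l; apply: ler_wpM2l => //; exact: Ex_sqr_itg.
Qed.

(** The condition on [M] makes the squared clipping error at most [b / 16] in mean. Integrating
    [pointwise] gives [b <= 2 E[gM^2] + 8 b / 16], that is [E[gM^2] >= b / 4]. *)
Lemma clip_variance : 0 < b -> (b%:E <= \int[mu]_x (g x ^+ 2)%:E)%E -> 16 * B ^+ 2 <= b * M ^+ 2 ->
  b / 4 <= Ex mu (fun x => gM x ^+ 2).
Proof.
move=> b0 hb hM.
have bgM : bm gM by apply: bmB; [exact: bm_Ex bm_clip|exact: bm_cst].
have c2 : c ^+ 2 <= Ex (pprod mu mu) H.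
  rewrite /c -ExB; [|exact: itg_main|exact: bm_itg bm_clip].
  apply: Ex_sqr_itg => //; apply: itgB; [exact: itg_main|exact: bm_itg bm_clip].
have mI : measurable_fun setT (fun x => \int[mu]_y (H (x, y))%:E)%E.
  apply: (measurable_fun_fubini_tonelli_F (m2 := mu) (fun xy => (H xy)%:E)).
    exact/measurable_EFinP.
  by move=> xy; rewrite lee_fin sqr_ge0.
have I0 x : (0 <= \int[mu]_y (H (x, y))%:E)%E by apply: integral_ge0 => y _; rewrite lee_fin sqr_ge0.
have mg2 : measurable_fun setT (fun x => (2 * gM x ^+ 2 + 4 * c ^+ 2)%:E).
  apply/measurable_EFinP; apply: measurable_funD; last exact: measurable_cst.
  by apply: measurable_funM; [exact: measurable_cst|apply: measurable_funX; case: bgM].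
have key : (\int[mu]_x (g x ^+ 2)%:E <= (2 * Ex mu (fun x => gM x ^+ 2) + 4 * c ^+ 2 + 4 * Ex (pprod mu mu) H)%:E)%E.
  apply: (@le_trans _ _ (\int[mu]_x ((2 * gM x ^+ 2 + 4 * c ^+ 2)%:E + 4%:E * \int[mu]_y (H (x, y))%:E))%E).
    apply: ge0_le_integral => //.
    - by move=> x _; rewrite lee_fin sqr_ge0.
    - by apply/measurable_EFinP; apply: measurable_funX; exact: measurable_condE.
    - apply: emeasurable_funD => //; apply: emeasurable_funM => //; exact: measurable_cst.
  have g20 x : 0 <= 2 * gM x ^+ 2 + 4 * c ^+ 2 by rewrite addr_ge0// mulr_ge0// sqr_ge0.
  rewrite ge0_integralD//; last 3 first.
  - by move=> x _; rewrite lee_fin.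
  - by move=> x _; apply: mule_ge0.
  - by apply: emeasurable_funM => //; exact: measurable_cst.
  rewrite ge0_integralZl//.
  have -> : (\int[mu]_x \int[mu]_y (H (x, y))%:E = (Ex (pprod mu mu) H)%:E)%E.
    rewrite Ex_EFin//; symmetry; apply: (fubini_tonelli1 (m1 := mu) (m2 := mu) (fun xy => (H xy)%:E)).
      exact/measurable_EFinP.
    by move=> xy; rewrite lee_fin sqr_ge0.
  have i2 : itg mu (fun x => 2 * gM x ^+ 2 + 4 * c ^+ 2).
    by apply: itgD; [apply: itgZ; exact: bm_itg (bmX 2 bgM)|exact: itg_cst].
  have := Ex_EFin i2; rewrite ExD; [|apply: itgZ; exact: bm_itg (bmX 2 bgM)|exact: itg_cst].
  rewrite ExZ; last exact: bm_itg (bmX 2 bgM).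
  by rewrite Ex_cst => <-; rewrite -EFinM -EFinD.
have := le_trans hb key; rewrite lee_fin => h1.
have h2 : Ex (pprod mu mu) H <= b / 16.
  apply: (le_trans EH); rewrite ler_pdivrMr ?exprn_gt0//; move: hM; set u := B ^+ 2; set v := M ^+ 2; lra.
move: h1 h2 c2; set u := Ex mu _; set v := Ex _ H; set w := c ^+ 2; lra.
Qed.

End clipped_variance.

Lemma Ex_pair {R : realType} {d : measure_display} {T : measurableType d} (mu : probability T R)
    (n : nat) (i k : 'I_n) (F : T * T -> R) : k != i -> bm F ->
  Ex (pow mu n) (fun s => F (tnth s i, tnth s k)) = Ex (pprod mu mu) F.
Proof.
move=> ki bF.
have bs : bm (fun s : n.-tuple T => F (tnth s i, tnth s k)).
  by apply: (bm_pre _ bF); apply: measurable_fun_pair; exact: measurable_tnth.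
rewrite (Ex_upd mu i bs).
have -> : (fun s : n.-tuple T => Ex mu (fun x => F (tnth (upd s i x) i, tnth (upd s i x) k))) =
    fun s => Ex mu (fun x => F (x, tnth s k)).
  apply/funext => s; apply: Ex_ext => x; rewrite !tnth_upd eqxx.
  by have -> : (k == i) = false by exact: negbTE.
rewrite (Ex_coord k (bm_itg mu (bm_Ex2 mu mu bF))) -Ex_swap//.
rewrite Ex_pprod//; first exact: bm_itg.
by move=> x; exact: bm_itg (bm_sec1 x bF).
Qed.

(** Nothing limits [M] from above, so it is 1 plus the sum of the four quantities that have to be
    dominated; as [M >= 1], every positive power of [M] dominates them too. *)
Lemma clip_level {R : realType} (b l om gam N S B2 : R) : 0 < b -> 0 < l -> 0 < om -> 0 < gam ->
  0 <= N -> 0 <= S -> 0 <= B2 -> exists M : R, [/\ 0 < M, 16 * B2 <= b * M ^+ 2,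
    N * (B2 / M ^+ 4) <= om, N * (B2 / M ^+ 4) <= gam & S / 2 * (B2 / M ^+ 3) <= om / l].
Proof.
move=> b0 l0 om0 g0 N0 S0 B0.
pose X1 := 16 * B2 / b; pose X2 := N * B2 / om; pose X3 := N * B2 / gam; pose X4 := S / 2 * B2 * l / om.
have X10 : 0 <= X1 by rewrite divr_ge0 ?mulr_ge0// ltW.
have X20 : 0 <= X2 by rewrite divr_ge0 ?mulr_ge0// ltW.
have X30 : 0 <= X3 by rewrite divr_ge0 ?mulr_ge0// ltW.
have X40 : 0 <= X4 by rewrite divr_ge0 ?mulr_ge0// ltW.
pose M := 1 + X1 + X2 + X3 + X4.
have M1 : 1 <= M by rewrite /M; lra.
have M0 : 0 < M := lt_le_trans ltr01 M1.
have Mk k : M <= M ^+ k.+1 by rewrite exprS ler_peMr ?(ltW M0)// exprn_ege1.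
exists M; split => //.
- have -> : 16 * B2 = b * X1 by rewrite /X1; field; rewrite gt_eqF.
  by apply: ler_wpM2l; [exact: ltW|apply: le_trans (Mk 1%N); rewrite /M; lra].
- rewrite mulrA ler_pdivrMr; last exact: exprn_gt0.
  have -> : N * B2 = om * X2 by rewrite /X2; field; rewrite gt_eqF.
  by apply: ler_wpM2l; [exact: ltW|apply: le_trans (Mk 3%N); rewrite /M; lra].
- rewrite mulrA ler_pdivrMr; last exact: exprn_gt0.
  have -> : N * B2 = gam * X3 by rewrite /X3; field; rewrite gt_eqF.
  by apply: ler_wpM2l; [exact: ltW|apply: le_trans (Mk 3%N); rewrite /M; lra].
- rewrite mulrA ler_pdivrMr; last exact: exprn_gt0.
  have -> : S / 2 * B2 = om / l * X4 by rewrite /X4; field; rewrite !gt_eqF.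
  apply: ler_wpM2l; first by rewrite divr_ge0// ltW.
  by apply: le_trans (Mk 2%N); rewrite /M; lra.
Qed.

Section averages.
Context {R : realType} {d : measure_display} {T : measurableType d} (J : finType).
Variables (h : T * T -> J -> R) (n : nat).

Lemma measurable_uavg (mh : forall j, measurable_fun setT (fun xy => h xy j)) j :
  measurable_fun setT (fun s : n.-tuple T => uavg h s j).
Proof.
apply: measurable_funM; first exact: measurable_cst.
apply: measurable_sum => i; rewrite [X in measurable_fun _ X](_ : _ = fun s : n.-tuple T =>
  \sum_(k < n) (if k != i then h (tnth s i, tnth s k) j else 0)); last first.
  by apply/funext => s; rewrite [LHS]big_mkcond.
apply: measurable_sum => k; case: (k != i); last exact: measurable_cst.
by apply: (measurableT_comp (mh j)); apply: measurable_fun_pair; exact: measurable_tnth.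
Qed.

Hypothesis bh : forall j, bm (fun xy => h xy j).

Let bh2 i k j : bm (fun s : n.-tuple T => h (tnth s i, tnth s k) j).
Proof. by apply: (bm_pre _ (bh j)); apply: measurable_fun_pair; exact: measurable_tnth. Qed.

Lemma bm_wt i j : bm (fun s : n.-tuple T => wt h s i j).
Proof.
apply: bmB; apply: bmM; try exact: bm_cst.
  by apply: bm_sum => k; exact: bh2.
by apply: bm_sum => k; apply: bm_sum => k'; exact: bh2.
Qed.

Lemma bm_Ghat j k : bm (fun s : n.-tuple T => Ghat h s j k).
Proof.
apply: bmM; first exact: bm_cst.
by apply: bm_sum => i; apply: bmM; exact: bm_wt.
Qed.

End averages.

Lemma wt_ext {R : realType} {d : measure_display} {T : measurableType d} (J : finType)
    (h h' : T * T -> J -> R) (n : nat) (s : n.-tuple T) :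
  (forall i k j, k != i -> h (tnth s i, tnth s k) j = h' (tnth s i, tnth s k) j) ->
  (forall j, uavg h s j = uavg h' s j) /\ (forall i j, wt h s i j = wt h' s i j).
Proof.
move=> e.
have e1 j : uavg h s j = uavg h' s j.
  by congr (_ * _); apply: eq_bigr => i _; apply: eq_bigr => k ki; exact: e.
split => // i j; rewrite /wt e1; congr (_ * _ - _).
by apply: eq_bigr => k ki; exact: e.
Qed.

(** * The comparison for unbounded kernels *)

Section general_rate.
Context {R : realType} {d : measure_display} {T : measurableType d} (J : finType).
Variables (mu : probability T R) (h : T * T -> J -> R) (n : nat).
Variables (l om B b K lam D r gam : R).
Hypothesis mh : forall j, measurable_fun setT (fun xy => h xy j).
Hypothesis sym : forall x y j, h (x, y) j = h (y, x) j.
Hypothesis J0 : (0 < #|J|)%N.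
Hypothesis n2 : (1 < n)%N.
Hypothesis l1 : 1 <= l.
Hypothesis om0 : 0 < om.
Hypothesis B1 : 1 <= B.
Hypothesis b0 : 0 < b.
Hypothesis K0 : 0 < K.
Hypothesis lam0 : 0 < lam.
Hypothesis D0 : 0 < D.
Hypothesis r2 : 2 <= r.
Hypothesis rlam : 2 * r <= lam * l ^+ 2.
Hypothesis gam01 : 0 < gam < 1.
Hypothesis iD : itg (pprod mu mu) (fun xy => mx (h xy) `^ (2 * r)).
Hypothesis hD : Ex (pprod mu mu) (fun xy => mx (h xy) `^ (2 * r)) <= D `^ (2 * r).
Hypothesis h3 : forall j, Ex (pprod mu mu) (fun xy => `|h xy j| ^+ 3) <= B.
Hypothesis i4 : forall j, itg (pprod mu mu) (fun xy => `|h xy j| ^+ 4).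
Hypothesis h4 : forall j, Ex (pprod mu mu) (fun xy => `|h xy j| ^+ 4) <= B ^+ 2.
Hypothesis hb : forall j, (b%:E <= \int[mu]_x (hproj mu h x j ^+ 2)%:E)%E.
Hypothesis cardJ : (2 * #|J|)%:R <= expR (l ^+ 2).
Hypothesis xl : ln (16 * (#|J| * #|J|)%:R / (gam / 2)) <= (4 + K) * l ^+ 2.
Hypothesis H2 : D ^+ 2 * l ^+ 6 * (n%:R / (gam / 2)) `^ r^-1 <= om ^+ 3 * n%:R.
Hypothesis H3 : B * l ^+ 7 <= om ^+ 3 * Num.sqrt n%:R.

(** Clipping reduces the variance bound to [b / 4]. The last two summands cover the cases [om > 1]
    and [covariance_const * om > b / 8], in which the estimate exceeds 1 and is trivial. *)
Definition rate_const : R := rectangle_const (b / 4) K lam + 1 + covariance_const K lam * (8 / b).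

Let l0 : 0 < l := lt_le_trans ltr01 l1.
Let B0 : 0 < B := lt_le_trans ltr01 B1.
Let b40 : 0 < b / 4. Proof. by rewrite divr_gt0. Qed.
(** [lam * l ^+ 2] dominates the moment order [2 * r], and [6 * l ^+ 2] the logarithm of the number
    of pairs of coordinates; the type-2 bounds ask both of [Q]. *)
Let Q := (lam + 6) * l ^+ 2.
Let gam2 : 0 < gam / 2 < 1.
Proof. by case/andP: gam01 => ? ?; rewrite divr_gt0//= ltr_pdivrMr//; lra. Qed.

Let Crect0 : 0 <= rectangle_const (b / 4) K lam.
Proof.
have s0 := sdev_gt0 b40; have A0 := Abeta_gt0 K0 lam0.
have a0 x : 0 <= x -> 0 <= 96 / x :> R by move=> ?; exact: divr_ge0 (ler0n _ 96) _.
apply: addr_ge0; last exact: addr_ge0 (mulr_ge0 (exprn_ge0 18 (ler0n R 2)) (sqr_ge0 _)) ler01.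
apply: addr_ge0; last exact: mulr_ge0 (ler0n _ 2) (a0 _ (ltW s0)).
apply: mulr_ge0 (ler0n _ 2) _; apply: addr_ge0.
  exact: mulr_ge0 (ler0n _ 8) (a0 _ (mulr_ge0 (ltW A0) (ltW s0))).
exact: mulr_ge0 (ler0n _ 2) (mulr_ge0 (ler0n _ 44) (exprn_ge0 3 (ler0n R 10))).
Qed.

Let Ccov0 : 0 <= covariance_const K lam := le_trans ler01 (covariance_const_ge K0 lam0).

Lemma rate_const_gt0 : 0 < rate_const.
Proof.
apply: ltr_wpDr; first by apply: mulr_ge0 => //; rewrite divr_ge0// ltW.
by apply: ltr_wpDl.
Qed.

Let rect_close (s : n.-tuple T) (lo hi : J -> R) : R :=
  `|Pr (pow mu n) (fun s' => [forall j, lo j <= scaled_dev mu h s' j <= hi j]) -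
    Pr (pow N01 n) (fun e => [forall j, lo j <= gsum (wt h s) e j <= hi j])|.

Let mtst j : measurable_fun setT (fun s : n.-tuple T => scaled_dev mu h s j).
Proof.
apply: measurable_funM; last exact: measurable_cst.
apply: measurable_funM; first exact: measurable_cst.
by apply: measurable_funB; [exact: measurable_uavg|exact: measurable_cst].
Qed.

Lemma rect_close_le1 s lo hi : rect_close s lo hi <= 1.
Proof.
have m1 : mb (fun s' : n.-tuple T => [forall j, lo j <= scaled_dev mu h s' j <= hi j]).
  by apply: mb_forall => j; apply: mb_and; apply: mb_le.
have m2 : mb (fun e : n.-tuple R => [forall j, lo j <= gsum (wt h s) e j <= hi j]).
  by apply: mb_forall => j; apply: mb_and; apply: mb_le => //; exact: measurable_gsum.
rewrite /rect_close ler_norml.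
have := Pr_ge0 (pow mu n) (fun s' => [forall j, lo j <= scaled_dev mu h s' j <= hi j]).
have := Pr_ge0 (pow (@N01 R) n) (fun e => [forall j, lo j <= gsum (wt h s) e j <= hi j]).
have := Pr_le1 (pow mu n) m1; have := Pr_le1 (pow (@N01 R) n) m2.
by move=> ? ? ? ?; apply/andP; split; lra.
Qed.

Section small_rate.
Hypothesis om1 : om <= 1.
Hypothesis H4 : covariance_const K lam * om <= b / 4 / 2.
Variable M : R.
Hypothesis M0 : 0 < M.
Hypothesis Mb : 16 * B ^+ 2 <= b * M ^+ 2.
Let N : R := (#|J| * (n * n))%:R.
Hypothesis Mom : N * (B ^+ 2 / M ^+ 4) <= om.
Hypothesis Mgam : N * (B ^+ 2 / M ^+ 4) <= gam / 2.
Hypothesis Mth : Num.sqrt n%:R / 2 * (B ^+ 2 / M ^+ 3) <= om / l.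

Let hM xy j : R := clip M (h xy j).
Let bhM j : bm (fun xy => hM xy j) := bm_clip (mh j) M0.
Let symM x y j : hM (x, y) j = hM (y, x) j. Proof. by rewrite /hM sym. Qed.
Let hM_le xy j : `|hM xy j| <= `|h xy j| := clip_le (h xy j) (ltW M0).

Let hDM : Ex (pprod mu mu) (fun xy => mx (hM xy) `^ (2 * r)) <= D `^ (2 * r).
Proof.
have r20 : 0 <= 2 * r by apply: mulr_ge0 => //; exact: le_trans r2.
apply: le_trans hD; apply: Ex_le => //; first exact: bm_itg (bm_powR (bm_mx bhM) r20).
by move=> xy; apply: ler_mx_powR => //; apply: mx_mono => j; exact: hM_le.
Qed.

Let hkM (k : nat) j : (k <= 4)%N ->
  Ex (pprod mu mu) (fun xy => `|hM xy j| ^+ k) <= Ex (pprod mu mu) (fun xy => `|h xy j| ^+ k).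
Proof.
move=> k4; apply: Ex_le => [||xy].
- exact: bm_itg (bmX k (bm_abs (bhM j))).
- exact: itg_low_power (mh j) (i4 j) k k4.
- by apply: lerXn2r; rewrite ?nnegrE.
Qed.

Let h3M j : Ex (pprod mu mu) (fun xy => `|hM xy j| ^+ 3) <= B.
Proof. exact: le_trans (hkM j _) (h3 j). Qed.
Let h4M j : Ex (pprod mu mu) (fun xy => `|hM xy j| ^+ 4) <= B ^+ 2.
Proof. exact: le_trans (hkM j _) (h4 j). Qed.

Let hbM j : b / 4 <= Gam mu hM j j.
Proof. exact: (clip_variance (mh j) (i4 j) (h4 j) M0 b0 (hb j) Mb). Qed.

Let clipped (s : n.-tuple T) :=
  [exists jik : J * ('I_n * 'I_n), (jik.2.2 != jik.2.1) && (M < `|h (tnth s jik.2.1, tnth s jik.2.2) jik.1|)].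

Let mpair j (i k : 'I_n) : mb (fun s : n.-tuple T => M < `|h (tnth s i, tnth s k) j|).
Proof.
apply: mb_lt; first exact: measurable_cst.
apply: measurableT_comp => //; apply: (measurableT_comp (mh j)).
by apply: measurable_fun_pair; exact: measurable_tnth.
Qed.

Let mclip1 (jik : J * ('I_n * 'I_n)) : mb (fun s : n.-tuple T =>
  (jik.2.2 != jik.2.1) && (M < `|h (tnth s jik.2.1, tnth s jik.2.2) jik.1|)).
Proof. by apply: mb_and; [exact: mb_cst|exact: mpair]. Qed.

Let mclipped : mb clipped. Proof. exact: mb_exists mclip1. Qed.

Let Pclipped : Pr (pow mu n) clipped <= N * (B ^+ 2 / M ^+ 4).
Proof.
apply: (le_trans (Pr_exists _ mclip1)).
have X0 : 0 <= B ^+ 2 / M ^+ 4 by rewrite divr_ge0 ?sqr_ge0// exprn_ge0// ltW.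
have -> : N * (B ^+ 2 / M ^+ 4) = \sum_(jik : J * ('I_n * 'I_n)) B ^+ 2 / M ^+ 4.
  by rewrite sumr_const !card_prod card_ord -mulr_natl.
apply: ler_sum => -[j [i k]] _ /=; case: (boolP (k != i)) => ki /=; last first.
  by rewrite /Pr Ex_cst.
have mF : mb (fun xy => M < `|h xy j|) by apply: mb_lt => //; exact: measurableT_comp.
apply: le_trans (clip_tail_prob (mh j) (i4 j) (h4 j) M0).
by rewrite /Pr (Ex_pair mu ki (mb_bm mF)).
Qed.

Let good (s : n.-tuple T) :=
  [forall j, [forall k, `|Gam mu hM j k - Ghat hM s j k| <= Del_ l om K lam]] && ~~ clipped s.

Let mGam j k : mb (fun s : n.-tuple T => `|Gam mu hM j k - Ghat hM s j k| <= Del_ l om K lam).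
Proof.
have [mG _] : bm (fun s : n.-tuple T => Gam mu hM j k - Ghat hM s j k).
  by apply: bmB; [exact: bm_cst|exact: bm_Ghat].
by apply: mb_le => //; exact: measurableT_comp.
Qed.

Let mgood1 : mb (fun s : n.-tuple T =>
  [forall j, [forall k, `|Gam mu hM j k - Ghat hM s j k| <= Del_ l om K lam]]).
Proof. by apply: mb_forall => j; apply: mb_forall => k; exact: mGam. Qed.

Let mgood : mb good. Proof. by apply: mb_and => //; exact: mb_neg. Qed.

Let Pbad : Pr (pow mu n) (fun s => ~~ good s) <= gam.
Proof.
pose bad1 (s : n.-tuple T) :=
  ~~ [forall j, [forall k, `|Gam mu hM j k - Ghat hM s j k| <= Del_ l om K lam]].
have mbad1 : mb bad1 by exact: mb_neg.
apply: (@le_trans _ _ (Pr (pow mu n) (fun s => bad1 s || clipped s))).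
  apply: Pr_mono => [||s]; [exact: mb_neg|exact: mb_or|].
  by rewrite negb_and negbK.
apply: (le_trans (Pr_or _ mbad1 mclipped)).
(* One half is spent on the covariance event of the clipped kernel, the other on the event that
   clipping is noticed. *)
have -> : gam = gam / 2 + gam / 2 by field.
apply: lerD; last exact: le_trans Pclipped Mgam.
have /andP[g0 g1] := gam2.
have l21 : 1 <= l ^+ 2 by rewrite exprn_ege1.
have rQ : 2 * r <= Q by apply: (le_trans rlam); rewrite /Q mulrDl lerDl; apply: mulr_ge0; rewrite ?sqr_ge0.
have cQ : 2 * (#|J| * #|J|)%:R <= expR (Q / 2).
  apply: (@le_trans _ _ (expR (2 * l ^+ 2))).
    have -> : expR (2 * l ^+ 2) = expR (l ^+ 2) ^+ 2 by rewrite -expRM_natl.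
    apply: (@le_trans _ _ ((2 * #|J|)%:R ^+ 2)).
      rewrite !natrM exprMn expr2; apply: ler_wpM2r; first by rewrite sqr_ge0.
      by rewrite ler_peMr// ler1n.
    by rewrite ler_sqr ?nnegrE ?expR_ge0.
  rewrite ler_expR /Q; have -> : (lam + 6) * l ^+ 2 / 2 = (lam / 2 + 1) * l ^+ 2 + 2 * l ^+ 2 by field.
  by rewrite lerDr; apply: mulr_ge0 (sqr_ge0 _); have := lam0; lra.
have x0 : 0 <= ln (16 * (#|J| * #|J|)%:R / (gam / 2)).
  apply: ln_ge0; rewrite ler_pdivlMr// mul1r; apply: (le_trans (ltW g1)).
  by rewrite -natrM ler1n !muln_gt0 J0.
have dev_le : covdev J n r D B (gam / 2) Q <= Del_ l om K lam.
  exact: (covdev_pieces n2 r2 B0 gam2 K0 lam0 l1 om0 (erefl : Q = (lam + 6) * l ^+ 2) xl x0 H2 H3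
    erefl erefl erefl erefl).
apply: le_trans (covariance_bound bhM J0 n2 r2 D0 B0 g0 hDM h4M rQ cQ g1).
apply: Pr_mono => [||s].
- exact: mbad1.
- apply: mb_exists => j; apply: mb_exists => k; apply: mb_lt => //.
  have [mG _] : bm (fun s : n.-tuple T => Gam mu hM j k - Ghat hM s j k).
    by apply: bmB; [exact: bm_cst|exact: bm_Ghat].
  exact: measurableT_comp.
- rewrite /bad1 negb_forall => /existsP[j]; rewrite negb_forall => /existsP[k]; rewrite -ltNge => hjk.
  by apply/existsP; exists j; apply/existsP; exists k; exact: le_lt_trans dev_le hjk.
Qed.

Let unclipped s : ~~ clipped s ->
  forall i k j, k != i -> hM (tnth s i, tnth s k) j = h (tnth s i, tnth s k) j.
Proof.
move=> /existsPn nc i k j ki; apply: clip_id.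
by have := nc (j, (i, k)); rewrite /= ki /= -leNgt.
Qed.

Let hT' : Pr (pow mu n) (fun s => [exists j, om / l < `|scaled_dev mu h s j - scaled_dev mu hM s j|]) <= om.
Proof.
apply: le_trans Mom; apply: le_trans Pclipped; apply: Pr_mono => [||s].
- apply: mb_exists => j; apply: mb_lt => //; apply: measurableT_comp => //.
  apply: measurable_funB => //.
  by case: (bm_scaled_dev mu bhM n2 j).
- exact: mclipped.
(* For an unclipped sample the two averages coincide, so the statistics differ only by the shift of
   the mean, which [clip_mean] and the choice of [M] control. *)
- move=> /existsP[j hj]; case: (boolP (clipped s)) => // /unclipped /wt_ext[e1 _].
  exfalso; move: hj; rewrite ltNge => /negP; apply.
  rewrite /scaled_dev -e1.
  have -> : Num.sqrt n%:R * (uavg hM s j - hmean mu h j) / 2 - Num.sqrt n%:R * (uavg hM s j - hmean mu hM j) / 2 =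
    - (Num.sqrt n%:R / 2 * (hmean mu h j - hmean mu hM j)) by field.
  rewrite normrN normrM ger0_norm; last by rewrite divr_ge0 ?sqrtr_ge0.
  apply: le_trans Mth; apply: ler_wpM2l; first by rewrite divr_ge0 ?sqrtr_ge0.
  exact: (clip_mean (mh j) (i4 j) (h4 j) M0).
Qed.

Lemma small_rate : exists good : n.-tuple T -> bool, [/\ mb good,
  Pr (pow mu n) (fun s => ~~ good s) <= gam &
  forall s, good s -> forall lo hi, rect_close s lo hi <= rate_const * om].
Proof.
exists good; split => // s /andP[/forallP hG /unclipped /wt_ext[_ e]] lo hi.
have hG' j k : `|Gam mu hM j k - Ghat hM s j k| <= Del_ l om K lam by exact: (forallP (hG j) k).
have om01 : 0 < om <= 1 by rewrite om0.
have := rect_bound bhM symM J0 n2 l1 om01 B1 b40 K0 lam0 D0 r2 gam2 hDM h3M hbM cardJ H2 H3 H4 hG' mtst hT' lo hi.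
have -> : wt hM s = wt h s by apply/funext => i; apply/funext => j; exact: e.
move=> h1; apply: (le_trans h1); apply: ler_wpM2r; first exact: ltW.
rewrite /rate_const -addrA lerDl addr_ge0//; apply: mulr_ge0 => //; by rewrite divr_ge0// ltW.
Qed.

End small_rate.

Lemma general_rate : exists good : n.-tuple T -> bool, [/\ mb good,
  Pr (pow mu n) (fun s => ~~ good s) <= gam &
  forall s, good s -> forall lo hi,
    `|Pr (pow mu n) (fun s' => [forall j, lo j <= scaled_dev mu h s' j <= hi j]) -
      Pr (pow N01 n) (fun e => [forall j, lo j <= gsum (wt h s) e j <= hi j])| <= rate_const * om].
Proof.
case: (lerP om 1) => om1; last first.
  exists (fun=> true); split; [exact: mb_cst|by rewrite /Pr Ex_cst; case/andP: gam01 => /ltW|].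
  move=> s _ lo hi; apply: (le_trans (rect_close_le1 s lo hi)).
  have c1 : 1 <= rate_const.
    by rewrite /rate_const addrAC lerDr addr_ge0//; apply: mulr_ge0 => //; rewrite divr_ge0// ltW.
  by apply: (le_trans (ltW om1)); rewrite ler_peMl// ltW.
case: (lerP (covariance_const K lam * om) (b / 4 / 2)) => H4; last first.
  exists (fun=> true); split; [exact: mb_cst|by rewrite /Pr Ex_cst; case/andP: gam01 => /ltW|].
  move=> s _ lo hi; apply: (le_trans (rect_close_le1 s lo hi)).
  apply: (@le_trans _ _ (covariance_const K lam * (8 / b) * om)).
    have -> : covariance_const K lam * (8 / b) * om = (covariance_const K lam * om) * (8 / b) by ring.
    rewrite -ler_pdivrMr ?divr_gt0// invf_div mul1r; apply: le_trans (ltW H4).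
    by rewrite le_eqVlt; apply/orP; left; apply/eqP; field.
  by apply: ler_wpM2r; [exact: ltW|rewrite /rate_const lerDr addr_ge0].
have /andP[g0 _] := gam2.
have [M [M0 Mb Mom Mgam Mth]] := clip_level b0 l0 om0 g0 (ler0n R (#|J| * (n * n)))
  (sqrtr_ge0 n%:R) (sqr_ge0 B).
exact: small_rate om1 H4 M M0 Mb Mom Mgam Mth.
Qed.

End general_rate.

(** * Rates *)

Lemma square_of_ratio {R : realType} (B s l t N : R) : s ^+ 2 = l -> t ^+ 2 = N -> t != 0 ->
  B ^+ 2 * l ^+ 7 / N = (B * s ^+ 7 / t) ^+ 2.
Proof. by move=> <- <- t0; field. Qed.

Section rates_arithmetic.
Context {R : realType}.
Variables (n d : nat) (B : R).
Hypothesis n4 : (4 <= n)%N.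
Hypothesis d3 : (3 <= d)%N.
Hypothesis B1 : 1 <= B.

Definition lognd : R := ln (n * d)%:R.

Let n0 : (0 : R) < n%:R. Proof. by rewrite ltr0n (leq_trans _ n4). Qed.
Let d0 : (0 : R) < d%:R. Proof. by rewrite ltr0n (leq_trans _ d3). Qed.
Let nd0 : (0 : R) < (n * d)%:R. Proof. by rewrite natrM mulr_gt0. Qed.
Let nn4 : 4 <= n%:R :> R. Proof. by rewrite ler_nat. Qed.
Let dd3 : 3 <= d%:R :> R. Proof. by rewrite ler_nat. Qed.

Lemma lognd_ge2 : 2 <= lognd.
Proof.
rewrite /lognd -ler_expR lnK//.
apply: (@le_trans _ _ 12); last first.
  by rewrite natrM (le_trans (_ : 12 <= 4 * 3))// ?ler_pM//; lra.
have dbl (u c c' : R) : 0 <= c -> expR u <= c -> c ^+ 2 <= c' -> expR (2 * u) <= c'.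
  move=> c0 uc; rewrite expRM_natl; apply: le_trans.
  by apply: lerXn2r; rewrite ?nnegrE ?expR_ge0.
(* This bound is squared four times with upward rounding, ending at [expR 2 <= 12 <= n d]. *)
have h : expR (8^-1 : R) <= 37 / 32.
  apply: (@le_trans _ _ (1 + 8^-1 + 2 * 8^-1 ^+ 2)); last by lra.
  by apply: expR_quadratic; lra.
have -> : (2 : R) = 2 * (2 * (2 * (2 * 8^-1))) by lra.
have h1 : expR (2 * 8^-1 : R) <= 27 / 20 by apply: (dbl _ _ _ _ h); lra.
have h2 : expR (2 * (2 * 8^-1) : R) <= 11 / 6 by apply: (dbl _ _ _ _ h1); lra.
have h3 : expR (2 * (2 * (2 * 8^-1)) : R) <= 34 / 10 by apply: (dbl _ _ _ _ h2); lra.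
by apply: (dbl _ _ _ _ h3); lra.
Qed.

Let L0 : 0 < lognd. Proof. exact: lt_le_trans lognd_ge2. Qed.
Let L1 : 1 <= lognd. Proof. by apply: le_trans lognd_ge2; rewrite ler1n. Qed.

Lemma sqrt_lognd : 1 <= Num.sqrt lognd /\ Num.sqrt lognd ^+ 2 = lognd.
Proof.
split; last by rewrite sqr_sqrtr// ltW.
by rewrite -[X in X <= _](sqrtr1 R) ler_wsqrtr.
Qed.

Lemma expR_lognd : expR lognd = (n * d)%:R.
Proof. by rewrite /lognd lnK. Qed.

(** In this form the requirement [H3] holds with equality for [om = varpi1 B n d]. *)
Lemma varpi1_cube : varpi1 B n d ^+ 3 * Num.sqrt n%:R = B * Num.sqrt lognd ^+ 7.
Proof.
have [l1 l2] := sqrt_lognd.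
have l0 : 0 < Num.sqrt lognd := lt_le_trans ltr01 l1.
have B0 : 0 < B := lt_le_trans ltr01 B1.
have sn0 : 0 < Num.sqrt n%:R :> R by rewrite sqrtr_gt0.
have -> : B * Num.sqrt lognd ^+ 7 = B * Num.sqrt lognd ^+ 7 / Num.sqrt n%:R * Num.sqrt n%:R.
  by rewrite divfK// gt_eqF.
congr (_ * _); rewrite /varpi1 -/lognd.
have -> : B ^+ 2 * lognd ^+ 7 / n%:R = (B * Num.sqrt lognd ^+ 7 / Num.sqrt n%:R) ^+ 2.
  exact: square_of_ratio l2 (sqr_sqrtr (ltW n0)) (lt0r_neq0 sn0).
have X0 : 0 <= B * Num.sqrt lognd ^+ 7 / Num.sqrt n%:R.
  by apply: divr_ge0; [apply: mulr_ge0; [exact: ltW|exact: exprn_ge0 (ltW l0)]|exact: ltW].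
rewrite -powR_mulrn ?powR_ge0// -powR_mulrn// -!powRrM.
have -> : 2%:R * (6%:R^-1 * 3%:R) = 1 :> R by lra.
by rewrite powRr1.
Qed.

Lemma varpi1_ge0 : 0 <= varpi1 B n d. Proof. exact: powR_ge0. Qed.

Lemma varpi1_gt0 : 0 < varpi1 B n d.
Proof.
have B0 : 0 < B := lt_le_trans ltr01 B1.
by apply: powR_gt0; apply: divr_gt0 => //; apply: mulr_gt0; apply: exprn_gt0.
Qed.

(** The same for [H2], with [D = B] and [r = q / 2], up to the replacement of [gam] by its half. *)
Lemma varpiB2_cube (q gam : R) : 0 < gam -> varpiB2 q B n d gam ^+ 3 * n%:R =
  B ^+ 2 * lognd ^+ 3 * (n%:R / gam) `^ (2 / q).
Proof.
move=> g0; rewrite /varpiB2 -/lognd.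
have N0 : n%:R != 0 :> R by rewrite gt_eqF.
have B0 : 0 < B := lt_le_trans ltr01 B1.
rewrite -powR_mulrn ?powR_ge0// -powRrM.
have -> : 3%:R^-1 * 3%:R = 1 :> R by lra.
rewrite powRr1; last first.
  apply: divr_ge0; first by apply: mulr_ge0; [exact: sqr_ge0|exact: exprn_ge0 (ltW L0)].
  by apply: mulr_ge0; exact: powR_ge0.
rewrite powRM ?invr_ge0 ?(ltW n0) ?(ltW g0)//.
rewrite -(powR_inv1 (ltW g0)) -powRrM mulN1r powRN.
have -> : n%:R `^ (1 - 2 / q) = n%:R / n%:R `^ (2 / q) :> R.
  by rewrite powRD ?N0 ?implybT// powRr1 ?(ltW n0)// powRN.
have p1 : 0 < n%:R `^ (2 / q) :> R by rewrite powR_gt0.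
have p2 : 0 < gam `^ (2 / q) by rewrite powR_gt0.
by field; rewrite !gt_eqF.
Qed.

Variables (K gam : R).
Hypothesis gam01 : 0 < gam < 1.
Hypothesis hgam : ln (1 / gam) <= K * ln (d * n)%:R.

Lemma log_card_le : ln (16 * (d * d)%:R / (gam / 2)) <= (4 + K) * lognd.
Proof.
have /andP[g0 g1] := gam01.
have -> : 16 * (d * d)%:R / (gam / 2) = (32 * (d * d)%:R) * (1 / gam) :> R by field; rewrite gt_eqF.
have dd0 : 0 < 32 * (d * d)%:R :> R by rewrite natrM !mulr_gt0.
have g1' : 0 < 1 / gam by rewrite divr_gt0.
rewrite lnM ?posrE// [leRHS]mulrDl; apply: lerD; last first.
  by apply: (le_trans hgam); rewrite mulnC.
have -> : 4 * lognd = ln ((n * d)%:R ^+ 4) by rewrite lnXn// mulr_natl.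
rewrite ler_ln ?posrE ?exprn_gt0// !natrM exprMn.
have -> : n%:R ^+ 4 * d%:R ^+ 4 = n%:R ^+ 4 * d%:R ^+ 2 * (d%:R * d%:R) :> R by ring.
apply: ler_wpM2r; first by rewrite mulr_ge0// ltW.
apply: (@le_trans _ _ (4 ^+ 4 * 3 ^+ 2)); first by lra.
by apply: ler_pM => //; apply: lerXn2r; rewrite ?nnegrE// ltW.
Qed.

Lemma card_le_exp : (2 * d)%:R <= expR (Num.sqrt lognd ^+ 2) :> R.
Proof.
have [_ ->] := sqrt_lognd; rewrite expR_lognd ler_nat leq_mul2r.
by rewrite (leq_trans _ n4)// orbT.
Qed.

Lemma inv_gam_le : 0 < gam -> gam^-1 <= expR (K * lognd).
Proof.
move=> g0; have := hgam; rewrite div1r mulnC -/lognd => h.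
by rewrite -ler_ln ?posrE ?invr_gt0 ?expR_gt0// expRK.
Qed.

(** The exponent is the inverse of [(1 + K) lognd], and [2 n / gam] is at most
    [expR ((1 + K) lognd)]: the factor 2 is absorbed by [d >= 3], and [hgam] bounds [1 / gam]. *)
Lemma root_le_exp (kap : R) : 0 < K -> kap = 2 * (1 + K) ->
  (n%:R / (gam / 2)) `^ (kap * lognd / 2)^-1 <= expR 1.
Proof.
move=> K0 kapE; have /andP[g0 g1] := gam01.
have k0 : 0 < kap by rewrite kapE mulr_gt0// addr_gt0.
have h : n%:R / (gam / 2) <= expR ((1 + K) * lognd).
  have -> : n%:R / (gam / 2) = (n%:R * 2) * gam^-1 by field; rewrite gt_eqF.
  rewrite mulrDl mul1r expRD; apply: ler_pM.
  - by rewrite mulr_ge0// ltW.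
  - by rewrite invr_ge0 ltW.
  - by rewrite expR_lognd natrM ler_wpM2l ?(ltW n0)// (le_trans _ dd3)// ler_nat.
  - exact: inv_gam_le.
have e0 : 0 <= (kap * lognd / 2)^-1 by rewrite invr_ge0 divr_ge0// mulr_ge0// ltW.
apply: (@le_trans _ _ (expR ((1 + K) * lognd) `^ (kap * lognd / 2)^-1)).
  by apply: ge0_ler_powR; rewrite ?nnegrE ?expR_ge0// divr_ge0 ?divr_ge0// ltW.
rewrite -expRM ler_expR kapE le_eqVlt; apply/orP; left; apply/eqP; field.
by rewrite !gt_eqF// addr_gt0.
Qed.

End rates_arithmetic.

(** This is [y <= expR y] at [y = x / q], raised to the power [q]. *)
Lemma powR_le_expR {R : realType} (x q : R) : 0 <= x -> 0 < q -> x `^ q <= q `^ q * expR x.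
Proof.
move=> x0 q0; have -> : x = q * (x / q) by rewrite mulrC divfK// gt_eqF.
have y0 : 0 <= x / q by rewrite divr_ge0// ltW.
rewrite powRM ?(ltW q0)//; apply: ler_wpM2l; first exact: powR_ge0.
rewrite [q * (x / q)]mulrC expRM; apply: ge0_ler_powR; rewrite ?nnegrE ?expR_ge0 ?(ltW q0)//.
by apply: le_trans (expR_ge1Dx _); rewrite lerDr.
Qed.

Lemma measurable_mx {R : realType} {d : measure_display} {T : measurableType d} (J : finType)
    (f : T -> J -> R) : (forall j, measurable_fun setT (fun x => f x j)) ->
  measurable_fun setT (fun x => mx (f x)).
Proof.
move=> mf; rewrite /mx; elim: (index_enum J) => [|j r IH].
  by under eq_fun do rewrite big_nil; exact: measurable_cst.
under eq_fun do rewrite big_cons.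
by apply: measurable_maxr => //; exact: measurableT_comp.
Qed.

Lemma measurable_mx_powR {R : realType} {d : measure_display} {T : measurableType d} (J : finType)
    (f : T -> J -> R) (q : R) : (forall j, measurable_fun setT (fun x => f x j)) ->
  measurable_fun setT (fun x => mx (f x) `^ q).
Proof. by move=> mf; apply: (measurableT_comp (measurable_powR q)); exact: measurable_mx. Qed.

Section exponential_moment.
Context {R : realType} {d : measure_display} {T : measurableType d} (J : finType).
Variables (m : probability T R) (f : T -> J -> R) (B q : R).
Hypothesis mf : forall j, measurable_fun setT (fun x => f x j).
Hypothesis B0 : 0 < B.
Hypothesis q0 : 0 < q.
Hypothesis iexp : forall j, itg m (fun x => expR (`|f x j| / (2 * B))).
Hypothesis eexp : forall j, Ex m (fun x => expR (`|f x j| / (2 * B))) <= 2.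
Hypothesis qJ : (2 * #|J|)%:R <= expR q.

Let dom x : mx (f x) `^ q <= (2 * B * q) `^ q * \sum_j expR (`|f x j| / (2 * B)).
Proof.
have B20 : 0 < 2 * B by rewrite mulr_gt0.
have e0 j : 0 <= expR (`|f x j| / (2 * B)) by exact: expR_ge0.
case: (posnP #|J|) => J0.
  have -> : mx (f x) = 0.
    by rewrite /mx big_pred0// => j; have := max_card (pred1 j); rewrite J0 card1.
  by rewrite powR0 ?gt_eqF// mulr_ge0 ?powR_ge0// sumr_ge0.
have [j ->] := mx_attained J0 (f x).
have -> : `|f x j| = 2 * B * (`|f x j| / (2 * B)) by rewrite mulrC divfK// gt_eqF.
have y0 : 0 <= `|f x j| / (2 * B) by rewrite divr_ge0// ltW.
rewrite (powRM q (ltW B20) y0) (powRM q (ltW B20) (ltW q0)) -mulrA; apply: ler_wpM2l; first exact: powR_ge0.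
apply: (le_trans (powR_le_expR y0 q0)); apply: ler_wpM2l; first exact: powR_ge0.
by rewrite (bigD1 j)//= lerDl sumr_ge0.
Qed.

(** The maximum over coordinates is replaced by a sum, whose cost [2 #|J| <= expR q] is only a
    factor e after the [q]-th root is taken. *)
Lemma exponential_moment : itg m (fun x => mx (f x) `^ q) /\
  Ex m (fun x => mx (f x) `^ q) <= (2 * expR 1 * B * q) `^ q.
Proof.
have B20 : 0 < 2 * B by rewrite mulr_gt0.
have isum : itg m (fun x => \sum_j expR (`|f x j| / (2 * B))) by exact: itg_sum.
have ir : itg m (fun x => (2 * B * q) `^ q * \sum_j expR (`|f x j| / (2 * B))) by exact: itgZ.
have il : itg m (fun x => mx (f x) `^ q).
  by apply: itg_dom ir => [|x]; [exact: measurable_mx_powR|rewrite ger0_norm ?powR_ge0].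
split => //; apply: (le_trans (Ex_le il ir dom)).
rewrite ExZ// Ex_sum//.
have -> : 2 * expR 1 * B * q = (2 * B * q) * expR 1 by ring.
rewrite (powRM q (mulr_ge0 (ltW B20) (ltW q0)) (expR_ge0 1)).
apply: ler_wpM2l; first exact: powR_ge0.
rewrite -expRM mul1r; apply: le_trans qJ.
apply: (@le_trans _ _ (\sum_(j : J) (2 : R))); first by apply: ler_sum => j _; exact: eexp.
by rewrite sumr_const natrM mulr_natr.
Qed.

End exponential_moment.

Section rates.
Context {R : realType} {d : measure_display} {T : measurableType d} (J : finType).
Variables (mu : probability T R) (h : T * T -> J -> R) (n : nat).
Variables (B b K gam : R).
Hypothesis mh : forall j, measurable_fun setT (fun xy => h xy j).
Hypothesis sym : forall x y j, h (x, y) j = h (y, x) j.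
Hypothesis n4 : (4 <= n)%N.
Hypothesis J3 : (3 <= #|J|)%N.
Hypothesis B1 : 1 <= B.
Hypothesis b0 : 0 < b.
Hypothesis K0 : 0 < K.
Hypothesis gam01 : 0 < gam < 1.
Hypothesis hgam : ln (1 / gam) <= K * ln (#|J| * n)%:R.
Hypothesis h3 : forall j, Ex (pprod mu mu) (fun xy => `|h xy j| ^+ 3) <= B.
Hypothesis i4 : forall j, itg (pprod mu mu) (fun xy => `|h xy j| ^+ 4).
Hypothesis h4 : forall j, Ex (pprod mu mu) (fun xy => `|h xy j| ^+ 4) <= B ^+ 2.
Hypothesis hb : forall j, (b%:E <= \int[mu]_x (hproj mu h x j ^+ 2)%:E)%E.

(* [s] is the observed sample, [s'] an independent copy distributed as the data. *)
Definition rate_event (c : R) := exists good : n.-tuple T -> bool, [/\ mb good,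
  Pr (pow mu n) (fun s => ~~ good s) <= gam &
  forall s, good s -> forall lo hi,
    `|Pr (pow mu n) (fun s' => [forall j, lo j <= scaled_dev mu h s' j <= hi j]) -
      Pr (pow N01 n) (fun e => [forall j, lo j <= gsum (wt h s) e j <= hi j])| <= c].

Let n2 : (1 < n)%N. Proof. exact: leq_trans n4. Qed.
Let J0 : (0 < #|J|)%N. Proof. exact: leq_trans J3. Qed.
Let B0 : 0 < B := lt_le_trans ltr01 B1.
Let n0 : (0 : R) < n%:R. Proof. by rewrite ltr0n (leq_trans _ n4). Qed.
Let g0 : 0 < gam. Proof. by case/andP: gam01. Qed.
Let L := lognd (R := R) n #|J|.
Let l : R := Num.sqrt L.
Let L2 : 2 <= L := lognd_ge2 (R := R) n4 J3.
Let L0 : 0 < L. Proof. exact: lt_le_trans L2. Qed.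
Let L1 : 1 <= L. Proof. by apply: le_trans L2; rewrite ler1n. Qed.
Let l1 : 1 <= l := (sqrt_lognd (R := R) n4 J3).1.
Let l2 : l ^+ 2 = L := (sqrt_lognd (R := R) n4 J3).2.
Let l0 : 0 < l := lt_le_trans ltr01 l1.
Let l6 : l ^+ 6 = L ^+ 3. Proof. by rewrite -l2 -exprM. Qed.
Let w1 := varpi1 B n #|J|.
Let w10 : 0 < w1 := varpi1_gt0 n4 J3 B1.

Lemma rate_trivial c : 1 <= c -> rate_event c.
Proof.
move=> c1; exists (fun=> true); split; [exact: mb_cst|by rewrite /Pr Ex_cst ltW|].
by move=> s _ lo hi; apply: le_trans c1; exact: rect_close_le1.
Qed.

Let cardJ := card_le_exp (R := R) n4 J3.
Let xl : ln (16 * (#|J| * #|J|)%:R / (gam / 2)) <= (4 + K) * l ^+ 2.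
Proof. by rewrite l2; exact: log_card_le. Qed.

Lemma moment_rate (q : R) : 4 <= q ->
  itg (pprod mu mu) (fun xy => mx (h xy) `^ q) -> Ex (pprod mu mu) (fun xy => mx (h xy) `^ q) <= B `^ q ->
  rate_event (2 * rate_const b K q * (w1 + varpiB2 q B n #|J| gam)).
Proof.
move=> q4 iq Eq.
have q0 : 0 < q by apply: lt_le_trans q4.
have r2 : 2 <= q / 2 by rewrite ler_pdivlMr//; move: q4; lra.
have qr : 2 * (q / 2) = q by field.
set w2 := varpiB2 _ _ _ _ _.
have w20 : 0 <= w2 := powR_ge0 _ _.
(* The factor 2, cubed to 8, absorbs the power 2^(2 / q) that comes from halving [gam]. *)
pose om := 2 * (w1 + w2).
have om0 : 0 < om by rewrite mulr_gt0// ltr_wpDr.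
have rlam : 2 * (q / 2) <= q * l ^+ 2 by rewrite qr l2 ler_peMr// ltW.
have iq' : itg (pprod mu mu) (fun xy => mx (h xy) `^ (2 * (q / 2))) by rewrite qr.
have Eq' : Ex (pprod mu mu) (fun xy => mx (h xy) `^ (2 * (q / 2))) <= B `^ (2 * (q / 2)) by rewrite qr.
have om3 x : 0 <= x -> x <= w1 + w2 -> 8 * x ^+ 3 <= om ^+ 3.
  move=> x0 xw; rewrite /om exprMn; have -> : (2 : R) ^+ 3 = 8 by ring.
  by apply: ler_wpM2l => //; apply: lerXn2r; rewrite ?nnegrE// (le_trans x0).
have H3 : B * l ^+ 7 <= om ^+ 3 * Num.sqrt n%:R.
  rewrite -(varpi1_cube n4 J3 B1); apply: ler_wpM2r; first exact: sqrtr_ge0.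
  apply: le_trans (om3 w1 (ltW w10) _); last by rewrite lerDl.
  by rewrite ler_peMl ?exprn_ge0 ?(ltW w10)// ler1n.
have H2 : B ^+ 2 * l ^+ 6 * (n%:R / (gam / 2)) `^ (q / 2)^-1 <= om ^+ 3 * n%:R.
  apply: (@le_trans _ _ (8 * w2 ^+ 3 * n%:R)); last first.
    by apply: ler_wpM2r; [exact: ltW|apply: om3 => //; rewrite lerDr ltW].
  rewrite -[leRHS]mulrA (varpiB2_cube n4 J3 B1 q g0) -/L l6 [X in _ `^ X]invf_div [leRHS]mulrCA.
  apply: ler_wpM2l; first by apply: mulr_ge0; [exact: sqr_ge0|exact: exprn_ge0 (ltW L0)].
  have -> : n%:R / (gam / 2) = 2 * (n%:R / gam) by field; rewrite gt_eqF.
  have ng0 : 0 <= n%:R / gam by rewrite divr_ge0// ltW.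
  rewrite (powRM _ (ler0n R 2) ng0); apply: ler_wpM2r; first exact: powR_ge0.
  apply: (@le_trans _ _ (2 `^ 1)); last by rewrite powRr1//; lra.
  by apply: ler_powR; [rewrite ler1n|rewrite ler_pdivrMr//; move: q4; lra].
have := general_rate mh sym J0 n2 l1 om0 B1 b0 K0 q0 B0 r2 rlam gam01 iq' Eq' h3 i4 h4 hb cardJ xl H2 H3.
by have -> : rate_const b K q * om = 2 * rate_const b K q * (w1 + w2) by rewrite /om; ring.
Qed.

(** [4 e^3 kap^2], with [kap = 2 (1 + K)], is the constant in [D^2 l^6] for [D = 2 e B kap l^2],
    times the e that bounds the root of [2 n / gam]. Adding 1 makes the scale at least 1, so that
    its cube dominates it. *)
Definition exponential_scale : R := 1 + 4 * expR 1 ^+ 3 * (2 * (1 + K)) ^+ 2.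
Definition exponential_const : R := (1 + rate_const b K (2 * (1 + K))) * exponential_scale.

(* For [q = 2 * (1 + K) * ln (n d)] the powers [n^(2 / q)], [gam^(- 2 / q)] and
   [(2 d)^(1 / q)] are bounded. *)
Lemma exponential_rate :
  (forall j, itg (pprod mu mu) (fun xy => expR (`|h xy j| / (2 * B)))) ->
  (forall j, Ex (pprod mu mu) (fun xy => expR (`|h xy j| / (2 * B))) <= 2) ->
  rate_event (exponential_const * w1).
Proof.
move=> iexp eexp.
pose kap := 2 * (1 + K).
have kap2 : 2 <= kap by rewrite /kap; have := K0; lra.
have kap0 : 0 < kap by apply: lt_le_trans kap2.
have c1 : 1 <= exponential_scale.
  rewrite /exponential_scale lerDl; apply: mulr_ge0; last exact: sqr_ge0.
  exact: mulr_ge0 (ler0n R 4) (exprn_ge0 3 (expR_ge0 1)).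
have C0 := rate_const_gt0 (b := b) b0 K0 kap0.
(* When [w1 <= 1] one has [B l^3 <= B l^7 <= sqrt n]; this converts the [B^2 l^10] of [H2] into
   [w1^3 n], so no second rate appears. *)
have [w1_le1|w1_gt1] := lerP w1 1; last first.
  apply: rate_trivial; rewrite /exponential_const -/kap -mulrA mulrDl mul1r.
  apply: (@le_trans _ _ (exponential_scale * w1)); first by rewrite mulr_ege1// ltW.
  by rewrite lerDl; apply: mulr_ge0 (ltW C0) _; apply: mulr_ge0; [exact: le_trans c1|exact: ltW].
pose q := kap * L.
have q4 : 4 <= q.
  by have -> : (4 : R) = 2 * 2 by [ring]; exact: ler_pM (ler0n R 2) (ler0n R 2) kap2 L2.
have q0 : 0 < q by apply: lt_le_trans q4.
have qJ : (2 * #|J|)%:R <= expR q.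
  apply: (le_trans cardJ); rewrite ler_expR -/l -/L l2 /q ler_peMl ?(ltW L0)//.
  by apply: le_trans kap2; rewrite ler1n.
have [iq Eq] := exponential_moment mh B0 q0 iexp eexp qJ.
pose D := 2 * expR 1 * B * q.
have D0 : 0 < D := mulr_gt0 (mulr_gt0 (mulr_gt0 (ltr0Sn R 1) (expR_gt0 1)) B0) q0.
have r2 : 2 <= q / 2 by rewrite ler_pdivlMr//; move: q4; lra.
have qr : 2 * (q / 2) = q by field.
pose om := exponential_scale * w1.
have om0 : 0 < om by rewrite mulr_gt0// (lt_le_trans _ c1).
have rlam : 2 * (q / 2) <= kap * l ^+ 2 by rewrite qr l2.
have iq' : itg (pprod mu mu) (fun xy => mx (h xy) `^ (2 * (q / 2))) by rewrite qr.
have Eq' : Ex (pprod mu mu) (fun xy => mx (h xy) `^ (2 * (q / 2))) <= D `^ (2 * (q / 2)) by rewrite qr.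
have c3 : exponential_scale <= exponential_scale ^+ 3 by rewrite exprS ler_peMr ?(le_trans ler01 c1)// exprn_ege1.
have sn0 : 0 < Num.sqrt n%:R :> R by rewrite sqrtr_gt0.
have sn2 : Num.sqrt n%:R ^+ 2 = n%:R :> R by rewrite sqr_sqrtr// ltW.
have W3 : B * l ^+ 7 = w1 ^+ 3 * Num.sqrt n%:R by rewrite -(varpi1_cube n4 J3 B1).
have H3 : B * l ^+ 7 <= om ^+ 3 * Num.sqrt n%:R.
  rewrite W3; apply: ler_wpM2r; first exact: ltW.
  by rewrite exprMn ler_peMl ?exprn_ge0 ?(ltW w10)// (le_trans c1).
have H2 : D ^+ 2 * l ^+ 6 * (n%:R / (gam / 2)) `^ (q / 2)^-1 <= om ^+ 3 * n%:R.
  have rt : (n%:R / (gam / 2)) `^ (q / 2)^-1 <= expR 1.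
    exact: (root_le_exp n4 J3 gam01 hgam K0 (erefl kap)).
  apply: (@le_trans _ _ (D ^+ 2 * l ^+ 6 * expR 1)).
    by apply: ler_wpM2l => //; apply: mulr_ge0 (sqr_ge0 _) (exprn_ge0 6 (ltW l0)).
  have -> : D ^+ 2 * l ^+ 6 * expR 1 = (4 * expR 1 ^+ 3 * kap ^+ 2) * (B * l ^+ 3 * (B * l ^+ 7)).
    by rewrite /D /q -l2; ring.
  have -> : om ^+ 3 * n%:R = exponential_scale ^+ 3 * (w1 ^+ 3 * Num.sqrt n%:R * Num.sqrt n%:R).
    by rewrite -[in LHS]sn2 /om; ring.
  have Bl0 : 0 <= B * l ^+ 7 by rewrite mulr_ge0 ?exprn_ge0// ltW.
  apply: ler_pM.
  - apply: mulr_ge0; last exact: sqr_ge0.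
    exact: mulr_ge0 (ler0n R 4) (exprn_ge0 3 (expR_ge0 1)).
  - by apply: mulr_ge0 => //; rewrite mulr_ge0 ?exprn_ge0// ltW.
  - by apply: le_trans c3; rewrite /exponential_scale -/kap lerDr.
  - rewrite -W3 mulrC; apply: ler_wpM2l => //.
    apply: (@le_trans _ _ (B * l ^+ 7)).
      by apply: ler_wpM2l; [exact: ltW|exact: ler_weXn2l].
    by rewrite W3 ler_piMl ?(ltW sn0)// exprn_ile1// ltW.
have [good [mg Pg Hg]] := general_rate mh sym J0 n2 l1 om0 B1 b0 K0 kap0 D0 r2 rlam gam01 iq' Eq' h3 i4 h4 hb cardJ xl H2 H3.
exists good; split => // s gs lo hi; apply: (le_trans (Hg s gs lo hi)).
rewrite /om /exponential_const -/kap mulrA; apply: ler_wpM2r; first exact: ltW.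
by apply: ler_wpM2r; [exact: le_trans ler01 c1|rewrite lerDr].
Qed.

End rates.

(** * Hyperrectangles *)

Section measure_approximation.
Context {R : realType} {d : measure_display} {T : measurableType d}.

(** Dominated convergence of indicators. The approximating sets need not be monotone: membership of
    each point has to be correct only from some index on. *)
Lemma cvg_measure_near (mu : {measure set T -> \bar R}) (A_ : nat -> set T) (A : set T) :
  mu setT = 1%E -> (forall k, measurable (A_ k)) -> measurable A ->
  (forall x, \forall k \near \oo, A_ k x <-> A x) -> mu (A_ k) @[k --> \oo] --> mu A.
Proof.
move=> mu1 mA_ mA nearA.
have E B : measurable B -> mu B = (\int[mu]_x (\1_B x)%:E)%E.
  by move=> mB; rewrite integral_indic// setIT.
rewrite (E A mA); under eq_fun do rewrite (E _ (mA_ _)).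
apply: (@dominated_cvg _ _ _ mu setT measurableT (fun k x => (\1_(A_ k) x)%:E) _ (fun=> 1%E)).
- by move=> k; apply/measurable_EFinP; exact: measurable_indic.
- move=> x _; apply: cvg_near_cst; near=> k.
  have h : A_ k x <-> A x by near: k; exact: nearA.
  rewrite !indicE; suff -> : (x \in A_ k) = (x \in A) by [].
  by apply/idP/idP; rewrite !inE => /h.
- by [].
- apply/integrableP; split; first exact: measurable_cst.
  by rewrite (eq_integral (fun=> 1%E))// ?integral_cst// ?mu1 ?mule1 ?ltry// => x _; rewrite abse1.
- by move=> k x _; rewrite /= lee_fin ger0_norm// indicE; case: (_ \in _).
Unshelve. all: by end_near. Qed.

Lemma measure_dist_limit (mu nu : {measure set T -> \bar R}) (A_ : nat -> set T) (A : set T) (c : R) :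
  mu setT = 1%E -> nu setT = 1%E -> (forall k, measurable (A_ k)) -> measurable A ->
  (forall x, \forall k \near \oo, A_ k x <-> A x) ->
  (forall k, `|mu (A_ k) - nu (A_ k)| <= c%:E)%E -> (`|mu A - nu A| <= c%:E)%E.
Proof.
move=> mu1 nu1 mA_ mA nearA le_c.
have fin (m : {measure set T -> \bar R}) B : m setT = 1%E -> measurable B -> m B \is a fin_num.
  move=> m1 mB; have le : (m B <= m setT)%E by apply: le_measure; rewrite ?inE.
  by move: le; rewrite m1 => le; rewrite ge0_fin_numE// (le_lt_trans le)// ltry.
have cu : fine (mu (A_ k)) @[k --> \oo] --> fine (mu A).
  by apply: fine_cvg; rewrite fineK ?fin//; exact: cvg_measure_near.
have cv : fine (nu (A_ k)) @[k --> \oo] --> fine (nu A).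
  by apply: fine_cvg; rewrite fineK ?fin//; exact: cvg_measure_near.
have E B : measurable B -> (`|mu B - nu B| = (`|fine (mu B) - fine (nu B)|)%:E)%E.
  by move=> mB; rewrite -[in LHS](fineK (fin mu B mu1 mB)) -[in LHS](fineK (fin nu B nu1 mB)).
rewrite E// lee_fin.
apply: (cvgr_to_le (cvg_norm (cvgB cu cv))).
by apply: nearW => k; have := le_c k; rewrite E// lee_fin.
Qed.

End measure_approximation.

Section grid_rectangles.
Context {R : realType} (d : nat).

(** A countable family with bounds in multiples of [1 / (k + 1)]. Countability matters twice: the
    exceptional null sets of the conditional law can be united, and the event on which all grid
    rectangles are close is measurable. *)
Definition grid := (nat * ({ffun 'I_d -> int} * {ffun 'I_d -> int}))%type.
Definition grid_lo (k : grid) (j : 'I_d) : R := (k.2.1 j)%:~R / k.1.+1%:R.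
Definition grid_hi (k : grid) (j : 'I_d) : R := (k.2.2 j)%:~R / k.1.+1%:R.
Definition box (lo hi : 'I_d -> R) : set (d.-tuple R) :=
  [set x | [forall j, lo j <= tnth x j <= hi j]].

(** An infinite end point is replaced by plus or minus [k] after division by [k + 1]. *)
Definition round_down (a : \bar R) (k : nat) : int :=
  match a with
  | EFin r => Num.floor (k.+1%:R * r)
  | EPInf => (k * k.+1)%:Z
  | ENInf => - (k * k.+1)%:Z
  end.

(** Rounding a lower bound down keeps its boundary points, so the closed condition is reproduced
    exactly at each fixed [x] once the mesh is fine enough. *)
Lemma round_down_near (a : \bar R) (x : R) :
  \forall k \near \oo, ((round_down a k)%:~R / k.+1%:R <= x) = (a <= x%:E)%E.
Proof.
have kk k : (k * k.+1)%:~R / k.+1%:R = k%:R :> R.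
  by rewrite -pmulrn natrM mulfK// pnatr_eq0.
case: a => [r| |] /=.
- rewrite lee_fin; case: (lerP r x) => rx.
    apply: nearW => k; apply/idP; apply: le_trans rx.
    by rewrite ler_pdivrMr ?ltr0n// mulrC; exact: floor_le.
  have e0 : 0 < r - x by rewrite subr_gt0.
  near=> k; apply/negbTE; rewrite -ltNge ltr_pdivlMr ?ltr0n//.
  have h1 : k.+1%:R^-1 < r - x by near: k; exact: (near_infty_natSinv_lt (PosNum e0)).
  have h2 : k.+1%:R * r < (Num.floor (k.+1%:R * r))%:~R + 1.
    by have := floorD1_gt (k.+1%:R * r); rewrite intrD.
  have h3 : 1 < (r - x) * k.+1%:R by rewrite -ltr_pdivrMr ?ltr0n// div1r.
  by move: h2 h3; rewrite mulrBl mulrC; lra.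
- near=> k; rewrite kk leye_eq /=; apply/negbTE; rewrite -ltNge.
  by near: k; exact: nbhs_infty_gtr.
- near=> k; rewrite mulrNz mulNr kk leNye; apply/idP; rewrite lerNl ltW//.
  by near: k; exact: nbhs_infty_gtr.
Unshelve. all: by end_near. Qed.

Lemma measurable_box lo hi : measurable (box lo hi).
Proof.
have : mb (fun x : d.-tuple R => [forall j, lo j <= tnth x j <= hi j]).
  by apply: mb_forall => j; apply: mb_and; apply: mb_le => //; exact: measurable_tnth.
move=> h; rewrite (_ : box lo hi =
  setT `&` (fun x : d.-tuple R => [forall j, lo j <= tnth x j <= hi j]) @^-1` [set true]).
  exact: h.
by rewrite setTI.
Qed.

Lemma measurable_hyperrectangle (a b : 'I_d -> \bar R) :
  measurable [set x : d.-tuple R | forall j, (a j <= (tnth x j)%:E <= b j)%E].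
Proof.
pose B j : set R := [set r | (a j <= r%:E <= b j)%E].
have mB j : measurable (B j).
  rewrite /B (_ : [set r | _] = EFin @^-1` [set` `[a j, b j]]); last first.
    by apply/seteqP; split => r /=; rewrite in_itv.
  rewrite -[X in measurable X]setTI; apply: EFin_measurable => //.
  exact: emeasurable_itv.
exact: measurable_rect mB.
Qed.

(** Lower bounds are rounded down and upper bounds up, the latter through their negatives; the
    inequality passes to the limit along the mesh. *)
Lemma rect_dist_le (mu nu : {measure set (d.-tuple R) -> \bar R}) (c : R) :
  mu setT = 1%E -> nu setT = 1%E ->
  (forall k : grid, (`|mu (box (grid_lo k) (grid_hi k)) - nu (box (grid_lo k) (grid_hi k))| <= c%:E)%E) ->
  (rect_dist mu nu <= c%:E)%E.
Proof.
move=> mu1 nu1 le_c; apply: ge_ereal_sup => _ [A [a [b [ab ->]]] <-].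
pose g (k : nat) : grid := (k, ([ffun j => round_down (a j) k], [ffun j => - round_down (- b j)%E k])).
apply: (measure_dist_limit (A_ := fun k => box (grid_lo (g k)) (grid_hi (g k)))) => //.
- by move=> k; exact: measurable_box.
- exact: measurable_hyperrectangle.
move=> x; near=> k.
have h1 j : ((round_down (a j) k)%:~R / k.+1%:R <= tnth x j) = (a j <= (tnth x j)%:E)%E.
  by move: j; near: k; apply: filter_forall => j; exact: round_down_near.
have h2 j : ((round_down (- b j)%E k)%:~R / k.+1%:R <= - tnth x j) = (- b j <= (- tnth x j)%:E)%E.
  by move: j; near: k; apply: filter_forall => j; exact: round_down_near.
have E j : (grid_lo (g k) j <= tnth x j <= grid_hi (g k) j) = (a j <= (tnth x j)%:E <= b j)%E.
  rewrite /grid_lo /grid_hi /= !ffunE h1; congr (_ && _).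
  by rewrite mulrNz mulNr lerNr h2 EFinN leeN2.
rewrite /box /=; split => [/forallP h j|h]; first by rewrite -E.
by apply/forallP => j; rewrite E.
Unshelve. all: by end_near. Qed.

End grid_rectangles.

(** * Conditional laws *)

Section laws.
Context {R : realType} {disp : measure_display} {Omega : measurableType disp}.
Variable P : probability Omega R.

Lemma law_of_has_law d (S : measurableType d) (X : {RV P >-> S}) (F : probability S R) :
  has_law P X F -> law P F X.
Proof. by move=> h; split; [exact: measurable_funPT|exact: h]. Qed.

Lemma law_pair d1 d2 (S1 : measurableType d1) (S2 : measurableType d2)
    (m1 : probability S1 R) (m2 : probability S2 R) (X : Omega -> S1) (Y : Omega -> S2) :
  law P m1 X -> law P m2 Y -> independent_RVs P X Y ->
  law P (pprod m1 m2) (fun w => (X w, Y w)).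
Proof.
move=> [mX lX] [mY lY] ind.
have mXY : measurable_fun setT (fun w => (X w, Y w)) by exact: measurable_fun_pair.
split => // A mA; symmetry.
have U := @product_measure_unique _ _ _ _ _ m1 m2 (distribution P (mfun_Sub (mem_set mXY))).
apply: U => // C D mC mD; have := ind C D mC mD.
by rewrite lX// lY//; exact.
Qed.

Lemma independent_pair d (S : measurableType d) (I : finType) (X : I -> Omega -> S) (i k : I) :
  i != k -> mutually_independent P X -> independent_RVs P (X i) (X k).
Proof.
move=> ik ind A C mA mC.
have mAC l : measurable (if l == i then A else C) by case: ifP.
have := ind [set i; k]%SET (fun l => if l == i then A else C) mAC.
rewrite big_setU1/= ?inE//= big_set1 eqxx eq_sym (negbTE ik) => <-; congr (P _).
apply/seteqP; split => w /=.
  by move=> [h1 h2] l /=; rewrite !inE; case/orP => /eqP ->; rewrite ?eqxx// eq_sym (negbTE ik).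
move=> h; split.
  by have := h i; rewrite /= !inE eqxx; apply.
by have := h k; rewrite /= !inE eqxx orbT eq_sym (negbTE ik); apply.
Qed.

Lemma law_tuple d (S : measurableType d) (F : probability S R) n (X : 'I_n -> {RV P >-> S}) :
  mutually_independent P (fun i => X i : Omega -> S) -> (forall i, has_law P (X i) F) ->
  law P (pow F n) (fun w => [tuple X i w | i < n]).
Proof.
move=> ind lX; apply: law_pow.
  apply/measurable_fun_tnthP => i.
  rewrite (_ : _ \o _ = X i); first exact: measurable_funPT.
  by apply/funext => w /=; rewrite tnth_mktuple.
move=> A mA; have := ind [set: 'I_n]%SET A mA.
have -> : \big[*%E/1%E]_(i in [set: 'I_n]%SET) P (X i @^-1` A i) = (\prod_(i < n) F (A i))%E.
  by apply: eq_big => [i|i _]; [rewrite inE|exact: lX].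
move=> <-; congr (P _); apply/seteqP; split => w /=.
  by move=> h i _ /=; have := h i; rewrite tnth_mktuple.
by move=> h i; rewrite tnth_mktuple; apply: h; rewrite /= inE.
Qed.

End laws.

(** No integrability is involved: both sides are differences of the same two integrals of
    non-negative functions. *)
Lemma law_integral {R : realType} {d1 d2 : measure_display} {T1 : measurableType d1}
    {T2 : measurableType d2} (m1 : probability T1 R) (m2 : probability T2 R) (phi : T1 -> T2)
    (f : T2 -> \bar R) : law m1 m2 phi -> measurable_fun setT f ->
  (\int[m1]_x f (phi x) = \int[m2]_y f y)%E.
Proof.
move=> hl mf; rewrite integralE [RHS]integralE; congr (_ - _)%E.
  rewrite -(law_ge0_integral hl (f := f^\+%E)) => [|| y]; [|exact: measurable_funepos|exact: funepos_ge0].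
  by apply: eq_integral => x _; rewrite !funeposE.
rewrite -(law_ge0_integral hl (f := f^\-%E)) => [|| y]; [|exact: measurable_funeneg|exact: funeneg_ge0].
by apply: eq_integral => x _; rewrite !funenegE.
Qed.

Section conditional_law.
Context {R : realType} {disp : measure_display} {Omega : measurableType disp}.
Context {d1 d2 d3 : measure_display}.
Context {S1 : measurableType d1} {S2 : measurableType d2} {S3 : measurableType d3}.
Variables (P : probability Omega R) (m1 : probability S1 R) (m2 : probability S2 R).
Variables (X : Omega -> S1) (Y : Omega -> S2) (f : S1 * S2 -> S3).
Hypothesis lX : law P m1 X.
Hypothesis lXY : law P (pprod m1 m2) (fun w => (X w, Y w)).
Hypothesis mf : measurable_fun setT f.
Variable kappa : R.-pker S1 ~> S3.
Hypothesis rcd : regular_cond_distribution P (fun w => f (X w, Y w)) X kappa.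

(** Both functions of [s] have the same integral over every measurable [D]: for [kappa] by the
    definition of a conditional distribution, for the section measure because the joint law of [X]
    and [Y] is a product. *)
Lemma kernel_ae_eq (A : set S3) : measurable A ->
  \forall s \ae m1, kappa s A = m2 (xsection (f @^-1` A) s).
Proof.
move=> mA.
have mfA : measurable (f @^-1` A) by rewrite -[X in measurable X]setTI; exact: mf.
have mk : measurable_fun setT (kappa ^~ A) by exact: measurable_kernel.
have mq : measurable_fun setT (m2 \o xsection (f @^-1` A)) by exact: measurable_fun_xsection.
have ik : m1.-integrable setT (kappa ^~ A).
  apply/integrableP; split => //.
  apply: (@le_lt_trans _ _ (\int[m1]_s 1)%E); last first.
    by rewrite integral_cst// mul1e; apply: (@le_lt_trans _ _ 1%E); [exact: probability_le1|exact: ltry].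
  apply: ge0_le_integral => //; first exact: measurableT_comp.
  move=> s _; rewrite gee0_abs// -(prob_kernel (s := kappa) s).
  by apply: le_measure; rewrite ?inE.
have := @integral_ae_eq _ _ _ m1 setT measurableT (m2 \o xsection (f @^-1` A)) (kappa ^~ A) ik mq.
move=> H; have {}H : ae_eq m1 setT (kappa ^~ A) (m2 \o xsection (f @^-1` A)).
  apply: H => D _ mD.
  have mXD : measurable (X @^-1` D) by rewrite -[X in measurable X]setTI; exact: lX.1.
  rewrite integral_mkcond.
  have e1 : (\int[m1]_s ((kappa ^~ A) \_ D) s = \int[P]_w (((kappa ^~ A) \_ D) (X w)))%E.
    by symmetry; apply: (law_integral lX); apply/(measurable_restrictT _ _).1 => //; exact: measurable_funTS.
  rewrite e1; have -> : (fun w => ((kappa ^~ A) \_ D) (X w)) = (fun w => kappa (X w) A) \_ (X @^-1` D).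
    by apply/funext => w; rewrite !patchE; congr (if _ then _ else _); apply/idP/idP; rewrite !inE.
  rewrite -integral_mkcond rcd//.
  have -> : X @^-1` D `&` (fun w => f (X w, Y w)) @^-1` A =
      (fun w => (X w, Y w)) @^-1` ((D `*` setT) `&` f @^-1` A).
    by apply/seteqP; split => w /= [h1 h2]; split => //; case: h1.
  rewrite lXY.2; last by apply: measurableI => //; exact: measurableX.
  rewrite /pprod /= /product_measure1 [RHS]integral_mkcond; apply: eq_integral => s _.
  rewrite patchE /=; case: ifPn => [|] sD.
    congr (m2 _); apply/seteqP; split => e; rewrite /xsection /= !inE /=; [by case|].
    by move=> h; split => //; split => //; move: sD; rewrite inE.
  rewrite (_ : xsection _ s = set0) ?measure0//.
  apply/seteqP; split => e //; rewrite /xsection /= inE => -[[/= h _] _].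
  by move: sD; rewrite notin_setE.
by apply: filterS H => s; apply.
Qed.

End conditional_law.

(** * Transfer of the rate to the given probability space and kernel *)

Section rate_transfer.
Context {R : realType} {disp : measure_display} {Omega : measurableType disp}.
Context {d1 d2 : measure_display} {S1 : measurableType d1} {S2 : measurableType d2} {d : nat}.
Variables (P : probability Omega R) (m1 : probability S1 R) (m2 : probability S2 R).
Variables (X : Omega -> S1) (Y : Omega -> S2) (T1 : S1 -> d.-tuple R) (f : S1 * S2 -> d.-tuple R).
Hypothesis lX : law P m1 X.
Hypothesis lXY : law P (pprod m1 m2) (fun w => (X w, Y w)).
Hypothesis mT1 : measurable_fun setT T1.
Hypothesis mf : measurable_fun setT f.
Variable kappa : R.-pker S1 ~> (d.-tuple R).
Hypothesis rcd : regular_cond_distribution P (fun w => f (X w, Y w)) X kappa.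
Variables (good : S1 -> bool) (gam c : R).
Hypothesis c0 : 0 <= c.
Hypothesis mgood : mb good.
Hypothesis Pgood : Pr m1 (fun s => ~~ good s) <= gam.
Hypothesis close : forall s, good s -> forall lo hi : 'I_d -> R,
  `|Pr m1 (fun s' => [forall j, lo j <= tnth (T1 s') j <= hi j]) -
    Pr m2 (fun e => [forall j, lo j <= tnth (f (s, e)) j <= hi j])| <= c.

Let mTX : measurable_fun setT (fun w => T1 (X w)).
Proof. by apply: measurableT_comp => //; exact: lX.1. Qed.

Let mu : probability (d.-tuple R) R := distribution P (mfun_Sub (mem_set mTX)).
Let gbox (k : grid d) : set (d.-tuple R) := box (grid_lo k) (grid_hi k).
Let near_box (k : grid d) : set S1 := [set s | (`|mu (gbox k) - kappa s (gbox k)| <= c%:E)%E].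
Let ok : set S1 := [set s | forall k, near_box k s].

Let mbox (k : grid d) : measurable (gbox k). Proof. exact: measurable_box. Qed.

Let mnear_box k : measurable (near_box k).
Proof.
rewrite /near_box -[X in measurable X]setTI.
apply: (emeasurable_fun_infty_c measurableT).
apply: measurableT_comp => //; apply: emeasurable_funB; first exact: measurable_cst.
by apply: measurable_kernel; exact: mbox.
Qed.

Let mok : measurable ok.
Proof.
rewrite (_ : ok = \bigcap_(i in [set: nat]) (if unpickle i is Some k then near_box k else setT)).
  by apply: bigcap_measurableType => i _; case: (unpickle i).
apply/seteqP; split => s /= h; first by move=> i _; case: (unpickle i).
by move=> k; have := h (pickle k) I; rewrite pickleK.
Qed.

Let box_empty (m : {measure set (d.-tuple R) -> \bar R}) (lo hi : 'I_d -> R) j :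
  hi j < lo j -> m (box lo hi) = 0%E.
Proof.
move=> hl; rewrite (_ : box lo hi = set0) ?measure0//; apply/seteqP; split => x //= /forallP /(_ j).
by move=> /andP[h1 h2]; move: (le_trans h1 h2); rewrite leNgt hl.
Qed.

(** Grid rectangles decide the supremum, so the event is the preimage of a measurable set. A grid
    rectangle with crossed bounds is no hyperrectangle, but it is empty and both measures vanish on
    it. *)
Let rect_event :
  [set w | (rect_dist (fun A => P ((fun w => T1 (X w)) @^-1` A)) (kappa (X w)) <= c%:E)%E] = X @^-1` ok.
Proof.
apply/seteqP; split => w /= h.
  move=> k; rewrite /near_box /=.
  have [/forallP le_lohi|] := boolP [forall j, grid_lo k j <= grid_hi k j :> R]; last first.
    rewrite negb_forall => /existsP[j]; rewrite -ltNge => hl.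
    by rewrite /gbox (box_empty mu hl) (box_empty (kappa (X w)) hl) sube0 abse0 lee_fin.
  apply: le_trans h; apply: ereal_sup_ubound; exists (gbox k) => //.
  exists (fun j => (grid_lo k j)%:E), (fun j => (grid_hi k j)%:E); split => [j|].
    by rewrite lee_fin.
  apply/seteqP; split => x /=; first by move=> /forallP hx j; rewrite !lee_fin.
  by move=> hx; apply/forallP => j; have := hx j; rewrite !lee_fin.
apply: (rect_dist_le (mu := mu)); [exact: probability_setT|exact: prob_kernel|exact: h].
Qed.

(** The null sets belonging to the single grid rectangles are merged into one; off it and on [good],
    the kernel is the explicit Gaussian law to which [close] applies. *)
Let Pok : ((1 - gam)%:E <= m1 ok)%E.
Proof.
have ae_all : \forall s \ae m1, forall i : nat, if unpickle i is Some k then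
    kappa s (gbox k) = m2 (xsection (f @^-1` gbox k) s) else True.
  apply: ae_foralln => i; case: (unpickle i) => [k|]; last by apply: aeW.
  by apply: (kernel_ae_eq lX lXY mf rcd); exact: mbox.
have [N [mN N0 subN]] := ae_all.
have sub : ~` ok `<=` [set s | ~~ good s] `|` N.
  move=> s nok; have [gs|] := boolP (good s); last by left.
  right; apply: subN => /= all_s; apply: nok => k.
  have := all_s (pickle k); rewrite pickleK => kE.
  have mA1 : mb (fun s' => [forall j, grid_lo k j <= tnth (T1 s') j <= grid_hi k j]).
    by apply: mb_forall => j; apply: mb_and; apply: mb_le => //;
      apply: (measurableT_comp (@measurable_tnth _ _ _ j)).
  have mfs : measurable_fun setT (fun e => f (s, e)) by apply: measurableT_comp => //; exact: pair1_measurable.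
  have mA2 : mb (fun e => [forall j, grid_lo k j <= tnth (f (s, e)) j <= grid_hi k j]).
    by apply: mb_forall => j; apply: mb_and; apply: mb_le => //;
      apply: (measurableT_comp (@measurable_tnth _ _ _ j)).
  have muE : mu (gbox k) = (Pr m1 (fun s' => [forall j, grid_lo k j <= tnth (T1 s') j <= grid_hi k j]))%:E.
    rewrite (PrE m1 mA1) -(lX.2); first by [].
    by rewrite -[X in measurable X]setTI; exact: (mA1 measurableT [set true]).
  have kapE : kappa s (gbox k) = (Pr m2 (fun e => [forall j, grid_lo k j <= tnth (f (s, e)) j <= grid_hi k j]))%:E.
    rewrite kE (PrE m2 mA2); congr (m2 _); apply/seteqP; split => e; rewrite /xsection /= inE//.
  by rewrite /near_box /= muE kapE -EFinB lee_fin; exact: close.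
have mng : measurable [set s | ~~ good s].
  by have H := mb_neg mgood; rewrite -[X in measurable X]setTI; exact: (H measurableT [set true]).
have h1 : (m1 (~` ok) <= gam%:E)%E.
  apply: (@le_trans _ _ (m1 ([set s | ~~ good s] `|` N))).
    by apply: le_measure; rewrite ?inE//; [exact: measurableC|exact: measurableU].
  apply: (le_trans (measureU2 _ mng mN)).
  have N0' : m1 N = 0%E := N0.
  have h2 : (m1 [set s | ~~ good s] + m1 N <= gam%:E)%E.
    by rewrite N0' adde0 -(PrE m1 (mb_neg mgood)) lee_fin.
  exact: h2.
have := probability_setC m1 (measurableC mok); rewrite setCK => ->.
by rewrite EFinB leeB.
Qed.

Lemma rate_transfer : ((1 - gam)%:E <=
  P [set w | rect_dist (fun A => P ((fun w => T1 (X w)) @^-1` A)) (kappa (X w)) <= c%:E])%E.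
Proof. by apply: (le_trans Pok); rewrite -(lX.2 _ mok) -rect_event. Qed.

End rate_transfer.

Lemma independent_sym {R : realType} {disp : measure_display} {Omega : measurableType disp}
    (P : probability Omega R) d1 d2 (S1 : measurableType d1) (S2 : measurableType d2)
    (X : Omega -> S1) (Y : Omega -> S2) : independent_RVs P X Y -> independent_RVs P Y X.
Proof. by move=> ind A C mA mC; rewrite setIC ind// muleC. Qed.

Lemma itg_of_bound {R : realType} {d : measure_display} {T : measurableType d} (m : probability T R)
    (f : T -> R) (c : R) : measurable_fun setT f -> (forall x, 0 <= f x) ->
  (\int[m]_x (f x)%:E <= c%:E)%E -> itg m f /\ Ex m f <= c.
Proof.
move=> mf f0 le_c.
have i : itg m f.
  apply/integrableP; split; first exact/measurable_EFinP.
  rewrite (eq_integral (fun x => (f x)%:E)) => [|x _]; last by rewrite /= ger0_norm.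
  by apply: (le_lt_trans le_c); exact: ltry.
by split => //; rewrite -lee_fin Ex_EFin.
Qed.

Section statistic.
Context {R : realType} {p d n : nat}.
Variables (h : p.-tuple R -> p.-tuple R -> d.-tuple R) (F : probability (p.-tuple R) R).

Definition hcoord (xy : p.-tuple R * p.-tuple R) (j : 'I_d) : R := tnth (h xy.1 xy.2) j.

Lemma tnth_Ustat (s : n.-tuple (p.-tuple R)) j : tnth (Ustat h s) j = uavg hcoord s j.
Proof. by rewrite tnth_mktuple. Qed.

Lemma tnth_Tstat (theta : d.-tuple R) (s : n.-tuple (p.-tuple R)) j : tnth theta j = hmean F hcoord j ->
  tnth (Tstat h theta s) j = scaled_dev F hcoord s j.
Proof. by move=> e; rewrite tnth_mktuple tnth_Ustat e. Qed.

Lemma tnth_Tsharp s (e : n.-tuple R) j : tnth (Tsharp h s e) j = gsum (wt hcoord s) e j.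
Proof.
rewrite tnth_mktuple /gsum /dot mulr_sumr; apply: eq_bigr => i _.
by rewrite tnth_Ustat mulrA.
Qed.

Hypothesis mh : measurable_fun setT (fun xy : p.-tuple R * p.-tuple R => h xy.1 xy.2).

Lemma measurable_hcoord j : measurable_fun setT (fun xy => hcoord xy j).
Proof. exact: (measurableT_comp (@measurable_tnth _ _ _ j) mh). Qed.

Lemma measurable_Tstat (theta : d.-tuple R) :
  measurable_fun setT (fun s : n.-tuple (p.-tuple R) => Tstat h theta s).
Proof.
apply/measurable_fun_tnthP => j.
rewrite (_ : _ \o _ = fun s => Num.sqrt n%:R * (uavg hcoord s j - tnth theta j) / 2); last first.
  by apply/funext => s; rewrite /= tnth_mktuple tnth_Ustat.
apply: measurable_funM; last exact: measurable_cst.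
apply: measurable_funM; first exact: measurable_cst.
by apply: measurable_funB; [exact: (measurable_uavg measurable_hcoord)|exact: measurable_cst].
Qed.

Lemma measurable_Tsharp :
  measurable_fun setT (fun se : n.-tuple (p.-tuple R) * n.-tuple R => Tsharp h se.1 se.2).
Proof.
have m1 (g : n.-tuple (p.-tuple R) -> R) : measurable_fun setT g ->
    measurable_fun setT (fun se : n.-tuple (p.-tuple R) * n.-tuple R => g se.1).
  by move=> mg; apply: (measurableT_comp mg); exact: measurable_fst.
apply/measurable_fun_tnthP => j.
rewrite (_ : _ \o _ = fun se => gsum (wt hcoord se.1) se.2 j); last first.
  by apply/funext => s; rewrite /= tnth_Tsharp.
apply: measurable_sum => i; apply: measurable_funM; last first.
  by apply: (measurableT_comp (@measurable_tnth _ _ _ i)); exact: measurable_snd.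
apply: measurable_funM; first exact: measurable_cst.
apply: (m1 (fun s => wt hcoord s i j)); apply: measurable_funB; last exact: (measurable_uavg measurable_hcoord).
apply: measurable_funM; first exact: measurable_cst.
rewrite [X in measurable_fun _ X](_ : _ = fun s : n.-tuple (p.-tuple R) =>
  \sum_(k < n) (if k != i then hcoord (tnth s i, tnth s k) j else 0)); last first.
  by apply/funext => s; rewrite [LHS]big_mkcond.
apply: measurable_sum => k; case: (k != i); last exact: measurable_cst.
by apply: (measurableT_comp (measurable_hcoord j)); apply: measurable_fun_pair; exact: measurable_tnth.
Qed.

End statistic.

(** Passing from [B] to [2 * B] provides an admissible constant strictly below [2 * B] whether or
    not the infimum is attained; the bound 2 is the admissible 1 plus the subtracted 1. *)
Lemma psi1_exponential {R : realType} {disp : measure_display} {Omega : measurableType disp}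
    (P : probability Omega R) (xi : Omega -> R) (B : R) : 0 < B -> measurable_fun setT xi ->
  (psi1_norm P xi <= B%:E)%E ->
  (\int[P]_w (expR (`|xi w| / (2 * B)))%:E <= 2%:E)%E.
Proof.
move=> B0 mxi psiB.
have B2 : 0 < 2 * B by rewrite mulr_gt0.
have /ereal_inf_lt[_ [C [C0 EC] <-]] : (psi1_norm P xi < (2 * B)%:E)%E.
  by apply: (le_lt_trans psiB); rewrite lte_fin; lra.
rewrite lte_fin => CB.
have mexp c : measurable_fun setT (fun w => expR (`|xi w| / c)).
  apply: measurableT_comp => //; apply: measurable_funM; last exact: measurable_cst.
  exact: measurableT_comp.
have ge1 c w : 0 < c -> 1 <= expR (`|xi w| / c) by move=> c0; rewrite -expR0 ler_expR divr_ge0// ltW.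
have h1 : (\int[P]_w (expR (`|xi w| / C) - 1)%:E <= 1)%E by move: EC; rewrite unlock.
apply: (@le_trans _ _ (\int[P]_w ((expR (`|xi w| / C) - 1)%:E + 1%:E))%E).
  apply: ge0_le_integral => //.
  - by apply/measurable_EFinP; exact: mexp.
  - apply: emeasurable_funD; last exact: measurable_cst.
    by apply/measurable_EFinP; apply: measurable_funB; [exact: mexp|exact: measurable_cst].
  - move=> w _; rewrite -EFinD subrK lee_fin ler_expR; apply: ler_wpM2l => //.
    by rewrite lef_pV2 ?posrE// ltW.
rewrite ge0_integralD//.
- have -> : 2%:E = (1 + 1%:E)%E :> \bar R by rewrite -EFinD.
  apply: leeD => //; rewrite integral_cst// -[leRHS]mul1e; apply: lee_wpmul2l => //.
  exact: probability_le1.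
- by move=> w _; rewrite lee_fin subr_ge0 ge1.
- by apply/measurable_EFinP; apply: measurable_funB; [exact: mexp|exact: measurable_cst].
Qed.

Lemma mx_powR_scale {R : realType} (J : finType) (v : J -> R) (B q : R) : 0 < B -> 0 < q -> (0 < #|J|)%N ->
  mx v `^ q = B `^ q * \big[Num.max/0]_j ((`|v j| / B) `^ q).
Proof.
move=> B0 q0 J0.
have E j : `|v j| `^ q = B `^ q * (`|v j| / B) `^ q.
  rewrite -powRM ?(ltW B0) ?divr_ge0 ?(ltW B0)//; congr (_ `^ _).
  by rewrite mulrC divfK// gt_eqF.
apply/eqP; rewrite eq_le; apply/andP; split.
  have [j ->] := mx_attained J0 v; rewrite E; apply: ler_wpM2l; first exact: powR_ge0.
  exact: (le_bigmax 0 (fun j => (`|v j| / B) `^ q) j).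
have Bq0 : 0 < B `^ q by rewrite powR_gt0.
rewrite mulrC -ler_pdivlMr//; apply: bigmax_le; first by rewrite divr_ge0 ?powR_ge0.
move=> j _; rewrite ler_pdivlMr// mulrC -E; apply: ge0_ler_powR; rewrite ?nnegrE ?mx_ge0 ?(ltW q0)//.
exact: le_mx.
Qed.

Lemma exponential_const_gt0 {R : realType} (b K : R) : 0 < b -> 0 < K -> 0 < exponential_const b K.
Proof.
move=> b0 K0; have k0 : 0 < 2 * (1 + K) by rewrite mulr_gt0// addr_gt0.
apply: mulr_gt0; first by rewrite addr_gt0// rate_const_gt0.
rewrite ltr_wpDr//; apply: mulr_ge0; last exact: sqr_ge0.
exact: mulr_ge0 (ler0n R 4) (exprn_ge0 3 (expR_ge0 1)).
Qed.

Theorem theorem3p5 (R : realType) (b bbar K : R)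
    (hb : 0 < b) (hbbar : 0 < bbar) (hK : 0 < K) :
  exists (C1 : R) (C2 : R -> R), 0 < C1 /\ (forall q : R, 0 < C2 q) /\
  forall (n p d : nat) (hn : (4 <= n)%N) (hd : (3 <= d)%N)
    (disp : measure_display) (Omega : measurableType disp)
    (P : probability Omega R)
    (F : probability (p.-tuple R) R)
    (X : 'I_n -> {RV P >-> p.-tuple R}) (Z Z' : {RV P >-> p.-tuple R})
    (e : 'I_n -> {RV P >-> R})
    (h : p.-tuple R -> p.-tuple R -> d.-tuple R)
    (i1 i2 : 'I_n) (B gamma : R),
  let sample := fun w : Omega => [tuple X i w | i < n] in
  let weights := fun w : Omega => [tuple e i w | i < n] in
  let theta := kernel_mean h P (X i1) (X i2) in
  let g := hajek h P Z' theta in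
  let Tn := fun w : Omega => Tstat h theta (sample w) in
  let Tn_sharp := fun w : Omega => Tsharp h (sample w) (weights w) in
  forall kappa : R.-pker (n.-tuple (p.-tuple R)) ~> (d.-tuple R),
  let rhoB := fun w : Omega =>
    rect_dist (fun A => P (Tn @^-1` A)) (kappa (sample w)) in
  i1 = 0%N :> nat -> i2 = 1%N :> nat ->
  mutually_independent P (fun i => X i : Omega -> p.-tuple R) ->
  (forall i, has_law P (X i) F) ->
  has_law P Z F -> has_law P Z' F ->
  independent_RVs P Z Z' ->
  independent_RVs P (fun w => (Z w, Z' w)) sample ->
  mutually_independent P (fun i => e i : Omega -> R) ->
  (forall i, has_law P (e i) (normal_prob 0 1)) ->
  independent_RVs P weights sample ->
  regular_cond_distribution P Tn_sharp sample kappa ->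
  measurable_fun setT (fun xy : p.-tuple R * p.-tuple R => h xy.1 xy.2) ->
  (forall x y, h x y = h y x) ->
  (forall k, ('E_P[fun w => `|tnth (h (X i1 w) (X i2 w)) k|%R] < +oo)%E) ->
  1 <= B ->
  (forall m, (b%:E <= 'E_P[fun w => (tnth (g (Z w)) m ^+ 2)%R])%E) ->
  (forall (l : nat) (m : 'I_d), (1 <= l <= 2)%N ->
    ('E_P[fun w => (`|tnth (h (Z w) (Z' w)) m| ^+ (2 + l))%R] <= (B ^+ l)%:E)%E) ->
  0 < gamma < expR (- 1) ->
  ln (1 / gamma) <= K * ln (d * n)%:R ->
  ln d%:R <= bbar * n%:R ->
  ((forall m, (psi1_norm P (fun w => tnth (h (Z w) (Z' w)) m) <= B%:E)%E) ->
    ((1 - gamma)%:E <=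
       P [set w | rhoB w <= (C1 * varpi1 B n d)%:E])%E) /\
  (forall q : R, 4 <= q ->
    ('E_P[fun w => (\big[Num.max/0]_(m < d)
                     ((`|tnth (h (Z w) (Z' w)) m| / B) `^ q))%R] <= 1)%E ->
    ((1 - gamma)%:E <=
       P [set w | rhoB w <=
                  (C2 q * (varpi1 B n d + varpiB2 q B n d gamma))%:E])%E).
Proof.
(* The second constant has to be positive for every real [q]; 1 is a filler for [q < 4]. *)
exists (exponential_const b K), (fun q => if 4 <= q then 2 * rate_const b K q else 1).
split; first exact: exponential_const_gt0.
split.
  move=> q; case: ifP => // q4; apply: mulr_gt0 => //; apply: rate_const_gt0 => //.
  exact: lt_le_trans q4.
move=> n p d hn hd disp Omega P F X Z Z' e h i1 i2 B gamma sample weights theta g Tn Tn_sharp kappa rhoB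
  i1E i2E indX lawX lawZ lawZ' indZ _ indE lawE indES rcd mh symh _ B1 hg hmom gam01 hgam _.
have B0 : 0 < B := lt_le_trans ltr01 B1.
have gam01' : 0 < gamma < 1.
  by case/andP: gam01 => -> /lt_trans; apply; rewrite expR_lt1 ltrN10.
pose hh := hcoord h.
have mhh j : measurable_fun setT (fun xy => hh xy j) := measurable_hcoord mh j.
have sym x y j : hh (x, y) j = hh (y, x) j by rewrite /hh /hcoord /= symh.
have lX i : law P F (X i) := law_of_has_law (lawX i).
have lZ := law_of_has_law lawZ; have lZ' := law_of_has_law lawZ'.
have lZZ : law P (pprod F F) (fun w => (Z w, Z' w)) := law_pair lZ lZ' indZ.
have i12 : i1 != i2 by rewrite -val_eqE /= i1E i2E.
have lXX : law P (pprod F F) (fun w => (X i1 w, X i2 w)) :=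
  law_pair (lX i1) (lX i2) (independent_pair i12 indX).
have lS : law P (pow F n) sample := law_tuple indX lawX.
have lE : law P (pow N01 n) weights by apply: law_tuple indE _ => i A mA; exact: lawE.
have lSE : law P (pprod (pow F n) (pow N01 n)) (fun w => (sample w, weights w)) :=
  law_pair lS lE (independent_sym indES).
(* The expectations in [theta] and [g] are taken on [Omega]. Transport along the laws identifies
   them with [hmean] and [hproj] of the coordinate kernel, [fine] being applied to equal extended
   reals. *)
have thetaE j : tnth theta j = hmean F hh j.
  rewrite tnth_mktuple unlock; congr fine.
  by apply: (law_integral (f := fun xy => (hh xy j)%:E) lXX); apply/measurable_EFinP; exact: mhh.
have gE x j : tnth (g x) j = hproj F hh x j.
  rewrite tnth_mktuple thetaE; congr (_ - _); rewrite unlock; congr fine.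
  apply: (law_integral (f := fun y => (hh (x, y) j)%:E) lZ'); apply/measurable_EFinP.
  by apply: (measurableT_comp (mhh j)); exact: pair1_measurable.
have Zint (f : p.-tuple R * p.-tuple R -> R) : measurable_fun setT f ->
    'E_P[fun w => f (Z w, Z' w)]%E = (\int[pprod F F]_xy (f xy)%:E)%E.
  by move=> mf; rewrite unlock; apply: (law_integral (f := fun xy => (f xy)%:E) lZZ); exact/measurable_EFinP.
have moment l j : (1 <= l <= 2)%N -> itg (pprod F F) (fun xy => `|hh xy j| ^+ (2 + l)) /\
    Ex (pprod F F) (fun xy => `|hh xy j| ^+ (2 + l)) <= B ^+ l.
  move=> l12.
  have mf : measurable_fun setT (fun xy => `|hh xy j| ^+ (2 + l)).
    by apply: measurable_funX; exact: measurableT_comp.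
  apply: itg_of_bound => //.
  by rewrite -Zint//; exact: hmom.
have h3 j : Ex (pprod F F) (fun xy => `|hh xy j| ^+ 3) <= B by have [_] := moment 1%N j isT.
have i4 j : itg (pprod F F) (fun xy => `|hh xy j| ^+ 4) := (moment 2%N j isT).1.
have h4 j : Ex (pprod F F) (fun xy => `|hh xy j| ^+ 4) <= B ^+ 2 := (moment 2%N j isT).2.
have hbF j : (b%:E <= \int[F]_x (hproj F hh x j ^+ 2)%:E)%E.
  apply: (le_trans (hg j)); rewrite unlock.
  have -> : (fun w => (tnth (g (Z w)) j ^+ 2)%:E) = fun w => (hproj F hh (Z w) j ^+ 2)%:E.
    by apply/funext => w; rewrite gE.
  rewrite (law_integral (f := fun x => (hproj F hh x j ^+ 2)%:E) lZ)//.
  by apply/measurable_EFinP; apply: measurable_funX; exact: measurable_condE (mhh j) (i4 j).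
have J3 : (3 <= #|'I_d|)%N by rewrite card_ord.
have hgam' : ln (1 / gamma) <= K * ln (#|'I_d| * n)%:R by rewrite card_ord.
have transfer c : 0 <= c -> rate_event F hh n gamma c ->
    ((1 - gamma)%:E <= P [set w | rhoB w <= c%:E])%E.
  move=> c0 [good [mgood Pgood close]].
  apply: (rate_transfer (f := fun se => Tsharp h se.1 se.2) lS lSE (measurable_Tstat mh theta)
    (measurable_Tsharp mh) rcd c0 mgood Pgood) => s gs lo hi.
  have -> : (fun s' : n.-tuple (p.-tuple R) => [forall j, lo j <= tnth (Tstat h theta s') j <= hi j]) =
      fun s' => [forall j, lo j <= scaled_dev F hh s' j <= hi j].
    by apply/funext => s'; apply: eq_forallb => j; rewrite (tnth_Tstat s' (thetaE j)).
  have -> : (fun e' : n.-tuple R => [forall j, lo j <= tnth (Tsharp h (s, e').1 (s, e').2) j <= hi j]) =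
      fun e' => [forall j, lo j <= gsum (wt hh s) e' j <= hi j].
    by apply/funext => e'; apply: eq_forallb => j; rewrite tnth_Tsharp.
  exact: close.
have w10 := varpi1_ge0 n d B.
split.
  move=> psi1; apply: transfer.
    by apply: mulr_ge0 => //; exact: ltW (exponential_const_gt0 hb hK).
  have mexp j : measurable_fun setT (fun xy => expR (`|hh xy j| / (2 * B))).
    apply: measurableT_comp => //; apply: measurable_funM; last exact: measurable_cst.
    exact: measurableT_comp.
  have mZh j : measurable_fun setT (fun w => tnth (h (Z w) (Z' w)) j).
    exact: (measurableT_comp (f := fun xy => hh xy j) (mhh j) lZZ.1).
  have ex j : itg (pprod F F) (fun xy => expR (`|hh xy j| / (2 * B))) /\
      Ex (pprod F F) (fun xy => expR (`|hh xy j| / (2 * B))) <= 2.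
    apply: itg_of_bound => //.
    have := psi1_exponential B0 (mZh j) (psi1 j).
    by rewrite -(law_integral (f := fun xy => (expR (`|hh xy j| / (2 * B)))%:E) lZZ)//; exact/measurable_EFinP.
  have := exponential_rate mhh sym hn J3 B1 hb hK gam01' hgam' h3 i4 h4 hbF (fun j => (ex j).1) (fun j => (ex j).2).
  by rewrite card_ord.
move=> q q4 hq; rewrite q4; apply: transfer.
  apply: mulr_ge0; last by apply: addr_ge0 => //; exact: powR_ge0.
  by apply: mulr_ge0 => //; apply: ltW; apply: rate_const_gt0 => //; exact: lt_le_trans q4.
have q0 : 0 < q by exact: lt_le_trans q4.
have mmx : measurable_fun setT (fun xy => mx (hh xy) `^ q) := measurable_mx_powR q mhh.
have Bq0 : 0 < B `^ q by rewrite powR_gt0.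
pose M (xy : p.-tuple R * p.-tuple R) : R := \big[Num.max/0]_(m < d) ((`|hh xy m| / B) `^ q).
have ME xy : mx (hh xy) `^ q = B `^ q * M xy.
  by apply: mx_powR_scale => //; rewrite card_ord (leq_trans _ hd).
have mM : measurable_fun setT M.
  have -> : M = fun xy => (B `^ q)^-1 * mx (hh xy) `^ q.
    by apply/funext => xy; rewrite ME mulKf// gt_eqF.
  by apply: measurable_funM => //; exact: measurable_cst.
have M0 xy : 0 <= M xy by rewrite -(pmulr_rge0 _ Bq0) -ME powR_ge0.
have [iM EM] : itg (pprod F F) M /\ Ex (pprod F F) M <= 1.
  by apply: itg_of_bound => //; rewrite -Zint.
have mxE : (fun xy => mx (hh xy) `^ q) = fun xy => B `^ q * M xy by apply/funext => xy; exact: ME.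
have iq : itg (pprod F F) (fun xy => mx (hh xy) `^ q) by rewrite mxE; exact: itgZ.
have Eq : Ex (pprod F F) (fun xy => mx (hh xy) `^ q) <= B `^ q.
  by rewrite mxE ExZ// ler_piMr// ltW.
have := moment_rate mhh sym hn J3 B1 hb hK gam01' hgam' h3 i4 h4 hbF q4 iq Eq.
by rewrite card_ord.
Qed.
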